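(* The maps $F$ and $k\circ w\circ\delta$ are the same as maps from $J(K)/\phi A(K)$ to $L^{\ast}/L^{\ast q}$.
   Context: Let $C$ be a curve defined over a number field $K$, with Jacobian $J$, identified with $\mathrm{Pic}^0(C(\overline{K}))$. Let $A$ be an abelian variety over $K$ and $\phi: A\to J$ an isogeny defined over $K$ whose kernel $A[\phi]$ has exponent $q=p^l$ for a prime $p$. Let $\delta: J(K)\to H^1(K,A[\phi])$ be the coboundary map from the long exact Galois cohomology sequence of $0\to A[\phi]\to A\xrightarrow{\phi} J\to 0$; its kernel is $\phi A(K)$. Assume (Assumption I) that every element of $J(K)/\phi A(K)$ is represented by a divisor class containing a degree-0 divisor of $C$ defined over $K$. Let $\hat\phi:\hat J\to\hat A$ be the dual isogeny, $\lambda: J\to\hat J$ the canonical principal polarization with respect to $C$, and $\Psi=\lambda^{-1}(\hat J[\hat\phi])\subseteq J[q]$. Let $\{D_1,\dots,D_n\}$ be a $\mathrm{Gal}(\overline K/K)$-invariant set of degree-0 divisors of $C$ whose classes $[D_i]$ span $\Psi$. Let $L'=\prod_{i=1}^n\overline{K}$ with $\sigma\in\mathrm{Gal}(\overline K/K)$ acting by $\sigma(a_1,\dots,a_n)=(\sigma(a_{\bar\sigma^{-1}1}),\dots,\sigma(a_{\bar\sigma^{-1}n}))$, where $\bar\sigma\in S_n$ is defined by $\sigma(D_i)=D_{\bar\sigma i}$; let $L$ be the Galois invariants of $L'$. Choose functions $f_i$ defined over $K(D_i)$ with divisor $(f_i)=qD_i$, and let $F=(f_1,\dots,f_n)$; evaluated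 on degree-0 $K$-rational divisors whose support avoids $\bigcup\mathrm{Supp}(D_i)$ (via $g(\sum n_jR_j)=\prod g(R_j)^{n_j}$), $F$ induces a well-defined homomorphism to $L^\ast/L^{\ast q}$. Let $e_\phi$ denote the $\phi$-Weil pairing between $A[\phi]$ and $\hat J[\hat\phi]$, and define $w: A[\phi]\to\mu_q(L')$ by $w(P)=(e_\phi(P,\lambda[D_1]),\dots,e_\phi(P,\lambda[D_n]))$; it is injective and defined over $K$, and induces $w: H^1(K,A[\phi])\to H^1(K,\mu_q(L'))$. Let $k: H^1(K,\mu_q(L'))\to L^\ast/L^{\ast q}$ be the Kummer isomorphism sending the class of $\sigma\mapsto \sigma(\sqrt[q]{l})/\sqrt[q]{l}$ to $l$. *)

(* Defs.v *)
From HB Require Import structures.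
From mathcomp Require Import all_boot all_order all_algebra.
From mathcomp Require Import freeg mpoly.
From mathcomp Require Import boolp classical_sets.

Set Implicit Arguments.
Unset Strict Implicit.
Unset Printing Implicit Defensive.
Import GRing.Theory.
Local Open Scope ring_scope.

(* Varieties over K are handled classically, through their points over an
   algebraic closure iota : K -> Kb, together with the action of Gal(Kb/K).
   All base fields below have characteristic 0. *)

Section Points.
Variables (K : fieldType) (Kb : closedFieldType) (iota : {rmorphism K -> Kb}).

Record absgal : Type := AbsGal {
  gal_fun :> {rmorphism Kb -> Kb};
  gal_bij : bijective gal_fun;
  gal_fix : forall x, gal_fun (iota x) = iota x }.

Lemma gal_mul_fix (s t : absgal) x : (s \o t) (iota x) = iota x.
Proof. by rewrite /= !gal_fix. Qed.

Definition gal_mul (s t : absgal) : absgal :=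
  @AbsGal (s \o t) (bij_comp (gal_bij s) (gal_bij t)) (gal_mul_fix s t).

(* A point of projective space is represented by its unique vector of
   homogeneous coordinates whose first nonzero coordinate is 1, so that
   equality of points is Leibniz equality. *)
Definition normalized n (v : 'rV[Kb]_n) : bool :=
  [exists i, (v 0 i == 1) && [forall j : 'I_n, (j < i)%N ==> (v 0 j == 0)]].

Definition pevK n (p : {mpoly K[n]}) (v : 'rV[Kb]_n) : Kb :=
  mmap iota (fun i => v 0 i) p.

Definition pev n (p : {mpoly Kb[n]}) (v : 'rV[Kb]_n) : Kb :=
  p.@[fun i => v 0 i].

Record zeros n (E : seq {mpoly K[n]}) : Type := Zero {
  coords :> 'rV[Kb]_n;
  coordsP : normalized coords && all (fun p => pevK p coords == 0) E }.

HB.instance Definition _ n (E : seq {mpoly K[n]}) := [isSub for @coords n E].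
HB.instance Definition _ n (E : seq {mpoly K[n]}) :=
  [Choice of zeros E by <:].

Lemma gal_coords_subproof (s : absgal) n (E : seq {mpoly K[n]}) (x : zeros E) :
  let v := map_mx s x in
  normalized v && all (fun p => pevK p v == 0) E.
Proof.
case: x => v /= /andP[/existsP[i /andP[/eqP vi /forallP vj]] /allP Ev].
apply/andP; split.
  apply/existsP; exists i; rewrite mxE vi rmorph1 eqxx /=.
  apply/forallP => j; apply/implyP => ji; rewrite mxE.
  by move/implyP: (vj j) => /(_ ji)/eqP->; rewrite rmorph0.
apply/allP => p pE; apply/eqP.
have -> : pevK p (map_mx s v) = s (pevK p v).
  rewrite /pevK /mmap rmorph_sum; apply: eq_bigr => m _ /=.
  rewrite rmorphM gal_fix; congr (_ * _).
  rewrite /mmap1 rmorph_prod; apply: eq_bigr => k _ /=.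
  by rewrite rmorphXn mxE.
by rewrite (eqP (Ev p pE)) rmorph0.
Qed.

Definition gal_zero (s : absgal) n (E : seq {mpoly K[n]}) (x : zeros E) :
  zeros E := Zero (gal_coords_subproof s x).

Definition zclosed n (E : seq {mpoly K[n]}) (Z : set (zeros E)) : Prop :=
  exists S : set {mpoly Kb[n]},
    (forall p, S p -> exists d, p \is d.-homog) /\
    Z = [set x | forall p, S p -> pev p x = 0]%classic.

Definition zirreducible n (E : seq {mpoly K[n]}) (Z : set (zeros E)) : Prop :=
  (exists x, Z x) /\
  forall Z1 Z2 : set (zeros E), zclosed Z1 -> zclosed Z2 ->
    (Z `<=` Z1 `|` Z2 -> Z `<=` Z1 \/ Z `<=` Z2)%classic.

(* Irreducibility is that of the set of points over Kb, i.e. geometric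
   irreducibility; equations have coefficients in K. *)
Record variety : Type := Variety {
  ncoords : nat;
  veqs : seq {mpoly K[ncoords]};
  veqs_homog : forall p, p \in veqs -> exists d, p \is d.-homog;
  v_irr : zirreducible (@setT (zeros veqs)) }.

Definition pts (X : variety) : Type := zeros (@veqs X).
HB.instance Definition _ (X : variety) := Choice.on (pts X).

Definition gal_pt (s : absgal) (X : variety) (x : pts X) : pts X :=
  gal_zero s x.

Definition rational_pt (X : variety) (x : pts X) : Prop :=
  forall s : absgal, gal_pt s x = x.

Definition has_chain (X : variety) (d : nat) : Prop :=
  exists Z : nat -> set (pts X),
    (forall i, (i <= d)%N -> zclosed (Z i) /\ zirreducible (Z i)) /\
    (forall i, (i < d)%N -> (Z i `<` Z i.+1)%classic).

Definition krull_dim (X : variety) (d : nat) : Prop :=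
  has_chain X d /\ ~ has_chain X d.+1.

(* [regular_map S v w]: in homogeneous coordinates v on the source and w on
   the target, T -> T' is given, around each point, by homogeneous polynomials
   of the same degree with coefficients in S. *)
Definition regular_map (S : set Kb) (T : Type) N M
    (v : T -> 'rV[Kb]_N) (w : T -> 'rV[Kb]_M) : Prop :=
  forall t : T, exists d (F : 'I_M -> {mpoly Kb[N]}),
    [/\ forall j, F j \is d.-homog /\ forall m, S (F j)@_m,
        exists j, pev (F j) (v t) != 0
      & forall t', exists c, forall j, pev (F j) (v t') = c * w t' 0 j].

Definition baseK : set Kb := range iota.

Definition morphism (X Y : variety) (f : pts X -> pts Y) : Prop :=
  regular_map baseK (fun x => coords x) (fun x => coords (f x)).

Definition segre (X Y : variety) (u : pts X * pts Y) :=
  mxvec ((coords u.1)^T *m coords u.2).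

Definition morphism2 (X Y Z : variety) (f : pts X -> pts Y -> pts Z) : Prop :=
  regular_map baseK (@segre X Y) (fun u => coords (f u.1 u.2)).

Record abvar : Type := AbVar {
  av :> variety;
  av_zero : pts av;
  av_opp : pts av -> pts av;
  av_add : pts av -> pts av -> pts av;
  av_addA : associative av_add;
  av_addC : commutative av_add;
  av_add0 : left_id av_zero av_add;
  av_addN : left_inverse av_zero av_opp av_add;
  av_opp_morph : morphism av_opp;
  av_add_morph : morphism2 av_add }.

HB.instance Definition _ (A : abvar) := GRing.isZmodule.Build (pts A)
  (@av_addA A) (@av_addC A) (@av_add0 A) (@av_addN A).

Definition isogeny (A B : abvar) (phi : pts A -> pts B) : Prop :=
  [/\ morphism phi, {morph phi : x y / x + y},
      forall y, exists x, phi x = y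
    & exists s : seq (pts A), forall x, phi x = 0 -> x \in s].

(* A rational function on X is represented by any total function that agrees
   on a nonempty open set with a quotient of homogeneous polynomials of the
   same degree; two of them are identified when they agree on a nonempty open
   set.  Field operations, and pullback along dominant maps, are then
   pointwise operations. *)
Section Rational.
Variable X : variety.
Implicit Types (f g h : pts X -> Kb) (x y : pts X) (P : pts X -> Prop).

Definition basic_open (H : {mpoly Kb[ncoords X]}) : set (pts X) :=
  [set y | pev H (coords y) != 0]%classic.

Definition nearby x P : Prop :=
  exists d H, [/\ H \is d.-homog, basic_open H x
                & forall y, basic_open H y -> P y].

Definition generically P : Prop := exists x, nearby x P.

Definition quot (F G : {mpoly Kb[ncoords X]}) f : Prop :=
  generically (fun y => basic_open G y /\
                        f y = pev F (coords y) / pev G (coords y)).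

Definition rational_over (S : set Kb) f : Prop :=
  exists d F G, [/\ F \is d.-homog, G \is d.-homog,
    forall m, S F@_m, forall m, S G@_m & quot F G f].

Definition nzrational f : Prop :=
  rational_over setT f /\ generically (fun y => f y != 0).

(* f is regular at x, with value v; note that v need not be [f x]. *)
Definition has_value f x (v : Kb) : Prop :=
  exists d F G, [/\ F \is d.-homog, G \is d.-homog, basic_open G x,
    quot F G f & v = pev F (coords x) / pev G (coords x)].

Definition value f x : Kb := xget 0 [set v | has_value f x v]%classic.

Definition regular_at f x : Prop := exists v, has_value f x v.
Definition unit_at f x : Prop := exists2 v, v != 0 & has_value f x v.

(* Cartier divisors, given by a choice of a local equation at each point. *)
Definition divisor : Type := pts X -> (pts X -> Kb).

Definition cartier (D : divisor) : Prop :=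
  forall x, nzrational (D x) /\
            nearby x (fun y => unit_at (fun z => D y z / D x z) y).

Definition div0 : divisor := fun _ _ => 1.
Definition div_sub (D E : divisor) : divisor := fun x z => D x z / E x z.

Definition is_div_of f (D : divisor) : Prop :=
  nzrational f /\ forall x, unit_at (fun z => f z / D x z) x.

Definition lin_equiv (D E : divisor) : Prop :=
  exists f, is_div_of f (div_sub D E).

Definition pic_class (D : divisor) : set divisor :=
  [set E | cartier E /\ lin_equiv E D]%classic.

(* D is the divisor of the closed subset Z of pure codimension 1: its local
   equation at each point generates the ideal of germs vanishing on Z. *)
Definition is_divisor_of_set (D : divisor) (Z : set (pts X)) : Prop :=
  cartier D /\
  forall y h, rational_over setT h ->
    (regular_at h y /\ nearby y (fun z => Z z -> has_value h z 0)) <->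
    regular_at (fun z => h z / D y z) y.

End Rational.

Definition pullback (X Y : variety) (phi : pts X -> pts Y) (D : divisor Y) :
  divisor X := fun x z => D (phi x) (phi z).

Section DualAbelianVariety.
Variable A : abvar.

Definition translate (a : pts A) (D : divisor A) : divisor A :=
  pullback (fun x : pts A => x + a) D.

(* c is a point over Kb of the dual abelian variety of A. *)
Definition in_pic0 (c : set (divisor A)) : Prop :=
  exists D, [/\ cartier D, forall a, lin_equiv (translate a D) D
              & c = pic_class D].

End DualAbelianVariety.

Section WeilPairing.
Variables (A B : abvar) (phi : pts A -> pts B).

Definition dual_isogeny (c : set (divisor B)) : set (divisor A) :=
  [set E | exists2 D, c D & pic_class (pullback phi D) E]%classic.

Definition dual_ker (c : set (divisor B)) : Prop :=
  in_pic0 c /\ dual_isogeny c = pic_class (@div0 A).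

(* With phi^* D = div(g), e_phi(P, [D]) is the constant g(X) / g(X + P).  The
   sign of this convention goes with that of polarization below: for an
   elliptic curve, t_x^* Theta - Theta is linearly equivalent to
   (0) - (x), not to (x) - (0). *)
Definition weil_pairing (P : pts A) (c : set (divisor B)) : Kb :=
  xget 1 [set e | exists D g, [/\ c D, is_div_of g (pullback phi D)
    & generically (fun x : pts A => g x = e * g (x + P))]]%classic.

End WeilPairing.

Section Curve.
Variable C : variety.

Definition uniformizer (x : pts C) (t : pts C -> Kb) : Prop :=
  [/\ nzrational t, has_value t x 0
    & forall h, has_value h x 0 -> regular_at (fun z => h z / t z) x].

(* A curve is nonsingular when each maximal ideal of a local ring is
   principal. *)
Definition smooth_curve : Prop :=
  krull_dim C 1 /\ forall x, exists t, uniformizer x t.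

Definition cdiv : Type := {freeg (pts C) / int}.

Definition has_ord (f : pts C -> Kb) (x : pts C) (m : int) : Prop :=
  exists2 t, uniformizer x t & unit_at (fun z => f z / t z ^ m) x.

Definition is_cdiv_of (f : pts C -> Kb) (D : cdiv) : Prop :=
  nzrational f /\ forall x, has_ord f x (coeff x D).

Definition gal_cdiv (s : absgal) (D : cdiv) : cdiv :=
  \sum_(x <- dom D) << coeff x D *g gal_pt s x >>.

Definition rational_cdiv (D : cdiv) : Prop :=
  forall s : absgal, gal_cdiv s D = D.

(* The field K(D) is the fixed field of the stabilizer of D. *)
Definition field_of_cdiv (D : cdiv) : set Kb :=
  [set c | forall s : absgal, gal_cdiv s D = D -> s c = c]%classic.

Definition eval_cdiv (f : pts C -> Kb) (D : cdiv) : Kb :=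
  \prod_(x <- dom D) value f x ^ coeff x D.

(* J is the Jacobian of C, where cl identifies Pic^0(C) with J(Kb); only the
   values of cl on divisors of degree 0 matter.  Since the characteristic is 0,
   a bijective homomorphism from the Albanese variety of C is an isomorphism,
   so that these properties determine J up to isomorphism. *)
Definition is_jacobian (J : abvar) (cl : cdiv -> pts J) : Prop :=
  [/\ forall D E, deg D = 0 -> deg E = 0 -> cl (D + E) = cl D + cl E,
      forall x, exists2 D, deg D = 0 & cl D = x,
      forall D, deg D = 0 -> (cl D = 0 <-> exists f, is_cdiv_of f D),
      forall s D, deg D = 0 -> cl (gal_cdiv s D) = gal_pt s (cl D)
    & morphism2 (fun P Q : pts C => cl (<< P >> - << Q >>))].

Variables (J : abvar) (cl : cdiv -> pts J).

(* The image of C^(g-1) under sum_i [P_i - P0], where g = dim J. *)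
Definition theta (P0 : pts C) : set (pts J) :=
  [set x | exists r (P : 'I_r -> pts C),
     krull_dim J r.+1 /\ x = \sum_(i < r) cl (<< P i >> - << P0 >>)]%classic.

(* The canonical principal polarization x |-> [t_x^* Theta - Theta]; the base
   point in Theta is immaterial. *)
Definition polarization (x : pts J) : set (divisor J) :=
  [set E | exists P0 T, is_divisor_of_set T (theta P0) /\
                        pic_class (div_sub (translate x T) T) E]%classic.

End Curve.

(* Coefficients are a subgroup B of a commutative group (M, op) on which
   Gal(Kb/K) acts by act.  The last clause of cocycle is continuity for the
   Krull topology.  A class in H^1 is the set of all cocycles it contains. *)
Section Cohomology.
Variables (M : Type) (op : M -> M -> M) (act : absgal -> M -> M) (B : set M).

Definition cocycle (xi : absgal -> M) : Prop :=
  [/\ forall s, B (xi s),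
      forall s t, xi (gal_mul s t) = op (xi s) (act s (xi t))
    & exists S : seq Kb, forall s t : absgal,
        (forall x, x \in S -> s x = t x) -> xi s = xi t].

Definition cohomologous (xi eta : absgal -> M) : Prop :=
  exists2 b, B b & forall s, op (xi s) (act s b) = op (eta s) b.

Definition h1_class (xi : absgal -> M) : set (absgal -> M) :=
  [set eta | cocycle eta /\ cohomologous xi eta]%classic.

End Cohomology.

Definition in_ker (A B : abvar) (phi : pts A -> pts B) : set (pts A) :=
  [set P | phi P = 0]%classic.

Definition ker_exponent (A B : abvar) (phi : pts A -> pts B) (q : nat) :=
  forall m, (forall P, in_ker phi P -> P *+ m = 0) <-> (q %| m)%N.

(* Elements of J(K) / phi A(K) are cosets. *)
Definition is_coset (A J : abvar) (phi : pts A -> pts J) (X : set (pts J)) :=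
  exists2 x, rational_pt x &
    X = [set y | exists2 a, rational_pt a & y = x + phi a]%classic.

Definition coboundary (A J : abvar) (phi : pts A -> pts J) (X : set (pts J)) :
  set (absgal -> pts A) :=
  [set xi | exists P : pts A, X (phi P) /\
    h1_class +%R (fun s => @gal_pt s A) (in_ker phi)
      (fun s => gal_pt s P - P) xi]%classic.

Section EtaleAlgebra.
Variables (C : variety) (n q : nat) (D : 'I_n -> cdiv C).

Definition algL' : Type := {ffun 'I_n -> Kb}.

Definition mulL (a b : algL') : algL' := [ffun i => a i * b i].
Definition expL (a : algL') (m : nat) : algL' := [ffun i => a i ^+ m].
Definition unitL' : set algL' := [set a | forall i, a i != 0]%classic.

(* The index j such that s (D j) = D i. *)
Definition perm_inv (s : absgal) (i : 'I_n) : 'I_n :=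
  odflt i [pick j | gal_cdiv s (D j) == D i].

Definition actL (s : absgal) (a : algL') : algL' :=
  [ffun i => s (a (perm_inv s i))].

Definition unitL : set algL' :=
  [set a | unitL' a /\ forall s, actL s a = a]%classic.

Definition muL : set algL' := [set a | expL a q = [ffun => 1]]%classic.

(* The class of a in L^* / L^*q, as a coset. *)
Definition qclass (a : algL') : set algL' :=
  [set b | exists2 c, unitL c & b = mulL a (expL c q)]%classic.

Definition mu_class := h1_class mulL actL muL.

(* The Kummer isomorphism sends the class of s |-> s(r) / r to r ^ q; its
   value is the set of all such r ^ q, a coset of L^*q. *)
Definition kummer (c : set (absgal -> algL')) : set algL' :=
  [set l | unitL l /\ exists r, [/\ unitL' r, expL r q = l
     & c = mu_class (fun s => [ffun i => actL s r i / r i])]]%classic.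

Definition evalF (f : 'I_n -> pts C -> Kb) (E : cdiv C) : algL' :=
  [ffun i => eval_cdiv (f i) E].

Definition good_cdiv (E : cdiv C) : Prop :=
  [/\ deg E = 0, rational_cdiv E
    & forall i x, x \in dom E -> x \notin dom (D i)].

Variables (A J : abvar) (phi : pts A -> pts J) (cl : cdiv C -> pts J).

Definition mapF (f : 'I_n -> pts C -> Kb) (X : set (pts J)) : set algL' :=
  [set l | exists E, [/\ good_cdiv E, X (cl E)
                       & qclass (evalF f E) l]]%classic.

Definition map_w (P : pts A) : algL' :=
  [ffun i => weil_pairing phi P (polarization cl (cl (D i)))].

Definition map_w_h1 (c : set (absgal -> pts A)) : set (absgal -> algL') :=
  [set eta | exists2 xi, c xi & mu_class (map_w \o xi) eta]%classic.

Definition in_Psi (x : pts J) : Prop := dual_ker phi (polarization cl x).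

End EtaleAlgebra.
End Points.

(* Main.v *)
(* Fix i and put x = [D_i], E_i = t_x^* Theta - Theta, phi^* E_i = div g_i.
   Restricting along u : Q |-> y - [Q - P0], for y generic, turns E_i into a
   divisor on C of class x, so that u^* E_i - D_i = div w_i for a function w_i
   (autoduality).  For a rational divisor E = sum n_k Q_k and points X_k of A
   over u(Q_k), the number R_i = prod (g_i(X_k) / w_i(Q_k))^n_k is a q-th root
   of f_i(E), because q E_i is principal on J.  With phi P = cl E and
   S = sum n_k X_k, the number r_i = R_i e_i(S + P) depends only on i and P, and
   replacing P by P + kappa multiplies it by e_i(kappa).  As it does not depend
   on the choices of y, g_i, w_i, X_k, a Galois automorphism s sends r_j to the
   r_i computed from s P, where D_i = s D_j; hence s(r)/r = w(s P - P), which is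
   the theorem.  The independence rests on a complete curve carrying no
   nonconstant regular functions.  The multiplicity one in autoduality is where
   characteristic 0 is used: if every y - Q in Theta were a tangency, a
   derivation along C would preserve the ideal of Theta. *)

(* A variety being only its set of points, geometry is rebuilt from homogeneous forms: regular maps
   pull forms of a given degree back to forms up to a local factor, and identities between forms are
   checked generically. A projective Nullstellensatz gives completeness, hence closed images and
   constancy of pole-free functions; degree 0 of principal divisors follows by counting functions
   with bounded poles. Theta is the image of C^(g-1), where g enters only as the length of chains of
   closed sets in J. The images W_r of C^r form such a chain, so W_g = J, and for generic y the
   curve y - C meets Theta in g distinct points whose sum is y. That each of them counts once is the
   hardest step. On J only Cartier divisors with explicit local equations are used. If J has no
   positive dimension, Theta as defined is empty; J is then shown to be a point and handled apart. F
   is evaluated on divisors disjoint from the D_i, while Assumption I yields an arbitrary rational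
   representative. It is moved by the divisor of a Galois-fixed function, built by descent in spaces
   of forms with integer coefficients that avoid finitely many conditions. *)
Require Import Defs.
From HB Require Import structures.
From mathcomp Require Import all_boot all_order all_fingroup all_algebra all_field.
From mathcomp Require Import freeg mpoly.
From mathcomp Require Import boolp classical_sets.
From mathcomp Require Import ring zify.
Set Implicit Arguments.
Unset Strict Implicit.
Unset Printing Implicit Defensive.
Import GRing.Theory Num.Theory.
Local Open Scope ring_scope.

(** * Spaces with graded functions *)

Section GradedSpaces.
Variable k : fieldType.

(* A set of points with the functions given on it by homogeneous polynomials
   (evaluated at normalized coordinates).  Degrees lie in a monoid so that
   products of varieties, with bihomogeneous polynomials, are covered. *)
Record gsp := Gsp {
  gcar :> Type;
  gidx : nmodType;
  form : gidx -> (gcar -> k) -> Prop;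
  formD : forall i a b, form i a -> form i b -> form i (fun s => a s + b s);
  formZ : forall i c a, form i a -> form i (fun s => c * a s);
  formM : forall i j a b,
    form i a -> form j b -> form (i + j) (fun s => a s * b s);
  form1 : form 0 (fun _ => 1);
  form_nv : forall i s, exists2 a, form i a & a s != 0 }.

Lemma form_ext (S : gsp) (i : gidx S) (a b : S -> k) :
  form i a -> a =1 b -> form i b.
Proof. by move=> fa /funext <-. Qed.

Lemma form_cast (S : gsp) (i j : gidx S) (a : S -> k) :
  form i a -> i = j -> form j a.
Proof. by move=> fa <-. Qed.

Section Basic.
Variable S : gsp.
Implicit Types (i j : gidx S) (a b : S -> k) (s t : S) (P Q : S -> Prop).

Lemma form0 i : S -> form i (fun _ : S => 0 : k).
Proof.
move=> s; have [a fa _] := form_nv i s.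
by apply: form_ext (formZ 0 fa) _ => t; rewrite mul0r.
Qed.

Lemma formB i a b : form i a -> form i b -> form i (fun s => a s - b s).
Proof.
move=> fa fb; apply: form_ext (formD fa (formZ (-1) fb)) _ => s.
by rewrite mulN1r.
Qed.

Lemma form_sum (I : Type) (r : seq I) i (F : I -> S -> k) : S ->
  (forall l, form i (F l)) -> form i (fun s => \sum_(l <- r) F l s).
Proof.
move=> s hF; elim: r => [|l r IH].
  by apply: form_ext (form0 i s) _ => t; rewrite big_nil.
by apply: form_ext (formD (hF l) IH) _ => t; rewrite big_cons.
Qed.

Lemma form_prod (I : Type) (r : seq I) (d : I -> gidx S) (F : I -> S -> k) :
  (forall l, form (d l) (F l)) ->
  form (\sum_(l <- r) d l) (fun s => \prod_(l <- r) F l s).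
Proof.
move=> hF; elim: r => [|l r IH].
  by rewrite big_nil; apply: form_ext (form1 S) _ => t; rewrite big_nil.
by rewrite big_cons; apply: form_ext (formM (hF l) IH) _ => t; rewrite big_cons.
Qed.

Lemma formX i a m : form i a -> form (i *+ m) (fun s => a s ^+ m).
Proof.
move=> fa; elim: m => [|m IH].
  by rewrite mulr0n; apply: form_ext (form1 S) _ => s; rewrite expr0.
by rewrite mulrS; apply: form_ext (formM fa IH) _ => s; rewrite exprS.
Qed.

(** Zariski neighbourhoods, through the basic open sets where a form does not vanish. [gen] asks for
    one nonempty open set, so that its conjunctions ([gen_and]) are where irreducibility enters. *)
Definition near s P := exists i a, [/\ form i a, a s != 0 &
  forall t, a t != 0 -> P t].
Definition gen P := exists s, near s P.

Lemma near_form i a s : form i a -> a s != 0 -> near s (fun t => a t != 0).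
Proof. by exists i, a. Qed.

Lemma near_self s P : near s P -> P s.
Proof. by move=> [i [a [_ ? /(_ s)]]]; apply. Qed.

Lemma near_imp s P Q : near s P -> (forall t, P t -> Q t) -> near s Q.
Proof. by move=> [i [a [? ? H]]] PQ; exists i, a; split=> // t /H /PQ. Qed.

Lemma near_and s P Q : near s P -> near s Q -> near s (fun t => P t /\ Q t).
Proof.
move=> [i [a [fa as0 H]]] [j [b [fb bs0 H']]].
exists (i + j), (fun t => a t * b t); split; first exact: formM.
  by rewrite mulf_neq0.
by move=> t; rewrite mulf_eq0 negb_or => /andP[/H ? /H' ?].
Qed.

Lemma near_T s P : (forall t, P t) -> near s P.
Proof.
by move=> HP; exists 0, (fun _ => 1); split; rewrite ?oner_neq0//; apply: form1.
Qed.

Lemma near_gen s P : near s P -> gen P. Proof. by exists s. Qed.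

Lemma gen_imp P Q : gen P -> (forall t, P t -> Q t) -> gen Q.
Proof. by move=> [s nP] PQ; exists s; apply: near_imp PQ. Qed.

Lemma gen_form i a s : form i a -> a s != 0 -> gen (fun t => a t != 0).
Proof. by move=> fa a0; exists s; apply: near_form fa a0. Qed.

Definition gclosed (Z : set S) := forall s, ~ Z s -> near s (fun t => ~ Z t).

Lemma gclosed_setI (I : Type) (Z : I -> set S) :
  (forall x, gclosed (Z x)) -> gclosed [set s | forall x, Z x s].
Proof.
move=> cZ s /existsNP[x nZ]; apply: near_imp (cZ x s nZ) _.
by move=> t nt /(_ x).
Qed.

Lemma gclosedI (Z Y : set S) :
  gclosed Z -> gclosed Y -> gclosed [set s | Z s /\ Y s].
Proof.
move=> cZ cY s /not_andP[] n; [have := cZ s n|have := cY s n];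
  by move/near_imp; apply=> t + [].
Qed.

Lemma gclosedU (Z Y : set S) :
  gclosed Z -> gclosed Y -> gclosed [set s | Z s \/ Y s].
Proof.
move=> cZ cY s /not_orP[nZ nY]; apply: near_imp (near_and (cZ s nZ) (cY s nY)) _.
by move=> t [? ?] [].
Qed.

Lemma gclosed0 i a : form i a -> gclosed [set s | a s = 0].
Proof. by move=> fa s /eqP a0; apply: near_imp (near_form fa a0) _ => t /eqP. Qed.

Lemma gclosed_form (Z : set S) s : gclosed Z -> ~ Z s ->
  exists i a, [/\ form i a, a s != 0 & forall t, Z t -> a t = 0].
Proof.
move=> cZ /cZ[i [a [fa a0 H]]]; exists i, a; split=> // t Zt.
by apply/eqP/negP => /negP /H.
Qed.

Definition girr := (exists s : S, True) /\
  forall i j a b s t, form i a -> form j b -> a s != 0 -> b t != 0 ->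
  exists u, a u != 0 /\ b u != 0.

Hypothesis irr : girr.

Lemma gen_and P Q : gen P -> gen Q -> gen (fun t => P t /\ Q t).
Proof.
move=> [s [i [a [fa a0 HP]]]] [t [j [b [fb b0 HQ]]]].
have [u [au bu]] := irr.2 _ _ _ _ _ _ fa fb a0 b0.
exists u, (i + j), (fun t => a t * b t); split; first exact: formM.
  by rewrite mulf_neq0.
by move=> v; rewrite mulf_eq0 negb_or => /andP[/HP ? /HQ ?].
Qed.

Lemma gen_ex P : gen P -> exists s, P s.
Proof. by move=> [s /near_self]; exists s. Qed.

Lemma gen_near s P Q : near s P -> gen Q -> exists t, P t /\ Q t.
Proof. by move=> /near_gen nP /(gen_and nP)/gen_ex. Qed.

Lemma form_eq0 i a : form i a -> gen (fun s => a s = 0) -> forall s, a s = 0.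
Proof.
move=> fa ga s; apply/eqP/negP => /negP as0.
by have [t [/eqP]] := gen_near (near_form fa as0) ga.
Qed.

(** The bridge from generic to global: an identity between quotients is cleared of denominators on a
    dense open set, and then holds at every point, also where the denominators vanish. *)
Lemma form_eq i a b : form i a -> form i b ->
  gen (fun s => a s = b s) -> forall s, a s = b s.
Proof.
move=> fa fb gab s; apply/eqP; rewrite -subr_eq0; apply/eqP.
by apply: (form_eq0 (formB fa fb)); apply: gen_imp gab _ => t ->; rewrite subrr.
Qed.

Lemma gclosed_irr (Z Y : set S) : gclosed Z -> gclosed Y ->
  (forall s, Z s \/ Y s) -> (forall s, Z s) \/ (forall s, Y s).
Proof.
move=> cZ cY ZY; apply: contrapT => /not_orP[/existsNP[s nZ] /existsNP[t nY]].
have [u [nZu nYu]] := gen_ex (gen_and (near_gen (cZ s nZ)) (near_gen (cY t nY))).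
by case: (ZY u).
Qed.

End Basic.

(** The factor [c] depends on the degree [j] but not on the form: it cancels in quotients of forms
    of one degree, which is why values of rational functions can be pulled back. *)
Definition greg (S T : gsp) (u : S -> T) := forall s (j : gidx T),
  exists c (i : gidx S), c s != 0 /\
    forall a, form j a -> form i (fun t => c t * a (u t)).

Lemma greg_comp (S T U : gsp) (u : S -> T) (v : T -> U) :
  greg u -> greg v -> greg (fun s => v (u s)).
Proof.
move=> ru rv s j; have [c [i [c0 hc]]] := rv (u s) j.
have [d [l [d0 hd]]] := ru s i.
exists (fun t => d t * c (u t)), l; split; first by rewrite mulf_neq0.
by move=> a /hc /hd fa; apply: form_ext fa _ => t; rewrite mulrA.
Qed.

Lemma greg_const (S T : gsp) (t : T) : greg (fun _ : S => t).
Proof.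
move=> s j; exists (fun _ => 1), 0; split; first exact: oner_neq0.
move=> a _; apply: form_ext (formZ (a t) (form1 S)) _ => u.
by rewrite mulr1 mul1r.
Qed.

Lemma greg_id (S : gsp) : greg (fun s : S => s).
Proof.
move=> s j; exists (fun _ => 1), j; split; first exact: oner_neq0.
by move=> a fa; apply: form_ext fa _ => t; rewrite mul1r.
Qed.

Lemma greg_near (S T : gsp) (u : S -> T) s (P : T -> Prop) :
  greg u -> near (u s) P -> near s (fun t => P (u t)).
Proof.
move=> ru [j [a [fa a0 HP]]]; have [c [i [c0 /(_ a fa) fc]]] := ru s j.
exists i, (fun t => c t * a (u t)); split=> //; first by rewrite mulf_neq0.
by move=> t; rewrite mulf_eq0 negb_or => /andP[_ /HP].
Qed.

Lemma greg_gen (S T : gsp) (u : S -> T) (P : T -> Prop) : girr T ->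
  greg u -> (forall t, exists s, u s = t) -> gen P -> gen (fun s => P (u s)).
Proof.
move=> irr ru su [t nP]; have [s us] := su t.
by exists s; apply: greg_near ru _; rewrite us.
Qed.

Lemma greg_closed (S T : gsp) (u : S -> T) (Z : set T) :
  greg u -> gclosed Z -> gclosed [set s | Z (u s)].
Proof. by move=> ru cZ s /cZ /(greg_near ru). Qed.

(** * Products and bihomogeneous forms *)

Section Product.
Variables S T : gsp.

(** Finite sums of products stand for bihomogeneous polynomials; with one argument fixed they are
    forms on the other factor ([form_slice1], [form_slice2]). *)
Definition pform (ij : (gidx S * gidx T)%type) (a : S * T -> k) :=
  exists n (b : 'I_n -> S -> k) (c : 'I_n -> T -> k),
    [/\ forall l, form ij.1 (b l), forall l, form ij.2 (c l)
      & forall x, a x = \sum_(l < n) b l x.1 * c l x.2].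

Lemma pformD i a b : pform i a -> pform i b -> pform i (fun s => a s + b s).
Proof.
move=> [n [b1 [c1 [fb1 fc1 E1]]]] [m [b2 [c2 [fb2 fc2 E2]]]].
exists (n + m)%N, (fun l => match split l with inl l => b1 l | inr l => b2 l end),
  (fun l => match split l with inl l => c1 l | inr l => c2 l end).
split=> [l|l|x]; [by case: split|by case: split|].
rewrite E1 E2 big_split_ord /=; congr (_ + _); apply: eq_bigr => l _.
  by rewrite (unsplitK (inl l)).
by rewrite (unsplitK (inr l)).
Qed.

Lemma pformZ i c a : pform i a -> pform i (fun s => c * a s).
Proof.
move=> [n [b1 [c1 [fb1 fc1 E1]]]].
exists n, (fun l s => c * b1 l s), c1; split=> // [l|x]; first exact: formZ.
by rewrite E1 mulr_sumr; apply: eq_bigr => l _; rewrite mulrA.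
Qed.

Lemma pform_mul1 i j a b :
  form i a -> form j b -> pform (i, j) (fun x => a x.1 * b x.2).
Proof.
move=> fa fb; exists 1%N, (fun _ => a), (fun _ => b); split=> // x.
by rewrite big_ord1.
Qed.

Lemma pform_sum (I : Type) (r : seq I) i (F : I -> S * T -> k) : 
  (forall l, pform i (F l)) -> pform i (fun s => \sum_(l <- r) F l s).
Proof.
move=> hF; elim: r => [|l r IH].
  exists 0%N, (fun _ _ => 0), (fun _ _ => 0); split=> [[]//|[]//|x].
  by rewrite big_ord0 big_nil.
rewrite (_ : (fun _ => _) = (fun s => F l s + \sum_(j <- r) F j s)).
  exact: pformD.
by apply/funext => s; rewrite big_cons.
Qed.

Lemma pformM i j a b :
  pform i a -> pform j b -> pform (i + j) (fun s => a s * b s).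
Proof.
move=> [n [b1 [c1 [fb1 fc1 E1]]]] [m [b2 [c2 [fb2 fc2 E2]]]].
rewrite (_ : (fun _ => _) = (fun x => \sum_(l < n) \sum_(p < m)
   (b1 l x.1 * b2 p x.1) * (c1 l x.2 * c2 p x.2))); last first.
  apply/funext => x; rewrite E1 E2 mulr_suml; apply: eq_bigr => l _.
  by rewrite mulr_sumr; apply: eq_bigr => p _; rewrite mulrACA.
apply: pform_sum => l; apply: pform_sum => p.
exact: (pform_mul1 (formM (fb1 l) (fb2 p)) (formM (fc1 l) (fc2 p))).
Qed.

Lemma pform1 : pform 0 (fun _ => 1).
Proof.
have := pform_mul1 (form1 S) (form1 T).
by rewrite (_ : (fun _ => _) = fun _ => 1)//; apply/funext => x; rewrite mulr1.
Qed.

Lemma pform_nv i s : exists2 a, pform i a & a s != 0.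
Proof.
case: i s => i j [s t]; have [a fa a0] := form_nv i s.
have [b fb b0] := form_nv j t.
by exists (fun x => a x.1 * b x.2); [apply: pform_mul1|rewrite mulf_neq0].
Qed.

Definition gprod : gsp := Gsp pformD pformZ pformM pform1 pform_nv.

Lemma form_slice1 (i : gidx gprod) a (s0 : S) (t : T) :
  form i a -> form i.1 (fun s => a (s, t) : k).
Proof.
move=> [n [b [c [fb fc E]]]].
apply: (form_ext (form_sum (index_enum 'I_n) s0 (fun l => formZ (c l t) (fb l)))).
by move=> u; rewrite E; apply: eq_bigr => l _; rewrite mulrC.
Qed.

Lemma form_slice2 (i : gidx gprod) a (s : S) (t0 : T) :
  form i a -> form i.2 (fun t => a (s, t) : k).
Proof.
move=> [n [b [c [fb fc E]]]].
apply: (form_ext (form_sum (index_enum 'I_n) t0 (fun l => formZ (b l s) (fc l)))).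
by move=> u; rewrite E.
Qed.

Lemma greg_fst : greg (fun x : gprod => x.1).
Proof.
move=> [s t] i; exists (fun _ => 1), (i, 0); split; first exact: oner_neq0.
move=> a fa; apply: (@form_ext gprod _ _ _ (pform_mul1 fa (form1 T))) => x.
by rewrite mulr1 mul1r.
Qed.

Lemma greg_snd : greg (fun x : gprod => x.2).
Proof.
move=> [s t] i; exists (fun _ => 1), (0, i); split; first exact: oner_neq0.
by move=> a fa; apply: (@form_ext gprod _ _ _ (pform_mul1 (form1 S) fa)) => x.
Qed.

Lemma greg_pair (U : gsp) (u : U -> S) (v : U -> T) :
  greg u -> greg v -> greg (fun x => (u x, v x) : gprod).
Proof.
move=> ru rv x [i j]; have [c [p [c0 hc]]] := ru x i.
have [d [q [d0 hd]]] := rv x j.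
exists (fun y => c y * d y), (p + q); split; first by rewrite mulf_neq0.
move=> a [n [b [e [fb fe E]]]].
apply: (form_ext (form_sum (index_enum 'I_n) x
  (fun l => formM (hc _ (fb l)) (hd _ (fe l))))) => y.
by rewrite E /= mulr_sumr; apply: eq_bigr => l _; rewrite mulrACA.
Qed.

End Product.
End GradedSpaces.

(** * Varieties and their morphisms as graded spaces *)

Section Varieties.
Variables (K : fieldType) (Kb : closedFieldType) (iota : {rmorphism K -> Kb}).
Local Notation variety := (variety iota).

Lemma pevZ n (F : {mpoly Kb[n]}) d c v :
  F \is d.-homog -> pev F (c *: v) = c ^+ d * pev F v.
Proof.
move=> /dhomogP hF; rewrite /pev !mevalE mulr_sumr; apply: eq_big_seq => m mF.
rewrite mulrCA -(hF m mF) /= mdegE expr_sum -big_split /=; congr (_ * _).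
by apply: eq_bigr => i _; rewrite mxE exprMn.
Qed.

Section VForm.
Variable X : variety.

Definition vform (d : nat) (a : pts X -> Kb) :=
  exists2 F : {mpoly Kb[ncoords X]}, F \is d.-homog & a =1 fun x => pev F (coords x).

Lemma vformD d a b : vform d a -> vform d b -> vform d (fun x => a x + b x).
Proof.
move=> [F hF E] [G hG E']; exists (F + G); first exact: rpredD.
by move=> x; rewrite E E' /pev mevalD.
Qed.

Lemma vformZ d c a : vform d a -> vform d (fun x => c * a x).
Proof.
move=> [F hF E]; exists (c *: F); first exact: rpredZ.
by move=> x; rewrite E /pev mevalZ.
Qed.

Lemma vformM d e a b :
  vform d a -> vform e b -> vform (d + e)%R (fun x => a x * b x).
Proof.
move=> [F hF E] [G hG E']; exists (F * G); first exact: dhomogM.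
by move=> x; rewrite E E' /pev mevalM.
Qed.

Lemma vform1 : vform 0 (fun _ => 1).
Proof. by exists 1; [exact: dhomog1|move=> x; rewrite /pev meval1]. Qed.

Lemma dhomogXU n (i : 'I_n) : ('X_i : {mpoly Kb[n]}) \is 1.-homog.
Proof. by rewrite dhomogX /= mdeg1. Qed.

Lemma vform_nv d x : exists2 a, vform d a & a x != 0.
Proof.
have /andP[/existsP[i /andP[/eqP xi _]] _] := coordsP x.
exists (fun y => (coords y) 0 i ^+ d).
  exists ('X_i ^+ d); last by move=> y; rewrite /pev rmorphXn /= mevalXU.
  by have := dhomogMn d (dhomogXU i); rewrite mul1n.
by rewrite xi expr1n oner_neq0.
Qed.

Canonical gv : gsp Kb := Gsp vformD vformZ vformM vform1 vform_nv.

Lemma nearP (x : pts X) P : nearby x P <-> near x P.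
Proof.
split=> [[d [H [hH Hx HP]]]|[d [a [[H hH E] ax HP]]]].
  by exists d, (fun y => pev H (coords y)); split=> //; exists H.
exists d, H; split=> //; first by rewrite /basic_open /= -E.
by move=> y; rewrite /basic_open /= -E => /HP.
Qed.

Lemma genP (P : pts X -> Prop) : generically P <-> gen P.
Proof. by split=> [[x /nearP]|[x /nearP]]; exists x. Qed.

Lemma gvirr : girr gv.
Proof.
have [[x _] irr] := @v_irr _ _ _ X; split; first by exists x.
move=> d e a b s t [F hF EF] [G hG EG] as0 bt0; apply: contrapT => nu.
pose Z (H : {mpoly Kb[ncoords X]}) := [set y : pts X | forall p, [set H]%classic p -> pev p (coords y) = 0]%classic.
have cZ H d' : H \is d'.-homog -> zclosed (Z H).
  by move=> hH; exists [set H]%classic; split=> // p ->; exists d'.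
case: (irr (Z F) (Z G) (cZ F d hF) (cZ G e hG)).
- move=> y _; apply: contrapT => /not_orP[/existsNP[p /not_implyP[/= -> Fy]]].
  move=> /existsNP[q /not_implyP[/= -> Gy]]; apply: nu; exists y.
  by rewrite EF EG; split; apply/eqP.
- by move=> /(_ s I F erefl) /eqP; rewrite -EF (negbTE as0).
- by move=> /(_ t I G erefl) /eqP; rewrite -EG (negbTE bt0).
Qed.

Lemma gclosedP (Z : set (pts X)) : gclosed (S := gv) Z <-> zclosed Z.
Proof.
split=> [cZ|[S [hS ->]] s /existsNP[p /not_implyP[Sp /eqP ps]]]; last first.
  have [d hp] := hS p Sp.
  exists d, (fun y => pev p (coords y)); split=> //; first by exists p.
  by move=> t pt /(_ p Sp) /eqP; rewrite (negbTE pt).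
exists [set p | (exists d, p \is d.-homog) /\ forall x, Z x -> pev p (coords x) = 0]%classic.
split; first by move=> p [].
apply/seteqP; split=> x /= Zx; first by move=> p [_]; apply.
apply: contrapT => /(gclosed_form cZ)[d [a [[F hF E] ax0 a0]]].
move: ax0; rewrite E Zx ?eqxx//; split; first by exists d.
by move=> y Zy; rewrite -E a0.
Qed.

End VForm.

Lemma form_pev (S : gsp Kb) N (i0 : gidx S) (v : S -> 'rV[Kb]_N)
    (F : {mpoly Kb[N]}) (d : nat) : S ->
  (forall j, form i0 (fun s => v s 0 j)) -> F \is d.-homog ->
  form (i0 *+ d) (fun s => pev F (v s)).
Proof.
move=> s0 hv /dhomogP hF.
have hm m : m \in msupp F -> form (i0 *+ d) (fun s => F@_m * \prod_i (v s 0 i) ^+ m i).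
  move=> mF; apply: formZ; have := form_prod (index_enum 'I_N) (fun j => formX (m j) (hv j)).
  by rewrite sumrMnr -mdegE (hF m mF).
suff : forall r, {subset r <= msupp F} ->
    form (i0 *+ d) (fun s => \sum_(m <- r) F@_m * \prod_i (v s 0 i) ^+ m i).
  by move=> /(_ (msupp F) (fun m => id)) H; apply: (form_ext H) => s; rewrite /pev mevalE.
elim=> [|m r IH] sub.
  by apply: (form_ext (form0 _ s0)) => s; rewrite big_nil.
have mF : m \in msupp F by apply: sub; rewrite inE eqxx.
have rF : {subset r <= msupp F} by move=> l lr; apply: sub; rewrite inE lr orbT.
by apply: (form_ext (formD (hm _ mF) (IH rF))) => s; rewrite big_cons.
Qed.

(** Around [s] the map is given by forms proportional to the normalized coordinates of the image,
    with ratio [c t]. A form of degree [e] thus pulls back to a form after multiplication by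
    [c t ^+ e]. *)
Lemma regular_map_greg (B : set Kb) (S : gsp Kb) N (v : S -> 'rV[Kb]_N)
    (i0 : gidx S) (Y : variety) (u : S -> pts Y) :
  (forall j, form i0 (fun s => v s 0 j)) ->
  regular_map B v (fun s => coords (u s)) -> greg (T := gv Y) u.
Proof.
move=> hv ru s e; have [d [F [hF [j0 Fj0] hc]]] := ru s.
have [c cE] := choice hc.
exists (fun t => c t ^+ e), ((i0 *+ d) *+ e); split.
  by rewrite expf_neq0//; apply: contraNneq Fj0 => c0; rewrite cE c0 mul0r.
move=> a [G hG E].
have hFv j : form (i0 *+ d) (fun t => (\row_j pev (F j) (v t)) 0 j).
  by apply: (form_ext (form_pev s hv (hF j).1)) => t; rewrite mxE.
apply: (form_ext (form_pev s hFv hG)) => t; rewrite E -pevZ//; congr pev.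
by apply/rowP => j; rewrite !mxE cE.
Qed.

Lemma coords_form (X : variety) j : form (1%N : gidx (gv X)) (fun x => (coords x) 0 j).
Proof. by exists 'X_j; [exact: dhomogXU|move=> x; rewrite /pev mevalXU]. Qed.

Lemma morphism_greg (X Y : variety) (u : pts X -> pts Y) :
  Defs.morphism u -> greg (S := gv X) (T := gv Y) u.
Proof.
move=> hu; apply: (@regular_map_greg _ (gv X) _ _ (1%N : nat) _ _ _ hu) => j.
exact: coords_form.
Qed.

Lemma morphism2_greg (X Y Z : variety) (u : pts X -> pts Y -> pts Z) :
  morphism2 u -> greg (S := gprod (gv X) (gv Y)) (T := gv Z) (fun x => u x.1 x.2).
Proof.
move=> hu.
apply: (@regular_map_greg _ (gprod (gv X) (gv Y)) _ _ (1%N : nat, 1%N : nat) _ _ _ hu) => j.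
case/mxvec_indexP: j => i j.
apply: (@form_ext _ (gprod (gv X) (gv Y)) _ _ _
  (pform_mul1 (coords_form i) (coords_form j))) => x.
by rewrite /segre mxvecE !mxE big_ord1 mxE.
Qed.

End Varieties.

(** * Rational functions as generic quotients of forms *)

Section Rational.
Variables (K : fieldType) (Kb : closedFieldType) (iota : {rmorphism K -> Kb}).
Local Notation variety := (variety iota).
Variable X : variety.
Implicit Types (f g : pts X -> Kb) (a b : pts X -> Kb) (x y : pts X).

Local Notation gen := (@gen Kb (gv X)).
Local Notation near := (@near Kb (gv X)).
Let irr := gvirr X.

(** [f] is tied to the fraction only generically, so values at a point are read off [a] and [b],
    never off [f]. Different fractions for the same [f] are compared by [quo_uniq]. *)
Definition quo f a b :=
  exists d, [/\ vform d a, vform d b & gen (fun s => b s != 0 /\ f s = a s / b s)].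

Lemma quo_nz f a b : quo f a b -> exists x, b x != 0.
Proof. by move=> [d [_ _ /gen_ex[x [bx _]]]]; exists x. Qed.

Lemma quoT f : rational_over setT f <-> exists a b, quo f a b.
Proof.
split=> [[d [F [G [hF hG _ _ /genP q]]]]|[a [b [d [[F hF EF] [G hG EG] q]]]]].
  exists (fun x => pev F (coords x)), (fun x => pev G (coords x)), d.
  by split=> //; [exists F|exists G].
exists d, F, G; split=> //; apply/genP; apply: gen_imp q _ => y.
by rewrite EF EG.
Qed.

Lemma has_valueP f x v :
  has_value f x v <-> exists a b, [/\ quo f a b, b x != 0 & v = a x / b x].
Proof.
split=> [[d [F [G [hF hG Gx /genP q ->]]]]|[a [b [[d [[F hF EF] [G hG EG] q]] bx ->]]]].
  exists (fun x => pev F (coords x)), (fun x => pev G (coords x)); split=> //.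
  by exists d; split=> //; [exists F|exists G].
exists d, F, G; split=> //; first by rewrite /basic_open /= -EG.
  by apply/genP; apply: gen_imp q _ => y; rewrite EF EG.
by rewrite EF EG.
Qed.

Lemma regularP f x : regular_at f x <-> exists a b, quo f a b /\ b x != 0.
Proof.
split=> [[v /has_valueP[a [b [q bx _]]]]|[a [b [q bx]]]]; first by exists a, b.
by exists (a x / b x); apply/has_valueP; exists a, b.
Qed.

Lemma unitP f x : unit_at f x <-> exists a b, [/\ quo f a b, a x != 0 & b x != 0].
Proof.
split=> [[v v0 /has_valueP[a [b [q bx Ev]]]]|[a [b [q ax bx]]]].
  by exists a, b; split=> //; apply: contraNneq v0 => a0; rewrite Ev a0 mul0r.
exists (a x / b x); first by rewrite mulf_neq0 ?invr_neq0.
by apply/has_valueP; exists a, b.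
Qed.

Lemma quo_uniq f a b c d : quo f a b -> quo f c d -> forall x, a x * d x = c x * b x.
Proof.
move=> [n [fa fb q]] [m [fc fd r]].
apply: (form_eq irr (formM fa fd) (form_cast (formM fc fb) (addrC _ _))).
apply: gen_imp (gen_and irr q r) _ => s [[b0 fE] [d0]]; rewrite fE => E.
by apply: (mulIf (invr_neq0 b0)); rewrite mulfK// mulrAC E divfK.
Qed.

Lemma quo_gen f g a b : quo f a b -> gen (fun x => f x = g x) -> quo g a b.
Proof.
move=> [n [fa fb q]] E; exists n; split=> //.
by apply: gen_imp (gen_and irr q E) _ => s [[? ->] ->].
Qed.

Lemma quoM f g a b c d :
  quo f a b -> quo g c d -> quo (fun x => f x * g x) (fun x => a x * c x) (fun x => b x * d x).
Proof.
move=> [n [fa fb q]] [m [fc fd r]]; exists (n + m)%R; split; [exact: formM..|].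
apply: gen_imp (gen_and irr q r) _ => s [[b0 ->] [d0 ->]].
by split; [rewrite mulf_neq0|rewrite mulf_div].
Qed.

Lemma quoD f g a b c d : quo f a b -> quo g c d ->
  quo (fun x => f x + g x) (fun x => a x * d x + c x * b x) (fun x => b x * d x).
Proof.
move=> [n [fa fb q]] [m [fc fd r]]; exists (n + m)%R; split.
- exact: formD (formM fa fd) (form_cast (formM fc fb) (addrC _ _)).
- exact: formM.
apply: gen_imp (gen_and irr q r) _ => s [[b0 ->] [d0 ->]].
by split; [rewrite mulf_neq0|rewrite addf_div].
Qed.

Lemma quoV f a b : quo f a b -> (exists x, a x != 0) -> quo (fun x => (f x)^-1) b a.
Proof.
move=> [n [fa fb q]] [x0 ax0]; exists n; split=> //.
by apply: gen_imp (gen_and irr q (gen_form fa ax0)) _ => s [[b0 ->] a0]; rewrite invf_div.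
Qed.

Lemma quo_const c : quo (fun _ => c) (fun _ => c) (fun _ => 1).
Proof.
exists 0; split; [|exact: vform1|].
  by apply: (form_ext (formZ c (vform1 X))) => x; rewrite mulr1.
have [x _] := irr.1; exists x; apply: near_T => y.
by rewrite oner_neq0 divr1.
Qed.

Lemma quo_form d a b : vform d a -> vform d b -> (exists x, b x != 0) ->
  quo (fun x => a x / b x) a b.
Proof.
by move=> fa fb [x bx]; exists d; split=> //; apply: gen_imp (gen_form fb bx) _.
Qed.

Lemma has_value_uniq f x v w : has_value f x v -> has_value f x w -> v = w.
Proof.
move=> /has_valueP[a [b [q bx ->]]] /has_valueP[c [d [r dx ->]]].
by apply/eqP; rewrite eqr_div// (quo_uniq q r) mulrC.
Qed.

Lemma valueE f x v : has_value f x v -> value f x = v.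
Proof.
move=> h; have : has_value f x (value f x) by apply: (@xgetPex _ 0); exists v.
by move/has_value_uniq; apply.
Qed.

Lemma has_value_gen f g x v :
  has_value f x v -> gen (fun x => f x = g x) -> has_value g x v.
Proof.
move=> /has_valueP[a [b [q bx ->]]] E; apply/has_valueP; exists a, b.
by split=> //; apply: quo_gen q E.
Qed.

Lemma has_valueM f g x v w : has_value f x v -> has_value g x w ->
  has_value (fun x => f x * g x) x (v * w).
Proof.
move=> /has_valueP[a [b [q bx ->]]] /has_valueP[c [d [r dx ->]]].
apply/has_valueP; exists (fun x => a x * c x), (fun x => b x * d x).
by split; [exact: quoM|rewrite mulf_neq0|rewrite mulf_div].
Qed.

Lemma has_valueD f g x v w : has_value f x v -> has_value g x w ->
  has_value (fun x => f x + g x) x (v + w).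
Proof.
move=> /has_valueP[a [b [q bx ->]]] /has_valueP[c [d [r dx ->]]].
apply/has_valueP; exists (fun x => a x * d x + c x * b x), (fun x => b x * d x).
by split; [exact: quoD|rewrite mulf_neq0|rewrite addf_div].
Qed.

Lemma has_valueV f x v : v != 0 -> has_value f x v -> has_value (fun x => (f x)^-1) x v^-1.
Proof.
move=> v0 /has_valueP[a [b [q bx Ev]]].
have a0 : a x != 0 by apply: contraNneq v0 => a0; rewrite Ev a0 mul0r.
by apply/has_valueP; exists b, a; rewrite Ev invf_div; split=> //; apply: quoV q _; exists x.
Qed.

Lemma has_value_const c x : has_value (fun _ => c) x c.
Proof.
apply/has_valueP; exists (fun _ => c), (fun _ => 1).
by rewrite oner_neq0 divr1; split=> //; apply: quo_const.
Qed.

Lemma has_valueX f x v m : has_value f x v -> has_value (fun x => f x ^+ m) x (v ^+ m).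
Proof.
move=> h; elim: m => [|m IH]; first exact: has_value_const.
rewrite exprS (_ : (fun _ => _) = fun x => f x * f x ^+ m); first exact: has_valueM.
by apply/funext => y; rewrite exprS.
Qed.

Lemma has_valueXz f x v (m : int) : v != 0 -> has_value f x v ->
  has_value (fun x => f x ^ m) x (v ^ m).
Proof.
move=> v0 h; case: m => m; first exact: has_valueX.
by apply: has_valueV; [rewrite expf_neq0|exact: has_valueX].
Qed.

Lemma unit_value f x : unit_at f x -> value f x != 0 /\ has_value f x (value f x).
Proof. by move=> [v v0 h]; rewrite (valueE h). Qed.

Lemma unit_gen f g x : unit_at f x -> gen (fun x => f x = g x) -> unit_at g x.
Proof. by move=> [v v0 h] E; exists v => //; apply: has_value_gen h E. Qed.

Lemma unitM f g x : unit_at f x -> unit_at g x -> unit_at (fun x => f x * g x) x.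
Proof.
by move=> [v v0 h] [w w0 h']; exists (v * w); [rewrite mulf_neq0|apply: has_valueM].
Qed.

Lemma unitV f x : unit_at f x -> unit_at (fun x => (f x)^-1) x.
Proof.
by move=> [v v0 h]; exists (v^-1); [rewrite invr_neq0|apply: has_valueV].
Qed.

Lemma unitD f g x : unit_at f x -> unit_at g x -> unit_at (fun x => f x / g x) x.
Proof. by move=> h /unitV h'; apply: unitM. Qed.

Lemma unit_const c x : c != 0 -> unit_at (fun _ : pts X => c) x.
Proof. by exists c => //; apply: has_value_const. Qed.

Lemma unitXz f x (m : int) : unit_at f x -> unit_at (fun x => f x ^ m) x.
Proof.
by move=> [v v0 h]; exists (v ^ m); [rewrite expfz_neq0|apply: has_valueXz].
Qed.

Lemma unitX f x m : unit_at f x -> unit_at (fun x => f x ^+ m) x.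
Proof. exact: (@unitXz _ _ m). Qed.

Lemma unit_near f x : unit_at f x -> near x (unit_at f).
Proof.
move=> /unitP[a [b [[d [fa fb q]] ax bx]]].
apply: near_imp (near_and (near_form fa ax) (near_form fb bx)) _ => y [ay by0].
by apply/unitP; exists a, b; split=> //; exists d.
Qed.

Lemma unit_regular f x : unit_at f x -> regular_at f x.
Proof. by move=> [v _ h]; exists v. Qed.

Lemma nzP f : nzrational f <-> exists a b, quo f a b /\ exists x, a x != 0.
Proof.
split=> [[/quoT[a [b [d [fa fb q]]]] /genP f0]|[a [b [q [x ax]]]]].
  exists a, b; split; first by exists d.
  have [x [[b0 ->] +]] := gen_ex (gen_and irr q f0).
  by exists x; move: b1; rewrite mulf_eq0 negb_or => /andP[].
have [d [fa fb q']] := q; split; first by apply/quoT; exists a, b.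
apply/genP; apply: gen_imp (gen_and irr q' (gen_form fa ax)) _ => y [[b0 ->] a0].
by rewrite mulf_neq0 ?invr_neq0.
Qed.

Lemma nz_gen f : nzrational f -> gen (fun x => f x != 0).
Proof. by move=> [_ /genP]. Qed.

Lemma quo_nzn f a b : nzrational f -> quo f a b -> exists x, a x != 0.
Proof.
move=> /nz_gen f0 [d [_ _ q]]; have [x [[b0 ->]]] := gen_ex (gen_and irr q f0).
by rewrite mulf_eq0 negb_or => /andP[? _]; exists x.
Qed.

Lemma nzM f g : nzrational f -> nzrational g -> nzrational (fun x => f x * g x).
Proof.
move=> /nzP[a [b [q [x ax]]]] /nzP[c [d [r [y cy]]]]; apply/nzP.
exists (fun x => a x * c x), (fun x => b x * d x); split; first exact: quoM.
have [n [fa _ _]] := q; have [m [fc _ _]] := r.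
have [z [az cz]] := irr.2 _ _ _ _ _ _ fa fc ax cy.
by exists z; rewrite mulf_neq0.
Qed.

Lemma nzV f : nzrational f -> nzrational (fun x => (f x)^-1).
Proof.
move=> /nzP[a [b [q ax]]]; apply/nzP; exists b, a; split; first exact: quoV.
exact: quo_nz q.
Qed.

Lemma nz_div f g : nzrational f -> nzrational g -> nzrational (fun x => f x / g x).
Proof. by move=> nf /nzV; apply: nzM. Qed.

Lemma nz_const c : c != 0 -> nzrational (fun _ : pts X => c).
Proof.
move=> c0; apply/nzP; exists (fun _ => c), (fun _ => 1); split; first exact: quo_const.
by have [x _] := irr.1; exists x.
Qed.

Lemma nzXz f (m : int) : nzrational f -> nzrational (fun x => f x ^ m).
Proof.
have nzXn g n : nzrational g -> nzrational (fun x => g x ^+ n).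
  move=> ng; elim: n => [|n IH]; first exact/nz_const/oner_neq0.
  rewrite (_ : (fun _ => _) = fun x => g x * g x ^+ n); first exact: nzM.
  by apply/funext => x; rewrite exprS.
by move=> nf; case: m => m; [apply: nzXn|apply: nzV; apply: nzXn].
Qed.

Lemma nz_gen_eq f g : nzrational f -> gen (fun x => f x = g x) -> nzrational g.
Proof.
move=> /nzP[a [b [q ax]]] E; apply/nzP; exists a, b; split=> //.
exact: quo_gen q E.
Qed.

Lemma unit_nz f x : unit_at f x -> nzrational f.
Proof. by move=> /unitP[a [b [q ax _]]]; apply/nzP; exists a, b; split=> //; exists x. Qed.

End Rational.

(** * Chain conditions and the Nullstellensatz *)

Section Noetherian.

(** Each index is chosen to minimise [u] beyond the previous one. *)
Lemma nondecreasing_subseq (u : nat -> nat) : exists g : nat -> nat,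
  (forall i, (g i < g i.+1)%N) /\ forall i j, (i <= j)%N -> (u (g i) <= u (g j))%N.
Proof.
have minP N : exists i, (N <= i)%N /\ forall j, (N <= j)%N -> (u i <= u j)%N.
  suff : forall v i, (N <= i)%N -> (u i <= v)%N ->
      exists i, (N <= i)%N /\ forall j, (N <= j)%N -> (u i <= u j)%N.
    by move=> /(_ (u N) N (leqnn _) (leqnn _)).
  elim=> [|v IH] i Ni ui; first by exists i; split=> // j _; apply: leq_trans ui _.
  case: (pselect (exists2 j, (N <= j)%N & (u j <= v)%N)) => [[j Nj uj]|nj].
    exact: IH Nj uj.
  exists i; split=> // j Nj; apply: leq_trans ui _; rewrite ltnNge.
  by apply/negP => uj; apply: nj; exists j.
have [f fP] := choice minP.
pose g := fix g i := if i is i'.+1 then f (g i').+1 else f 0%N.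
have gS i : (g i < g i.+1)%N by have [] := fP (g i).+1.
have gmin i j : (g i <= j)%N -> (u (g i) <= u j)%N.
  case: i => [|i] gj; first by have [_ H] := fP 0%N; apply: H.
  by have [H1 H2] := fP (g i).+1; apply: H2; apply: leq_trans gj.
exists g; split=> // i j ij; apply: gmin.
elim: j ij => [|j IH]; first by rewrite leqn0 => /eqP->.
rewrite leq_eqVlt => /orP[/eqP->//|/IH /leq_trans]; apply; exact/ltnW/gS.
Qed.

(** Passing to subsequences makes the exponents of one variable after another nondecreasing; the
    first two terms of the last subsequence are comparable. *)
Lemma dickson n (m : nat -> 'X_{1..n}) :
  exists i j, (i < j)%N /\ (m i <= m j)%MM.
Proof.
suff [g [gS gm]] : exists g : nat -> nat, (forall i, (g i < g i.+1)%N) /\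
    forall l, l \in enum 'I_n -> forall i j, (i <= j)%N -> (m (g i) l <= m (g j) l)%N.
  exists (g 0%N), (g 1%N); split=> //; apply/mnm_lepP => l; apply: gm => //.
  by rewrite mem_enum.
elim: (enum 'I_n) => [|l r [g [gS gm]]]; first by exists id; split.
have [h [hS hm]] := nondecreasing_subseq (fun i => m (g i) l).
have gmono i j : (i < j)%N -> (g i < g j)%N.
  elim: j => // j IH; rewrite ltnS leq_eqVlt => /orP[/eqP->//|/IH].
  by move/ltn_trans; apply.
have hmono i j : (i <= j)%N -> (h i <= h j)%N.
  elim: j => [|j IH]; first by rewrite leqn0 => /eqP->.
  rewrite leq_eqVlt => /orP[/eqP->//|/IH /leq_trans]; apply; exact/ltnW/hS.
exists (fun i => g (h i)); split=> [i|l']; first exact/gmono/hS.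
rewrite inE => /orP[/eqP->|lr] i j ij; first exact: hm.
by apply: gm => //; apply: hmono.
Qed.

Variables (k : fieldType) (n : nat).
Implicit Types (p q r : {mpoly k[n]}) (J : set {mpoly k[n]}).

Definition mideal J :=
  [/\ J 0, forall p q, J p -> J q -> J (p + q) & forall p q, J q -> J (p * q)].

Let inI (p : nat -> {mpoly k[n]}) m x :=
  forall J, mideal J -> (forall l, (l < m)%N -> J (p l)) -> J x.

Lemma mlead_cancel p q : mlead p = mlead q -> mleadc p = mleadc q -> p - q != 0 ->
  (mlead (p - q) < mlead p)%O.
Proof.
move=> E C pq0; rewrite Order.POrderTheory.lt_neqAle; apply/andP; split.
  apply: contraNneq pq0 => E'; rewrite -mleadc_eq0 E' mcoeffB {2}E C subrr//.
by have := mleadB_le p q; rewrite -E Order.JoinTheory.joinxx.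
Qed.

(** The Hilbert basis theorem by leading monomials. If no [p m] lies in the ideal [inI p m] of its
    predecessors, let [r m] be congruent to [p m] modulo that ideal with minimal leading monomial.
    By Dickson the lead of some [r i] divides that of an [r j] with [i < j], and cancelling it
    contradicts minimality. *)
Lemma poly_acc (p : nat -> {mpoly k[n]}) :
  exists m (q : nat -> {mpoly k[n]}), p m = \sum_(l < m) q l * p l.
Proof.
apply: contrapT => np.
have notI m : ~ inI p m (p m).
  move=> /(_ [set x | exists q : nat -> {mpoly k[n]}, x = \sum_(l < m) q l * p l]%classic).
  move=> H; apply: np; exists m; apply: H.
    split=> [|x y [q ->] [q' ->]|x y [q ->]].
    - by exists (fun _ => 0); rewrite big1// => i _; rewrite mul0r.
    - exists (fun l => q l + q' l); rewrite -big_split /=.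
      by apply: eq_bigr => l _; rewrite mulrDl.
    - exists (fun l => x * q l); rewrite mulr_sumr.
      by apply: eq_bigr => l _; rewrite mulrA.
  move=> l lm; exists (fun l' => (l' == l)%:R).
  rewrite (bigD1 (Ordinal lm)) //= eqxx mul1r big1 ?addr0// => i.
  by rewrite -val_eqE /= => /negbTE->; rewrite mul0r.
have minP m : exists r, inI p m (r - p m) /\
    forall r', inI p m (r' - p m) -> ~~ (mlead r' < mlead r)%O.
  apply: contrapT => nr.
  suff : forall r, ~ inI p m (r - p m).
    by move=> /(_ (p m)); apply; rewrite subrr => J [].
  elim/mleadrect => r IH Ir; apply: nr; exists r; split=> // r' Ir'.
  by apply/negP => /IH.
have [r rP] := choice minP.
have r0 m : r m != 0.
  apply/negP => /eqP E; have [] := rP m; rewrite E sub0r => H _; apply: (notI m) => J iJ hJ.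
  have [_ _ /(_ (-1) _ (H J iJ hJ))] := iJ; by rewrite mulN1r opprK.
have [i [j [ij le]]] := dickson (fun m => mlead (r m)).
pose s := (mleadc (r j) / mleadc (r i)) *: ('X_[(mlead (r j) - mlead (r i))%MM] * r i).
have ci : mleadc (r i) != 0 by rewrite mleadc_eq0.
have cj : mleadc (r j) != 0 by rewrite mleadc_eq0.
have cij : mleadc (r j) / mleadc (r i) != 0 by rewrite mulf_neq0 ?invr_neq0.
have X0 : ('X_[(mlead (r j) - mlead (r i))%MM] : {mpoly k[n]}) != 0.
  by rewrite -mleadc_eq0 mleadXm mcoeffX eqxx oner_neq0.
have Es : mlead s = mlead (r j) by rewrite mleadZ// mleadM// mleadXm submK.
have Cs : mleadc s = mleadc (r j).
  have := mleadcM 'X_[(mlead (r j) - mlead (r i))%MM] (r i).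
  rewrite mleadXm submK// mcoeffX eqxx mul1r => E.
  by rewrite Es mcoeffZ E divfK.
have Is : inI p j s.
  move=> J iJ hJ; have [_ JD JM] := iJ; rewrite /s -mul_mpolyC; do 2 apply: (JM).
  have [H _] := rP i; rewrite -(subrK (p i) (r i)).
  apply: JD; last exact: hJ.
  by apply: H => // l li; apply: hJ; apply: ltn_trans ij.
have [Ij /(_ (r j - s))] := rP j.
have IJ : inI p j (r j - s - p j).
  move=> J iJ hJ; have [_ JD JM] := iJ; rewrite addrAC; apply: JD; first exact: Ij.
  by rewrite -mulN1r; apply: JM; apply: Is.
move=> /(_ IJ) /negP; apply; apply: mlead_cancel => //.
apply/negP => /eqP E; move: IJ; rewrite E sub0r => H.
apply: (notI j) => J iJ hJ; have [_ _ /(_ (-1) _ (H J iJ hJ))] := iJ.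
by rewrite mulN1r opprK.
Qed.

Lemma pihomogM d e p q : p \is d.-homog ->
  pihomog mdeg e (q * p) = if (d <= e)%N then pihomog mdeg (e - d) q * p else 0.
Proof.
move=> hp; rewrite {1}(pihomog_partitionE (leqnn (mmeasure mdeg q))).
set N := mmeasure _ _; rewrite mulr_suml raddf_sum /=.
have E (l : 'I_N) : pihomog mdeg e (pihomog mdeg l q * p) =
    if (l + d == e)%N then pihomog mdeg l q * p else 0.
  have h : pihomog mdeg l q * p \is (l + d).-homog by apply: dhomogM hp; apply: pihomogP.
  by case: eqP => [<-|/eqP ne]; [rewrite pihomog_dE|rewrite (pihomog_ne0 ne)].
rewrite (eq_bigr _ (fun l _ => E l)); case: leqP => de; last first.
  rewrite big1// => l _; case: eqP => // le.
  by move: de; rewrite -le ltnNge leq_addl.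
case: (ltnP (e - d) N) => h.
  rewrite (bigD1 (Ordinal h)) //= subnK// eqxx big1 ?addr0// => l.
  rewrite -val_eqE /= => ne; case: eqP => // le.
  by move: ne; rewrite -le addnK eqxx.
rewrite big1 => [|l _].
  rewrite (_ : pihomog _ _ q = 0) ?mul0r//.
  rewrite [q in LHS](pihomog_partitionE (leqnn (mmeasure mdeg q))) raddf_sum big1// => l _.
  apply: (@pihomog_ne0 _ _ _ l); last exact: pihomogP.
  by apply: contraTneq h => <-; rewrite -ltnNge.
case: eqP => // le; move: h; rewrite -le addnK leqNgt ltn_ord//.
Qed.

End Noetherian.

Section VNoetherian.
Variables (K : fieldType) (Kb : closedFieldType) (iota : {rmorphism K -> Kb}).
Variable X : variety iota.

(** Homogeneous version of [poly_acc]: the component of degree [d m] of the relation drops the forms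
    of degree above [d m]. *)
Lemma acc_form (a : nat -> pts X -> Kb) (d : nat -> nat) :
  (forall l, vform (d l) (a l)) -> exists m (b : nat -> pts X -> Kb),
    (forall l, (d l <= d m)%N -> vform (d m - d l) (b l)) /\
    forall x, a m x = \sum_(l < m | (d l <= d m)%N) b l x * a l x.
Proof.
move=> fa; have h l : exists F : {mpoly Kb[ncoords X]}, F \is (d l).-homog /\
    a l =1 fun x => pev F (coords x) by have [F ? ?] := fa l; exists F.
have [F FP] := choice h; have [m [q E]] := poly_acc F.
exists m, (fun l x => pev (pihomog mdeg (d m - d l) (q l)) (coords x)); split.
  by move=> l _; exists (pihomog mdeg (d m - d l) (q l)) => //; apply: pihomogP.
move=> x; have [hm ->] := FP m; rewrite -(pihomog_dE hm) E raddf_sum /=.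
rewrite /pev raddf_sum [RHS]big_mkcond /=; apply: eq_bigr => l _.
have [hl El] := FP l; rewrite (pihomogM _ _ hl) El; case: ifP => _; last exact: meval0.
by rewrite mevalM.
Qed.

(** Noetherian induction. An endless strict descent would give at each step a polynomial vanishing
    on the next set but not at some point of the current one, against [poly_acc]. *)
Lemma gclosed_min (P : set (pts X) -> Prop) (Z : set (pts X)) :
  gclosed (S := gv X) Z -> P Z -> exists Y, [/\ gclosed (S := gv X) Y, P Y &
    forall Y', gclosed (S := gv X) Y' -> P Y' -> (forall x, Y' x -> Y x) -> 
      forall x, Y x -> Y' x].
Proof.
move=> cZ PZ; apply: contrapT => nY.
pose T := {Y : set (pts X) | gclosed (S := gv X) Y /\ P Y}.
have step (t : T) : exists t' : T, (forall x, sval t' x -> sval t x) /\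
    exists x, sval t x /\ ~ sval t' x.
  case: t => Y [cY PY] /=; apply: contrapT => nt; apply: nY; exists Y; split=> // Y' cY' PY' sub x Yx.
  by apply: contrapT => nx; apply: nt; exists (exist _ Y' (conj cY' PY')); split=> //; exists x.
have [s sP] := choice step.
pose z := fix z i : T := if i is i'.+1 then s (z i') else exist _ Z (conj cZ PZ).
have sub i j : (i <= j)%N -> forall x, sval (z j) x -> sval (z i) x.
  elim: j => [|j IH]; first by rewrite leqn0 => /eqP->.
  rewrite leq_eqVlt => /orP[/eqP->//|/IH H] x /= zx.
  by apply: H; apply: (sP (z j)).1.
have wit i : exists (x : pts X) (F : {mpoly Kb[ncoords X]}), [/\ sval (z i) x,
    pev F (coords x) != 0 & forall y, sval (z i.+1) y -> pev F (coords y) = 0].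
  have [_ [x [zx nz]]] := sP (z i).
  have [d [a [[F hF E] ax a0]]] := gclosed_form (svalP (z i.+1)).1 nz.
  exists x, F; split=> //; first by have /= <- := E x.
  by move=> y zy; have /= <- := E y; apply: a0.
have [x xP] := choice wit; have [F FP] := choice xP.
have [m [q E]] := poly_acc F.
have [zm /eqP nF _] := FP m; apply: nF; rewrite E /pev raddf_sum big1// => l _.
rewrite /= mevalM; have [_ _ H] := FP l.
by move: (H (x m)); rewrite /pev => ->; [rewrite mulr0|apply: sub zm].
Qed.

End VNoetherian.

(** * Zeros of prime ideals over an algebraically closed field *)

Section PrimeZero.
Variable k : closedFieldType.

(** Iterated univariate polynomials let the induction on the number of variables use pseudo-division
    over an integral domain with one variable less. *)
Fixpoint iterpoly n : idomainType :=
  if n is m.+1 then {poly (iterpoly m)} : idomainType else k.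

Section Eval.
Variables (A : comNzRingType) (f0 : {rmorphism k -> A}).

Fixpoint itev n : (nat -> A) -> {rmorphism iterpoly n -> A} :=
  if n is m.+1 then fun x =>
    (horner_eval (x 0%N) \o map_poly (itev m (fun i => x i.+1)))
      : {rmorphism iterpoly m.+1 -> A}
  else fun _ => f0 : {rmorphism iterpoly 0 -> A}.

Lemma itev_const n x c : exists p, itev n x p = f0 c.
Proof.
elim: n x => [|n IH] x; first by exists c.
have [p E] := IH (fun i => x i.+1); exists p%:P.
by rewrite /= map_polyC /= /horner_eval hornerC.
Qed.

Lemma itev_var n x i : (i < n)%N -> exists p, itev n x p = x i.
Proof.
elim: n x i => [|n IH] x [|i] //= lt; first by exists 'X; rewrite map_polyX /horner_eval hornerX.
have [p E] := IH (fun i => x i.+1) i lt; exists p%:P.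
by rewrite map_polyC /= /horner_eval hornerC.
Qed.

End Eval.

Lemma itev_comp (A B : comNzRingType) (f0 : {rmorphism k -> A})
    (g : {rmorphism A -> B}) (f1 : {rmorphism k -> B}) n x y p :
  (forall c, g (f0 c) = f1 c) -> (forall i, (i < n)%N -> g (x i) = y i) ->
  g (itev f0 n x p) = itev f1 n y p.
Proof.
move=> gf; elim: n x y p => [|n IH] x y p gx; first exact: gf.
rewrite /= /horner_eval -gx// -horner_map -map_poly_comp; congr (_.[_]).
by apply: eq_map_poly => c /=; apply: IH => i ni; apply: gx.
Qed.

Definition prime_ideal (R : comNzRingType) (P : set R) :=
  [/\ P 0, forall p q, P p -> P q -> P (p + q), forall p q, P q -> P (p * q),
      ~ P 1 & forall p q, P (p * q) -> P p \/ P q].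

Section Step.
Variables (R : idomainType) (P : set {poly R}).
Hypothesis prP : prime_ideal P.

Let E (q : {poly R}) := forall i, P (q`_i)%:P.

Lemma prime_ideal_polyC : prime_ideal [set c | P c%:P].
Proof.
have [P0 PD PM P1 PP] := prP; split=> //=.
- by move=> p q ? ?; rewrite polyCD; apply: PD.
- by move=> p q ?; rewrite polyCM; apply: PM.
- by move=> p q; rewrite polyCM => /PP.
Qed.

Lemma coef_ideal q : E q -> P q.
Proof.
have [P0 PD PM _ _] := prP => Eq; rewrite -[q]coefK poly_def.
elim/big_ind: _ => // i _; rewrite -mul_polyC mulrC; exact: PM.
Qed.

Lemma coef_idealD p q : E p -> E q -> E (p + q).
Proof. by have [_ PD _ _ _] := prP => Ep Eq i; rewrite coefD polyCD; apply: PD. Qed.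

Lemma coef_idealM p q : E q -> E (p * q).
Proof.
have [P0 PD PM _ _] := prP => Eq i; rewrite coefM raddf_sum /=.
by elim/big_ind: _ => // j _; rewrite polyCM; apply: PM.
Qed.

(** Take an element of least size outside the extended ideal. If its leading coefficient were in
    [P], removing the leading term would give a smaller one. *)
Lemma coef_ideal_min (I : set {poly R}) :
  (forall p q, I p -> I q -> I (p + q)) -> (forall p q, I q -> I (p * q)) ->
  (forall q, E q -> I q) -> (exists2 p, I p & ~ E p) ->
  exists h, [/\ I h, ~ P (lead_coef h)%:P & forall p, I p -> (size p < size h)%N -> E p].
Proof.
move=> ID IM EI [p Ip nEp].
suff : forall n (p : {poly R}), (size p <= n)%N -> I p -> ~ E p -> exists h, [/\ I h, ~ E h
    & forall p, I p -> (size p < size h)%N -> E p].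
  move=> /(_ _ p (leqnn _) Ip nEp)[h [Ih nEh hm]]; exists h; split=> // Plc; apply/nEh.
  have h0 : h != 0 by apply/eqP => h0; apply/nEh => i; rewrite h0 coef0 raddf0; case: prP.
  pose t := (lead_coef h)%:P * 'X^((size h).-1) : {poly R}.
  have Et : E t by move=> i; rewrite coefCM coefXn; case: eqP; rewrite ?mulr1// mulr0 raddf0; case: prP.
  rewrite -(subrK t h); apply: coef_idealD => //; apply: hm.
    by apply: ID => //; rewrite -mulN1r; apply/IM/EI.
  have sh : (0 < size h)%N by rewrite lt0n size_poly_eq0.
  rewrite -(prednK sh) ltnS; apply/leq_sizeP => j; rewrite leq_eqVlt => /orP[/eqP<-|lt].
    by rewrite coefB coefCM coefXn eqxx mulr1 lead_coefE subrr.
  rewrite coefB coefCM coefXn gtn_eqF// mulr0 subr0 nth_default//.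
  by rewrite -(prednK sh).
elim=> [|n IH] {Ip nEp}p sp Ip nEp.
  by exists p; split=> // q _; move: sp; rewrite leqn0 => /eqP->.
case: (pselect (exists q, [/\ I q, ~ E q & (size q < size p)%N])) => [[q [Iq nEq lt]]|nq].
  by apply: IH Iq nEq; rewrite -ltnS; apply: leq_trans lt sp.
by exists p; split=> // q Iq lt; apply: contrapT => nEq; apply: nq; exists q.
Qed.

(* Zeros of a prime ideal P of R[X]: either P is extended from R, or it is
   generated by one polynomial up to inverting its leading coefficient; in the
   second case b is invertible modulo P up to an element of R. *)
Lemma prime_ideal_extend (b : {poly R}) : ~ P b ->
  (forall p, P p -> E p) /\ (exists i, ~ P (b`_i)%:P) \/
  exists (f : {poly R}) (e : R), [/\ (1 < size f)%N, ~ P (lead_coef f)%:P, ~ P e%:P,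
     forall p, P p -> exists m q r, (lead_coef f)^+ m *: p = q * f + r /\ E r
   & exists u p, P p /\ e%:P = u * b + p].
Proof.
have [P0 PD PM P1 PP] := prP => nPb.
case: (pselect (exists2 p, P p & ~ E p)) => [exf|nf]; last first.
  left; split=> [p Pp|]; first by apply: contrapT => nE; apply: nf; exists p.
  by apply: contrapT => H; apply/nPb/coef_ideal => i; apply: contrapT => ?; apply: H; exists i.
right; have [f [Pf lf fm]] := coef_ideal_min PD PM coef_ideal exf.
have PN p : P p -> P (- p) by move=> Pp; rewrite -mulN1r; apply: PM.
(* [f] generates [P] up to leading coefficients, and [h] below plays the same role for the ideal [I]
   generated by [P] and [b]. The aim is that [h] is constant; it will serve as [e]. *)
pose I := [set x | exists u p, P p /\ x = u * b + p]%classic.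
have ID p q : I p -> I q -> I (p + q).
  move=> [u [p' [Pp ->]]] [v [q' [Pq ->]]]; exists (u + v), (p' + q').
  by split; [apply: PD|rewrite mulrDl addrACA].
have IM p q : I q -> I (p * q).
  move=> [u [q' [Pq ->]]]; exists (p * u), (p * q').
  by split; [apply: PM|rewrite mulrDr mulrA].
have PI p : P p -> I p by exists 0, p; rewrite mul0r add0r.
have [h [Ih lh hm]] := coef_ideal_min ID IM (fun q Eq => PI _ (coef_ideal Eq))
   (let: ex_intro2 p Pp nE := exf in ex_intro2 _ _ p (PI p Pp) nE).
have nz (p : {poly R}) : ~ P (lead_coef p)%:P -> p != 0.
  by move=> H; apply/eqP => p0; apply: H; rewrite p0 lead_coef0.
have lcX (p : {poly R}) m : ~ P (lead_coef p)%:P -> ~ P ((lead_coef p)^+ m)%:P.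
  move=> H; elim: m => [|m IH]; first by rewrite expr0.
  by rewrite exprS polyCM => /PP[].
have nEf : ~ E f by move=> /(_ (size f).-1).
have nEh : ~ E h by move=> /(_ (size h).-1).
have divE p (q := p %/ h) (r := p %% h) : I p -> E r /\
    (lead_coef h ^+ scalp p h)%:P * p = q * h + r.
  move=> Ip; have eq := Pdiv.Idomain.divp_eq p h; split; last by rewrite mul_polyC.
  apply: hm; last by rewrite ltn_modp nz.
  have -> : r = (lead_coef h ^+ scalp p h)%:P * p + (- q) * h.
    by rewrite mul_polyC eq mulNr addrAC subrr add0r.
  by apply: ID; apply: IM.
have nPh : ~ P h.
  move=> Ph; have Ib : I b by exists 1, 0; rewrite mul1r addr0.
  have [Er eq] := divE b Ib.
  have : P ((lead_coef h ^+ scalp b h)%:P * b).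
    by rewrite eq; apply: PD; [apply: PM|apply: coef_ideal].
  by move=> /PP[/lcX|].
(* Up to a power of its leading coefficient [h] divides [f], so the quotient [q] lies in [P] because
   [h] does not. If [h] were not constant, [q] would be smaller than [f], hence have all its
   coefficients in [P], and the leading coefficient of [f] would be in [P] too. *)
have sh : size h = 1%N.
  apply/eqP; rewrite eqn_leq lt0n size_poly_eq0 nz// andbT leqNgt; apply/negP => sh.
  have [Er eq] := divE f (PI _ Pf); set q : {poly R} := f %/ h in eq; set r : {poly R} := f %% h in Er eq.
  have Pq : P q.
    have : P (q * h).
      have -> : q * h = (lead_coef h ^+ scalp f h)%:P * f - r by rewrite eq addrK.
      by apply: PD; [apply: PM|apply/PN/coef_ideal].
    by move=> /PP[].
  have Eq : E q.
    have [->|q0] := eqVneq (q : {poly R}) 0; first by move=> i; rewrite coef0 raddf0.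
    apply: fm => //; have hf : (size h <= size f)%N.
      by rewrite leqNgt; apply/negP => /(hm f (PI _ Pf))/nEf.
    have : (size (q * h)%R <= size f)%N.
      have -> : q * h = (lead_coef h ^+ scalp f h)%:P * f - r by rewrite eq addrK.
      apply: leq_trans (size_polyD _ _) _; rewrite geq_max size_polyN mul_polyC size_scale_leq /=.
      by apply: leq_trans hf; apply/ltnW; rewrite ltn_modp nz.
    rewrite size_mul ?(nz _ lh)//; move: sh; case: (size h) => [|[|m]] // _.
    by rewrite !addnS /= => lt; apply: leq_trans lt; rewrite ltnS leq_addr.
  have : E ((lead_coef h ^+ scalp f h)%:P * f).
    by rewrite eq; apply: coef_idealD => //; rewrite mulrC; apply: coef_idealM.
  by move=> /(_ (size f).-1); rewrite coefCM polyCM => /PP[/lcX|].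
have hC : h = (lead_coef h)%:P.
  by rewrite [LHS]size1_polyC ?sh// lead_coefE sh.
exists f, (lead_coef h); split=> //.
- rewrite ltnNge; apply/negP => sf; apply: lf.
  have -> : (lead_coef f)%:P = f by rewrite lead_coefE [RHS]size1_polyC//; case: (size f) sf => [|[]].
  by [].
- move=> p Pp; exists (scalp p f), (p %/ f), (p %% f); have eq := Pdiv.Idomain.divp_eq p f.
  split=> //; apply: fm; last by rewrite ltn_modp nz.
  have -> : p %% f = (lead_coef f ^+ scalp p f)%:P * p + (- (p %/ f)) * f.
    by rewrite mul_polyC eq mulNr addrAC subrr add0r.
  by apply: PD; apply: PM.
- by have [u [p [Pp eh]]] := Ih; exists u, p; rewrite -hC.
Qed.

End Step.

(** A zero [v] of the contraction of [P] is extended by one coordinate. If [P] is extended, [v] is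
    chosen off the zeros of a coefficient of [b] and the new coordinate off the roots of [b].
    Otherwise [v] keeps [lead_coef f] and [e] nonzero; a root of [f] over [v] is a zero of [P], and
    [b] cannot vanish there since it divides [e] modulo [P]. *)
Lemma prime_zero n (P : set (iterpoly n)) b : prime_ideal P -> ~ P b ->
  exists v : nat -> k, (forall p, P p -> itev idfun n v p = 0) /\ itev idfun n v b != 0.
Proof.
elim: n P b => [|n IH] P b prP nPb.
  exists (fun _ => 0); have [P0 PD PM P1 PP] := prP; split=> /= [p Pp|].
    apply/eqP/negP => /negP p0; apply: P1; rewrite -(mulVf p0); exact: PM.
  by apply/eqP => b0; apply: nPb; rewrite b0.
have ev_nz (v : nat -> k) (p : {poly iterpoly n}) i :
    itev idfun n v p`_i != 0 -> map_poly (itev idfun n v) p != 0.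
  by apply: contraNneq => /(congr1 (fun q : {poly k} => q`_i)); rewrite coef_map coef0 => ->.
have ev_E (v : nat -> k) (p : {poly iterpoly n}) :
    (forall c, P c%:P -> itev idfun n v c = 0) -> (forall i, P (p`_i)%:P) ->
    map_poly (itev idfun n v) p = 0.
  by move=> hv Ep; apply/polyP => i; rewrite coef_map coef0; apply: hv.
have prp := prime_ideal_polyC prP.
case: (prime_ideal_extend prP nPb) => [[PE [i nbi]]|].
  have [v [hv bv]] := IH _ _ prp nbi.
  have /closed_nonrootP[t /negbTE nt] := ev_nz _ _ _ bv.
  exists (fun i => if i is j.+1 then v j else t); split=> [p Pp|] /=.
    by rewrite /horner_eval /= (ev_E v) ?horner0//; apply: PE.
  by rewrite /horner_eval /=; move: nt; rewrite /root => ->.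
move=> [f [e [sf nlf ne fdiv [u [p0 [Pp0 eq]]]]]].
have [_ _ _ _ /(_ (lead_coef f) e)] := prp => /= H.
have nle : ~ [set c | P c%:P]%classic (lead_coef f * e) by move=> /H[].
have [v [hv]] := IH _ _ prp nle; rewrite rmorphM mulf_eq0 negb_or => /andP[lv ev].
have sfv : size (map_poly (itev idfun n v) f) != 1%N.
  have -> : size (map_poly (itev idfun n v) f) = size f.
    by rewrite size_map_poly_id0// lv.
  by rewrite gtn_eqF.
have /closed_rootP[t /eqP ft] := sfv.
have zP p : P p -> (map_poly (itev idfun n v) p).[t] = 0.
  move=> /fdiv[m [q [r [E Er]]]].
  have : (map_poly (itev idfun n v) (lead_coef f ^+ m *: p)).[t] = 0.
    by rewrite E rmorphD rmorphM /= hornerD hornerM ft mulr0 (ev_E v)// horner0 addr0.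
  rewrite map_polyZ hornerZ rmorphXn /= => /eqP.
  by rewrite mulf_eq0 expf_eq0 (negbTE lv) andbF => /eqP.
exists (fun i => if i is j.+1 then v j else t); split=> [p Pp|]; first exact: zP.
rewrite /= /horner_eval /=; apply: contraNneq ev => bt.
have : (map_poly (itev idfun n v) (u * b + p0)).[t] = 0.
  by rewrite rmorphD rmorphM /= hornerD hornerM bt mulr0 zP// addr0.
by rewrite -eq map_polyC hornerC => ->.
Qed.

Lemma mpoly_prime_zero n (P : set {mpoly k[n]}) (b : {mpoly k[n]}) :
  prime_ideal P -> ~ P b ->
  exists v : 'I_n -> k, (forall p, P p -> p.@[v] = 0) /\ b.@[v] != 0.
Proof.
move=> prP nPb; pose x (i : nat) : {mpoly k[n]} := if insub i is Some j then 'X_j else 0.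
pose kap := itev (@mpolyC n k) n x.
have surj p : exists q, kap q = p.
  have sX m : exists q, kap q = 'X_[m].
    rewrite mpolyXE_id; elim/big_ind: _ => [|p1 p2 [q1 <-] [q2 <-]|i _].
    - by exists 1; rewrite rmorph1.
    - by exists (q1 * q2); rewrite rmorphM.
    - have [q E] := itev_var (@mpolyC n k) x (ltn_ord i).
      by exists (q ^+ m i); rewrite rmorphXn /= [kap q]E /x valK.
  elim/mpolyind: p => [|c m p _ _ [q <-]]; first by exists 0; rewrite rmorph0.
  have [q1 E1] := sX m; have [q2 E2] := itev_const (@mpolyC n k) n x c.
  by exists (q2 * q1 + q); rewrite rmorphD rmorphM /= E1 [kap q2]E2 mul_mpolyC.
have [b' Eb] := surj b.
have prQ : prime_ideal [set q | P (kap q)].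
  have [P0 PD PM P1 PP] := prP; split=> /=; rewrite ?rmorph0 ?rmorph1//.
  - by move=> p q ? ?; rewrite rmorphD; apply: PD.
  - by move=> p q ?; rewrite rmorphM; apply: PM.
  - by move=> p q; rewrite rmorphM => /PP.
have nb : ~ P (kap b') by rewrite Eb.
have [v [hv bv]] := prime_zero prQ nb.
have ev q : (kap q).@[fun i => v (i : 'I_n)] = itev idfun n v q.
  apply: (itev_comp (g := meval (fun i : 'I_n => v i))) => [c|i ni]; first exact: mevalC.
  by rewrite /x insubT /= mevalXU.
exists (fun i => v (i : 'I_n)); split=> [p|]; last by rewrite -Eb ev.
by have [q <-] := surj p => /hv; rewrite ev.
Qed.

(** The chain condition gives an ideal maximal among those above [J] containing no power of [b].
    Adding either of two elements outside it brings in a power of [b], and the product of these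
    powers lies in the ideal enlarged by the product of the two elements. *)
Lemma prime_ideal_max n (J : set {mpoly k[n]}) (b : {mpoly k[n]}) :
  mideal J -> (forall m, ~ J (b ^+ m)) -> exists P, [/\ prime_ideal P, ~ P b &
    forall p, J p -> P p].
Proof.
move=> iJ nJ.
pose good (I : set {mpoly k[n]}) := mideal I /\ forall m, ~ I (b ^+ m).
have [P [gP [JP maxP]]] : exists P, good P /\ (forall p, J p -> P p) /\
    forall Q, good Q -> (forall p, P p -> Q p) -> forall p, Q p -> P p.
  apply: contrapT => nP.
  pose T := {I : set {mpoly k[n]} | good I /\ forall p, J p -> I p}.
  have step (t : T) : exists t' : T, (forall p, sval t p -> sval t' p) /\
      exists p, sval t' p /\ ~ sval t p.
    case: t => I [gI JI]; apply: contrapT => nt; apply: nP; exists I; split=> //; split=> //.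
    move=> Q gQ IQ p Qp; apply: contrapT => nI; apply: nt.
    exists (exist _ Q (conj gQ (fun p Jp => IQ p (JI p Jp)))); split=> //=; by exists p.
  have [s sP] := choice step.
  pose z := fix z i : T := if i is i'.+1 then s (z i') else exist _ J (conj (conj iJ nJ) (fun p Jp => Jp)).
  have sub i j : (i <= j)%N -> forall x, sval (z i) x -> sval (z j) x.
    elim: j => [|j IH]; first by rewrite leqn0 => /eqP->.
    by rewrite leq_eqVlt => /orP[/eqP->//|/IH H] x /H /(proj1 (sP _)).
  have wit i : exists p, sval (z i.+1) p /\ ~ sval (z i) p by have [] := sP (z i).
  have [p pP] := choice wit; have [m [q E]] := poly_acc p.
  have [_] := pP m; apply; rewrite E.
  have [[[z0 zD zM] _] _] := svalP (z m).
  elim/big_ind: _ => [//|//|l _]; apply: zM; apply: (sub l.+1) => //.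
  by have [] := pP l.
have [[P0 PD PM] nb] := gP; exists P; split=> //; last by rewrite -(expr1 b); apply: nb.
split=> //; first by rewrite -(expr0 b); apply: nb.
move=> p q Ppq; apply: contrapT => /not_orP[np nq].
have ext (x : {mpoly k[n]}) : ~ P x -> exists m y z, P z /\ b ^+ m = y * x + z.
  move=> nx; apply: contrapT => H; apply: nx.
  apply: (maxP [set w | exists y z, P z /\ w = y * x + z]%classic).
  - split=> [|m [y [z [Pz E]]]]; last by apply: H; exists m, y, z.
    split; first by exists 0, 0; rewrite mul0r addr0.
      move=> _ _ [y [z [Pz ->]]] [y' [z' [Pz' ->]]]; exists (y + y'), (z + z').
      by split; [apply: PD|rewrite mulrDl addrACA].
    move=> u _ [y [z [Pz ->]]]; exists (u * y), (u * z).
    by split; [apply: PM|rewrite mulrDr mulrA].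
  - by move=> w Pw; exists 0, w; rewrite mul0r add0r.
  - by exists 1, 0; rewrite mul1r addr0.
have [m [y [z [Pz E]]]] := ext _ np; have [m' [y' [z' [Pz' E']]]] := ext _ nq.
apply: (nb (m + m')%N); rewrite exprD E E'.
have -> : (y * p + z) * (y' * q + z') = (y * y') * (p * q) + (y * p + z) * z' + (y' * q) * z.
  by ring.
exact: (PD _ _ (PD _ _ (PM _ _ Ppq) (PM _ _ Pz')) (PM _ _ Pz)).
Qed.

End PrimeZero.

(** * The projective Nullstellensatz *)

Section Projective.
Variables (K : fieldType) (Kb : closedFieldType) (iota : {rmorphism K -> Kb}).
Variable X : variety iota.

Lemma pevK_map n (p : {mpoly K[n]}) v :
  pevK iota p v = pev (map_mpoly iota p) v.
Proof.
rewrite /pevK /pev /map_mpoly /mmap rmorph_sum; apply: eq_bigr => m _ /=.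
by rewrite rmorphM /= mevalC mmap1_id mevalX.
Qed.

Lemma map_mpoly_homog n (p : {mpoly K[n]}) d :
  p \is d.-homog -> map_mpoly iota p \is d.-homog.
Proof.
move=> /dhomogP hp; rewrite /map_mpoly /mmap big_seq; apply: rpred_sum => m mp.
by rewrite /= mmap1_id mul_mpolyC; apply: rpredZ; rewrite dhomogX /=; apply/eqP/hp.
Qed.

Lemma point_of_vector (v : 'rV[Kb]_(ncoords X)) : v != 0 ->
  (forall p, p \in @veqs _ _ _ X -> pevK iota p v = 0) ->
  exists (x : pts X) c, c != 0 /\ v = c *: coords x.
Proof.
move=> v0 hv; have [i0 vi0] : exists i, v 0 i != 0.
  apply: contrapT => /forallNP H; move/negP: v0; apply; apply/eqP/rowP => i.
  by rewrite mxE; apply/eqP/negP => /negP; apply: H.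
have [i vi mini] := @arg_minnP _ i0 (fun i => v 0 i != 0) val vi0.
have P : normalized ((v 0 i)^-1 *: v) &&
    all (fun p => pevK iota p ((v 0 i)^-1 *: v) == 0) (@veqs _ _ _ X).
  apply/andP; split.
    apply/existsP; exists i; rewrite mxE mulVf// eqxx /=; apply/forallP => j.
    apply/implyP => ji; rewrite mxE mulf_eq0; apply/orP; right.
    by apply: contraLR ji; rewrite -leqNgt => /mini.
  apply/allP => p pX; have [d hp] := veqs_homog pX.
  by rewrite pevK_map (pevZ _ _ (map_mpoly_homog hp)) -pevK_map hv// mulr0.
by exists (Zero P), (v 0 i); split=> //=; rewrite scalerA mulfV// scale1r.
Qed.

Section Irrelevant.
Variable H : nat -> (pts X -> Kb) -> Prop.
Hypothesis HF : forall d a, H d a -> vform d a.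
Hypothesis Hnz : forall x, exists d a, H d a /\ a x != 0.

Definition hspan N (a : pts X -> Kb) := exists n (A h : 'I_n -> pts X -> Kb) (e d : 'I_n -> nat),
  [/\ forall i, vform (e i) (A i), forall i, H (d i) (h i), forall i, (e i + d i)%N = N
    & forall x, a x = \sum_i A i x * h i x].

Lemma hspan_ext N a b : hspan N a -> a =1 b -> hspan N b.
Proof. by move=> h /funext <-. Qed.

Lemma hspan0 N : hspan N (fun _ => 0).
Proof.
exists 0%N, (fun _ _ => 0), (fun _ _ => 0), (fun _ => 0%N), (fun _ => 0%N).
by split=> [[]|[]|[]|x] //; rewrite big_ord0.
Qed.

Lemma hspanD N a b : hspan N a -> hspan N b -> hspan N (fun x => a x + b x).
Proof.
move=> [n [A [h [e [d [fA Hh ed E]]]]]] [n' [A' [h' [e' [d' [fA' Hh' ed' E']]]]]].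
pose g T (u : 'I_n -> T) (u' : 'I_n' -> T) (l : 'I_(n + n')) :=
  match split l with inl l => u l | inr l => u' l end.
exists (n + n')%N, (g _ A A'), (g _ h h'), (g _ e e'), (g _ d d'); rewrite /g.
split=> [l|l|l|x]; [by case: split..|].
rewrite E E' big_split_ord /=; congr (_ + _); apply: eq_bigr => l _.
  by rewrite (unsplitK (inl l)).
by rewrite (unsplitK (inr l)).
Qed.

Lemma hspanM N e a b : vform e b -> hspan N a -> hspan (N + e) (fun x => a x * b x).
Proof.
move=> fb [n [A [h [e' [d [fA Hh ed E]]]]]].
exists n, (fun i x => A i x * b x), h, (fun i => (e' i + e)%N), d; split=> // [i|i|x].
- exact: (vformM (fA i) fb).
- by rewrite addnAC ed.
- by rewrite E mulr_suml; apply: eq_bigr => i _; rewrite mulrAC.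
Qed.

Lemma hspan_const N c a : hspan N a -> hspan N (fun x => c * a x).
Proof.
have fc : vform 0 (fun _ : pts X => c).
  by apply: (form_ext (formZ c (vform1 X))) => x; rewrite mulr1.
move=> /(hspanM fc); rewrite addn0 => h; apply: (hspan_ext h) => x; exact: mulrC.
Qed.

Lemma hspan_self d a : H d a -> hspan d a.
Proof.
move=> Ha; exists 1%N, (fun _ _ => 1), (fun _ => a), (fun _ => 0%N), (fun _ => d).
by split=> // [i|x]; [exact: vform1|rewrite big_ord1 mul1r].
Qed.

(** Membership is tested on the points of [X], so that [J] contains the equations of [X] along with
    polynomials representing [H]. *)
Let J (p : {mpoly Kb[ncoords X]}) :=
  forall N, hspan N (fun x => pev (pihomog mdeg N p) (coords x)).

Lemma hspan_ideal : mideal J.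
Proof.
have JD p q : J p -> J q -> J (p + q).
  move=> Jp Jq N; apply: (hspan_ext (hspanD (Jp N) (Jq N))) => x.
  by rewrite raddfD /= /pev mevalD.
split=> //.
  by move=> N; apply: (hspan_ext (hspan0 N)) => x; rewrite raddf0 /pev meval0.
move=> p q Jq; elim/mpolyind: p => [|c m p _ _ IH].
  by move=> N; apply: (hspan_ext (hspan0 N)) => x; rewrite mul0r raddf0 /pev meval0.
rewrite mulrDl; apply: JD => // N.
have hm : ('X_[m] : {mpoly Kb[ncoords X]}) \is (mdeg m).-homog by rewrite dhomogX /=.
rewrite -scalerAl linearZ /= mulrC (pihomogM _ _ hm); case: leqP => mN; last first.
  by apply: (hspan_ext (hspan0 N)) => x; rewrite scaler0 /pev meval0.
have fm : vform (mdeg m) (fun x : pts X => pev 'X_[m] (coords x)) by exists 'X_[m].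
have := hspan_const c (hspanM fm (Jq (N - mdeg m)%N)); rewrite subnK// => h.
by apply: (hspan_ext h) => x; rewrite /pev mevalZ mevalM.
Qed.

(** As [H] has no common zero on [X], every variable has a power in [J]: otherwise a prime ideal
    above [J] avoiding some ['X_j] would have a nonzero zero, that is a point of [X] where all of
    [H] vanishes. *)
Lemma projective_nullstellensatz : exists N, forall a, vform N a -> hspan N a.
Proof.
have [[x0 _] _] := gvirr X.
have n0 : (0 < ncoords X)%N.
  by have /andP[/existsP[i _] _] := coordsP x0; apply: leq_ltn_trans (ltn_ord i).
suff hX : forall j, exists m, J ('X_j ^+ m).
  have [M MP] := choice hX; have [J0 JD JM] := hspan_ideal.
  (* Pigeonhole: in a monomial of degree [N] some exponent reaches [M j]. The existence of at least
     one variable makes the comparison of the sums strict. *)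
  pose N := \sum_j M j; exists N => a [F hF E].
  have Jm m : mdeg m = N -> J 'X_[m].
    move=> mN; have [j mj] : exists j, (M j <= m j)%N.
      apply: contrapT => /forallNP lt.
      have : (mdeg m < N)%N.
        rewrite mdegE /N; pose j0 := Ordinal n0.
        rewrite (bigD1 j0) //= [X in (_ < X)%N](bigD1 j0) //=.
        rewrite -addSn leq_add//; first by rewrite ltnNge; apply/negP/lt.
        by apply: leq_sum => j _; rewrite ltnW// ltnNge; apply/negP/lt.
      by rewrite mN ltnn.
    have -> : m = ((m - U_(j) *+ M j) + U_(j) *+ M j)%MM.
      rewrite submK//; apply/mnm_lepP => i; rewrite mulmnE mnm1E.
      by case: eqP => [<-|]; rewrite ?mul1n ?mul0n.
    by rewrite mpolyXD -mpolyXn; apply/JM/MP.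
  suff /(_ N) h : J F by apply: (hspan_ext h) => x; rewrite pihomog_dE// -E.
  rewrite (mpolyE F); rewrite big_seq; elim/big_ind: _ => // m mF.
  by rewrite -mul_mpolyC; apply/JM/Jm/(dhomog_mf hF).
move=> j; apply: contrapT => /forallNP nJ.
have [P [prP nP JP]] := prime_ideal_max hspan_ideal nJ.
have [v [hv]] := mpoly_prime_zero prP nP; rewrite mevalXU => vj.
pose w : 'rV[Kb]_(ncoords X) := \row_i v i.
have pw p : pev p w = p.@[v] by apply: meval_eq => i; rewrite mxE.
have w0 : w != 0 by apply: contraNneq vj => /rowP/(_ j); rewrite !mxE => ->.
have hE p : p \in @veqs _ _ _ X -> pevK iota p w = 0.
  move=> pX; rewrite pevK_map pw; apply/hv/JP => N; have [d hp] := veqs_homog pX.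
  apply: (hspan_ext (hspan0 N)) => x; have [<-|ne] := eqVneq d N.
    rewrite pihomog_dE ?map_mpoly_homog// -pevK_map.
    by have /andP[_ /allP/(_ p pX)/eqP] := coordsP x.
  by rewrite (pihomog_ne0 ne) ?map_mpoly_homog// /pev meval0.
have [x [c [c0 wE]]] := point_of_vector w0 hE.
have [d [a [Ha ax]]] := Hnz x; have [F hF E] := HF Ha.
move/negP: ax; apply; apply/eqP; rewrite E; apply: (mulfI (expf_neq0 d c0)).
rewrite mulr0 -pevZ// -wE pw; apply/hv/JP => N; have [<-|ne] := eqVneq d N.
  by apply: (hspan_ext (hspan_self Ha)) => y; rewrite pihomog_dE// E.
by apply: (hspan_ext (hspan0 N)) => y; rewrite (pihomog_ne0 ne)// /pev meval0.
Qed.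

End Irrelevant.

(** The monomials of degree [N], which commute with Galois. On [X] they span but may be linearly
    dependent, which matters in [proj_open]. *)
Lemma form_basis N : exists s (mu : 'I_s -> pts X -> Kb),
  (forall i, vform N (mu i) /\ forall (g : absgal iota) x, mu i (gal_pt g x) = g (mu i x)) /\
  forall a, vform N a -> exists c : 'I_s -> Kb, forall x, a x = \sum_i c i * mu i x.
Proof.
set n := ncoords X.
pose B := [seq m : 'X_{1..n < N.+1} <- enum {: 'X_{1..n < N.+1}} | mdeg m == N].
pose e (i : 'I_(size B)) : 'X_{1..n} := tnth (in_tuple B) i.
have eN i : mdeg (e i) = N.
  have := mem_tnth i (in_tuple B); rewrite mem_filter => /andP[/eqP + _]; exact.
exists (size B), (fun i x => pev 'X_[e i] (coords x)); split=> [i|a [F hF E]].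
  split=> [|g x]; first by exists 'X_[e i] => //; rewrite dhomogX /= eN.
  rewrite /pev !mevalX rmorph_prod; apply: eq_bigr => j _.
  by rewrite rmorphXn /= mxE.
have sF : (msize F <= N.+1)%N.
  by rewrite mmeasureE; apply/bigmax_leqP_seq => m mF _; rewrite (dhomog_mf hF mF).
exists (fun i => F@_(e i)) => x; rewrite E /pev [in LHS](mpolywE sF) raddf_sum /=.
transitivity (\sum_(m <- B) meval (fun i => (coords x) 0 i) (F@_m *: 'X_[m])).
  rewrite /B big_filter big_enum_cond [RHS]big_mkcond /=.
  apply: eq_bigr => m _; case: eqP => // /eqP mN.
  by rewrite (dhomog_nemf_coeff hF mN) scale0r meval0.
by rewrite (big_tnth _ _ B) /=; apply: eq_bigr => i _; exact: mevalZ.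
Qed.

End Projective.

(** * Completeness *)

Section Complete.
Variables (K : fieldType) (Kb : closedFieldType) (iota : {rmorphism K -> Kb}).

Lemma gen_all (S : gsp Kb) (I : eqType) (r : seq I) (P : I -> S -> Prop) :
  girr S -> (forall i, i \in r -> gen (P i)) -> gen (fun s => forall i, i \in r -> P i s).
Proof.
move=> irr; elim: r => [|i r IH] h.
  by have [s _] := irr.1; exists s; apply: near_T.
have h' : gen (fun s => forall i, i \in r -> P i s).
  by apply: IH => j jr; apply: h; rewrite inE jr orbT.
apply: gen_imp (gen_and irr (h i (mem_head _ _)) h') _ => s [Pi Pr] j.
by rewrite inE => /orP[/eqP->//|/Pr].
Qed.

Section Constant.
Variable X : variety iota.
Let irr := gvirr X.
Local Notation gen := (@gen Kb (gv X)).

(* A function f without poles acts on forms of some large degree N, so its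
   values are eigenvalues of one matrix. *)
Lemma regular_const f : (forall x : pts X, regular_at f x) ->
  exists c, gen (fun x => f x = c).
Proof.
(* [H] collects the denominators of [f], which have no common zero because [f] is regular
   everywhere. A form in their span remains a form when multiplied by [f]. *)
move=> rf; pose H d b := vform d b /\ exists2 a, vform d a &
  gen (fun s => b s != 0 /\ f s = a s / b s).
have HF d a : H d a -> vform d a by case.
have Hnz x : exists d a, H d a /\ a x != 0.
  have /regularP[a [b [[d [fa fb q]] bx]]] := rf x.
  by exists d, b; split=> //; split=> //; exists a.
have [N hN] := projective_nullstellensatz HF Hnz; have [s [mu [/all_and2[fmu _] mugen]]] := form_basis X N.
have act i : exists nu, vform N nu /\ gen (fun x => nu x = f x * mu i x).
  have [n [A [h [e [d [fA Hh ed E]]]]]] := hN _ (fmu i).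
  have /choice[a aP] : forall l, exists a, vform (d l) a /\
      gen (fun s => h l s != 0 /\ f s = a s / h l s).
    by move=> l; have [_ [a fa q]] := Hh l; exists a.
  exists (fun x => \sum_l A l x * a l x); split.
    have [x _] := irr.1; apply: (form_sum (S := gv X) (index_enum 'I_n) x) => l.
    by rewrite -(ed l); apply: (vformM (fA l)); have [] := aP l.
  have /(gen_all irr) G : forall l, l \in index_enum 'I_n ->
      gen (fun s => h l s != 0 /\ f s = a l s / h l s) by move=> l _; have [] := aP l.
  apply: gen_imp G _ => x hx; rewrite E mulr_sumr; apply: eq_bigr => l _.
  by have [h0 ->] := hx l (mem_index_enum _); rewrite mulrCA divfK.
have [nu nuP] := choice act.
have /choice[M ME] : forall i, exists c : 'I_s -> Kb, forall x, nu i x = \sum_j c j * mu j x.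
  by move=> i; apply: mugen; have [] := nuP i.
pose Mx : 'M[Kb]_s := \matrix_(j, i) M i j.
have [x0 _] := irr.1; have [a fa ax0] := vform_nv (X := X) N x0.
have [ca caE] := mugen a fa.
have [r rE] := closed_field_poly_normal (char_poly Mx).
rewrite (monicP (char_poly_monic Mx)) scale1r in rE.
have /regularP[a0 [b0 [[d [fa0 fb0 q]] _]]] := rf x0.
have G1 : gen (fun x => root (char_poly Mx) (f x)).
  have /(gen_all irr) G : forall i, i \in index_enum 'I_s ->
      gen (fun x => nu i x = f x * mu i x) by move=> i _; have [] := nuP i.
  apply: gen_imp (gen_and irr G (gen_form (S := gv X) fa ax0)) _ => x [hx ax].
  rewrite -eigenvalue_root_char; apply/eigenvalueP; exists (\row_i mu i x).
    apply/rowP => i; rewrite !mxE -(hx i (mem_index_enum _)) ME; apply: eq_bigr => j _.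
    by rewrite !mxE mulrC.
  apply: contraNneq ax => /rowP mu0; rewrite caE big1// => i _.
  by have := mu0 i; rewrite !mxE => ->; rewrite mulr0.
(* The values of [f] are generically among finitely many eigenvalues; by irreducibility a single one
   is taken. *)
have [c cr a0E] : exists2 c, c \in r & forall x, a0 x = c * b0 x.
  apply: contrapT => nc.
  have /(gen_all irr) G : forall c, c \in r -> gen (fun x => a0 x - c * b0 x != 0).
    move=> c cr; have /existsNP[x ne] : ~ forall x, a0 x = c * b0 x by move=> E; apply: nc; exists c.
    apply: (gen_form (S := gv X) (formB (S := gv X) fa0 (formZ (g := gv X) c fb0)) (s := x)).
    by rewrite subr_eq0; apply/eqP.
  have [x [[rt [b0x fx]] hx]] := gen_ex (gen_and irr (gen_and irr G1 q) G).
  move: rt; rewrite rE root_prod_XsubC => /hx; rewrite fx divfK// subrr eqxx //.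
exists c; apply: gen_imp q _ => x [b0x ->].
by rewrite a0E mulfK.
Qed.

Lemma unit_everywhere_const f : (forall x : pts X, unit_at f x) ->
  exists2 c, c != 0 & gen (fun x => f x = c).
Proof.
move=> uf; have [c E] := regular_const (fun x => unit_regular (uf x)).
exists c => //; have [x _] := irr.1.
have [x1 [-> //]] := gen_ex (gen_and irr E (nz_gen (unit_nz (uf x)))).
Qed.

End Constant.

Section Projection.
Variables (Y : gsp Kb) (C : variety iota).
Local Notation P := (gprod Y (gv C)).

Lemma form_det s (J : 'I_s -> gidx Y) (M : Y -> 'M[Kb]_s) (y0 : Y) :
  (forall m j, form (J m) (fun y => M y m j)) ->
  form (\sum_m J m) (fun y => \det (M y)).
Proof.
move=> fM; rewrite /determinant; apply: (form_sum (index_enum {perm 'I_s}) y0) => p.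
by apply: formZ; apply: form_prod.
Qed.

(** The Nullstellensatz on the fibre of [y0] lifts each spanning form [mu m] of degree [N] to a form
    [B m] on the product that vanishes with [F]. Expanding [B m] in the [mu j] gives a matrix [M y]
    with [M y0 = 1]. Where its determinant, a form on [Y], is nonzero, a common zero of [F] would be
    a common zero of all the [mu j]. *)
Lemma proj_open (F : gidx P -> (P -> Kb) -> Prop) (y0 : Y) :
  (forall i a, F i a -> form i a) ->
  (forall x, exists i a, F i a /\ a (y0, x) != 0) ->
  near y0 (fun y => forall x, exists i a, F i a /\ a (y, x) != 0).
Proof.
move=> FF Fnz.
pose H d (h : pts C -> Kb) := exists j a, F (j, d) a /\ h = fun x => a (y0, x).
have [x0 _] := (gvirr C).1.
have HF d h : H d h -> vform d h.
  by move=> [j [a [Fa ->]]]; apply: (form_slice2 y0 x0 (FF _ _ Fa)).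
have Hnz x : exists d h, H d h /\ h x != 0.
  have [[j d] [a [Fa ax]]] := Fnz x.
  by exists d, (fun x => a (y0, x)); split=> //; exists j, a.
have [N hN] := projective_nullstellensatz HF Hnz; have [s [mu [/all_and2[fmu _] mugen]]] := form_basis C N.
pose T (m : pts C -> Kb) := exists j (B : P -> Kb), [/\ form ((j, N) : gidx P) B,
  forall x, B (y0, x) = m x & forall y x, (forall i a, F i a -> a (y, x) = 0) -> B (y, x) = 0].
have TD m m' : T m -> T m' -> T (fun x => m x + m' x).
  move=> [j [B [fB EB zB]]] [j' [B' [fB' EB' zB']]].
  have [g fg g0] := form_nv (g := Y) j y0; have [g' fg' g'0] := form_nv (g := Y) j' y0.
  have lift l (h : Y -> Kb) : form l h -> form ((l, 0) : gidx P) (fun u => h u.1).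
    move=> fh; apply: (form_ext (S := P) (pform_mul1 fh (form1 (gv C)))) => u; exact: mulr1.
  exists (j + j'), (fun u => (g' y0)^-1 * (B u * g' u.1) + (g y0)^-1 * (B' u * g u.1)).
  split=> [|x|y x z].
  - apply: (formD (g := P)); apply: (formZ (g := P)).
      apply: (form_cast (S := P) (formM (g := P) fB (lift _ _ fg'))).
      by congr pair; exact: addr0.
    apply: (form_cast (S := P) (formM (g := P) fB' (lift _ _ fg))).
    by congr pair; [exact: addrC|exact: addr0].
  - by rewrite /= EB EB' mulrCA mulVf// mulr1 mulrCA mulVf// mulr1.
  - by rewrite zB// zB'// !mul0r !mulr0 addr0.
have TH m : hspan H N m -> T m.
  move=> [n [A [h [e [d [fA Hh ed E]]]]]].
  have -> : m = fun x => \sum_i A i x * h i x by apply/funext.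
  elim: (index_enum _) => [|i r IH].
    exists 0, (fun _ => 0); split=> // [|x]; last by rewrite big_nil.
    exact: (form0 (S := P) ((0, N) : gidx P) (y0, x0)).
  have -> : (fun x => \sum_(i <- i :: r) A i x * h i x) =
      fun x => A i x * h i x + \sum_(i <- r) A i x * h i x.
    by apply/funext => x; rewrite big_cons.
  apply: TD => //; have [j [a [Fa ->]]] := Hh i.
  exists j, (fun u => A i u.2 * a u); split=> // [|y x z]; last by rewrite (z _ _ Fa) mulr0.
  have fm : form ((0, e i) + (j, d i) : gidx P) (fun u => A i u.2 * a u).
    apply: (form_ext (S := P) (formM (g := P) (pform_mul1 (form1 Y) (fA i)) (FF _ _ Fa))) => u.
    by rewrite mul1r.
  by apply: (form_cast (S := P) fm); congr pair; [exact: add0r|exact: ed].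
have /choice[J /choice[B BP]] := fun m => TH _ (hN _ (fmu m)).
have /choice[Q QP] : forall m, exists Q : Y -> 'rV[Kb]_s,
    (forall j, form (J m) (fun y => Q y 0 j)) /\
    forall y x, B m (y, x) = \sum_j Q y 0 j * mu j x.
  move=> m; have [[n [b [c [fb fc E]]]] _ _] := BP m.
  have /choice[e eE] := fun l => mugen _ (fc l).
  exists (fun y => \row_j \sum_l e l j * b l y); split=> [j|y x].
    apply: (form_ext (form_sum (index_enum 'I_n) y0 (fun l => formZ (e l j) (fb l)))) => y.
    by rewrite mxE.
  rewrite E /=; under eq_bigr do rewrite eE mulr_sumr.
  rewrite exchange_big /=; apply: eq_bigr => j _; rewrite mxE mulr_suml.
  by apply: eq_bigr => l _; rewrite mulrCA mulrA.
have /choice[g gP] : forall m, exists g : Y -> Kb, form (J m) g /\ g y0 != 0.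
  by move=> m; have [g fg g0] := form_nv (g := Y) (J m) y0; exists g.
(* The coefficients [Q m] need not give the identity at [y0], as the [mu j] may be dependent. Their
   defect there is a linear relation between the [mu j]; subtracting it, carried by a form [g m]
   nonzero at [y0], does not change [B m]. *)
pose M y : 'M[Kb]_s := \matrix_(m, j) (Q m y 0 j - (Q m y0 0 j - (m == j)%:R) / g m y0 * g m y).
have fM m j : form (J m) (fun y => M y m j).
  have [fQ _] := QP m; have [fg _] := gP m.
  by apply: (form_ext (formB (fQ j) (formZ _ fg))) => y; rewrite mxE.
have M0 : M y0 = 1%:M.
  by apply/matrixP => m j; rewrite !mxE divfK ?(gP m).2// opprB addrCA subrr addr0.
have BM m y x : B m (y, x) = \sum_j M y m j * mu j x.
  have [_ E] := QP m; have [_ Bm _] := BP m.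
  have z : \sum_j (Q m y0 0 j - (m == j)%:R) * mu j x = 0.
    under eq_bigr do rewrite mulrBl.
    rewrite sumrB -E Bm (bigD1 m) //= eqxx mul1r big1 ?addr0 ?subrr// => j.
    by rewrite eq_sym => /negbTE->; rewrite mul0r.
  rewrite E; under [in RHS]eq_bigr do rewrite mxE mulrBl.
  have E' : \sum_j (Q m y0 0 j - (m == j)%:R) / g m y0 * g m y * mu j x =
      (g m y0)^-1 * g m y * \sum_j (Q m y0 0 j - (m == j)%:R) * mu j x.
    by rewrite mulr_sumr; apply: eq_bigr => j _; ring.
  by rewrite sumrB E' z mulr0 subr0.
exists (\sum_m J m), (fun y => \det (M y)); split; first exact: form_det.
  by rewrite M0 det1 oner_neq0.
move=> y Dy x; apply: contrapT => nx.
have muz : \col_j mu j x = 0.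
  rewrite -[LHS]mul1mx -(@mulVmx _ _ (M y)) ?unitmxE ?unitfE// -mulmxA.
  suff -> : M y *m \col_j mu j x = 0 by rewrite mulmx0.
  apply/colP => m; rewrite [LHS]mxE mxE.
  transitivity (B m (y, x)); first by rewrite BM; apply: eq_bigr => j _; rewrite [X in _ * X]mxE.
  have [_ _ z] := BP m; apply: z => i a Fa; apply/eqP/negP => /negP ane.
  by apply: nx; exists i, a.
have [a fa] := vform_nv (X := C) N x; have [c ->] := mugen a fa.
rewrite big1 ?eqxx// => j _; have /colP/(_ j) := muz; rewrite !mxE => ->.
by rewrite mulr0.
Qed.

Lemma proj_closed (Z : set P) : gclosed Z -> gclosed [set y : Y | exists x, Z (y, x)].
Proof.
move=> cZ y0 nZ; pose F i (a : P -> Kb) := form i a /\ forall u, Z u -> a u = 0.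
have Fnz x : exists i a, F i a /\ a (y0, x) != 0.
  have [i [a [fa a0 az]]] : exists i (a : P -> Kb),
      [/\ form i a, a (y0, x) != 0 & forall u, Z u -> a u = 0].
    by apply: (gclosed_form cZ) => Zx; apply: nZ; exists x.
  by exists i, a.
apply: near_imp (proj_open (fun i a (h : F i a) => h.1) Fnz) _ => y Fy [x Zyx].
by have [i [a [[_ az]]]] := Fy x; rewrite az ?eqxx.
Qed.

End Projection.
End Complete.

(** * Orders and divisors on a curve *)

Section Separation.
Variables (K : fieldType) (Kb : closedFieldType) (iota : {rmorphism K -> Kb}).
Variable X : variety iota.

Lemma normalized_inj n (v w : 'rV[Kb]_n) c :
  normalized v -> normalized w -> w = c *: v -> w = v.
Proof.
move=> /existsP[i /andP[/eqP vi /forallP vj]] /existsP[l /andP[/eqP wl /forallP wj]] E.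
have wi : w 0 i = c by rewrite E mxE vi mulr1.
have c0 : c != 0.
  by apply/eqP => c0; move: wl; rewrite E mxE c0 mul0r => /esym/eqP; rewrite oner_eq0.
case: (ltngtP i l) => il.
- by have := wj i; rewrite il wi (negbTE c0).
- have /implyP/(_ il)/eqP vl := vj l.
  by move: wl; rewrite E mxE vl mulr0 => /esym/eqP; rewrite oner_eq0.
- have c1 : c = 1 by rewrite -wi (ord_inj il).
  by rewrite E c1 scale1r.
Qed.

Lemma coords_inj (x y : pts X) : coords x = coords y -> x = y.
Proof. by move=> E; apply: val_inj. Qed.

Lemma coords_prop (x y : pts X) c : coords y = c *: coords x -> y = x.
Proof.
have /andP[nx _] := coordsP x; have /andP[ny _] := coordsP y.
by move=> E; apply/coords_inj/(normalized_inj nx ny E).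
Qed.

Lemma separate (x y : pts X) : x != y ->
  exists2 a, vform 1 a & a x = 0 /\ a y != 0.
Proof.
move=> xy; have [i [j ij]] : exists i j,
    (coords x) 0 i * (coords y) 0 j != (coords x) 0 j * (coords y) 0 i.
  apply: contrapT => H; move/negP: xy; apply; apply/eqP/esym.
  have /andP[/existsP[i /andP[/eqP xi _]] _] := coordsP x.
  apply: (@coords_prop _ _ ((coords y) 0 i)); apply/rowP => j; rewrite mxE.
  apply/eqP/negP => /negP ne; apply: H; exists i, j.
  by rewrite xi mul1r [X in _ != X]mulrC.
exists (fun z => (coords x) 0 i * (coords z) 0 j - (coords x) 0 j * (coords z) 0 i).
  by apply: (formB (S := gv X)); apply: formZ; apply: coords_form.
by split; [rewrite mulrC subrr|rewrite subr_eq0].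
Qed.

Lemma gclosed_pt (x : pts X) : gclosed (S := gv X) [set x]%classic.
Proof.
move=> y /eqP; rewrite eq_sym => /separate[a fa [ax ay]].
apply: near_imp (near_form (S := gv X) fa ay) _ => z az zx.
by move: az; rewrite zx ax eqxx.
Qed.

Lemma gclosed_seq (s : seq (pts X)) : gclosed (S := gv X) [set x | x \in s]%classic.
Proof.
elim: s => [|y s IH]; first by move=> x _; apply: near_T.
move=> x /= /negP; rewrite inE negb_or => /andP[/eqP xy /negP xs].
apply: near_imp (near_and (gclosed_pt xy) (IH x xs)) _ => z [zy zs].
by rewrite inE => /orP[/eqP|].
Qed.

Lemma infinite_field (s : seq Kb) : exists c, c \notin s.
Proof.
have : \prod_(c <- s) ('X - c%:P) != 0 :> {poly Kb}.
  by rewrite prodf_seq_neq0; apply/allP => c _ /=; rewrite polyXsubC_eq0.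
by move=> /closed_nonrootP[c]; rewrite root_prod_XsubC; exists c.
Qed.

Lemma avoid (s : seq (pts X)) : exists2 a, vform 1 a & forall x, x \in s -> a x != 0.
Proof.
elim: s => [|y s [a fa a0]].
  have [[x _] _] := gvirr X; have [a fa _] := vform_nv (X := X) 1 x.
  by exists a.
have [b fb by0] := vform_nv (X := X) 1 y.
have [c cn] := infinite_field (- (a y / b y) :: [seq - (a x / b x) | x <- s]).
exists (fun x => a x + c * b x); first exact: formD fa (formZ c fb).
move=> x xs; apply/eqP => E; have [bx|bx] := eqVneq (b x) 0.
  move: xs; rewrite inE => /orP[/eqP xy|/a0]; first by move: by0; rewrite -xy bx eqxx.
  by move: E; rewrite bx mulr0 addr0 => ->; rewrite eqxx.
have cE : c = - (a x / b x).
  by apply: (mulIf bx); rewrite mulNr divfK//; apply/eqP; rewrite -addr_eq0 addrC E.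
move: cn; rewrite inE negb_or => /andP[cy cs]; move: xs; rewrite inE => /orP[/eqP xy|xs].
  by move: cy; rewrite cE xy eqxx.
by move/negP: cs; apply; rewrite cE; apply/mapP; exists x.
Qed.

End Separation.

Section Curve.
Variables (K : fieldType) (Kb : closedFieldType) (iota : {rmorphism K -> Kb}).
Variable C : variety iota.
Hypothesis C_curve : smooth_curve C.
Local Notation gen := (@gen Kb (gv C)).
Let irr := gvirr C.
Implicit Types (f g : pts C -> Kb) (x y : pts C).

(** Otherwise a minimal infinite closed subset would be irreducible, and a point, this subset and
    [C] would form a chain of length 2. *)
Lemma curve_finite (Z : set (pts C)) : gclosed (S := gv C) Z -> (exists x, ~ Z x) ->
  exists s : seq (pts C), forall x, Z x -> x \in s.
Proof.
move=> cZ [x0 nx0]; apply: contrapT => inf.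
pose P (Y : set (pts C)) := (forall x, Y x -> Z x) /\ ~ exists s : seq (pts C), forall x, Y x -> x \in s.
have PZ : P Z by split.
have [Y [cY [YZ infY] minY]] := gclosed_min cZ PZ.
have [y Yy] : exists y, Y y.
  by apply: contrapT => nY; apply: infY; exists [::] => x Yx; exfalso; apply: nY; exists x.
have [z [Yz zy]] : exists z, Y z /\ z <> y.
  apply: contrapT => nz; apply: infY; exists [:: y] => x Yx; rewrite inE; apply/eqP.
  by apply: contrapT => xy; apply: nz; exists x.
have irrY : zirreducible Y.
  split; first by exists y.
  move=> Z1 Z2 /gclosedP c1 /gclosedP c2 sub.
  have key (W : set (pts C)) : gclosed (S := gv C) W ->
      (~ exists s : seq (pts C), forall x, Y x /\ W x -> x \in s) -> (Y `<=` W)%classic.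
    move=> cW iW x Yx.
    by have [] := minY _ (gclosedI cY cW) (conj (fun x h => YZ x (proj1 h)) iW) (fun x h => proj1 h) x Yx.
  case: (pselect (exists s : seq (pts C), forall x, Y x /\ Z1 x -> x \in s)) => [[s1 h1]|]; last by left; apply: key.
  case: (pselect (exists s : seq (pts C), forall x, Y x /\ Z2 x -> x \in s)) => [[s2 h2]|]; last by right; apply: key.
  exfalso; apply: infY; exists (s1 ++ s2) => x Yx; rewrite mem_cat.
  by case: (sub x Yx) => Wx; apply/orP; [left; apply: h1|right; apply: h2].
have [[_ noc] _] := C_curve; apply: noc.
exists (fun i => if i is i'.+1 then (if i' is 0 then Y else setT) else [set y]%classic); split.
  case=> [|[|i]] _.
  - split; first exact/gclosedP/gclosed_pt.
    split; first by exists y.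
    by move=> Z1 Z2 _ _ sub; case: (sub y erefl) => h; [left|right] => w ->.
  - by split => //; apply/gclosedP.
  - by split; [apply/gclosedP => w []|exact: v_irr].
case=> [|[|//]] _; rewrite properEneq; split=> //.
- by apply/eqP => E; apply: zy; have : [set y]%classic z by rewrite E.
- by move=> w ->.
- by apply/eqP => E; apply/nx0/YZ; rewrite E.
Qed.

Definition unif x : pts C -> Kb := xget (fun _ => 1) [set t | uniformizer x t]%classic.

Lemma unifP x : uniformizer x (unif x).
Proof.
have [t ut] := C_curve.2 x.
exact: (@xgetPex _ _ [set t | uniformizer x t]%classic) (ex_intro _ t ut).
Qed.

Lemma unif_nz x : nzrational (unif x). Proof. by have [] := unifP x. Qed.
Lemma unif0 x : has_value (unif x) x 0. Proof. by have [] := unifP x. Qed.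
Lemma unif_div x h : has_value h x 0 -> regular_at (fun z => h z / unif x z) x.
Proof. by have [_ _] := unifP x; apply. Qed.

Lemma unif_gen x : gen (fun z => unif x z != 0).
Proof. exact/nz_gen/unif_nz. Qed.

Definition ord_at f x (m : int) := unit_at (fun z => f z / unif x z ^ m) x.

Lemma has_value_unit0 f x v : has_value f x v -> v = 0 -> ~ unit_at f x.
Proof. by move=> hv v0 [w w0 /(has_value_uniq hv)]; rewrite v0 => /eqP; rewrite eq_sym (negbTE w0). Qed.

Lemma has_value_unifX x m : (0 < m)%N -> has_value (fun z => unif x z ^+ m) x 0.
Proof. by move=> m0; have := has_valueX m (unif0 x); rewrite expr0n eqn0Ngt m0. Qed.

Lemma unit_unifXz x (m : int) : unit_at (fun z => unif x z ^ m) x -> m = 0.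
Proof.
case: m => [[|m]|m] // u; exfalso.
  exact: has_value_unit0 (has_value_unifX x (ltn0Sn m)) erefl u.
apply: (has_value_unit0 (has_value_unifX x (ltn0Sn m)) erefl).
by apply: unit_gen (unitV u) _; apply: gen_imp (unif_gen x) _ => z _; rewrite invrK.
Qed.

Lemma ord_uniq f x m n : ord_at f x m -> ord_at f x n -> m = n.
Proof.
move=> um un; suff : n - m = 0 by move/eqP; rewrite subr_eq0 => /eqP.
apply: (@unit_unifXz x); apply: unit_gen (unitD um un) _.
apply: gen_imp (gen_and irr (unif_gen x) (nz_gen (unit_nz um))) _ => z [t0].
rewrite mulf_eq0 negb_or => /andP[f0 _].
by rewrite expfzDr// -invr_expz; field; rewrite f0 !expfz_neq0.
Qed.

Lemma ord_unit f x : ord_at f x 0 <-> unit_at f x.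
Proof.
by split=> u; apply: unit_gen u _; apply: gen_imp (unif_gen x) _ => z _;
  rewrite expr0z divr1.
Qed.

Lemma ord_gen f g x m : ord_at f x m -> gen (fun z => f z = g z) -> ord_at g x m.
Proof. by move=> u E; apply: unit_gen u _; apply: gen_imp E _ => z ->. Qed.

Lemma ordM f g x m n : ord_at f x m -> ord_at g x n ->
  ord_at (fun z => f z * g z) x (m + n).
Proof.
move=> um un; apply: unit_gen (unitM um un) _; apply: gen_imp (unif_gen x) _ => z t0.
by rewrite expfzDr// mulf_div.
Qed.

Lemma ordV f x m : ord_at f x m -> ord_at (fun z => (f z)^-1) x (- m).
Proof.
move=> um; apply: unit_gen (unitV um) _; apply: gen_imp (unif_gen x) _ => z t0.
by rewrite invf_div -invr_expz invrK mulrC.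
Qed.

Lemma ordD f g x m n : ord_at f x m -> ord_at g x n ->
  ord_at (fun z => f z / g z) x (m - n).
Proof. by move=> um /ordV; apply: ordM. Qed.

Lemma ordX f x m (n : nat) : ord_at f x m -> ord_at (fun z => f z ^+ n) x (m *+ n).
Proof.
move=> um; elim: n => [|n IH]; first exact/ord_unit/unit_const/oner_neq0.
rewrite mulrS; apply: ord_gen (ordM um IH) _; apply: gen_imp (unif_gen x) _ => z _.
by rewrite exprS.
Qed.

Lemma ord_nz f x m : ord_at f x m -> nzrational f.
Proof.
move=> um; apply: nz_gen_eq (nzM (unit_nz um) (nzXz m (unif_nz x))) _.
by apply: gen_imp (unif_gen x) _ => z t0; rewrite divfK// expfz_neq0.
Qed.

Lemma ord_unif x : ord_at (unif x) x 1.
Proof.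
apply: unit_gen (unit_const x (oner_neq0 Kb)) _; apply: gen_imp (unif_gen x) _ => z t0.
by rewrite expr1z divff.
Qed.

(* Krull intersection: by the ascending chain condition a nonzero function is
   not divisible by every power of a uniformizer. *)
Lemma ord_regular f x : nzrational f -> regular_at f x -> exists m : nat, ord_at f x m.
Proof.
move=> nf rf; apply: contrapT => /forallNP nm.
pose h m z := f z / unif x z ^+ m.
have hS m : gen (fun z => h m.+1 z = h m z / unif x z).
  by apply: gen_imp (unif_gen x) _ => z t0; rewrite /h exprSr invfM mulrA.
have rh m : regular_at (h m) x.
  elim: m => [|m [v hv]].
    have [v hv] := rf; exists v; apply: has_value_gen hv _.
    by apply: gen_imp (unif_gen x) _ => z _; rewrite /h divr1.
  have v0 : v = 0.
    by apply/eqP/negP => /negP v0; apply: (nm m); exists v.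
  rewrite v0 in hv; have [w hw] := unif_div hv; exists w; apply: has_value_gen hw _.
  by apply: gen_imp (hS m) _ => z ->.
have /choice[a aP] : forall m, exists ab : (pts C -> Kb) * (pts C -> Kb),
    quo (h m) ab.1 ab.2 /\ ab.2 x != 0.
  by move=> m; have /regularP[a [b H]] := rh m; exists (a, b).
have /choice[d dP] : forall m, exists d, [/\ vform d (a m).1, vform d (a m).2 &
    gen (fun s => (a m).2 s != 0 /\ h m s = (a m).1 s / (a m).2 s)].
  by move=> m; have [[d H] _] := aP m; exists d.
(* With [t] the uniformizer, the numerators of the [h m = f / t ^+ m] satisfy the chain condition,
   so the [M]-th one is expressed through earlier ones. Dividing by [h M] writes its denominator as
   a combination of multiples of [t ^+ (M - l)] with [l < M], so it would vanish at [x]. *)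
have [M [c [fc cE]]] := acc_form (a := fun m => (a m).1) (d := d) (fun m => let: And3 H _ _ := dP m in H).
have G : gen (fun s => forall l, l \in seq.iota 0 M.+1 ->
    (a l).2 s != 0 /\ h l s = (a l).1 s / (a l).2 s).
  by apply: (gen_all irr) => l _; have [_ _] := dP l.
have [l0 fl l0x] := vform_nv (X := C) (d M) x.
pose rhs s := \sum_(l < M | (d l <= d M)%N) c l s * (a l).2 s / l0 s * unif x s ^+ (M - l).
have E : gen (fun s => (a M).2 s / l0 s = rhs s).
  apply: gen_imp (gen_and irr (gen_and irr G (gen_form (S := gv C) fl l0x)) (gen_and irr (unif_gen x) (nz_gen nf))) _.
  move=> s [[hs ls] [ts fs]]; have [bM hM] := hs M ltac:(by rewrite mem_iota leq0n add0n ltnSn).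
  have hM0 : h M s != 0 by rewrite /h mulf_neq0 ?invr_neq0 ?expf_neq0.
  have aM : (a M).1 s = h M s * (a M).2 s by rewrite hM divfK.
  apply: (mulfI hM0); rewrite mulrA -aM cE /rhs mulr_suml mulr_sumr.
  apply: eq_bigr => l _; have [bl hl] := hs l ltac:(by rewrite mem_iota leq0n add0n ltnS ltnW).
  have -> : (a l).1 s = h l s * (a l).2 s by rewrite hl divfK.
  have -> : h l s = h M s * unif x s ^+ (M - l).
    rewrite /h -{2}(subnK (ltnW (ltn_ord l))) exprD; field.
    by rewrite !expf_neq0.
  by ring.
have [_ bMx] := aP M; have [_ fbM _] := dP M.
have v1 : has_value (fun s => (a M).2 s / l0 s) x ((a M).2 x / l0 x).
  by apply/has_valueP; exists (a M).2, l0; split=> //; apply: quo_form fbM fl _; exists x.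
have v2 : has_value rhs x 0.
  rewrite /rhs; elim: (index_enum _) => [|l r IH].
    apply: has_value_gen (has_value_const 0 x) _.
    by apply: gen_imp (unif_gen x) _ => z _; rewrite big_nil.
  case: (boolP (d l <= d M)%N) => dl; last first.
    apply: has_value_gen IH _; apply: gen_imp (unif_gen x) _ => z _.
    by rewrite big_cons (negbTE dl).
  have [_ fbl _] := dP l.
  have fcb : vform (d M) (fun s => c l s * (a l).2 s) by rewrite -(subnK dl); apply: vformM (fc l dl) fbl.
  have h1 : has_value (fun s => c l s * (a l).2 s / l0 s) x (c l x * (a l).2 x / l0 x).
    by apply/has_valueP; exists (fun s => c l s * (a l).2 s), l0; split=> //; apply: quo_form fcb fl _; exists x.
  have Ml : (0 < M - l)%N by rewrite subn_gt0.
  have := has_valueD (has_valueM h1 (has_value_unifX x Ml)) IH.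
  rewrite mulr0 addr0 => H; apply: has_value_gen H _; apply: gen_imp (unif_gen x) _ => z _.
  by rewrite big_cons dl.
have /eqP := has_value_uniq (has_value_gen v1 E) v2.
by rewrite mulf_eq0 invr_eq0 (negbTE bMx) (negbTE l0x).
Qed.

Lemma ord_ex f x : nzrational f -> exists m, ord_at f x m.
Proof.
move=> nf; have /nzP[a [b [q [y ay]]]] := nf; have [d [fa fb E]] := q.
have [z bz] := quo_nz q; have [l fl lx] := vform_nv (X := C) d x.
have o e : vform d e -> (exists y, e y != 0) -> exists m : nat, ord_at (fun s => e s / l s) x m.
  move=> fe ey; apply: ord_regular.
    by apply/nzP; exists e, l; split=> //; apply: quo_form fe fl _; exists x.
  by apply/regularP; exists e, l; split=> //; apply: quo_form fe fl _; exists x.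
have [m om] := o a fa (ex_intro _ y ay); have [n on] := o b fb (ex_intro _ z bz).
exists (m%:Z - n%:Z); apply: ord_gen (ordD om on) _.
apply: gen_imp (gen_and irr E (gen_form (S := gv C) fl lx)) _ => s [[b0 ->] l0].
by field; rewrite l0 b0.
Qed.

Lemma ord_ge0 f x m : ord_at f x m -> regular_at f x -> 0 <= m.
Proof.
by move=> om rf; have [n /(ord_uniq om)->] := ord_regular (ord_nz om) rf.
Qed.

Lemma ord_ge0_regular f x (m : nat) : ord_at f x m -> regular_at f x.
Proof.
move=> [v v0 hv]; exists (v * 0 ^+ m).
apply: has_value_gen (has_valueM hv (has_valueX m (unif0 x))) _.
by apply: gen_imp (unif_gen x) _ => z t0; rewrite divfK// expf_neq0.
Qed.

Lemma ord_gt0_value f x (m : nat) : ord_at f x m -> (0 < m)%N -> has_value f x 0.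
Proof.
move=> [v v0 hv] m0; have := has_valueM hv (has_valueX m (unif0 x)).
rewrite expr0n eqn0Ngt m0 mulr0 => H; apply: has_value_gen H _.
by apply: gen_imp (unif_gen x) _ => z t0; rewrite divfK// expf_neq0.
Qed.

Lemma ord_value0 f x m : ord_at f x m -> has_value f x 0 -> 0 < m.
Proof.
move=> om hv; have m_ge0 := ord_ge0 om (ex_intro _ 0 hv).
suff : m != 0 by lia.
by apply/eqP => m0; move: om; rewrite m0 => /ord_unit; apply: has_value_unit0 hv erefl.
Qed.

Lemma ord_uniformizer x t : uniformizer x t -> ord_at t x 1.
Proof.
move=> [nt t0 tdiv]; have [m om] := ord_ex x nt.
have m0 := ord_value0 om t0.
have r := tdiv _ (unif0 x); have := ord_ge0 (ordD (ord_unif x) om) r.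
suff : forall m : int, 0 < m -> 0 <= 1 - m -> m = 1 by move=> /(_ m m0) H /H <-.
by move=> n; lia.
Qed.

Lemma has_ordP f x m : has_ord f x m <-> ord_at f x m.
Proof.
split=> [[t ut u]|u]; last by exists (unif x) => //; apply: unifP.
have ot := ord_uniformizer ut; move: (ot); rewrite /ord_at => ut1.
apply: unit_gen (unitM u (unitXz m ut1)) _; have [nt _ _] := ut.
apply: gen_imp (gen_and irr (unif_gen x) (nz_gen nt)) _ => z [t0 tz].
rewrite expr1z exprMz_comm ?unitfE ?invr_eq0//; last exact: mulrC.
by rewrite exprz_inv -invr_expz; field; rewrite !expfz_neq0.
Qed.

Lemma cdiv_ex f : nzrational f -> exists D : cdiv C, is_cdiv_of f D.
Proof.
move=> nf; have /nzP[a [b [q ay]]] := nf; have by0 := quo_nz q; have [d [fa fb E]] := q.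
have fin e : vform d e -> (exists y, e y != 0) -> exists s : seq (pts C), forall x, e x = 0 -> x \in s.
  move=> fe [y ey]; apply: (curve_finite (Z := [set x | e x = 0]%classic) (gclosed0 (S := gv C) fe)).
  by exists y; apply/eqP.
have [s1 h1] := fin a fa ay; have [s2 h2] := fin b fb by0.
have /choice[m mP] := fun x => ord_ex x nf.
exists (\sum_(x <- undup (s1 ++ s2)) << m x *g x >>); split=> // x; apply/has_ordP.
suff -> : coeff x (\sum_(x <- undup (s1 ++ s2)) << m x *g x >>) = m x by [].
rewrite raddf_sum /=; under eq_bigr do rewrite coeffU.
case: (boolP (x \in s1 ++ s2)) => xs.
  rewrite (bigD1_seq x) ?mem_undup ?undup_uniq//= eqxx mulr1 big1 ?addr0// => y.
  by move=> /negbTE->; rewrite mulr0.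
rewrite big_seq big1 => [|y]; last first.
  by rewrite mem_undup; case: eqP => [->|]; rewrite ?(negbTE xs)// mulr0.
apply: (ord_uniq _ (mP x)); apply/ord_unit/unitP; exists a, b; split=> //.
  by apply: contra xs => /eqP/h1; rewrite mem_cat => ->.
by apply: contra xs => /eqP/h2; rewrite mem_cat orbC => ->.
Qed.

Lemma cdiv_const f g D : is_cdiv_of f D -> is_cdiv_of g D ->
  exists2 c, c != 0 & gen (fun z => f z = c * g z).
Proof.
move=> [nf hf] [ng hg].
have [x|c c0 E] := @unit_everywhere_const _ _ _ C (fun z => f z / g z).
  by apply/ord_unit; rewrite -(subrr (coeff x D)); apply: ordD; apply/has_ordP.
exists c => //; apply: gen_imp (gen_and irr E (nz_gen ng)) _ => z [<- g0].
by rewrite divfK.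
Qed.

End Curve.

(** * Principal divisors have degree zero *)

Section Degree.
Variables (K : fieldType) (Kb : closedFieldType) (iota : {rmorphism K -> Kb}).
Variable C : variety iota.
Hypothesis C_curve : smooth_curve C.
Local Notation gen := (@gen Kb (gv C)).
Local Notation unif := (@unif _ _ _ C).
Let irr := gvirr C.
Implicit Types (f g : pts C -> Kb) (x y : pts C).

Lemma mulrn_one (d : nat) : (1%N *+ d)%R = d.
Proof. by elim: d => [|d IH]; rewrite ?mulr0n// mulrS IH. Qed.

Lemma int_pole_bound (n d : nat) (m : int) :
  0 < m -> 0 <= - ((n : int) *+ d) + m *+ (n * d).
Proof.
move=> m0; have -> : (n : int) *+ d = 1 *+ (n * d) by rewrite -[n : int]natz -mulrnA.
by rewrite addrC subr_ge0 lerMn2r -gtz0_ge1 m0 orbT.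
Qed.

Lemma int_nonneg (m : int) : 0 <= m -> exists k : nat, m = k%:Z.
Proof. by case: m => // k _; exists k. Qed.

Lemma PoszD_sum (I : Type) (s : seq I) (F : I -> nat) :
  (\sum_(i <- s) F i)%N%:Z = \sum_(i <- s) (F i)%:Z.
Proof. by elim/big_rec2: _ => // i m n _ <-; rewrite PoszD. Qed.

Lemma field_cancel1 (F : fieldType) (a b c e x : F) : b != 0 -> c != 0 -> e != 0 ->
  a / b * (b / c) * ((e / c)^-1 * x) = a / e * x.
Proof. by move=> b0 c0 e0; field; rewrite b0 c0 e0. Qed.

Lemma field_cancel2 (F : fieldType) (a b c e g m : F) : b != 0 -> c != 0 -> g != 0 ->
  m != 0 -> a / b / c * (e / g) * (b * g / m) = a * e / m / c.
Proof. by move=> b0 c0 g0 m0; field; rewrite b0 c0 g0 m0. Qed.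

Lemma field_cancel3 (F : fieldType) (a b r m p : F) : a != 0 -> b != 0 -> m != 0 ->
  b * r / m * p = a * r / m * p / (a / b).
Proof. by move=> a0 b0 m0; field; rewrite a0 b0 m0. Qed.

Lemma gen_true (P : pts C -> Prop) : (forall x, P x) -> gen P.
Proof. by move=> hP; have [x _] := irr.1; exists x; apply: near_T. Qed.

Lemma regular_gen f g x : regular_at f x -> gen (fun z => f z = g z) -> regular_at g x.
Proof. by move=> [v hv] E; exists v; apply: has_value_gen hv E. Qed.

Lemma regularM f g x : regular_at f x -> regular_at g x -> regular_at (fun z => f z * g z) x.
Proof. by move=> [v hv] [v' hv']; exists (v * v'); apply: has_valueM. Qed.

Lemma regularX f x m : regular_at f x -> regular_at (fun z => f z ^+ m) x.
Proof. by move=> [v hv]; exists (v ^+ m); apply: has_valueX. Qed.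

Lemma regular_prod (I : eqType) (r : seq I) (f : I -> pts C -> Kb) x :
  (forall i, i \in r -> regular_at (f i) x) -> regular_at (fun z => \prod_(i <- r) f i z) x.
Proof.
elim: r => [|i r IH] h.
  by exists 1; apply: has_value_gen (has_value_const 1 x) _; apply: gen_true => z; rewrite big_nil.
have h' : forall j, j \in r -> regular_at (f j) x by move=> j jr; apply: h; rewrite inE jr orbT.
apply: regular_gen (regularM (h i (mem_head _ _)) (IH h')) _.
by apply: gen_true => z; rewrite big_cons.
Qed.

Lemma has_value_sum (I : Type) (r : seq I) (f : I -> pts C -> Kb) x v :
  (forall l, has_value (f l) x (v l)) ->
  has_value (fun x => \sum_(l <- r) f l x) x (\sum_(l <- r) v l).
Proof.
move=> h; elim: r => [|l r IH].
  rewrite big_nil; apply: has_value_gen (has_value_const 0 x) _.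
  by apply: gen_true => z; rewrite big_nil.
rewrite big_cons; apply: has_value_gen (has_valueD (h l) IH) _.
by apply: gen_true => z; rewrite big_cons.
Qed.

Lemma regular_sum (I : Type) (r : seq I) (f : I -> pts C -> Kb) x :
  (forall l, regular_at (f l) x) -> regular_at (fun z => \sum_(l <- r) f l z) x.
Proof. by move=> /choice[v hv]; exists (\sum_(l <- r) v l); apply: has_value_sum. Qed.

Lemma regularZ c f x : regular_at f x -> regular_at (fun z => c * f z) x.
Proof. by move=> rf; apply: regularM rf; exists c; apply: has_value_const. Qed.

Lemma unif_regular x : regular_at (unif x) x.
Proof. by exists 0; apply: unif0. Qed.

Definition indep n (W : 'I_n -> pts C -> Kb) := forall c : 'I_n -> Kb,
  gen (fun z => \sum_i c i * W i z = 0) -> forall i, c i = 0.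

(** A pivot [i0] with [v i0] nonzero, if there is one, imposes the linear condition [v] at the cost
    of one function. *)
Lemma indep_drop n (W : 'I_n.+1 -> pts C -> Kb) (v : 'I_n.+1 -> Kb) : indep W ->
  exists (W' : 'I_n -> pts C -> Kb), indep W' /\ forall j, exists i i' c,
    W' j = (fun z => W i z + c * W i' z) /\ v i + c * v i' = 0.
Proof.
move=> iW; have [i0 hi0] : exists i0, v i0 = 0 -> forall i, v i = 0.
  case: (pselect (exists i, v i <> 0)) => [[i vi]|nv]; first by exists i.
  by exists ord0 => _ i; apply: contrapT => vi; apply: nv; exists i.
exists (fun j z => W (fintype.lift i0 j) z + - (v (fintype.lift i0 j) / v i0) * W i0 z); split; last first.
  move=> j; exists (fintype.lift i0 j), i0, (- (v (fintype.lift i0 j) / v i0)); split=> //.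
  have [v0|v0] := eqVneq (v i0) 0; first by rewrite v0 (hi0 v0) mulr0 addr0.
  by rewrite mulNr divfK// subrr.
move=> c E j; pose c' i := if unlift i0 i is Some j then c j
  else - \sum_j c j * (v (fintype.lift i0 j) / v i0).
suff /iW/(_ (fintype.lift i0 j)) : gen (fun z => \sum_i c' i * W i z = 0) by rewrite /c' liftK.
apply: gen_imp E _ => z E; rewrite -[RHS]E (bigD1_ord i0) //= {1}/c' unlift_none.
rewrite (eq_bigr _ (fun j _ => mulrDr _ _ _)) big_split /= addrC; congr (_ + _).
  by apply: eq_bigr => l _; rewrite /c' liftK.
by rewrite mulNr mulr_suml -sumrN; apply: eq_bigr => l _; ring.
Qed.

Definition bounded (pl : seq (pts C)) (w : pts C -> Kb) :=
  forall x, regular_at (fun z => w z * unif x z ^+ count_mem x pl) x.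

(* dim L(D) <= deg D + 1 *)
Lemma bounded_indep pl (W : 'I_(size pl).+2 -> pts C -> Kb) :
  (forall i, bounded pl (W i)) -> ~ indep W.
Proof.
elim: pl W => [|p pl IH] W bW iW.
  have /choice[c cE] : forall i, exists c, gen (fun z => W i z = c).
    move=> i; apply: regular_const => x; apply: regular_gen (bW i x) _.
    by apply: gen_true => z; rewrite expr0 mulr1.
  have G : gen (fun z => forall i, i \in index_enum 'I_2 -> W i z = c i).
    by apply: gen_all => // i _; apply: cE.
  have cz (a b : Kb) : a * c ord0 + b * c ord_max = 0 -> a = 0 /\ b = 0.
    move=> E; pose e (i : 'I_2) := if i == ord0 then a else b.
    have H : forall i, e i = 0.
      apply: iW; apply: gen_imp G _ => z hz.
      by rewrite 2!big_ord_recl big_ord0 addr0 !hz ?mem_index_enum //= -[RHS]E; congr (_ * _ + _ * c _); apply: val_inj.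
    by split; [apply: (H ord0)|apply: (H ord_max)].
  have [c1 /eqP] : c ord_max = 0 /\ - c ord0 = 0 by apply: cz; ring.
  rewrite oppr_eq0 => /eqP c0.
  have [/eqP] : (1 : Kb) = 0 /\ (1 : Kb) = 0 by apply: cz; rewrite c0 c1 !mulr0 addr0.
  by rewrite oner_eq0.
(* [v i] is the leading coefficient that the bound allows at [p]; making it vanish lowers the bound
   there by one. *)
have /choice[v hv] : forall i, exists v, has_value (fun z => W i z * unif p z ^+ (count_mem p pl).+1) p v.
  by move=> i; have := bW i p; rewrite /= eqxx.
have [W' [iW' W'E]] := indep_drop v iW; apply: IH iW' => j x.
have [i [i' [c [-> vE]]]] := W'E j.
have [xp|xp] := eqVneq x p; last first.
  have h l : regular_at (fun z => W l z * unif x z ^+ count_mem x pl) x.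
    by have := bW l x; rewrite /= eq_sym (negbTE xp).
  have [v1 h1] := h i; have [v2 h2] := h i'; exists (v1 + c * v2).
  apply: has_value_gen (has_valueD h1 (has_valueM (has_value_const c x) h2)) _.
  by apply: gen_true => z; rewrite mulrDl mulrA.
rewrite xp; have := has_valueD (hv i) (has_valueM (has_value_const c p) (hv i')).
rewrite vE => H; apply: regular_gen (unif_div C_curve H) _.
apply: gen_imp (unif_gen C_curve p) _ => z t0; by rewrite exprSr !mulrA -mulrDl mulfK// mulrDl.
Qed.

Section Inequality.
Variables (f : pts C -> Kb) (D : cdiv C).
Hypothesis fD : is_cdiv_of f D.
Let zn x := if coeff x D is Posz n then n else 0%N.
Let pn x := if coeff x D is Negz n then n.+1 else 0%N.
Let r := dom D.

Let ordf x : ord_at f x (coeff x D). Proof. exact/(has_ordP C_curve)/fD.2. Qed.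

Let zn_coeff x : (0 < zn x)%N -> coeff x D = zn x. 
Proof. by rewrite /zn; case: (coeff x D). Qed.

Let regf x : pn x = 0%N -> regular_at f x.
Proof.
have := ordf x; rewrite /pn; case: (coeff x D) => // n o _.
exact: (ord_ge0_regular C_curve o).
Qed.

Let zn_r x : (0 < zn x)%N -> x \in r.
Proof. by rewrite /r mem_dom => h; rewrite (zn_coeff h); move: h; case: (zn x). Qed.

Let notr_unit x : x \notin r -> unit_at f x.
Proof. by move=> /coeff_outdom E; apply/(ord_unit C_curve); rewrite -E. Qed.

Definition ord_ge g x (m : nat) := regular_at (fun z => g z / unif x z ^+ m) x.

(** Functions regular off the poles of [f] that separate jets at its zeros. A quotient [u0] of forms
    has the right orders at the zeros of [f], but its denominator may vanish at other points [y]; a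
    power of [f - f(y)], which is a unit at the zeros of [f], cancels the pole at each such [y]. *)
Lemma zero_interpolant x k : (k < zn x)%N -> exists u,
  [/\ forall y, pn y = 0%N -> regular_at u y, nzrational u,
      exists2 v, v != 0 & has_value (fun z => u z / unif x z ^+ k) x v
    & forall y, (0 < zn y)%N -> y != x -> ord_ge u y (zn y)].
Proof.
move=> kx; have zx : (0 < zn x)%N by apply: leq_ltn_trans kx.
have /has_valueP[a0 [b0 [[e [fa0 fb0 q0]] b0x Ea0]]] := unif0 C_curve x.
have /choice[h hP] : forall y, exists h, vform 1 h /\ (y != x -> h y = 0 /\ h x != 0).
  move=> y; have [->|yx] := eqVneq y x.
    by have [h fh _] := vform_nv (X := C) 1 x; exists h.
  by have [h fh hh] := separate yx; exists h.
have [L fL Lr] := avoid r.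
have [L0 nL] : exists z, L z != 0 by exists x; apply: Lr; apply: zn_r.
pose R := [seq y <- r | y != x].
pose num z := a0 z ^+ k * \prod_(y <- R) h y z ^+ zn y.
pose d := (e *+ k + \sum_(y <- R) 1%N *+ zn y)%R : nat.
have fnum : vform d num.
  apply: formM; first exact: formX.
  by apply: (form_prod R) => y; apply: formX; have [] := hP y.
have fLd : vform d (fun z => L z ^+ d).
  by apply: (form_cast (S := gv C) (formX d fL)); exact: mulrn_one.
have [s sP] : exists s : seq (pts C), forall y, L y = 0 -> y \in s.
  apply: (curve_finite C_curve (Z := [set y | L y = 0]%classic)); last by exists L0; apply/eqP.
  exact: (gclosed0 (S := gv C) fL).
have nLd : exists z, L z ^+ d != 0 by exists L0; rewrite expf_neq0.
pose u0 z := num z / L z ^+ d.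
have q_u0 : quo u0 num (fun z => L z ^+ d) := quo_form fnum fLd nLd.
(* G kills the pole at a zero y of L. *)
have /choice[G GP] : forall y, exists G, [/\ nzrational G,
    forall z, pn z = 0%N -> regular_at G z, forall z, (0 < zn z)%N -> unit_at G z
    & L y = 0 -> regular_at (fun z => u0 z * G z) y].
  move=> y; have [Ly|Ly] := eqVneq (L y) 0; last first.
    exists (fun _ => 1); split; first exact/nz_const/oner_neq0.
    - by move=> z _; exists 1; apply: has_value_const.
    - by move=> z _; apply/unit_const/oner_neq0.
    - by move=> Ly0; rewrite Ly0 eqxx in Ly.
  have yr : y \notin r by apply/negP => /Lr; rewrite Ly eqxx.
  have [c c0 fc] := notr_unit yr.
  have nz : nzrational (fun z => f z + - c).
    have [a [b [q bz]]] : exists a b, quo f a b /\ exists z, b z != 0.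
      have /nzP[a [b [q _]]] := fD.1; exists a, b; split=> //; exact: quo_nz q.
    have qc := quoD q (quo_const _ (- c)); apply/nzP.
    eexists; eexists; split; first exact: qc.
    apply: contrapT => ne; have [d' [_ _ E]] := qc.
    have fE : gen (fun z => f z = c).
      apply: gen_imp E _ => z [_ E]; apply/eqP; rewrite -subr_eq0 E.
      have -> : a z * 1 + - c * b z = 0; last by rewrite mul0r.
      by apply/eqP/negP => /negP H; apply: ne; exists z.
    have uf : unit_at f x by apply: unit_gen (unit_const x c0) _; apply: gen_imp fE _ => z ->.
    by have := ord_uniq C_curve (ordf x) (proj2 (ord_unit C_curve f x) uf); rewrite zn_coeff//; case: (zn x) zx.
  have [my oy] := ord_ex C_curve y nz.
  have my0 : 0 < my.
    apply: (ord_value0 C_curve oy); have := has_valueD fc (has_value_const (- c) y).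
    by rewrite subrr.
  have [l fl ly] := vform_nv (X := C) 1 y.
  have nzL : nzrational (fun z => L z / l z).
    by apply/nzP; exists L, l; split; [apply: quo_form fL fl _; exists y|exists L0].
  have rL : regular_at (fun z => L z / l z) y.
    by apply/regularP; exists L, l; split=> //; apply: quo_form fL fl _; exists y.
  have [n on] := ord_regular C_curve nzL rL.
  exists (fun z => (f z + - c) ^+ (n * d)); split.
  - exact: (nzXz (n * d)%N nz).
  - move=> z pz; apply: regularX; have [v hv] := regf pz; exists (v - c).
    exact: has_valueD hv (has_value_const _ z).
  - move=> z zz; apply: unitX; exists (- c); first by rewrite oppr_eq0.
    have oz := ordf z; rewrite zn_coeff// in oz.
    by have := has_valueD (ord_gt0_value C_curve oz zz) (has_value_const (- c) z); rewrite add0r.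
  - move=> _; have [l' fl' l'y] := vform_nv (X := C) d y.
    have r1 : regular_at (fun z => num z / l' z) y.
      by apply/regularP; exists num, l'; split=> //; apply: quo_form fnum fl' _; exists y.
    have r2 : regular_at (fun z => l' z / l z ^+ d) y.
      apply/regularP; exists l', (fun z => l z ^+ d); split; last by rewrite expf_neq0.
      apply: quo_form fl' _ _; last by exists y; rewrite expf_neq0.
      by apply: (form_cast (S := gv C) (formX d fl)); exact: mulrn_one.
    have o3 := ordM C_curve (ordV C_curve (ordX C_curve d on)) (ordX C_curve (n * d) oy).
    have [k' k'E] : exists k' : nat, - ((n : int) *+ d) + my *+ (n * d) = k'%:Z.
      exists (absz (- ((n : int) *+ d) + my *+ (n * d))).
      by rewrite gez0_abs//; apply: int_pole_bound.
    rewrite k'E in o3; have r3 := ord_ge0_regular C_curve o3.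
    apply: regular_gen (regularM (regularM r1 r2) r3) _.
    apply: gen_imp (gen_and irr (gen_form (S := gv C) fl' l'y) (gen_and irr (gen_form (S := gv C) fL nL) (gen_form (S := gv C) fl ly))) _.
    move=> z [l'0 [Lz lz]]; rewrite /u0 expr_div_n.
    by rewrite field_cancel1// expf_neq0.
pose u z := u0 z * \prod_(y <- undup s) G y z.
have uG z : pn z = 0%N -> regular_at (fun w => \prod_(y <- undup s) G y w) z.
  by move=> pz; apply: regular_prod => y _; have [_ H _ _] := GP y; apply: H.
have u0r z : L z != 0 -> regular_at u0 z.
  move=> Lz; apply/regularP; exists num, (fun z => L z ^+ d); split=> //.
  by rewrite expf_neq0.
have uGu z : (0 < zn z)%N -> unit_at (fun w => \prod_(y <- undup s) G y w) z.
  move=> zz; elim: (undup s) => [|y s' IH].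
    apply: unit_gen (unit_const z (oner_neq0 Kb)) _.
    by apply: gen_true => w; rewrite big_nil.
  have [_ _ H _] := GP y; apply: unit_gen (unitM (H z zz) IH) _.
  by apply: gen_true => w; rewrite big_cons.
have num_ge y : (0 < zn y)%N -> y != x -> ord_ge u0 y (zn y).
  move=> zy yx; have [l fl ly] := vform_nv (X := C) 1 y.
  have hy : has_value (fun z => h y z / l z) y 0.
    apply/has_valueP; exists (h y), l; have [fh hh] := hP y.
    by split; [apply: quo_form fh fl _; exists y|done|rewrite (hh yx).1 mul0r].
  have r1 := regularX (zn y) (unif_div C_curve hy).
  pose rest z := a0 z ^+ k * \prod_(y' <- rem y R) h y' z ^+ zn y'.
  have yR : y \in R by rewrite mem_filter yx zn_r.
  have numE z : num z = h y z ^+ zn y * rest z.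
    by rewrite /num /rest (big_rem y yR) /= mulrCA.
  have frest : vform (e *+ k + \sum_(y' <- rem y R) 1%N *+ zn y')%R rest.
    apply: formM; first exact: formX.
    by apply: (form_prod (rem y R)) => y'; apply: formX; have [] := hP y'.
  have [l' fl' l'y] := vform_nv (X := C) (e *+ k + \sum_(y' <- rem y R) 1%N *+ zn y')%R y.
  have r2 : regular_at (fun z => rest z / l' z) y.
    by apply/regularP; exists rest, l'; split=> //; apply: quo_form frest fl' _; exists y.
  have r3 : regular_at (fun z => l z ^+ zn y * l' z / L z ^+ d) y.
    apply/regularP; exists (fun z => l z ^+ zn y * l' z), (fun z => L z ^+ d).
    have Ly : L y != 0 by apply: Lr; apply: zn_r.
    split; last by rewrite expf_neq0.
    apply: quo_form _ fLd nLd.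
    apply: (form_cast (S := gv C) (formM (formX (zn y) fl) fl')).
    by rewrite /d (big_rem y yR) /= addrCA.
  apply: regular_gen (regularM (regularM r1 r2) r3) _.
  apply: gen_imp (gen_and irr (unif_gen C_curve y) (gen_and irr (gen_form (S := gv C) fl ly) (gen_and irr (gen_form (S := gv C) fl' l'y) (gen_form (S := gv C) fL nL)))) _.
  move=> z [t0 [l0 [l'0 Lz]]]; rewrite /u0 numE !expr_div_n.
  by rewrite field_cancel2// expf_neq0.
have hval : exists2 v, v != 0 & has_value (fun z => u z / unif x z ^+ k) x v.
  have [vG vG0 hG] := uGu x zx.
  pose rest z := \prod_(y <- R) h y z ^+ zn y.
  have rest0 : rest x != 0.
    rewrite prodf_seq_neq0; apply/allP => y; rewrite mem_filter => /andP[yx _] /=.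
    by have [_ /(_ yx)[_ hx]] := hP y; rewrite expf_neq0.
  have Lx : L x != 0 by apply/Lr/zn_r.
  have frest : vform d (fun z => b0 z ^+ k * rest z).
    apply: formM; first exact: formX.
    by apply: (form_prod R) => y; apply: formX; have [] := hP y.
  have u1 : unit_at (fun z => (b0 z ^+ k * rest z) / L z ^+ d) x.
    apply/unitP; exists (fun z => b0 z ^+ k * rest z), (fun z => L z ^+ d).
    by split; [exact: quo_form frest fLd nLd|rewrite mulf_neq0// expf_neq0|rewrite expf_neq0].
  suff [v v0 hv] : unit_at (fun z => u z / unif x z ^+ k) x by exists v.
  apply: unit_gen (unitM u1 (uGu x zx)) _.
  apply: gen_imp (gen_and irr (unif_gen C_curve x) (gen_and irr q0 (gen_form (S := gv C) fL nL))) _.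
  move=> z [t0 [[b0z E] Lz]]; rewrite /u /u0 /num -/(rest z) E expr_div_n.
  have a0z : a0 z != 0 by apply: contraNneq t0 => a0z; rewrite E a0z mul0r.
  by apply: field_cancel3; rewrite expf_neq0.
exists u; split=> //.
- move=> y py; have [Ly|Ly] := eqVneq (L y) 0; last by apply: regularM (u0r y Ly) (uG y py).
  have ys : y \in undup s by rewrite mem_undup sP.
  have [_ _ _ /(_ Ly) H] := GP y.
  have H' : regular_at (fun z => \prod_(y' <- rem y (undup s)) G y' z) y.
    by apply: regular_prod => y' _; have [_ H' _ _] := GP y'; apply: H'.
  apply: regular_gen (regularM H H') _; apply: gen_true => z.
  by rewrite /u (big_rem y ys) /= mulrA.
- have [v v0 hv] := hval.
  have o : ord_at u x k by exists v.
  exact: (ord_nz C_curve o).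
- move=> y zy yx; have [v hv] := num_ge y zy yx; have [vG _ hG] := uGu y zy.
  exists (v * vG); apply: has_value_gen (has_valueM hv hG) _; apply: gen_true => z.
  by rewrite /u mulrAC.
Qed.

(** One function for each zero [x] and each [k < zn x]. In a combination vanishing to order [zn] at
    all zeros, induction on [k] applies: at [y], the coefficient of order [k] isolates the function
    of index [(y, k)]. *)
Lemma zero_basis : exists m (u : 'I_m -> pts C -> Kb),
  [/\ m = \sum_(x <- r) zn x, forall i y, pn y = 0%N -> regular_at (u i) y,
      forall i, nzrational (u i)
    & forall a : 'I_m -> Kb, (forall y, (0 < zn y)%N ->
        ord_ge (fun z => \sum_i a i * u i z) y (zn y)) -> forall i, a i = 0].
Proof.
pose idx := [seq (x, k) | x <- r, k <- seq.iota 0 (zn x)].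
have idxP x k : ((x, k) \in idx) = (x \in r) && (k < zn x)%N.
  by apply/allpairsPdep/idP => [[x' [k' [xr kr [-> ->]]]]|/andP[xr kx]];
    [move: kr; rewrite mem_iota xr|exists x, k; rewrite mem_iota].
have uidx : uniq idx.
  by apply: allpairs_uniq_dep => [|x _|[x k] [x' k'] _ _ /= [-> ->]];
    rewrite ?uniq_dom ?iota_uniq.
have /choice[u uP] : forall i : 'I_(size idx), exists u, let p := tnth (in_tuple idx) i in
    [/\ forall y, pn y = 0%N -> regular_at u y, nzrational u,
      exists2 v, v != 0 & has_value (fun z => u z / unif p.1 z ^+ p.2) p.1 v
    & forall y, (0 < zn y)%N -> y != p.1 -> ord_ge u y (zn y)].
  move=> i; have := mem_tnth i (in_tuple idx); case: (tnth _ i) => x k.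
  by rewrite [_ \in _]idxP => /andP[_]; apply: zero_interpolant.
exists (size idx), u; split=> [|i|i|a ha].
- rewrite size_allpairs_dep sumnE big_map; apply: eq_bigr => x _.
  by rewrite size_iota.
- by have [] := uP i.
- by have [] := uP i.
have dec (g : pts C -> Kb) y m k : (k < m)%N -> ord_ge g y m ->
    has_value (fun z => g z / unif y z ^+ k) y 0.
  move=> km [v hv]; have mk : (0 < m - k)%N by rewrite subn_gt0.
  have := has_valueM hv (has_value_unifX C_curve y mk); rewrite mulr0 => H.
  apply: has_value_gen H _; apply: gen_imp (unif_gen C_curve y) _ => z t0.
  have -> : unif y z ^+ m = unif y z ^+ (m - k) * unif y z ^+ k.
    by rewrite -exprD subnK// ltnW.
  by rewrite invfM mulrA mulrAC divfK// expf_neq0.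
suff H : forall k i, (tnth (in_tuple idx) i).2 = k -> a i = 0 by move=> i; apply: H.
elim/ltn_ind => k IH i; case E : (tnth (in_tuple idx) i) => [y k'] /= kk; rewrite {k'}kk in E.
have := mem_tnth i (in_tuple idx); rewrite E [_ \in _]idxP => /andP[yr ky].
have zy : (0 < zn y)%N by apply: leq_ltn_trans ky.
have [_ _ [v v0 hv] _] := uP i; rewrite E /= in hv.
have hval l : has_value (fun z => a l * (u l z / unif y z ^+ k)) y (if l == i then a i * v else 0).
  have [->|li] := eqVneq l i; first exact: has_valueM (has_value_const _ y) hv.
  rewrite -[X in has_value _ _ X](mulr0 (a l)).
  case El : (tnth (in_tuple idx) l) => [y' k'].
  have [_ _ [v' _ hv'] hy'] := uP l; rewrite El /= in hv' hy'.
  have [yy|yy] := eqVneq y y'; last first.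
    by apply: has_valueM (has_value_const _ y) (dec _ _ _ _ ky (hy' y zy yy)).
  rewrite -yy in El hv' hy'; case: (ltngtP k k') => kk'.
  - by apply: has_valueM (has_value_const _ y) (dec _ _ _ _ kk' _); exists v'.
  - rewrite (IH _ kk') ?El// mul0r; apply: has_value_gen (has_value_const 0 y) _.
    by apply: gen_true => z; rewrite mul0r.
  - exfalso; move/negP: li; apply; apply/eqP/val_inj.
    rewrite /= -(index_uniq (y, k) (ltn_ord l) uidx) -(index_uniq (y, k) (ltn_ord i) uidx).
    by rewrite -!(tnth_nth _ (in_tuple idx)) E El kk'.
have h1 := has_value_sum (index_enum _) hval.
have h2 := dec _ _ _ _ ky (ha y zy).
have := has_value_uniq h1 (has_value_gen h2 _).
rewrite -big_mkcond big_pred1_eq => /(_ _)/eqP; rewrite mulf_eq0 (negbTE v0) orbF => /(_ _)/eqP; apply.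
by apply: gen_true => z; rewrite mulr_suml; apply: eq_bigr => l _; rewrite mulrA.
Qed.

(** Let [m] count the zeros and [p] the poles. The [m * N] functions [u i * f ^+ j] with [j < N] are
    independent, and their poles are bounded by a divisor of degree at most [N * p] plus a constant.
    If [p < m], a large [N] contradicts [bounded_indep]. *)
Lemma zeros_le_poles : (\sum_(x <- r) zn x <= \sum_(x <- r) pn x)%N.
Proof.
rewrite leqNgt; apply/negP => lt.
have [m [u [mE ru nu iu]]] := zero_basis; rewrite -mE in lt.
have /choice[o oP] : forall iy : 'I_m * pts C, exists o, ord_at (u iy.1) iy.2 o.
  by move=> [i y]; apply: ord_ex.
pose M := (\sum_(i < m) \sum_(y <- r) absz (o (i, y)))%N.
have oM i y : y \in r -> - (M : int) <= o (i, y).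
  move=> yr; suff : (absz (o (i, y)) <= M)%N by lia.
  rewrite /M (bigD1 i) //= (big_rem y yr) /=; lia.
(* [M] bounds the poles of the [u i] at the points of [r], which contribute at most [size r * M];
   the 2 is the one of [bounded_indep]. *)
pose p := (\sum_(x <- r) pn x)%N; pose N := (2 + size r * M)%N.
pose pl := flatten [seq nseq (if (0 < pn y)%N then M + N * pn y else 0) y | y <- r].
have cpl x : count_mem x pl = if (0 < pn x)%N then (M + N * pn x)%N else 0%N.
  rewrite /pl count_flatten -map_comp sumnE big_map.
  rewrite (eq_bigr (fun y => (x == y) * (if (0 < pn y)%N then M + N * pn y else 0)))%N; last first.
    by move=> y _; rewrite /= count_nseq /= eq_sym.
  case: (boolP (x \in r)) => xr.
    rewrite (bigD1_seq x) ?uniq_dom//= eqxx mul1n big1 ?addn0// => y.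
    by rewrite eq_sym => /negbTE->.
  rewrite big_seq big1 => [|y yr]; last by case: eqP => // E; rewrite -E (negbTE xr) in yr.
  by rewrite /pn coeff_outdom.
have szpl : ((size pl).+2 <= m * N)%N.
  have : (size pl <= size r * M + N * p)%N.
    have -> : (size r * M + N * p)%N = (\sum_(y <- r) (M + N * pn y))%N.
      by rewrite big_split /= -big_distrr /= big_const_seq count_predT iter_addn_0 mulnC.
    rewrite /pl size_flatten /shape -map_comp sumnE big_map.
    by apply: leq_sum => y _; rewrite /= size_nseq; case: ifP.
  move: lt; rewrite -/p => lt; have := leq_mul lt (leqnn N); rewrite /N; lia.
pose T := ('I_m * 'I_N)%type; pose W (t : T) z := u t.1 z * f z ^+ t.2.
have cT : #|{: T}| = (m * N)%N by rewrite card_prod !card_ord.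
have bW t : bounded pl (W t).
  move=> x; rewrite cpl; case: ifP => px; last first.
    have px0 : pn x = 0%N by move: px; case: (pn x).
    apply: regular_gen (regularM (ru t.1 x px0) (regularX t.2 (regf px0))) _.
    by apply: gen_true => z; rewrite expr0 mulr1.
  have xr : x \in r by rewrite /r mem_dom; move: px; rewrite /pn; case: (coeff x D).
  have ox := ordM C_curve (ordM C_curve (oP (t.1, x)) (ordX C_curve t.2 (ordf x)))
     (ordX C_curve (M + N * pn x) (ord_unif C_curve x)).
  have cx : coeff x D = - (pn x)%:Z by move: px; rewrite /pn; case: (coeff x D).
  have [k kE] : exists k : nat, o (t.1, x) + coeff x D *+ t.2 + 1 *+ (M + N * pn x) = k%:Z.
    apply: int_nonneg; have := oM t.1 x xr; have tN : (t.2 <= N)%N by apply: ltnW.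
    have -> : coeff x D *+ t.2 = - (pn x * t.2)%N%:Z.
      by rewrite cx mulNrn -[(pn x)%:Z]natz -mulrnA natz.
    have le : (pn x * t.2 <= N * pn x)%N by rewrite mulnC leq_mul.
    rewrite natz; lia.
  by rewrite kE in ox; apply: (ord_ge0_regular C_curve ox).
have iW (c : T -> Kb) : gen (fun z => \sum_t c t * W t z = 0) -> forall t, c t = 0.
  move=> E; suff H : forall j (jN : (j < N)%N) i, c (i, Ordinal jN) = 0.
    by move=> [i [j jN]]; apply: H.
  (* The lowest power of [f] goes first: after division by [f ^+ j], the combination of the [u i] at
     level [j] is [f] times a function regular at the zeros of [f], hence trivial by
     [zero_basis]. *)
  elim/ltn_ind => j IH jN; apply: (iu (fun i => c (i, Ordinal jN))) => y zy.
  pose R z := \sum_(t : T | (j < t.2)%N) c t * (u t.1 z * f z ^+ (t.2 - j.+1)).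
  have py : pn y = 0%N by move: zy; rewrite /zn /pn; case: (coeff y D).
  have rR : regular_at R y.
    suff : regular_at (fun z => \sum_t (if (j < (t : T).2)%N then c t else 0) * (u t.1 z * f z ^+ (t.2 - j.+1))) y.
      move=> H; apply: regular_gen H _; apply: gen_true => z; rewrite /R [RHS]big_mkcond /=.
      by apply: eq_bigr => t _; case: ifP => //; rewrite mul0r.
    apply: regular_sum => t; apply: regularZ; apply: regularM; first exact: ru.
    exact/regularX/regf.
  have rf : regular_at (fun z => f z / unif y z ^+ zn y) y.
    by have := ordf y; rewrite zn_coeff// => /unit_regular.
  apply: regular_gen (regularZ (-1) (regularM rf rR)) _.
  apply: gen_imp (gen_and irr E (nz_gen fD.1)) _ => z [Ez f0].
  have S : f z ^+ j * (\sum_i c (i, Ordinal jN) * u i z + f z * R z) = 0.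
    rewrite -[RHS]Ez (bigID (fun t : T => (j <= t.2)%N)) /= [X in _ = _ + X]big1 ?addr0; last first.
      move=> [i [l lN]] /=; rewrite -ltnNge => lj; rewrite (IH l lj lN) mul0r //.
    rewrite (bigID (fun t : T => (t.2 == j :> nat)%N)) /= mulrDr; congr (_ + _).
      rewrite mulr_sumr (reindex_onto (fun i => (i, Ordinal jN)) fst) /=; last first.
        by move=> [i l] /andP[_ /eqP lj]; congr (_, _); apply: val_inj.
      apply: eq_big => [i|i _]; first by rewrite leqnn !eqxx.
      by rewrite /W /=; ring.
    rewrite /R !mulr_sumr; apply: eq_big => [t|t jt].
      by rewrite ltn_neqAle andbC eq_sym.
    have -> : W t z = u t.1 z * (f z * f z ^+ j * f z ^+ (t.2 - j.+1)).
      by rewrite -exprS -exprD subnKC.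
    by move: (f z ^+ j) (f z ^+ (t.2 - j.+1)) => A B; ring.
  move/eqP: S; rewrite mulf_eq0 expf_eq0 (negbTE f0) andbF /= addr_eq0 => /eqP ->.
  by rewrite mulN1r mulNr; congr (- _); rewrite mulrAC.
pose h (i : 'I_(size pl).+2) : T := enum_val (cast_ord (esym cT) (widen_ord szpl i)).
have hI : injective h by move=> i j /enum_val_inj /cast_ord_inj /(congr1 val) /= /val_inj.
apply: (@bounded_indep pl (fun i => W (h i)) (fun i => bW (h i))) => c E i.
have : \sum_(j | h j == h i) c j = 0.
  apply: (iW (fun t => \sum_(j | h j == t) c j)); apply: gen_imp E _ => z E.
  rewrite -[RHS]E [RHS](partition_big h predT) //=; apply: eq_bigr => t _.
  by rewrite mulr_suml; apply: eq_bigr => j /eqP->.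
by rewrite (eq_bigl (pred1 i)) ?big_pred1_eq// => j /=; rewrite (inj_eq hI).
Qed.

Lemma deg_zeros_poles : deg D = (\sum_(x <- r) zn x)%:Z - (\sum_(x <- r) pn x)%:Z.
Proof.
rewrite -[D in LHS]freeg_sumE raddf_sum /= !PoszD_sum -sumrB; apply: eq_bigr => x _.
by rewrite degU /zn /pn; case: (coeff x D) => n; rewrite ?subr0 ?sub0r// NegzE.
Qed.

End Inequality.

Theorem deg_principal f D : is_cdiv_of f D -> deg D = 0.
Proof.
move=> fD; have fD' : is_cdiv_of (fun z => (f z)^-1) (- D).
  split; first exact/nzV/fD.1.
  by move=> x; rewrite coeffN; apply/(has_ordP C_curve)/ordV/(has_ordP C_curve)/fD.2.
have h1 := zeros_le_poles fD; have h2 := zeros_le_poles fD'.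
have d1 := deg_zeros_poles D; have d2 := deg_zeros_poles (- D).
rewrite degN in d2; lia.
Qed.

End Degree.

(** * The Jacobian and the theta divisor *)

Section Jacobian.
Variables (K : fieldType) (Kb : closedFieldType) (iota : {rmorphism K -> Kb}).
Local Notation abvar := (abvar iota).
Local Notation closed X := (@gclosed Kb (gv X)).

Lemma add_greg (A : abvar) : greg (S := gprod (gv A) (gv A)) (T := gv A) (fun u => u.1 + u.2).
Proof. exact/(morphism2_greg (@av_add_morph _ _ _ A)). Qed.

Lemma opp_greg (A : abvar) : greg (S := gv A) (T := gv A) -%R.
Proof. exact/(morphism_greg (@av_opp_morph _ _ _ A)). Qed.

Section Group.
Variables (A : abvar) (S : gsp Kb).

Lemma gregD (u v : S -> pts A) : greg (T := gv A) u -> greg (T := gv A) v ->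
  greg (T := gv A) (fun s => u s + v s).
Proof. by move=> ru rv; apply: (greg_comp (greg_pair ru rv) (@add_greg A)). Qed.

Lemma gregN (u : S -> pts A) : greg (T := gv A) u -> greg (T := gv A) (fun s => - u s).
Proof. by move=> ru; apply: (greg_comp ru (@opp_greg A)). Qed.

Lemma gregB (u v : S -> pts A) : greg (T := gv A) u -> greg (T := gv A) v ->
  greg (T := gv A) (fun s => u s - v s).
Proof. by move=> ru rv; apply: gregD ru (gregN rv). Qed.

End Group.

Lemma greg_addr (A : abvar) (c : pts A) : greg (S := gv A) (T := gv A) (fun x => x + c).
Proof. exact: (gregD (S := gv A) (@greg_id _ (gv A)) (@greg_const _ (gv A) (gv A) c)). Qed.

(** The translates of [Z] by the multiples of [c] decrease, so two consecutive ones agree;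
    translating back, so do [Z] and its translate by [c]. *)
Lemma stable_sub (A : abvar) (Z : set (pts A)) c : closed A Z ->
  (forall z, Z z -> Z (z + c)) -> forall z, Z z -> Z (z - c).
Proof.
move=> cZ Zc; pose Y n := [set y : pts A | Z (y - c *+ n)]%classic.
have cY n : closed A (Y n) by apply: greg_closed cZ; apply: greg_addr.
have [Z' [_ [n ->] minZ]] := @gclosed_min _ _ _ A (fun Z' => exists n, Z' = Y n) _ (cY 0%N) (ex_intro _ 0%N erefl).
move=> z Zz; have := minZ (Y n.+1) (cY _) (ex_intro _ n.+1 erefl) _ (z + c *+ n).
rewrite /Y /= addrK mulrS opprD addrA [_ - c]addrAC addrK; apply=> // y.
by rewrite addrA addrAC => /Zc; rewrite subrK.
Qed.

Variables (C : variety iota) (C_curve : smooth_curve C).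
Variables (J : abvar) (cl : cdiv C -> pts J) (J_jac : is_jacobian cl).

Lemma clD D E : deg D = 0 -> deg E = 0 -> cl (D + E) = cl D + cl E.
Proof. by have [H _ _ _ _] := J_jac; apply: H. Qed.

Lemma cl0 : cl 0 = 0.
Proof. by apply: (addrI (cl 0)); rewrite -clD ?deg0// !addr0. Qed.

Lemma clN D : deg D = 0 -> cl (- D) = - cl D.
Proof.
move=> D0; apply: (addrI (cl D)); rewrite subrr -clD ?subrr ?cl0//.
by rewrite degN D0 oppr0.
Qed.

Lemma clB D E : deg D = 0 -> deg E = 0 -> cl (D - E) = cl D - cl E.
Proof. by move=> D0 E0; rewrite clD ?clN// degN E0 oppr0. Qed.

Lemma clMn D m : deg D = 0 -> cl (D *+ m) = cl D *+ m.
Proof.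
move=> D0; elim: m => [|m IH]; first by rewrite !mulr0n cl0.
by rewrite !mulrS clD ?IH// degMn D0 mul0rn.
Qed.

Lemma cl_sum (I : Type) (r : seq I) (F : I -> cdiv C) : (forall i, deg (F i) = 0) ->
  deg (\sum_(i <- r) F i) = 0 /\ cl (\sum_(i <- r) F i) = \sum_(i <- r) cl (F i).
Proof.
move=> F0; elim: r => [|i r [IH1 IH2]]; first by rewrite !big_nil cl0 deg0.
by rewrite !big_cons degD F0 IH1 clD// IH2.
Qed.

Lemma cl_principal D : deg D = 0 -> (cl D = 0 <-> exists f, is_cdiv_of f D).
Proof. by have [_ _ H _ _] := J_jac; apply: H. Qed.

Lemma cl_surj x : exists2 D, deg D = 0 & cl D = x.
Proof. by have [_ H _ _ _] := J_jac; apply: H. Qed.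

Lemma deg_diff (P Q : pts C) : deg (<< P >> - << Q >> : cdiv C) = 0.
Proof. by rewrite degB !degU subrr. Qed.

Variable P0 : pts C.
Definition abel_jacobi (a : pts C) : pts J := cl (<< a >> - << P0 >>).

Lemma aj_diff a b : cl (<< a >> - << b >>) = abel_jacobi a - abel_jacobi b.
Proof.
by rewrite /abel_jacobi -clB ?deg_diff//; congr cl; rewrite opprB addrA subrK.
Qed.

Lemma aj_greg : greg (S := gv C) (T := gv J) abel_jacobi.
Proof.
have [_ _ _ _ /morphism2_greg H] := J_jac.
exact: (greg_comp (greg_pair (@greg_id _ (gv C)) (@greg_const _ (gv C) (gv C) P0)) H).
Qed.

Lemma cl_aj (D : cdiv C) : deg D = 0 -> cl D = \sum_(p <- dom D) abel_jacobi p *~ coeff p D.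
Proof.
have jz p (m : int) : abel_jacobi p *~ m = cl (<< m *g p >> - << m *g P0 >>).
  have E k : << (k%:Z : int) *g p >> - << (k%:Z : int) *g P0 >> = (<< p >> - << P0 >> : cdiv C) *+ k.
    apply/eqP/freeg_eqP => z; rewrite coeffMn !coeffB !coeffU -[RHS]mulr_natl natz.
    by ring.
  case: m => m; first by rewrite E clMn ?deg_diff// -pmulrn.
  rewrite NegzE mulrNz -pmulrn -clMn ?deg_diff// -clN ?degMn ?deg_diff ?mul0rn//.
  congr cl; rewrite -E opprB; apply/eqP/freeg_eqP => z; rewrite !coeffB !coeffU; ring.
move=> D0; under eq_bigr do rewrite jz.
have dd p (m : int) : deg (<< m *g p >> - << m *g P0 >> : cdiv C) = 0.
  by rewrite degB !degU subrr.
have [_ <-] := cl_sum (dom D) (fun p => dd p (coeff p D)).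
congr cl; rewrite sumrB freeg_sumE; apply/eqP; rewrite -[X in X == _]subr0.
apply/eqP; congr (_ - _); apply/esym/eqP/freeg_eqP => z; rewrite coeff0 raddf_sum /=.
under eq_bigr do rewrite coeffU; rewrite -mulr_suml (_ : \sum_(p <- dom D) _ = 0) ?mul0r//.
rewrite -[RHS]D0 -[D in RHS]freeg_sumE raddf_sum /=.
by apply: eq_bigr => p _; rewrite degU.
Qed.

Definition Wset r : set (pts J) := [set x | exists P : 'I_r -> pts C, x = \sum_i abel_jacobi (P i)]%classic.

Lemma aj0 : abel_jacobi P0 = 0. Proof. by rewrite /abel_jacobi subrr cl0. Qed.

Lemma WsetS r y : Wset r.+1 y <-> exists a, Wset r (y - abel_jacobi a).
Proof.
split=> [[P ->]|[a [P E]]].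
  exists (P ord0), (fun i => P (fintype.lift ord0 i)).
  by rewrite big_ord_recl addrC addKr.
exists (fun i => if unlift ord0 i is Some j then P j else a).
rewrite big_ord_recl unlift_none; under eq_bigr do rewrite liftK.
by rewrite -E addrC subrK.
Qed.

Lemma Wset0 y : Wset 0 y <-> y = 0.
Proof.
split=> [[P ->]|->]; first by rewrite big_ord0.
by exists (fun _ => P0); rewrite big_ord0.
Qed.

Lemma Wset_add r a y : Wset r y -> Wset r.+1 (y + abel_jacobi a).
Proof. by move=> Wy; apply/WsetS; exists a; rewrite addrK. Qed.

Lemma Wset_mono r s y : (r <= s)%N -> Wset r y -> Wset s y.
Proof.
elim: s => [|s IH]; first by rewrite leqn0 => /eqP->.
rewrite leq_eqVlt => /orP[/eqP->//|/IH H] /H /(Wset_add P0).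
by rewrite aj0 addr0.
Qed.

Lemma subaj_greg : greg (S := gprod (gv J) (gv C)) (T := gv J) (fun u => u.1 - abel_jacobi u.2).
Proof.
apply: gregB; first exact: greg_fst.
exact: greg_comp (@greg_snd _ (gv J) (gv C)) aj_greg.
Qed.

Lemma Wset_closed r : closed J (Wset r).
Proof.
elim: r => [|r IH].
  have -> : Wset 0 = [set 0]%classic by apply/funext => y; apply/propext; exact: Wset0.
  exact: gclosed_pt.
have -> : Wset r.+1 = [set y | exists a, Wset r (y - abel_jacobi a)]%classic.
  by apply/funext => y; apply/propext; exact: WsetS.
exact: (proj_closed (Y := gv J) (greg_closed subaj_greg IH)).
Qed.

(** One point at a time: for fixed [s] the curve [s + C] lies in one of the two closed sets, and the
    [s] for which it lies in a given one form a closed set. *)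
Lemma Wset_irr r (Z Y : set (pts J)) : closed J Z -> closed J Y ->
  (forall x, Wset r x -> Z x \/ Y x) ->
  (forall x, Wset r x -> Z x) \/ (forall x, Wset r x -> Y x).
Proof.
elim: r Z Y => [|r IH] Z Y cZ cY ZY.
  have : Wset 0 0 by apply/Wset0.
  by case/ZY => h; [left|right] => x /Wset0->.
pose T (X : set (pts J)) := [set s | forall a, X (s + abel_jacobi a)]%classic.
have cT X : closed J X -> closed J (T X).
  by move=> cX; apply: gclosed_setI => a; apply: (greg_closed (greg_addr (abel_jacobi a)) cX).
have key s : Wset r s -> T Z s \/ T Y s.
  move=> Ws; have ra : greg (S := gv C) (T := gv J) (fun a => s + abel_jacobi a).
    exact: (gregD (@greg_const _ (gv C) (gv J) s) aj_greg).
  apply: (gclosed_irr (gvirr C) (greg_closed ra cZ) (greg_closed ra cY)) => a.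
  exact/ZY/Wset_add.
have [h|h] := IH (T Z) (T Y) (cT Z cZ) (cT Y cY) key.
- by left=> x /WsetS[a /h/(_ a)]; rewrite subrK.
- by right=> x /WsetS[a /h/(_ a)]; rewrite subrK.
Qed.

(** If adding points of [C] does not leave W_r, neither does subtracting them, by [stable_sub]; and
    the points of [C] generate [J]. *)
Lemma Wset_stable r : (forall x, Wset r.+1 x -> Wset r x) -> forall x, Wset r x.
Proof.
move=> st; have W0 : Wset r 0 by apply: (@Wset_mono 0) => //; apply/Wset0.
have add a z : Wset r z -> Wset r (z + abel_jacobi a) by move=> Wz; apply/st/Wset_add.
have sub a := stable_sub (@Wset_closed r) (add a).
have addn a m z : Wset r z -> Wset r (z + abel_jacobi a *~ m).
  move=> Wz; case: m => m.
    by elim: m => [|m IH]; rewrite ?mulr0z ?addr0// -pmulrn mulrSr addrA pmulrn; apply: add.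
  rewrite NegzE mulrNz; elim: m.+1 => [|n IH]; first by rewrite oppr0 addr0.
  by rewrite -pmulrn mulrSr opprD addrA pmulrn; apply: sub.
move=> x; have [D D0 <-] := cl_surj x; rewrite cl_aj//.
elim: (dom D) => [|p s IH]; first by rewrite big_nil.
by rewrite big_cons addrC; apply: addn.
Qed.

Lemma has_chain_le (X : variety iota) d d' : (d <= d')%N -> has_chain X d' -> has_chain X d.
Proof.
move=> dd [Z [h1 h2]]; exists Z; split=> i id.
  by apply: h1; apply: leq_trans dd.
by apply: h2; apply: leq_trans dd.
Qed.

Lemma krull_uniq (X : variety iota) d d' : krull_dim X d -> krull_dim X d' -> d = d'.
Proof.
move=> [h1 n1] [h2 n2]; apply/eqP; rewrite eqn_leq; apply/andP; split; rewrite leqNgt; apply/negP => lt.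
  by apply: n2; apply: has_chain_le h1.
by apply: n1; apply: has_chain_le h2.
Qed.

(** The W_i are irreducible, closed and increasing, so they stop growing at some [i <= d]; once this
    happens they fill [J]. *)
Lemma Wset_full d : krull_dim J d -> forall x, Wset d x.
Proof.
move=> [_ noch]; suff [s [sd Ws]] : exists s, (s <= d)%N /\ forall x, Wset s.+1 x -> Wset s x.
  by move=> x; apply: (Wset_mono sd); apply: Wset_stable.
apply: contrapT => ns; apply: noch; exists Wset; split=> i id.
  split; first exact/gclosedP/Wset_closed.
  split; first by exists (0 : pts J); apply: (@Wset_mono 0) => //; apply/Wset0.
  by move=> Z1 Z2 /gclosedP c1 /gclosedP c2; apply: Wset_irr.
rewrite properEneq; split; last by move=> x; apply: Wset_mono.
by apply/eqP => E; apply: ns; exists i; split=> // x; rewrite E.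
Qed.

Lemma theta_Wset r x : krull_dim J r.+1 -> (theta cl P0 x <-> Wset r x).
Proof.
move=> kr; split=> [[r' [P [kr' ->]]]|[P ->]]; last by exists r, P.
by have [<-] := krull_uniq kr' kr; exists P.
Qed.

Lemma theta_closed : closed J (theta cl P0).
Proof.
case: (pselect (exists r, krull_dim J r.+1)) => [[r kr]|nr].
  have -> : theta cl P0 = Wset r by apply/funext => x; apply/propext; exact: theta_Wset.
  exact: Wset_closed.
by move=> x _; apply: near_T => y [r [P [kr _]]]; apply: nr; exists r.
Qed.

Section LocalEquation.
Variables (T : divisor J) (Z : set (pts J)).
Hypotheses (TZ : is_divisor_of_set T Z) (cZ : closed J Z).
Let irrJ := gvirr J.

(** The defining property of [T] is tested on three functions: on [T w], which is therefore regular
    at [w] and vanishes on [Z]; on 1, which shows that [T w] is a unit at [w] off [Z]; and on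
    [P / l], which makes [F] divide, near [y], every form vanishing on [Z]. *)
Lemma local_equation y : exists d F G,
  [/\ vform d F, vform d G, quo (T y) F G, G y != 0 &
   [/\ exists z, F z != 0, near (S := gv J) y (fun z => F z = 0 <-> Z z) &
    forall e P, vform e P -> near (S := gv J) y (fun z => Z z -> P z = 0) ->
      exists m n A B, [/\ vform m A, vform n B, B y != 0, (e + n = d + m)%N &
                          forall z, P z * B z = F z * A z]]].
Proof.
have [cT TP] := TZ.
have reg w : regular_at (T w) w /\ near (S := gv J) w (fun z => Z z -> has_value (T w) z 0).
  have [nw _] := cT w; have [_ h] := TP w (T w) nw.1.
  have [|r1 /nearP r2] := h; last by split.
  exists 1; apply: has_value_gen (has_value_const 1 w) _.
  by apply: gen_imp (nz_gen nw) _ => z t0; rewrite divff.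
have [/regularP[F [G [q Gy]]] nv] := reg y; have [d [fF fG E]] := q.
have nF := quo_nzn (cT y).1 q.
have unitn w : ~ Z w -> unit_at (T w) w.
  move=> nZ; have [nw _] := cT w.
  have rone : rational_over setT (fun _ : pts J => (1 : Kb)).
    by apply/quoT; exists (fun _ => 1), (fun _ => 1); exact: quo_const.
  have [h _] := TP w (fun _ => 1) rone.
  have [|v hv] := h.
    split; first by exists 1; apply: has_value_const.
    by apply/nearP; apply: near_imp (cZ nZ) _ => z nz /nz.
  have [[v' hv'] _] := reg w.
  have E1 : gen (S := gv J) (fun z => 1 / T w z * T w z = 1).
    by apply: gen_imp (nz_gen nw) _ => z t0; rewrite divfK.
  have vv := has_value_uniq (has_value_gen (has_valueM hv hv') E1) (has_value_const 1 w).
  exists v' => //; apply: contra_eq_neq vv => ->.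
  by rewrite mulr0 eq_sym oner_neq0.
exists d, F, G; split=> //; split=> // [|e P fP PZ].
  have nG := near_form (S := gv J) fG Gy.
  have [_ /nearP nc] := cT y.
  apply: near_imp (near_and nG (near_and nc nv)) _ => z [Gz [uz hz]].
  split=> [Fz|Zz].
    apply: contrapT => nZz.
    have [v v0 hv] : unit_at (T y) z.
      have [nz _] := cT z; apply: unit_gen (unitD (unitn z nZz) uz) _.
      apply: gen_imp (gen_and irrJ (nz_gen nz) (nz_gen (cT y).1)) _ => w [tz ty].
      by rewrite invf_div mulrC divfK.
    have h0 : has_value (T y) z (F z / G z) by apply/has_valueP; exists F, G.
    by move/negP: v0; apply; rewrite (has_value_uniq hv h0) Fz mul0r.
  have h0 : has_value (T y) z (F z / G z) by apply/has_valueP; exists F, G.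
  have /eqP := has_value_uniq h0 (hz Zz).
  by rewrite mulf_eq0 invr_eq0 (negbTE Gz) orbF => /eqP.
have [l fl ly] := vform_nv (X := J) e y.
pose h z := P z / l z; have qh : quo h P l by apply: quo_form fP fl _; exists y.
have [h1 _] := TP y h (proj2 (quoT _) (ex_intro _ P (ex_intro _ l qh))).
have [|v hv] := h1.
  split; first by apply/regularP; exists P, l.
  apply/nearP; apply: near_imp (near_and PZ (near_form (S := gv J) fl ly)) _ => z [Pz lz] Zz.
  by apply/has_valueP; exists P, l; split=> //; rewrite Pz// mul0r.
have /has_valueP[A [B [q' By _]]] := hv; have [d' [fA fB E']] := q'.
exists (e + d')%N, (d + d')%N, (fun z => l z * A z), (fun z => G z * B z).
split; [exact: vformM fl fA|exact: vformM fG fB|by rewrite mulf_neq0|by rewrite addnCA|].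
have [zF zF0] := nF.
apply: (form_eq irrJ (vformM fP (vformM fG fB)) (form_cast (S := gv J) (vformM fF (vformM fl fA)) (addrCA _ _ _))).
have nl := gen_form (S := gv J) fl ly.
have nF' := gen_form (S := gv J) fF zF0.
apply: gen_imp (gen_and irrJ (gen_and irrJ E E') (gen_and irrJ nl nF')) _ => z [[[Gz Tz] [Bz hz]] [lz Fz]].
move: hz; rewrite /h Tz => hz.
have -> : P z = (P z / l z / (F z / G z)) * (l z * (F z / G z)).
  by field; rewrite Fz Gz lz.
by rewrite hz; field; rewrite Gz Bz.
Qed.

End LocalEquation.

End Jacobian.

(** * Effective divisors and linear equivalence on the curve *)

Section LinearSystem.
Variables (K : fieldType) (Kb : closedFieldType) (iota : {rmorphism K -> Kb}).
Variables (C : variety iota) (C_curve : smooth_curve C).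
Local Notation gen := (@gen Kb (gv C)).

Lemma curve_infinite (s : seq (pts C)) : exists x, x \notin s.
Proof.
apply: contrapT => ns; have all_s x : x \in s.
  by apply: contrapT => /negP xs; apply: ns; exists x.
have [[[Z [h1 h2]] _] _] := C_curve.
have [_ [[z0 Zz0] _]] := h1 0%N isT; have [_ [_ irr1]] := h1 1%N isT.
have := h2 0%N isT; rewrite properEneq => -[/eqP ne sub].
have [z [Zz nz]] : exists z, Z 1%N z /\ ~ Z 0%N z.
  apply: contrapT => H; apply: ne; apply/seteqP; split=> // x Zx.
  by apply: contrapT => nx; apply: H; exists x.
have c1 : zclosed [set z]%classic by apply/gclosedP/gclosed_pt.
have c2 : zclosed [set x | x \in [seq x <- s | x != z]]%classic by apply/gclosedP/gclosed_seq.
case: (irr1 _ _ c1 c2) => [x _|h|h] /=.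
- by case: (eqVneq x z) => [->|xz]; [left|right; rewrite mem_filter xz all_s].
- have := h z0 (sub _ Zz0); rewrite /= => E; by rewrite E in Zz0.
- by have := h z Zz; rewrite /= mem_filter eqxx.
Qed.

Lemma closed_cofinite (Z : set (pts C)) (s : seq (pts C)) : gclosed (S := gv C) Z ->
  (forall x, x \notin s -> Z x) -> forall x, Z x.
Proof.
move=> cZ h x; apply: contrapT => nx.
have [s' hs'] := curve_finite C_curve cZ (ex_intro _ x nx).
have [y] := curve_infinite (s ++ s'); rewrite mem_cat negb_or => /andP[/h/hs' ys'].
by rewrite ys'.
Qed.

Lemma effective_sum n (E : cdiv C) : (forall x, 0 <= coeff x E) -> deg E = n%:Z ->
  exists S : 'I_n -> pts C, E = \sum_i << S i >>.
Proof.
elim: n E => [|n IH] E pE dE.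
  have [x0 _] := curve_infinite [::]; exists (fun=> x0).
  rewrite big_ord0; apply: fgpos_eq0P => //; exact/fgposP.
have [z Ez] : exists z, 0 < coeff z E.
  apply: contrapT => nz; have : E = 0.
    apply/eqP/freeg_eqP => z; rewrite coeff0; have := pE z.
    have /negP : ~ (0 < coeff z E) by move=> h; apply: nz; exists z.
    by lia.
  by move=> E0; rewrite E0 deg0 in dE.
have [||S SE] := IH (E - << z >>).
- move=> x; rewrite coeffB coeffU mul1r; case: eqP => [<-|_]; last by rewrite subr0.
  by rewrite subr_ge0; lia.
- by rewrite degB degU dE; lia.
exists (fun i => if unlift ord0 i is Some j then S j else z).
rewrite big_ord_recl unlift_none; under eq_bigr do rewrite liftK.
by rewrite -SE addrC subrK.
Qed.

Variables (J : abvar iota) (cl : cdiv C -> pts J) (J_jac : is_jacobian cl) (P0 : pts C).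
Local Notation aj := (abel_jacobi cl P0).
Local Notation Wset := (Wset cl P0).

Lemma aj_sum n (S : 'I_n -> pts C) :
  deg (\sum_i << S i >> - << P0 >> *+ n : cdiv C) = 0 /\
  \sum_i aj (S i) = cl (\sum_i << S i >> - << P0 >> *+ n).
Proof.
have [d <-] := cl_sum J_jac (index_enum 'I_n) (fun i => deg_diff (S i) P0).
have E : \sum_i (<< S i >> - << P0 >>) = \sum_i << S i >> - << P0 >> *+ n :> cdiv C.
  by rewrite sumrB sumr_const card_ord.
by rewrite -E.
Qed.

Lemma deg_sum_pts n (S : 'I_n -> pts C) : deg (\sum_i << S i >> : cdiv C) = n%:Z.
Proof.
rewrite raddf_sum /=; under eq_bigr do rewrite degU.
by rewrite sumr_const card_ord natz.
Qed.

Lemma coeff_sum_pts n (S : 'I_n -> pts C) x :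
  coeff x (\sum_i << S i >> : cdiv C) = (\sum_i (S i == x))%N.
Proof.
rewrite raddf_sum PoszD_sum; apply: eq_bigr => i _ /=.
by rewrite coeffU mul1r; case: eqP.
Qed.

Lemma nonconst_sub (f : pts C -> Kb) c x (m : nat) : nzrational f -> ord_at f x (- m.+1%:Z) ->
  nzrational (fun z => f z - c).
Proof.
move=> nf of'; have /nzP[a [b [q _]]] := nf.
have qc := quoD q (quo_const _ (- c)); apply/nzP.
eexists; eexists; split; first exact: qc.
apply: contrapT => ne; have [d [_ _ E]] := qc.
have fE : gen (fun z => f z = c).
  apply: gen_imp (gen_and (gvirr C) E (nz_gen nf)) _ => z [[_ E'] _].
  apply/eqP; rewrite -subr_eq0 E'.
  have -> : a z * 1 + - c * b z = 0; last by rewrite mul0r.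
  by apply/eqP/negP => /negP H; apply: ne; exists z.
have [c0|c0] := eqVneq c 0.
  by have [y [-> /eqP]] := gen_ex (gen_and (gvirr C) fE (nz_gen nf)).
have uf : unit_at f x by apply: unit_gen (unit_const x c0) _; apply: gen_imp fE _ => z ->.
by have := ord_uniq C_curve of' (proj2 (ord_unit C_curve f x) uf).
Qed.

(* If y lies in W_r + a for a point a outside M, then M moves in a pencil, so
   y lies in W_r + b for every b. *)
Lemma pencil r (M : 'I_r.+1 -> pts C) a :
  Wset r (\sum_i aj (M i) - aj a) -> (forall k, a != M k) ->
  forall b, Wset r (\sum_i aj (M i) - aj b).
Proof.
move=> [R RE] aM; set y := \sum_i aj (M i) in RE *.
pose EM : cdiv C := \sum_i << M i >>; pose ER : cdiv C := << a >> + \sum_i << R i >>.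
have dR : deg ER = r.+1%:Z by rewrite degD degU deg_sum_pts; lia.
have dM : deg EM = r.+1%:Z := deg_sum_pts M.
have dEM : deg (EM - << P0 >> *+ r.+1) = 0 := proj1 (aj_sum M).
have yM : y = cl (EM - << P0 >> *+ r.+1) := proj2 (aj_sum M).
have yR : y = cl (ER - << P0 >> *+ r.+1).
  have [d E] := aj_sum R; have -> : y = aj a + \sum_i aj (R i) by rewrite -RE addrC subrK.
  rewrite E /abel_jacobi -(clD J_jac) ?deg_diff//; congr cl.
  by rewrite /ER mulrSr opprD addrACA [X in _ + X]addrC.
have dMR : deg (EM - ER) = 0 by rewrite degB dM dR subrr.
have dER : deg (ER - << P0 >> *+ r.+1) = 0 by rewrite degB dR degMn degU natz subrr.
have [f [nf of']] : exists f, is_cdiv_of f (EM - ER).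
  apply/(cl_principal J_jac) => //.
  have -> : EM - ER = (EM - << P0 >> *+ r.+1) - (ER - << P0 >> *+ r.+1).
    by rewrite opprB addrA subrK.
  by rewrite (clB J_jac)// -yM -yR subrr.
have ord x : ord_at f x (coeff x (EM - ER)) by apply/(has_ordP C_curve).
have cM x : coeff x EM = (\sum_i (M i == x))%N := coeff_sum_pts M x.
have cR x : coeff x ER = ((a == x) + \sum_i (R i == x))%N.
  by rewrite coeffD coeffU mul1r coeff_sum_pts PoszD; case: eqP.
have [m am] : exists m : nat, coeff a (EM - ER) = - m.+1%:Z.
  rewrite coeffB cM cR big1 => [|i _]; last by rewrite eq_sym (negbTE (aM i)).
  by rewrite eqxx; exists (\sum_i (R i == a))%N; lia.
have nfc c : nzrational (fun z => f z - c).
  by apply: (@nonconst_sub f c a m) => //; rewrite -am.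
(* [f] has divisor [EM - ER], with a pole at [a], so it is not constant. Subtracting its value at
   [b] keeps the poles within [ER] and creates a zero at [b]; the new divisor plus [ER] minus [b] is
   effective of degree [r]. *)
have Z b : b \notin dom (EM - ER) -> b != a -> (forall i, b != R i) -> Wset r (y - aj b).
  move=> bE ba bR; have [c c0 hc] : unit_at f b.
    by apply/(ord_unit C_curve); rewrite -(coeff_outdom bE).
  have [D' D'P] := cdiv_ex C_curve (nfc c); have d' := deg_principal C_curve D'P.
  have o' x : ord_at (fun z => f z - c) x (coeff x D') by apply/(has_ordP C_curve)/D'P.2.
  have ge x : - (coeff x ER) <= coeff x D'.
    have [n nE] : exists n : nat, coeff x ER = n%:Z by rewrite cR; eexists.
    rewrite nE; have rf : regular_at (fun z => f z * unif x z ^+ n) x.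
      have o1 := ordM C_curve (ord x) (ordX C_curve n (ord_unif C_curve x)).
      have [k kE] : exists k : nat, coeff x (EM - ER) + 1 *+ n = k%:Z.
        by apply: int_nonneg; rewrite coeffB nE cM natz; lia.
      by rewrite kE in o1; apply: (ord_ge0_regular C_curve o1).
    have rt : regular_at (fun z => unif x z ^+ n) x by apply/regularX/unif_regular.
    have r2 : regular_at (fun z => (f z - c) * unif x z ^+ n) x.
      have [v hv] := rf; have [v' hv'] := regularZ (- c) rt; exists (v + v').
      apply: has_value_gen (has_valueD hv hv') _; apply: gen_true => z; rewrite mulrDl mulNr //.
    have o2 := ordM C_curve (o' x) (ordX C_curve n (ord_unif C_curve x)).
    by have := ord_ge0 C_curve o2 r2; rewrite natz; lia.
  have gt0 : 0 < coeff b D'.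
    apply: (ord_value0 C_curve (o' b)); have := has_valueD hc (has_value_const (- c) b).
    by rewrite subrr.
  have [||S SE] := @effective_sum r (D' + ER - << b >>).
  - move=> x; rewrite coeffB coeffD coeffU mul1r; have := ge x.
    case: eqP => [<-|_] h; last by rewrite subr0; lia.
    have -> : coeff b ER = 0.
      rewrite cR eq_sym (negbTE ba) big1// => i _.
      by rewrite eq_sym (negbTE (bR i)).
    by move: gt0 => /=; lia.
  - by rewrite degB degD d' dR degU; lia.
  exists S; have [d E] := aj_sum S; rewrite E yR /abel_jacobi -(clB J_jac) ?deg_diff//.
  have p0 : cl D' = 0 by apply/(cl_principal J_jac) => //; exists (fun z => f z - c).
  rewrite -[LHS]addr0 -p0 -(clD J_jac)//; last by rewrite degB dER deg_diff subrr.
  congr cl; rewrite -SE; apply/eqP/freeg_eqP => z.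
  rewrite mulrSr !(coeffB, coeffD); move: (coeff z D') (coeff z ER) (coeff z <<b>>) (coeff z <<P0>>).
  by move: (coeff z (<<P0>> *+ r)) => *; lia.
have cZ : gclosed (S := gv C) [set b | Wset r (y - aj b)]%classic.
  have ry : greg (S := gv C) (T := gv J) (fun b => y - aj b).
    exact: (gregB (@greg_const _ (gv C) (gv J) y) (aj_greg J_jac P0)).
  exact: (greg_closed ry (Wset_closed J_jac (P0 := P0) (r := r))).
move=> b0; apply: (closed_cofinite (s := dom (EM - ER) ++ a :: [seq R i | i <- enum 'I_r]) cZ) => b.
rewrite mem_cat inE !negb_or => /and3P[bE ba bR]; apply: Z => // i.
by apply: contra bR => /eqP->; apply: map_f; rewrite mem_enum.
Qed.

End LinearSystem.

(** * Transversality *)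

(** A maximal independent family with rows taken in [S] itself, which may be any predicate; the rank
    bound [n] ends the search. *)
Lemma row_select (k : fieldType) n (S : 'rV[k]_n -> Prop) :
  exists t (M : 'M[k]_(t, n)), [/\ forall i, S (row i M), row_free M
    & forall v, S v -> (v <= M)%MS].
Proof.
apply: contrapT => nt.
have big t : exists M : 'M[k]_(t, n), (forall i, S (row i M)) /\ row_free M.
  elim: t => [|t [M [SM fM]]].
    by exists 0; split=> [[]|] //; rewrite /row_free mxrank0.
  have [v [Sv vM]] : exists v, S v /\ ~~ (v <= M)%MS.
    apply: contrapT => h; apply: nt; exists t, M; split=> // v Sv.
    by apply: contrapT => /negP vM; apply: h; exists v.
  rewrite -add1n; exists (col_mx v M); split=> [i|].
    case: (split_ordP i) => l ->.
      by rewrite rowKu; have -> : row l v = v by apply/rowP => c; rewrite !mxE ord1.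
    by rewrite rowKd.
  have ltM : (M < col_mx v M)%MS.
    apply/andP; split; first by rewrite -addsmxE addsmxSr.
    by apply: contra vM => h; apply: submx_trans h; rewrite -addsmxE addsmxSl.
  have := rank_ltmx ltM; rewrite (eqP fM) => lt.
  by rewrite /row_free eqn_leq rank_leq_row.
have [M [_ /eqP rM]] := big n.+1.
by have := rank_leq_col M; rewrite rM ltnn.
Qed.

Lemma det_kernel (k : fieldType) n (M : 'M[k]_n) (w : 'cV[k]_n) :
  M *m w = 0 -> w != 0 -> \det M = 0.
Proof.
move=> Mw w0; apply/eqP/negP => /negP d0; case/negP: w0.
have uM : M \in unitmx by rewrite unitmxE unitfE.
by rewrite -[w](mulKmx uM) Mw mulmx0.
Qed.

(** * Tangent vectors to the cone over the curve *)

Section Tangent.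
Variables (K : fieldType) (Kb : closedFieldType) (iota : {rmorphism K -> Kb}).
Variables (C : variety iota) (C_curve : smooth_curve C).
Local Notation N := (ncoords C).
Local Notation gen := (@gen Kb (gv C)).
Local Notation poly := {mpoly Kb[N]}.
Let irr := gvirr C.
Implicit Types (x z : pts C) (F G : poly) (w : 'cV[Kb]_N) (j : 'I_N).

Definition grad F x : 'rV[Kb]_N := \row_i pev F^`M(i) (coords x).

(** Tangent vectors to the affine cone over [C]. The cone contributes the radial direction, which
    the condition [w j 0 = 0] removes wherever the coordinate [j] is nonzero. *)
Definition tangent x w := forall d F, F \is d.-homog ->
  (forall z, pev F (coords z) = 0) -> grad F x *m w = 0.

Lemma mderiv_homog d F (i : 'I_N) : F \is d.-homog -> F^`M(i) \is (d.-1).-homog.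
Proof.
move=> /dhomogP hF; apply/dhomogP => m; rewrite mcoeff_msupp mcoeff_mderiv => h.
have : (m + U_(i))%MM \in msupp F.
  by rewrite mcoeff_msupp; apply: contraNneq h => ->; rewrite mul0rn.
by move=> /hF /=; rewrite mdegD mdeg1 => <-; rewrite addn1.
Qed.

Lemma gradM F G x : grad (F * G) x =
  pev G (coords x) *: grad F x + pev F (coords x) *: grad G x.
Proof.
apply/rowP => i; rewrite !mxE mderivM /pev mevalD !mevalM; congr (_ + _).
by rewrite mulrC.
Qed.

Lemma gradB F G x : grad (F - G) x = grad F x - grad G x.
Proof. by apply/rowP => i; rewrite !mxE mderivB /pev mevalB. Qed.

Lemma gradX i x : grad 'X_i x = delta_mx 0 i.
Proof.
apply/rowP => l; rewrite !mxE mderivX /pev mevalZ mnm1E /= eq_sym.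
case: eqP => [->|_]; last by rewrite mul0r.
have -> : (U_(i) - U_(i))%MM = 0%MM :> 'X_{1..N} by apply/mnmP => a; rewrite mnmBE mnm0E subnn.
by rewrite mpolyX0 meval1 mulr1.
Qed.

Lemma gradZ c F x : grad (c *: F) x = c *: grad F x.
Proof. by apply/rowP => l; rewrite !mxE mderivZ /pev mevalZ. Qed.

(** The velocity of the affine chart [phi] with respect to the uniformizer [t]. If it were zero,
    [QF] would give the numerator of [t], divided by [t], the value 0 at [x]; but up to the chart
    this quotient is the denominator of [t]. *)
Lemma tangent_ex x j : coords x 0 j != 0 ->
  exists w, [/\ tangent x w, w j 0 = 0 & w != 0].
Proof.
move=> xj; have [nt t0 tdiv] := unifP C_curve x; set t := unif x in nt t0 tdiv.
pose c z := coords x 0 j / coords z 0 j.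
pose phi z : 'rV[Kb]_N := c z *: coords z.
have fj := coords_form (X := C) j.
have gj : gen (fun z => coords z 0 j != 0) := gen_form (S := gv C) fj xj.
have phi0 i : has_value (fun z => phi z 0 i - coords x 0 i) x 0.
  have q : quo (fun z => (coords x 0 j * coords z 0 i - coords x 0 i * coords z 0 j) / coords z 0 j)
     (fun z => coords x 0 j * coords z 0 i - coords x 0 i * coords z 0 j) (fun z => coords z 0 j).
    apply: (quo_form (d := 1%N)) => //; last by exists x.
    exact: (formB (S := gv C) (formZ _ (coords_form i)) (formZ _ fj)).
  have h : has_value (fun z => (coords x 0 j * coords z 0 i - coords x 0 i * coords z 0 j) / coords z 0 j) x 0.
    by apply/has_valueP; eexists; eexists; split; [exact: q|exact: xj|rewrite /= [X in X - _]mulrC subrr mul0r].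
  apply: has_value_gen h _; apply: gen_imp gj _ => z zj.
  by rewrite !mxE /c mulrBl mulfK// mulrAC.
have [w0 hw] := choice (fun i => tdiv _ (phi0 i)).
pose w : 'cV[Kb]_N := \col_i w0 i.
pose Q F := has_value (fun z => (pev F (phi z) - pev F (coords x)) / t z) x ((grad F x *m w) 0 0).
have gt : gen (fun z => t z != 0) := unif_gen C_curve x.
have QV F : Q F -> has_value (fun z => pev F (phi z)) x (pev F (coords x)).
  move=> QF; have := has_valueD (has_valueM t0 QF) (has_value_const (pev F (coords x)) x).
  rewrite mul0r add0r => h; apply: has_value_gen h _; apply: gen_imp gt _ => z tz.
  by rewrite mulrC divfK// subrK.
have QC a : Q a%:MP.
  have := has_value_const 0 x => h; rewrite /Q.
  have -> : grad a%:MP x = 0 by apply/rowP => i; rewrite !mxE mderivC /pev meval0.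
  rewrite mul0mx mxE; apply: has_value_gen h _; apply: gen_true => z.
  by rewrite /pev !mevalC subrr mul0r.
have QX i : Q 'X_i.
  rewrite /Q gradX -rowE mxE mxE; apply: has_value_gen (hw i) _; apply: gen_true => z.
  by rewrite /pev !mevalXU.
have QD F G : Q F -> Q G -> Q (F + G).
  move=> QF QG; have := has_valueD QF QG.
  have -> : (grad F x *m w) 0 0 + (grad G x *m w) 0 0 = (grad (F + G) x *m w) 0 0.
    have -> : grad (F + G) x = grad F x + grad G x.
      by apply/rowP => i; rewrite !mxE mderivD /pev mevalD.
    by rewrite mulmxDl [RHS]mxE.
  move=> h; apply: has_value_gen h _; apply: gen_true => z.
  by rewrite -mulrDl /pev !mevalD; congr (_ / _); rewrite opprD addrACA.
have QM F G : Q F -> Q G -> Q (F * G).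
  move=> QF QG; have := has_valueD (has_valueM (QV F QF) QG)
    (has_valueM (has_value_const (pev G (coords x)) x) QF).
  have -> : pev F (coords x) * (grad G x *m w) 0 0 + pev G (coords x) * (grad F x *m w) 0 0
      = (grad (F * G) x *m w) 0 0.
    by rewrite gradM mulmxDl -!scalemxAl [RHS]mxE [X in _ = X + _]mxE [X in _ = _ + X]mxE addrC.
  move=> h; apply: has_value_gen h _; apply: gen_true => z.
  by rewrite !mulrA -mulrDl /pev !mevalM; congr (_ / _); ring.
have QF F : Q F.
  elim/mpolyind: F => [|a m p _ _ Qp]; first exact: (QC 0).
  apply/QD => //; rewrite -mul_mpolyC; apply/QM => //.
  rewrite mpolyXE_id; elim: (index_enum _) => [|i r IH]; first by rewrite big_nil; apply: (QC 1).
  rewrite big_cons; apply/QM => //.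
  by elim: (m i) => [|l IHl]; [exact: (QC 1)|rewrite exprS; apply/QM].
exists w; split.
- move=> d F hF F0; apply/matrixP => a b; rewrite !ord1 [RHS]mxE.
  apply: (has_value_uniq (QF F)); apply: has_value_gen (has_value_const 0 x) _.
  by apply: gen_true => z; rewrite (pevZ _ _ hF) !F0 mulr0 subrr mul0r.
- rewrite mxE; apply: (has_value_uniq (hw j)); apply: has_value_gen (has_value_const 0 x) _.
  by apply: gen_imp gj _ => z zj; rewrite !mxE /c divfK// subrr mul0r.
apply/negP => /eqP wz.
have /has_valueP[a [b [q bx /esym/eqP]]] := t0.
rewrite mulf_eq0 invr_eq0 (negbTE bx) orbF => /eqP ax.
have [d [[F hF EF] [G hG EG] E]] := q.
have h0 := QF F; have := QV G (QF G); rewrite /Q wz mulmx0 mxE in h0.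
rewrite -EG => h1; move/negP: bx; apply; rewrite (has_value_uniq h1 (w := 0))//.
apply: has_value_gen h0 _; apply: gen_imp (gen_and irr E (gen_and irr gj gt)) _ => z [[bz tE] [zj tz]].
have cz : c z != 0 by rewrite /c mulf_neq0 ?invr_eq0// invr_neq0.
have az : a z != 0 by apply: contraNneq tz => az; rewrite tE az mul0r.
by rewrite (pevZ _ _ hF) (pevZ _ _ hG) -!EF -EG ax subr0 tE invf_div mulrACA divff// mulr1.
Qed.

Lemma uform_ex x : exists m A, [/\ vform m A, A x = 0 &
  forall d P, vform d P -> P x = 0 -> exists n n' E E', [/\ vform n E, vform n' E', E x != 0,
    (d + n = m + n')%N & forall z, P z * E z = A z * E' z]].
Proof.
have [nt t0 tdiv] := unifP C_curve x.
have /has_valueP[a [b [q bx /esym/eqP]]] := t0.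
rewrite mulf_eq0 invr_eq0 (negbTE bx) orbF => /eqP ax.
have [m [fa fb E]] := q; exists m, a; split=> // d P fP Px.
have [l fl lx] := vform_nv (X := C) d x.
have qP := quo_form fP fl (ex_intro _ x lx).
have [|v /has_valueP[e [e' [r e'x _]]]] := tdiv (fun z => P z / l z).
  by apply/has_valueP; exists P, l; rewrite Px mul0r.
have [n [fe fe' E']] := r.
exists (m + n)%N, (d + n)%N, (fun z => b z * e' z), (fun z => l z * e z).
split; [exact: vformM fb fe'|exact: vformM fl fe|by rewrite mulf_neq0|by rewrite addnCA|].
apply: (form_eq irr (vformM fP (vformM fb fe')) (form_cast (S := gv C) (vformM fa (vformM fl fe)) (addrCA _ _ _))).
have gl := gen_form (S := gv C) fl lx.
have gt : gen (fun z => unif x z != 0) := unif_gen C_curve x.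
apply: gen_imp (gen_and irr (gen_and irr E E') (gen_and irr gl gt)) _ => z [[[bz tE] [e'z E1]] [lz tz]].
rewrite tE in E1; rewrite tE mulf_eq0 invr_eq0 negb_or in tz; case/andP: tz => az _.
have -> : e z = P z / l z / (a z / b z) * e' z by rewrite E1 divfK.
by field; rewrite az bz lz.
Qed.

(** Up to a factor nonzero at [x], every form vanishing at [x] is a multiple of [F], in particular
    the two-by-two minors [G] of the coordinates. A tangent vector killed by the differential of [F]
    is killed by theirs, hence radial. *)
Lemma tangent_line x j m F w : coords x 0 j != 0 -> F \is m.-homog -> pev F (coords x) = 0 ->
  (forall d P, vform d P -> P x = 0 -> exists n n' E E', [/\ vform n E, vform n' E', E x != 0,
    (d + n = m + n')%N & forall z, P z * E z = pev F (coords z) * E' z]) ->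
  tangent x w -> w j 0 = 0 -> grad F x *m w = 0 -> w = 0.
Proof.
move=> xj hF Fx hdiv tw wj Fw; apply/colP => i.
pose G : poly := coords x 0 j *: 'X_i - coords x 0 i *: 'X_j.
have hG : G \is 1.-homog by apply: rpredB; apply: rpredZ; apply: dhomogXU.
have EG z : pev G (coords z) = coords x 0 j * coords z 0 i - coords x 0 i * coords z 0 j.
  by rewrite /pev mevalB !mevalZ !mevalXU.
have Gx : pev G (coords x) = 0 by rewrite EG mulrC subrr.
have fG : vform 1 (fun z : pts C => pev G (coords z)) by exists G.
have [n [n' [E [E' [[H hH EH] [H' hH' EH'] Ex dE R]]]]] := hdiv 1%N _ fG Gx.
have hR : G * H - F * H' \is (1 + n)%N.-homog by apply: rpredB; [apply: dhomogM|rewrite dE; apply: dhomogM].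
have R0 z : pev (G * H - F * H') (coords z) = 0.
  by rewrite /pev mevalB !mevalM -!/(pev _ _) -EH -EH' R subrr.
have := tw _ _ hR R0; rewrite gradB !gradM Gx Fx !scale0r !addr0 mulmxBl -!scalemxAl Fw scaler0 subr0.
move/eqP; rewrite scaler_eq0 -EH (negbTE Ex) /= gradB !gradZ !gradX mulmxBl -!scalemxAl -!rowE.
move=> /eqP/matrixP/(_ 0 0); rewrite !mxE wj mulr0 subr0 => /eqP.
by rewrite mulf_eq0 (negbTE xj) /= => /eqP.
Qed.

(** At [x0] the tangent vectors with [w j 0 = 0] form a line, cut out by [t = N - 1] independent
    conditions that vary as forms. Cramer's rule, that is the cofactors along the row left free,
    solves them by forms not all vanishing at [x0]. *)
Lemma tangent_field x0 j : coords x0 0 j != 0 ->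
  exists e (v : 'I_N -> pts C -> Kb), [/\ forall i, vform e (v i),
    forall x, tangent x (\col_i v i x), forall x, v j x = 0 & exists i, v i x0 != 0].
Proof.
move=> x0j; pose good (R : pts C -> 'rV[Kb]_N) := forall x w, coords x 0 j != 0 ->
   tangent x w -> w j 0 = 0 -> R x *m w = 0.
pose S (r : 'rV[Kb]_N) := exists R d, [/\ R x0 = r, forall l, vform d (fun x => R x 0 l) & good R].
have [t [M [SM fM hM]]] := row_select S.
have [w [tw wj w0]] := tangent_ex x0j.
have SX d F : F \is d.-homog -> (forall z, pev F (coords z) = 0) -> S (grad F x0).
  move=> hF F0; exists (grad F), d.-1; split=> // [l|x w' _ tw' _]; last exact: tw' hF F0.
  by exists F^`M(l); [exact: mderiv_homog|move=> z; rewrite !mxE].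
have Sj : S (delta_mx 0 j).
  exists (fun _ => delta_mx 0 j), 0%N; split=> // [l|x w' _ _ wj'].
    exact: (form_ext (formZ ((delta_mx 0 j : 'rV[Kb]_N) 0 l) (vform1 C)) (fun z => mulr1 _)).
  by rewrite -rowE; apply/matrixP => a b; rewrite !ord1 !mxE.
have kill w' : M *m w' = 0 -> forall r, S r -> r *m w' = 0.
  by move=> Mw' r /hM/submxP[D ->]; rewrite -mulmxA Mw' mulmx0.
have ker_ex n (B : 'M[Kb]_(n, N)) : (n < N)%N -> exists2 u : 'cV[Kb]_N, u != 0 & B *m u = 0.
  move=> nN; have : kermx B^T != 0.
    by rewrite -mxrank_eq0 mxrank_ker mxrank_tr -lt0n subn_gt0 (leq_ltn_trans (rank_leq_row B)).
  case/rowV0Pn => u /sub_kermxP uB u0; exists u^T; first by rewrite trmx_eq0.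
  by apply: trmx_inj; rewrite trmx_mul trmxK uB trmx0.
(* The kernel of [M] is exactly a line: [tangent_ex] gives a nonzero vector in it, and with a second
   dimension some nonzero vector would also be killed by the differential of a local generator,
   against [tangent_line]. *)
have tN : (t.+1 = N)%N.
  apply/eqP; rewrite eqn_leq; apply/andP; split.
    rewrite ltn_neqAle -{2}(eqP fM) rank_leq_col andbT; apply/negP => /eqP tN.
    have fullM : row_full M by rewrite /row_full (eqP fM) tN.
    have [B BM] := row_fullP fullM; case/negP: w0.
    rewrite -[w]mul1mx -BM -mulmxA; have -> : M *m w = 0; last by rewrite mulmx0.
    apply/row_matrixP => i; rewrite row_mul row0.
    by have [R [d [<- _ gR]]] := SM i; apply: gR.
  rewrite leqNgt; apply/negP => lt.
  have [m [A [[F hF EF] Ax hdiv]]] := uform_ex x0.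
  have [u u0] := ker_ex _ (col_mx M (grad F x0)) (eq_ind_r (fun n => (n < N)%N) lt (addn1 t)).
  rewrite mul_col_mx => /eqP; rewrite -col_mx0 => /eqP/eq_col_mx[Mu Fu]; case/negP: u0; apply/eqP.
  apply: (@tangent_line x0 j m F u x0j hF) => //; first by rewrite -EF.
  - move=> d P fP Px; have [n [n' [E [E' [fE fE' Ex dE R]]]]] := hdiv d P fP Px.
    by exists n, n', E, E'; split=> // z; rewrite -EF.
  - by move=> d G hG G0; apply: (kill _ Mu); apply: SX hG G0.
  - by have := kill _ Mu _ Sj; rewrite -rowE => /matrixP/(_ 0 0); rewrite !mxE.
have [R RP] := choice SM; have [dg RP'] := choice RP.
pose B x (u : 'rV[Kb]_N) : 'M[Kb]_N :=
  \matrix_(i, l) if (insub (val i) : option 'I_t) is Some i' then R i' x 0 l else u 0 l.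
pose deg' (i : 'I_N) := if (insub (val i) : option 'I_t) is Some i' then dg i' else 0%N.
pose i0 : 'I_N := cast_ord tN ord_max.
have ins0 : (insub (val i0) : option 'I_t) = None by rewrite insubN// -leqNgt.
have insN (i : 'I_N) : i != i0 -> exists i' : 'I_t, (insub (val i) : option 'I_t) = Some i'.
  move=> ii; have it : (val i < t)%N.
    rewrite ltn_neqAle -ltnS tN ltn_ord andbT; apply: contra ii => /eqP it.
    by apply/eqP/val_inj.
  by exists (Ordinal it); rewrite insubT.
pose v l x := \det (B x (delta_mx 0 l)).
have Bv x u : \det (B x u) = \sum_l u 0 l * v l x.
  rewrite (expand_det_row _ i0); apply: eq_bigr => l _; rewrite !mxE ins0; congr (_ * _).
  rewrite /v (expand_det_row _ i0) (bigD1 l)//= big1 ?addr0 => [|l' ll'].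
    rewrite !mxE ins0 !eqxx mul1r; congr (_ * \det _); apply/matrixP => a b; rewrite !mxE.
    by have [i' ->] := insN (fintype.lift i0 a) ltac:(by rewrite eq_sym neq_lift).
  by rewrite !mxE ins0 (negbTE ll') mul0r.
have fv l : vform (\sum_i deg' i)%R (v l).
  apply: (form_det (Y := gv C) (M := fun x => B x (delta_mx 0 l)) x0) => i c /=.
  rewrite /deg'; case E : (insub (val i)) => [i'|].
    have [_ h _] := RP' i'; apply: form_ext (h c) _ => x; by rewrite mxE E.
  apply: (form_ext (formZ ((delta_mx 0 l : 'rV[Kb]_N) 0 c) (vform1 C))) => x.
  by rewrite mulr1 !mxE E.
(* All rows of [B x u] kill one nonzero tangent vector. Expanding the determinant along the free row
   turns this into the linear equation [u] for [v]. *)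
have kB x u : coords x 0 j != 0 -> good (fun _ => u) \/ (exists d F, [/\ F \is d.-homog, forall z, pev F (coords z) = 0 & u = grad F x]) -> \det (B x u) = 0.
  move=> xj hu; have [w' [tw' wj' w'0]] := tangent_ex xj.
  apply: (det_kernel _ w'0); apply/row_matrixP => i; rewrite row_mul row0.
  case E : (insub (val i) : option 'I_t) => [i'|].
    have [_ _ g] := RP' i'; rewrite -(g x w')//; congr (_ *m _).
    by apply/rowP => c; rewrite !mxE E.
  have -> : row i (B x u) = u by apply/rowP => c; rewrite !mxE E.
  case: hu => [g|[d [F [hF F0 ->]]]]; first exact: g xj tw' wj'.
  exact: tw' hF F0.
have xgen : gen (fun x => coords x 0 j != 0) := gen_form (S := gv C) (coords_form j) x0j.
exists (\sum_i deg' i)%N, v; split=> //.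
- move=> x d F hF F0; apply/matrixP => a b; rewrite !ord1 [RHS]mxE.
  have fs : vform (d.-1 + (\sum_i deg' i))%N (fun x => \sum_l grad F x 0 l * v l x).
    apply: (form_sum (S := gv C) (index_enum 'I_N) x0) => l.
    apply: vformM (fv l); exists F^`M(l); first exact: mderiv_homog.
    by move=> z; rewrite !mxE.
  rewrite mxE -[RHS](form_eq0 irr fs _ x); first by apply: eq_bigr => l _; rewrite !mxE.
  apply: gen_imp xgen _ => z zj; rewrite -Bv; apply: (kB z _ zj); right.
  by exists d, F.
- apply: (form_eq0 irr (fv j)); apply: gen_imp xgen _ => z zj; apply: (kB z _ zj); left.
  by move=> x' w' _ _ wj'; rewrite -rowE; apply/matrixP => a b; rewrite !ord1 !mxE.
have [l hl] : exists l, ~~ ((delta_mx 0 l : 'rV[Kb]_N) <= M)%MS.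
  apply: contrapT => /forallNP h; have : ((1%:M : 'M[Kb]_N) <= M)%MS.
    by apply/row_subP => l; rewrite row1; apply: contrapT => /negP; apply: h.
  by move/mxrankS; rewrite mxrank1 (eqP fM) -tN ltnn.
exists l; rewrite -unitfE -unitmxE -row_full_unit /row_full eqn_leq rank_leq_col /=.
suff : (M < B x0 (delta_mx 0 l))%MS by move/rank_ltmx; rewrite (eqP fM) tN.
apply/andP; split.
  apply/row_subP => i; have it : (val i < N)%N by rewrite -tN ltnS; apply/ltnW/ltn_ord.
  have -> : row i M = row (Ordinal it) (B x0 (delta_mx 0 l)).
    apply/rowP => c; rewrite !mxE /=; have [h _ _] := RP' i.
    by rewrite (valK i : insub _ = Some i) h mxE.
  exact: row_sub.
apply: contra hl => h; apply: submx_trans h.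
have E : delta_mx 0 l = row i0 (B x0 (delta_mx 0 l)) by apply/rowP => c; rewrite !mxE ins0.
by rewrite {1}E row_sub.
Qed.

End Tangent.

(** * Derivations of the homogeneous coordinate ring *)

Section Derivation.
Variables (K : fieldType) (Kb : closedFieldType) (iota : {rmorphism K -> Kb}).
Variables (C : variety iota) (C_curve : smooth_curve C).
Local Notation N := (ncoords C).
Local Notation gen := (@gen Kb (gv C)).
Local Notation near := (@near Kb (gv C)).
Let irr := gvirr C.

Definition uform x m (A : pts C -> Kb) := [/\ vform m A, A x = 0 &
  forall d P, vform d P -> P x = 0 -> exists n n' E E', [/\ vform n E, vform n' E', E x != 0,
    (d + n = m + n')%N & forall z, P z * E z = A z * E' z]].

(* A derivation of the homogeneous coordinate ring of C, of degree der_deg,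
   which near x0 does not vanish on uniformizers. *)
Record derivation (x0 : pts C) := Derivation {
  der_deg : nat;
  der :> nat -> (pts C -> Kb) -> pts C -> Kb;
  der_form : forall d a, vform d a -> vform (d + der_deg)%N (der d a);
  der_lin : forall d a b c, vform d a -> vform d b ->
    forall z, der d (fun z => a z + c * b z) z = der d a z + c * der d b z;
  der_mul : forall d d' a b, vform d a -> vform d' b ->
    forall z, der (d + d')%N (fun z => a z * b z) z = der d a z * b z + a z * der d' b z;
  der_unif : near x0 (fun x => exists m A, uform x m A /\ der m A x != 0) }.

Lemma derivation_ex x0 : exists D : derivation x0, True.
Proof.
have /andP[/existsP[j /andP[/eqP x0j _]] _] := coordsP x0.
have {}x0j : coords x0 0 j != 0 by rewrite x0j oner_neq0.
have [e [v0 [fv0 tv0 v0j [i v0i]]]] := tangent_field C_curve x0j.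
(* The extra coordinate compensates the drop of degree under differentiation, so that the derivation
   raises all degrees by [e]. *)
pose v l x := coords x 0 j * v0 l x.
have fv l : vform (1 + e)%N (v l) := vformM (coords_form j) (fv0 l).
have tv x : tangent x (\col_l v l x).
  move=> d F hF F0; have -> : \col_l v l x = coords x 0 j *: \col_l v0 l x by apply/colP => l; rewrite !mxE.
  by rewrite -scalemxAr (tv0 x d F hF F0) scaler0.
have vj x : v j x = 0 by rewrite /v v0j mulr0.
have vi : v i x0 != 0 by rewrite mulf_neq0.
pose hom d (a : pts C -> Kb) := [set F : {mpoly Kb[N]} | F \is d.-homog /\ a =1 fun z => pev F (coords z)]%classic.
have homP d a : vform d a -> hom d a (xget 0 (hom d a)).
  by move=> [F hF E]; apply: (@xgetPex _ 0 (hom d a)); exists F.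
pose ap F x := (grad F x *m (\col_i v i x : 'cV[Kb]_N)) 0 0.
pose der d a x := ap (xget 0 (hom d a)) x.
(* Two polynomials representing [a] differ by one that vanishes on [C], whose differential kills
   tangent vectors: the choice made by [xget] is immaterial. *)
have derE d a F : hom d a F -> forall x, der d a x = ap F x.
  move=> [hF EF] x; have [hG EG] : hom d a (xget 0 (hom d a)) by apply: homP; exists F.
  have h := tv x d (xget 0 (hom d a) - F) (rpredB hG hF).
  have F0 (z : pts C) : pev (xget 0 (hom d a) - F) (coords z) = 0.
    by rewrite /pev mevalB; have := EG z; have := EF z; rewrite /pev /= => <- <-; rewrite subrr.
  have /matrixP/(_ 0 0) := h F0; rewrite gradB mulmxBl [LHS]mxE [X in _ + X = _]mxE [RHS]mxE => /eqP.
  by rewrite subr_eq0 => /eqP.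
have apM F G x : ap (F * G) x = pev G (coords x) * ap F x + pev F (coords x) * ap G x.
  by rewrite /ap gradM mulmxDl -!scalemxAl [LHS]mxE [X in X + _ = _]mxE [X in _ + X = _]mxE.
have D1 d a : vform d a -> vform (d + e)%N (der d a).
  move=> [F hF EF]; apply: (form_ext _ (fun x => esym (derE d a F (conj hF EF) x))).
  have fs : vform (d + e)%N (fun x => \sum_l grad F x 0 l * v l x).
    apply: (form_sum (S := gv C) (index_enum 'I_N) x0) => l.
    have hl : F^`M(l) \is (d.-1).-homog := mderiv_homog l hF.
    have fF : vform d.-1 (fun x => grad F x 0 l) by exists F^`M(l) => // z; rewrite mxE.
    case: d hF fF {hl EF a} => [|d] hF fF; last by apply: (form_cast (vformM fF (fv l))); rewrite /GRing.add /=; lia.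
    apply: (form_ext (form0 (S := gv C) _ x0)) => z; rewrite mxE.
    suff -> : F^`M(l) = 0 by rewrite /pev meval0 mul0r.
    apply/mpolyP => m; rewrite mcoeff_mderiv mcoeff0; have [h|/memN_msupp_eq0->] := boolP ((m + U_(l))%MM \in msupp F).
      by have /dhomogP := hF => /(_ _ h); rewrite /= mdegD mdeg1 addn1.
    by rewrite mul0rn.
  by apply: (form_ext fs) => x; rewrite /ap mxE; apply: eq_bigr => l _; rewrite !mxE.
have D2 d a b c : vform d a -> vform d b ->
    forall z, der d (fun z => a z + c * b z) z = der d a z + c * der d b z.
  move=> [F hF EF] [G hG EG] z; rewrite (derE d a F)// (derE d b G)// (derE _ _ (F + c *: G)).
    rewrite /ap; have -> : grad (F + c *: G) z = grad F z + c *: grad G z.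
      by apply/rowP => l; rewrite !mxE mderivD mderivZ /pev mevalD mevalZ.
    by rewrite mulmxDl -scalemxAl [LHS]mxE [X in _ + X = _]mxE.
  split; first by apply: rpredD => //; apply: rpredZ.
  by move=> y; rewrite EF EG /pev mevalD mevalZ.
have D3 d d' a b : vform d a -> vform d' b ->
    forall z, der (d + d')%N (fun z => a z * b z) z = der d a z * b z + a z * der d' b z.
  move=> [F hF EF] [G hG EG] z; rewrite (derE d a F)// (derE d' b G)// (derE _ _ (F * G)).
    by rewrite apM EF EG mulrC.
  by split=> [|y]; [exact: dhomogM|rewrite EF EG /pev mevalM].
suff D4 : near x0 (fun x => exists m A, uform x m A /\ der m A x != 0).
  by exists (Derivation D1 D2 D3 D4).
apply: near_imp (near_and (near_form (S := gv C) (coords_form j) x0j) (near_form (S := gv C) (fv i) vi)) _.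
move=> x [xj vx]; have [m [A [fA Ax hdiv]]] := uform_ex C_curve x.
exists m, A; split=> //; have [F hF EF] := fA; rewrite (derE m A F)//.
apply/negP => /eqP ap0; have w0 : (\col_i v i x : 'cV[Kb]_N) = 0.
  apply: (@tangent_line _ _ _ _ x j m F _ xj hF) => //; first by rewrite -EF.
  - move=> d P fP Px; have [n [n' [E [E' [fE fE' Ex dE R]]]]] := hdiv d P fP Px.
    by exists n, n', E, E'; split=> // z; rewrite -EF.
  - by rewrite mxE vj.
  - by apply/matrixP => a b; rewrite !ord1 [RHS]mxE.
by move/colP/(_ i): w0; rewrite !mxE; apply/eqP.
Qed.

(** Membership in the square of the maximal ideal at [x]; one product suffices because that ideal is
    principal. *)
Definition double_zero f x := exists g h,
  [/\ has_value g x 0, has_value h x 0 & gen (fun z => f z = g z * h z)].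

Lemma double_zeroM f g x : double_zero f x -> regular_at g x -> double_zero (fun z => f z * g z) x.
Proof.
move=> [a [b [ha hb E]]] [v hv]; exists a, (fun z => b z * g z); split=> //.
  by have := has_valueM hb hv; rewrite mul0r.
by apply: gen_imp E _ => z ->; rewrite mulrA.
Qed.

Lemma double_zero_gen f g x : double_zero f x -> gen (fun z => f z = g z) -> double_zero g x.
Proof.
move=> [a [b [ha hb E]]] E'; exists a, b; split=> //.
by apply: gen_imp (gen_and irr E E') _ => z [-> ->].
Qed.

Lemma simple_zero f x : has_value f x 0 -> ~ double_zero f x -> ord_at f x 1.
Proof.
move=> f0 nd; have [v hv] := unif_div C_curve f0.
exists v; last by apply: has_value_gen hv _; apply: gen_true => z; rewrite expr1z.
apply/eqP => v0; apply: nd; rewrite v0 in hv; exists (unif x), (fun z => f z / unif x z).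
split=> //; first exact: unif0.
by apply: gen_imp (unif_gen C_curve x) _ => z t0; rewrite mulrC divfK.
Qed.

(** When [P] vanishes at [x], write [P * E = A * E'] with [A] a local generator, so that [D A] is
    nonzero at [x]. The zero of [P] is double when [E'] vanishes at [x], and by the product rule
    this is the vanishing of [D P]. *)
Lemma double_zeroP x0 (D : derivation x0) : near x0 (fun x => forall d P Q, vform d P -> vform d Q -> Q x != 0 ->
  double_zero (fun z => P z / Q z) x <-> P x = 0 /\ D d P x = 0).
Proof.
apply: near_imp (der_unif D) _ => x [m [A [[fA Ax hdiv] DA]]] d P Q fP fQ Qx; split.
  move=> [g [h [/has_valueP[a [b [[d1 [fa fb E1]] bx /esym/eqP]]]]]].
  rewrite mulf_eq0 invr_eq0 (negbTE bx) orbF => /eqP ax.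
  move=> /has_valueP[a' [b' [[d2 [fa' fb' E2]] b'x /esym/eqP]]].
  rewrite mulf_eq0 invr_eq0 (negbTE b'x) orbF => /eqP a'x E.
  have R : forall z, P z * (b z * b' z) = Q z * (a z * a' z).
    apply: (form_eq irr (vformM fP (vformM fb fb')) (vformM fQ (vformM fa fa'))).
    have gQ := gen_form (S := gv C) fQ Qx.
    apply: gen_imp (gen_and irr (gen_and irr E1 E2) (gen_and irr E gQ)) _.
    move=> z [[[bz ->] [b'z ->]] [PQ Qz]].
    have -> : P z = P z / Q z * Q z by rewrite divfK.
    by rewrite PQ; field; rewrite bz b'z.
  have Px : P x = 0.
    have := R x; rewrite ax mul0r mulr0 => /eqP; rewrite mulf_eq0 (negbTE (mulf_neq0 bx b'x)) orbF.
    by move/eqP.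
  split=> //; have := der_mul D fP (vformM fb fb') x; have := der_mul D fQ (vformM fa fa') x.
  rewrite (_ : (fun z => Q z * _) = fun z => P z * (b z * b' z)); last by apply/funext => z; rewrite R.
  rewrite (der_mul D fa fa') => ->; rewrite ax a'x Px !(mul0r, mulr0, addr0) => /esym/eqP.
  by rewrite mulf_eq0 (negbTE (mulf_neq0 bx b'x)) orbF => /eqP.
move=> [Px DP]; have [n [n' [E [E' [fE fE' Ex dE R]]]]] := hdiv d P fP Px.
have E'x : E' x = 0.
  have := der_mul D fP fE x; have := der_mul D fA fE' x; rewrite dE.
  rewrite (_ : (fun z => A z * _) = fun z => P z * E z); last by apply/funext => z; rewrite R.
  move=> ->; rewrite DP Px Ax !(mul0r, mulr0, addr0) => /eqP.
  by rewrite mulf_eq0 (negbTE DA) => /eqP.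
have [l fl lx] := vform_nv (X := C) m x.
exists (fun z => A z / l z), (fun z => (l z * E' z) / (Q z * E z)).
have q1 := quo_form fA fl (ex_intro _ x lx).
have QEx : Q x * E x != 0 by rewrite mulf_neq0.
have q2 : quo (fun z => (l z * E' z) / (Q z * E z)) (fun z => l z * E' z) (fun z => Q z * E z).
  apply: (quo_form (form_cast (S := gv C) (vformM fl fE') (esym dE)) (vformM fQ fE)).
  by exists x.
split.
- by apply/has_valueP; eexists; eexists; split; [exact: q1|exact: lx|rewrite Ax mul0r].
- by apply/has_valueP; eexists; eexists; split; [exact: q2|exact: QEx|rewrite /= E'x mulr0 mul0r].
have gl := gen_form (S := gv C) fl lx; have gQ := gen_form (S := gv C) (vformM fQ fE) QEx.
apply: gen_imp (gen_and irr gl gQ) _ => z [lz]; rewrite mulf_eq0 negb_or => /andP[Qz Ez].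
have -> : P z = A z * E' z / E z by rewrite -R mulfK.
by field; rewrite lz Qz Ez.
Qed.

Lemma der0 x0 (D : derivation x0) d z : D d (fun _ => 0) z = 0.
Proof.
have f0 := form0 (S := gv C) d z; have := der_lin D (-1) f0 f0 z.
rewrite (_ : (fun z => 0 + -1 * 0) = fun _ => 0); first by rewrite mulN1r subrr.
by apply/funext => y; rewrite mulr0 addr0.
Qed.

Lemma derX x0 (D : derivation x0) d a m z : vform d a ->
  D (d *+ m.+1)%R (fun z => a z ^+ m.+1) z = m.+1%:R * a z ^+ m * D d a z.
Proof.
move=> fa; elim: m => [|m IH].
  by rewrite mulr1n expr0 !mul1r; congr (D d _ z); apply/funext => y; rewrite expr1.
rewrite mulrS (_ : (fun z => _) = fun z => a z * a z ^+ m.+1); last first.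
  by apply/funext => y; rewrite exprS.
rewrite (der_mul D fa (formX m.+1 fa)) IH exprS [in RHS]mulrS; ring.
Qed.

(* In characteristic 0, ord (D P) = ord P - 1 at a zero of P. *)
Lemma der_ord (char0 : forall m, m.+1%:R != 0 :> Kb) x0 (D : derivation x0) d P A B n :
  vform d P -> (exists z, P z != 0) -> P x0 = 0 ->
  vform (der_deg D + n)%N A -> vform n B -> B x0 != 0 ->
  (forall z, D d P z * B z = P z * A z) -> False.
Proof.
move=> fP [z0 Pz0] Px fA fB Bx R.
have [m [U [[fU Ux hdiv] DU]]] := near_self (der_unif D).
have [Uz|Uz] := pselect (exists z, U z != 0); last first.
  have U0 : U = fun _ => 0 by apply/funext => z; apply/eqP/negP => /negP h; apply: Uz; exists z.
  by rewrite U0 der0 eqxx in DU.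
have [l fl lx] := vform_nv (X := C) d x0; have [l' fl' l'x] := vform_nv (X := C) m x0.
have qP := quo_form fP fl (ex_intro _ x0 lx); have qU := quo_form fU fl' (ex_intro _ x0 l'x).
have oU : ord_at (fun z => U z / l' z) x0 1.
  apply: simple_zero.
    by apply/has_valueP; eexists; eexists; split; [exact: qU|exact: l'x|rewrite Ux mul0r].
  by move/(near_self (double_zeroP D) _ _ _ fU fl' l'x) => [_ DU0]; rewrite DU0 eqxx in DU.
have [k Ok] := ord_ex C_curve x0 (proj2 (nzP _) (ex_intro _ _ (ex_intro _ _ (conj qP (ex_intro _ z0 Pz0))))).
have k0 : 0 < k.
  apply: (ord_value0 C_curve Ok).
  by apply/has_valueP; eexists; eexists; split; [exact: qP|exact: lx|rewrite Px mul0r].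
have [k' kE] : exists k' : nat, k = k'.+1 by case: (k) k0 => [[|k']|] // _; exists k'.
have : unit_at (fun z => (P z / l z) / (U z / l' z) ^+ k'.+1) x0.
  apply/(ord_unit C_curve); have := ordD C_curve Ok (ordX C_curve k'.+1 oU).
  by rewrite kE -natz subrr.
move=> /unitP[al [be [[p [fal fbe E]] alx bex]]].
have gl := gen_form (S := gv C) fl lx; have gl' := gen_form (S := gv C) fl' l'x.
have [z1 Uz1] := Uz; have gU := gen_form (S := gv C) fU Uz1.
pose E1 z := l' z ^+ k'.+1 * be z; pose E2 z := l z * al z.
have fE1 : vform (m *+ k'.+1 + p)%R E1 := vformM (formX k'.+1 fl') fbe.
have fE2 : vform (d + p)%R E2 := vformM fl fal.
have E1x : E1 x0 != 0 by rewrite mulf_neq0 ?expf_neq0.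
have E2x : E2 x0 != 0 by rewrite mulf_neq0.
have dd : (d + (m *+ k'.+1 + p) = m *+ k'.+1 + (d + p) :> nat)%R by rewrite addrCA.
have fUk : vform (m *+ k'.+1)%R (fun z => U z ^+ k'.+1) := formX k'.+1 fU.
have PE z : P z * E1 z = U z ^+ k'.+1 * E2 z.
  move: z; apply: (form_eq irr (vformM fP fE1) (form_cast (S := gv C) (vformM fUk fE2) (esym dd))).
  apply: gen_imp (gen_and irr E (gen_and irr gU (gen_and irr gl gl'))) _ => z [[bz Ez] [Uz' [lz l'z]]].
  rewrite /E1 /E2; have -> : al z = P z / l z / (U z / l' z) ^+ k'.+1 * be z by rewrite Ez divfK.
  rewrite expr_div_n; have := expf_neq0 k'.+1 Uz'; have := expf_neq0 k'.+1 l'z.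
  by move: (U z ^+ k'.+1) (l' z ^+ k'.+1) => u w w0 u0; field; rewrite lz w0 u0.
(* Put [k = k'.+1]. Differentiating [P * E1 = U ^+ k * E2] and replacing [D P * B] by [P * A] gives
   [U ^+ k' * W = 0], hence [W = 0]. At [x0], where [U] vanishes, only the term with the factor
   [k * D U] survives. *)
pose W z := A z * E1 z * U z * E2 z + U z * E2 z * D (m *+ k'.+1 + p)%R E1 z * B z
  - (k'.+1%:R * D m U z * E2 z + U z * D (d + p)%R E2 z) * E1 z * B z.
have W0 z : U z ^+ k' * W z = 0.
  have := der_mul D fUk fE2 z; have := der_mul D fP fE1 z.
  have -> : (d + (m *+ k'.+1 + p)%R = (m *+ k'.+1)%R + (d + p)%R)%N := dd.
  rewrite (_ : (fun z => P z * E1 z) = fun z => U z ^+ k'.+1 * E2 z); last by apply/funext => y; rewrite PE.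
  move=> ->; rewrite derX// => H.
  have {}H := congr1 (fun x => x * E1 z * B z) H; rewrite /= in H.
  transitivity (D d P z * B z * E1 z * E1 z - P z * A z * E1 z * E1 z + 0 :> Kb).
    rewrite R /W; have PEz := PE z; rewrite exprS in PEz H.
    have -> : U z ^+ k' * (A z * E1 z * U z * E2 z + U z * E2 z * D (m *+ k'.+1 + p)%R E1 z * B z
      - (k'.+1%:R * D m U z * E2 z + U z * D (d + p)%R E2 z) * E1 z * B z)
      = (U z * U z ^+ k' * E2 z) * (A z * E1 z + D (m *+ k'.+1 + p)%R E1 z * B z)
      - (k'.+1%:R * U z ^+ k' * D m U z * E2 z + U z * U z ^+ k' * D (d + p)%R E2 z) * E1 z * B z by ring.
    rewrite -H -PEz; have -> : (D d P z * E1 z + P z * D (m *+ k'.+1 + p)%R E1 z) * E1 z * B z =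
      (D d P z * B z) * E1 z * E1 z + P z * E1 z * D (m *+ k'.+1 + p)%R E1 z * B z by ring.
    by rewrite R; ring.
  by rewrite R subrr addr0.
have fW : vform (der_deg D + n + (m *+ k'.+1 + p) + m + (d + p))%N W.
  apply: (formB (S := gv C)); first apply: (formD (g := gv C)).
  - exact: (vformM (vformM (vformM fA fE1) fU) fE2).
  - apply: (form_cast (vformM (vformM (vformM fU fE2) (der_form D fE1)) fB)).
    by move: (m *+ k'.+1)%R => t; rewrite /GRing.add /=; clear; lia.
  have f1 : vform (m + der_deg D + (d + p))%N (fun z => k'.+1%:R * D m U z * E2 z + U z * D (d + p)%R E2 z).
    apply: (formD (g := gv C)).
      exact: (vformM (formZ (g := gv C) _ (der_form D fU)) fE2).
    by apply: (form_cast (vformM fU (der_form D fE2))); move: (m *+ k'.+1)%R => t; rewrite /GRing.add /=; clear; lia.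
  by apply: (form_cast (vformM (vformM f1 fE1) fB)); move: (m *+ k'.+1)%R => t; rewrite /GRing.add /=; clear; lia.
have Wx : W x0 = 0.
  apply: (form_eq0 irr fW); apply: gen_imp gU _ => z Uz'.
  by have /eqP := W0 z; rewrite mulf_eq0 expf_eq0 (negbTE Uz') andbF => /eqP.
have /eqP : k'.+1%:R * D m U x0 * E2 x0 * E1 x0 * B x0 = 0.
  by apply/eqP; rewrite -oppr_eq0 -[X in _ == X]Wx /W Ux; apply/eqP; ring.
apply/negP; exact: mulf_neq0 (mulf_neq0 (mulf_neq0 (mulf_neq0 (char0 k') DU) E2x) E1x) Bx.
Qed.

End Derivation.

(** The image of [u] may be small, so a generic equality on [Y] says nothing along it; the value is
    computed from a fraction whose denominator is nonzero at [u x]. *)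
Lemma restr_value (K : fieldType) (Kb : closedFieldType) (iota : {rmorphism K -> Kb})
  (X Y : variety iota) (u : pts X -> pts Y) d a b x : greg (S := gv X) (T := gv Y) u ->
  vform d a -> vform d b -> b (u x) != 0 ->
  has_value (fun z => a (u z) / b (u z)) x (a (u x) / b (u x)).
Proof.
move=> ru fa fb bx; have [c [i [cx hc]]] := ru x d.
have cbx : c x * b (u x) != 0 by rewrite mulf_neq0.
apply/has_valueP; exists (fun z => c z * a (u z)), (fun z => c z * b (u z)); split=> //.
  exists i; split; [exact: hc|exact: hc|].
  apply: gen_imp (gen_form (S := gv X) (hc _ fb) cbx) _ => z h; split=> //.
  by move: h; rewrite mulf_eq0 negb_or => /andP[cz _]; rewrite -mulf_div divff// mul1r.
by rewrite -mulf_div divff// mul1r.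
Qed.

(** The vectors of values span a space of finite dimension, so finitely many points [Q p] suffice;
    the coefficients come from a pseudo-inverse of the matrix of values there. *)
Lemma interpolation (k : fieldType) (S : Type) n (m : 'I_n -> S -> k) :
  exists t (Q : 'I_t -> S) (c : 'I_t -> 'I_n -> k),
  forall l z, m l z = \sum_p m l (Q p) * (\sum_i m i z * c p i).
Proof.
pose row z : 'rV[k]_n := \row_l m l z.
have [t [M [SM _ hM]]] := row_select (fun v => exists z, v = row z).
have [Q QE] := choice SM; exists t, Q, (fun p i => pinvmx M i p) => l z.
have /mulmxKpV E := hM _ (ex_intro _ z erefl).
transitivity ((row z *m pinvmx M *m M) 0 l); first by rewrite E mxE.
rewrite mxE; apply: eq_bigr => p _; rewrite mulrC; congr (_ * _).
  by have /rowP/(_ l) := QE p; rewrite !mxE.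
by rewrite mxE; apply: eq_bigr => i _; rewrite mxE.
Qed.

(** * Local equations of theta along translates of the curve *)

Section LocalEquations.
Variables (K : fieldType) (Kb : closedFieldType) (iota : {rmorphism K -> Kb}).
Variables (C : variety iota) (C_curve : smooth_curve C).
Variables (J : abvar iota) (cl : cdiv C -> pts J) (J_jac : is_jacobian cl) (P0 : pts C).
Local Notation aj := (abel_jacobi cl P0).
Local Notation Theta := (theta cl P0).
Variables (T : divisor J) (TZ : is_divisor_of_set T Theta).
Let irrJ := gvirr J.
Let irrC := gvirr C.
Local Notation JC := (gprod (gv J) (gv C)).

Definition theta_eqn x F G := exists d, [/\ vform d F, vform d G, G x != 0 &
  unit_at (fun z => T x z / (F z / G z)) x].

Lemma theta_eqn_nz x F G : theta_eqn x F G -> exists z, F z != 0.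
Proof.
move=> [d [fF fG Gx ux]]; apply: contrapT => /forallNP h.
have [v v0 hv] := ux; case/negP: v0; apply/eqP; apply: (has_value_uniq hv).
apply: has_value_gen (has_value_const 0 x) _; apply: gen_true => z.
have -> : F z = 0 by apply/eqP/negP => /negP /h.
by rewrite mul0r invr0 mulr0.
Qed.

Lemma theta_eqn_gen x F G : theta_eqn x F G -> gen (S := gv J) (fun z => [/\ F z != 0, G z != 0 & T x z != 0]).
Proof.
move=> L; have [z Fz] := theta_eqn_nz L; have [d [fF fG Gx _]] := L.
have [cT _] := TZ; have [nT _] := cT x.
apply: gen_imp (gen_and irrJ (nz_gen nT) (gen_and irrJ (gen_form (S := gv J) fF Fz) (gen_form (S := gv J) fG Gx))) _.
by move=> y [? []].
Qed.

Lemma theta_eqn_near x F G : theta_eqn x F G -> near (S := gv J) x (fun y => theta_eqn y F G).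
Proof.
move=> L; have [d [fF fG Gx ux]] := L; have [cT _] := TZ; have [_ /nearP uT] := cT x.
apply: near_imp (near_and (near_form (S := gv J) fG Gx) (near_and uT (unit_near ux))) _.
move=> y [Gy [u1 u2]]; exists d; split=> //; apply: unit_gen (unitM u1 u2) _.
apply: gen_imp (theta_eqn_gen L) _ => z [Fz Gz Tz].
by rewrite mulrA divfK.
Qed.

Lemma theta_eqn_uniq x F G F' G' : theta_eqn x F G -> theta_eqn x F' G' -> exists n b b',
  [/\ vform n b, vform n b', b x != 0, b' x != 0 &
      forall z, F z * G' z * b z = F' z * G z * b' z].
Proof.
move=> L L'; have [d [fF fG Gx u]] := L; have [d' [fF' fG' Gx' u']] := L'.
have /unitP[b' [b [[n [fb' fb E]] bx' bx]]] := unitD u' u.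
exists n, b, b'; split=> //.
apply: (form_eq irrJ (vformM (vformM fF fG') fb) (form_cast (S := gv J) (vformM (vformM fF' fG) fb') _)).
  by rewrite /GRing.add /=; lia.
apply: gen_imp (gen_and irrJ E (gen_and irrJ (theta_eqn_gen L) (theta_eqn_gen L'))) _.
move=> z [[bz Ez] [[Fz Gz Tz] [Fz' Gz' Tz']]].
have -> : b' z = b' z / b z * b z by rewrite divfK.
by rewrite -Ez; field; rewrite Fz Gz Fz' Gz' Tz.
Qed.

Hypothesis cZ : gclosed (S := gv J) Theta.

Lemma theta_eqn_ex x : exists F G, [/\ theta_eqn x F G,
  exists z, F z != 0, (F x = 0 <-> Theta x) &
  exists d, [/\ vform d F, vform d G, near (S := gv J) x (fun z => F z = 0 <-> Theta z) &
  forall e P, vform e P -> near (S := gv J) x (fun z => Theta z -> P z = 0) ->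
    exists m n A B, [/\ vform m A, vform n B, B x != 0, (e + n = d + m)%N &
                          forall z, P z * B z = F z * A z]]].
Proof.
have [d [F [G [fF fG q Gx [Fz nF hF]]]]] := local_equation TZ cZ x.
exists F, G; split=> //; first last.
- by exists d.
- exact: near_self nF.
exists d; split=> //; apply: unit_gen (unit_const x (oner_neq0 Kb)) _.
have [_ [_ _ E]] := q; have [z Fz'] := Fz.
apply: gen_imp (gen_and irrJ E (gen_form (S := gv J) fF Fz')) _ => y [[Gy ->] Fy].
by rewrite divff// mulf_neq0 ?invr_eq0// invr_neq0.
Qed.

Lemma theta_eqn_zero x F G : theta_eqn x F G -> (F x = 0 <-> Theta x).
Proof.
move=> L; have [F' [G' [L' _ <- _]]] := theta_eqn_ex x.
have [n [b [b' [_ _ bx bx' R]]]] := theta_eqn_uniq L L'.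
have [_ [_ _ Gx _]] := L; have [_ [_ _ Gx' _]] := L'; have /eqP := R x.
move=> E; split=> Fx; move: E; rewrite Fx !mul0r ?[0 == _]eq_sym !mulf_eq0.
  by rewrite (negbTE Gx) (negbTE bx') !orbF => /eqP.
by rewrite (negbTE Gx') (negbTE bx) !orbF => /eqP.
Qed.

Lemma theta_proper : exists z, ~ Theta z.
Proof.
have [x _] := irrJ.1; have [F [G [_ [z Fz] _ [d [fF _ nF _]]]]] := theta_eqn_ex x.
have [y [h Fy]] := gen_near irrJ nF (gen_form (S := gv J) fF Fz).
by exists y => /h /eqP; rewrite (negbTE Fy).
Qed.

(** The curve [y - C] meets Theta at [y - aj a] with multiplicity at least two; a curve inside Theta
    counts as tangent. By [tangency_all] the choice of local equation is immaterial. *)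
Definition tangency y a := exists F G, theta_eqn (y - aj a) F G /\
  double_zero (fun Q => F (y - aj Q) / G (y - aj Q)) a.

Lemma sub_greg y : greg (S := gv C) (T := gv J) (fun Q => y - aj Q).
Proof. exact: (gregB (@greg_const _ (gv C) (gv J) y) (aj_greg J_jac P0)). Qed.

Lemma tangency_all y a F G : tangency y a -> theta_eqn (y - aj a) F G ->
  double_zero (fun Q => F (y - aj Q) / G (y - aj Q)) a.
Proof.
move=> [F' [G' [L' D]]] L; have [n [b [b' [fb fb' bx bx' R]]]] := theta_eqn_uniq L L'.
have [d [_ fG Gx _]] := L; have [d' [_ fG' Gx' _]] := L'.
have hv := restr_value (sub_greg y) fb' fb bx.
apply: double_zero_gen (double_zeroM D (ex_intro _ _ hv)) _.
have nG := near_and (near_form (S := gv J) fG Gx) (near_and (near_form (S := gv J) fG' Gx') (near_form (S := gv J) fb bx)).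
exists a; apply: near_imp (greg_near (u := fun Q => y - aj Q) (sub_greg y) nG) _.
move=> Q [Gz [Gz' bz]]; apply/eqP; rewrite mulf_div eqr_div ?mulf_neq0//.
apply/eqP; have := R (y - aj Q); move: Gz Gz' bz; move: (y - aj Q) => z _ _ _ E.
by rewrite -(mulrA (F z)) in E; rewrite E; ring.
Qed.

Lemma tangency_theta y a : tangency y a -> Theta (y - aj a).
Proof.
move=> [F [G [L [g [h [hg hh E]]]]]]; apply/(theta_eqn_zero L); have [d [fF fG Gx _]] := L.
have hv := restr_value (sub_greg y) fF fG Gx.
have := has_value_uniq (has_value_gen hv E) (has_valueM hg hh).
by rewrite mul0r => /eqP; rewrite mulf_eq0 invr_eq0 (negbTE Gx) orbF => /eqP.
Qed.

Lemma der_sum x0 (D : derivation x0) d n (c : 'I_n -> Kb) (a : 'I_n -> pts C -> Kb) z :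
  (forall l, vform d (a l)) ->
  D d (fun z => \sum_l c l * a l z) z = \sum_l c l * D d (a l) z.
Proof.
elim: n c a => [|n IH] c a fa.
  by rewrite [RHS]big_ord0 -[RHS](der0 D d z); congr (D d _ z); apply/funext => y; rewrite big_ord0.
rewrite big_ord_recl /= -IH// addrC -(der_lin D)//.
  by congr (D d _ z); apply/funext => y; rewrite big_ord_recl addrC.
by apply: (form_sum (S := gv C) (index_enum _) z) => l; apply: (formZ (g := gv C)); apply: fa.
Qed.

Definition slice (x0 : pts C) (D : derivation x0) d (psi : JC -> Kb) (u : JC) :=
  D d (fun Q => psi (u.1, Q)) u.2.

Lemma slice_form x0 (D : derivation x0) (i : gidx JC) psi : form i psi ->
  form ((i.1, i.2 + der_deg D)%N : gidx JC) (slice D i.2 psi).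
Proof.
move=> [n [b [c [fb fc E]]]]; exists n, b, (fun l => D i.2 (c l)); split=> // [l|u].
  exact: (der_form D (fc l)).
rewrite /slice -der_sum//; congr (D i.2 _ u.2); apply/funext => Q; exact: E.
Qed.

(* Near a point of J x C, the divisor of y - a in Theta is cut out on JxC by
   psi, and its points of tangency to the fibres of J x C -> J by psi and its
   derivative along the fibres. *)
Lemma chart y0 a0 F G (D : derivation a0) : theta_eqn (y0 - aj a0) F G ->
  exists (i : gidx JC) c, let psi u := c u * F (u.1 - aj u.2) in
  let gam u := c u * G (u.1 - aj u.2) in
  [/\ form i psi, form i gam, gam (y0, a0) != 0 &
    near (S := JC) (y0, a0) (fun u => gam u != 0 /\
      (tangency u.1 u.2 <-> psi u = 0 /\ slice D i.2 psi u = 0))].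
Proof.
move=> L; have [d [fF fG Gx _]] := L.
have rs := subaj_greg J_jac P0; have [c [i [c0 hc]]] := rs (y0, a0) d.
exists i, c => psi gam; have fpsi : form i psi := hc F fF; have fgam : form i gam := hc G fG.
have g0 : gam (y0, a0) != 0 by rewrite mulf_neq0.
split=> //; have nL := greg_near (S := JC) (s := (y0, a0)) rs (theta_eqn_near L).
have nD := greg_near (S := JC) (s := (y0, a0)) (@greg_snd _ (gv J) (gv C)) (double_zeroP D).
apply: near_imp (near_and (near_form fgam g0) (near_and nL nD)) _ => -[y a] /= [gu [Lu hD]]; split=> //.
have fp2 := form_slice2 y a0 fpsi; have fg2 := form_slice2 y a0 fgam.
rewrite /slice /= -(hD i.2 (fun Q => psi (y, Q)) (fun Q => gam (y, Q)) fp2 fg2 gu).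
have E : gen (S := gv C) (fun Q => F (y - aj Q) / G (y - aj Q) = psi (y, Q) / gam (y, Q)).
  apply: gen_imp (gen_form (S := gv C) fg2 gu) _ => Q; rewrite /psi /gam /= mulf_eq0 negb_or => /andP[cq _].
  by rewrite -mulf_div divff// mul1r.
split=> [DB|DB]; first exact: double_zero_gen (tangency_all DB Lu) E.
by exists F, G; split=> //; apply: double_zero_gen DB _; apply: gen_imp E _.
Qed.

Lemma tangency_closed : gclosed (S := JC) [set u | tangency u.1 u.2]%classic.
Proof.
move=> [y a] /= nD; have [F [G [L _ _ _]]] := theta_eqn_ex (y - aj a).
have [D _] := derivation_ex C_curve a.
have [i [c [fp fg g0 ch]]] := chart D L; have [_ ch0] := near_self ch.
have fs := slice_form D fp.
have [psi0|psi0] := eqVneq (c (y, a) * F (y - aj a)) 0; last first.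
  by apply: near_imp (near_and ch (near_form fp psi0)) _ => u [[_ ->]] /eqP p0 [].
have s0 : slice D i.2 (fun u => c u * F (u.1 - aj u.2)) (y, a) != 0.
  by apply/eqP => s0; apply: nD; apply/ch0.
by apply: near_imp (near_and ch (near_form fs s0)) _ => u [[_ ->]] /eqP p0 [].
Qed.

(** [F] also generates the ideal of Theta x C. By interpolation [Phi] is a combination of finitely
    many slices [Phi (_, Q p)] with coefficients on [C]; each slice vanishes on Theta, hence is a
    multiple of [F], and the local denominators are multiplied together. *)
Lemma ideal_product x0 F d (i : gidx JC) Phi : vform d F ->
  (forall e P, vform e P -> near (S := gv J) x0 (fun z => Theta z -> P z = 0) ->
    exists m n A B, [/\ vform m A, vform n B, B x0 != 0, (e + n = d + m)%N &
                          forall z, P z * B z = F z * A z]) ->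
  form i Phi -> near (S := gv J) x0 (fun x => Theta x -> forall Q, Phi (x, Q) = 0) ->
  exists m n (A : JC -> Kb) B, [/\ form ((m, i.2) : gidx JC) A, vform n B, B x0 != 0,
    (i.1 + n = d + m)%N & forall u, Phi u * B u.1 = F u.1 * A u].
Proof.
move=> fF ideal fPhi nPhi; have [n0 [b [c [fb fc E]]]] := fPhi; have [q0 _] := irrC.1.
have [t [Q [g gE]]] := interpolation c.
pose th p z := \sum_l c l z * g p l.
have fth p : vform i.2 (th p).
  apply: (form_sum (S := gv C) (index_enum _) q0) => l.
  by apply: (form_ext (formZ (g p l) (fc l))) => z; rewrite mulrC.
have PhiE u : Phi u = \sum_p Phi (u.1, Q p) * th p u.2.
  rewrite E; under eq_bigr do rewrite gE mulr_sumr.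
  rewrite exchange_big /=; apply: eq_bigr => p _; rewrite E /= mulr_suml.
  by apply: eq_bigr => l _; rewrite mulrA.
suff H : forall s : seq 'I_t, exists m n (A : JC -> Kb) B, [/\ form ((m, i.2) : gidx JC) A, vform n B, B x0 != 0,
    (i.1 + n = d + m)%N & forall u, (\sum_(p <- s) Phi (u.1, Q p) * th p u.2) * B u.1 = F u.1 * A u].
  have [m [n [A [B [fA fB Bx dE R]]]]] := H (index_enum _).
  by exists m, n, A, B; split=> // u; rewrite PhiE R.
elim=> [|p s [m [n [A [B [fA fB Bx dE R]]]]]].
  have [B fB Bx] := vform_nv (X := J) d x0.
  exists i.1, d, (fun _ => 0), B; split=> //; [exact: (form0 (S := JC) _ (x0, q0))|by rewrite addnC|].
  by move=> u; rewrite big_nil mul0r mulr0.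
have [|m' [n' [A' [B' [fA' fB' Bx' dE' R']]]]] := ideal i.1 (fun x => Phi (x, Q p)) (form_slice1 x0 (Q p) fPhi).
  by apply: near_imp nPhi _ => z h /h.
have mm : (m + n' = m' + n)%N by lia.
exists (m + n')%N, (n + n')%N, (fun u => A u * B' u.1 + A' u.1 * th p u.2 * B u.1), (fun z => B z * B' z).
split; [|exact: vformM fB fB'|by rewrite mulf_neq0|by lia|].
  have fst_form k (b' : pts J -> Kb) : vform k b' -> form ((k, 0) : gidx JC) (fun u => b' u.1).
    by move=> fb'; apply: (form_ext (S := JC) (pform_mul1 fb' (form1 (gv C)))) => u; rewrite mulr1.
  have f1 := formM (g := JC) fA (fst_form _ _ fB').
  have f2 := formM (g := JC) (pform_mul1 fA' (fth p)) (fst_form _ _ fB).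
  apply: (form_ext (S := JC) (formD (g := JC) (form_cast f1 _) (form_cast f2 _))) => //.
    by congr pair; rewrite /= ?addr0// /GRing.add /=; lia.
  by congr pair; rewrite /= ?addr0// /GRing.add /=; lia.
move=> u; rewrite big_cons mulrDl mulrDr; have := R u; have := R' u.1.
set S := \sum_(_ <- _) _; move=> R1 R2.
have -> : Phi (u.1, Q p) * th p u.2 * (B u.1 * B' u.1) = Phi (u.1, Q p) * B' u.1 * th p u.2 * B u.1 by ring.
by rewrite R1 (mulrA S) R2; ring.
Qed.

Hypothesis char0 : forall m, m.+1%:R != 0 :> Kb.

(* If every y - a in Theta were a tangency, then the derivative of psi along
   the fibres, transported by (x, Q) |-> (x + Q, Q), would vanish on Theta x C
   and so be a multiple of psi. *)
Lemma transversal_ex : (forall y, exists a, Theta (y - aj a)) ->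
  exists y a, Theta (y - aj a) /\ ~ tangency y a.
Proof.
move=> meet; apply: contrapT => nDB.
have DB y a : Theta (y - aj a) -> tangency y a.
  by move=> Th; apply: contrapT => nD; apply: nDB; exists y, a.
(* With this [y0] the curve [y0 - C] leaves Theta, namely at [Q = P0], so that [psi] will not vanish
   identically on it. *)
have [z0 nz0] := theta_proper; pose y0 := z0 + aj P0; have [a0 Tha0] := meet y0.
set x0 := y0 - aj a0 in Tha0.
have [F [G [L _ _ [d [fF fG nF ideal]]]]] := theta_eqn_ex x0.
have [_ [_ _ Gx _]] := L.
have [D _] := derivation_ex C_curve a0.
have [i [c [fpsi fgam g0 ch]]] := chart D L; set psi := (fun u => _) in fpsi ch.
set gam := (fun u => _) in fgam g0 ch.
have fs := slice_form D fpsi; set e := der_deg D in fs.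
have rt : greg (S := JC) (T := JC) (fun u => (u.1 + aj u.2, u.2)).
  apply: greg_pair (@greg_snd _ (gv J) (gv C)).
  apply: gregD; first exact: greg_fst.
  exact: greg_comp (@greg_snd _ (gv J) (gv C)) (aj_greg J_jac P0).
have t0 : (x0 + aj a0, a0) = (y0, a0) by rewrite /x0 subrK.
have [c' [k [c'0 hc']]] := rt (x0, a0) (i.1, i.2 + e)%N.
pose Phi u := c' u * slice D i.2 psi (u.1 + aj u.2, u.2).
have fPhi : form k Phi := hc' _ fs.
(* For [x] in Theta, [(x + aj Q, Q)] is a tangency by assumption, so the derivative vanishes there
   for generic [Q] by the chart; being a form in [Q], it vanishes for all [Q]. *)
have nPhi : near (S := gv J) x0 (fun x => Theta x -> forall Q, Phi (x, Q) = 0).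
  have ch' : near (S := JC) ((fun u => (u.1 + aj u.2, u.2)) (x0, a0)) (fun u => gam u != 0 /\
      (tangency u.1 u.2 <-> psi u = 0 /\ slice D i.2 psi u = 0)) by rewrite /= t0.
  have [j [th [fth th0 H]]] := greg_near rt ch'.
  apply: near_imp (near_form (form_slice1 x0 a0 fth) th0) _ => x thx Thx.
  apply: (form_eq0 irrC (form_slice2 x a0 fPhi)).
  apply: gen_imp (gen_form (S := gv C) (form_slice2 x a0 fth) thx) _ => Q thQ.
  have [_ /= [h _]] := H (x, Q) thQ; have [|_ s0] := h; last by rewrite /Phi s0 mulr0.
  by apply: DB; rewrite addrK.
have [m [n [A [B [fA fB Bx dE R]]]]] := ideal_product fF ideal fPhi nPhi.
(* The forms [g1], [eta] and [c3] balance degrees. Pulled back along [Q |-> (y0 - aj Q, Q)],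
   divisibility by [F] says that the derivative of [P] is a multiple of [P] near its zero [a0],
   which [der_ord] forbids. *)
have [g1 fg1 g10] := form_nv (g := JC) (i.1, i.2 + e)%N (y0, a0).
pose eta u := c' u * g1 (u.1 + aj u.2, u.2); have feta : form k eta := hc' _ fg1.
have rs : greg (S := gv C) (T := JC) (fun Q => (y0 - aj Q, Q)).
  exact: (greg_pair (sub_greg y0) (@greg_id _ (gv C))).
have [c3 [q [c30 hc3]]] := rs a0 (k.1 + n, k.2)%N.
have fst_form l (b : pts J -> Kb) : vform l b -> form ((l, 0) : gidx JC) (fun u => b u.1).
  by move=> fb; apply: (form_ext (S := JC) (pform_mul1 fb (form1 (gv C)))) => u; rewrite mulr1.
have fX : vform q (fun Q => c3 Q * (eta (y0 - aj Q, Q) * B (y0 - aj Q))).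
  apply: (hc3 (fun u => eta u * B u.1)).
  apply: (form_cast (S := JC) (formM (g := JC) feta (fst_form _ _ fB))).
  by rewrite [k in LHS]surjective_pairing; congr pair; rewrite /= addr0.
have fY : vform q (fun Q => c3 Q * (G (y0 - aj Q) * A (y0 - aj Q, Q))).
  apply: (hc3 (fun u => G u.1 * A u)).
  apply: (form_cast (S := JC) (formM (g := JC) (fst_form _ _ fG) fA)).
  by congr pair; rewrite /= ?add0r// dE.
pose P Q := psi (y0, Q); have fP : vform i.2 P := form_slice2 y0 a0 fpsi.
have fgm : vform i.2 (fun Q => gam (y0, Q)) := form_slice2 y0 a0 fgam.
have Px : P a0 = 0.
  by rewrite /P /psi /= (proj2 (near_self nF) Tha0) mulr0.
have Pnz : exists Q, P Q != 0.
  apply: contrapT => nP; apply: nz0.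
  have cT : gclosed (S := gv C) [set Q | Theta (y0 - aj Q)]%classic := greg_closed (sub_greg y0) cZ.
  suff /(_ P0) : forall Q, Theta (y0 - aj Q) by rewrite /y0 addrK.
  apply: contrapT => /existsNP[Q1 nQ1].
  have ngam := near_form (S := gv C) fgm g0.
  have [Q [[hF gQ] nQ]] := gen_near irrC (near_and (greg_near (sub_greg y0) nF) ngam) (near_gen (cT Q1 nQ1)).
  apply: nQ; apply/hF; apply: contrapT => FQ; apply: nP; exists Q; rewrite /P /psi /= mulf_neq0//.
    by move: gQ; rewrite /gam mulf_eq0 negb_or => /andP[].
  exact/eqP.
have fg12 : vform (i.2 + e)%N (fun Q => g1 (y0, Q)) := form_slice2 y0 a0 fg1.
apply: (der_ord C_curve char0 (D := D) (n := (q + i.2)%N) fP Pnz Px (A := fun Q => g1 (y0, Q) * (c3 Q * (G (y0 - aj Q) * A (y0 - aj Q, Q))))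
  (B := fun Q => (c3 Q * (eta (y0 - aj Q, Q) * B (y0 - aj Q))) * gam (y0, Q))).
- apply: (form_cast (vformM fg12 fY)).
  by rewrite /GRing.add /= /e; lia.
- exact: vformM fX fgm.
- have eta0 : eta (x0, a0) != 0 by apply: mulf_neq0 => //; rewrite /= t0.
  exact: mulf_neq0 (mulf_neq0 c30 (mulf_neq0 eta0 Bx)) g0.
move=> Q; have R0 := R (y0 - aj Q, Q); rewrite /= /Phi /slice /= subrK in R0.
rewrite /eta /= subrK /P /gam /psi /= -/psi.
have -> : D i.2 (fun Q0 => c (y0, Q0) * F (y0 - aj Q0)) Q * (c3 Q * (c' (y0 - aj Q, Q) * g1 (y0, Q) * B (y0 - aj Q)) * (c (y0, Q) * G (y0 - aj Q)))
 = (c' (y0 - aj Q, Q) * D i.2 (fun Q0 => c (y0, Q0) * F (y0 - aj Q0)) Q * B (y0 - aj Q)) * (c3 Q * g1 (y0, Q) * (c (y0, Q) * G (y0 - aj Q))) by ring.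
by rewrite R0; ring.
Qed.

End LocalEquations.

(** * Closed conditions on tuples of points of the curve *)

Section SeparatelyClosed.
Variables (K : fieldType) (Kb : closedFieldType) (iota : {rmorphism K -> Kb}).
Variable C : variety iota.

Definition upd n (M : 'I_n -> pts C) i a := fun j => if j == i then a else M j.

(** Closedness in each variable separately, enough for an induction that frees one variable at a
    time; tuples are thus handled without embedding a power of [C] as a variety. *)
Definition sepclosed n (Z : ('I_n -> pts C) -> Prop) :=
  forall M i, gclosed (S := gv C) [set a | Z (upd M i a)]%classic.

Definition fcons n (a : pts C) (M : 'I_n -> pts C) : 'I_n.+1 -> pts C :=
  fun i => if unlift ord0 i is Some j then M j else a.

Lemma fcons_eta n (M : 'I_n.+1 -> pts C) : fcons (M ord0) (fun j => M (fintype.lift ord0 j)) = M.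
Proof. by apply/funext => i; rewrite /fcons; case: unliftP => [j|] ->. Qed.

Lemma fcons_upd0 n a b (M : 'I_n -> pts C) : fcons a M = upd (fcons b M) ord0 a.
Proof. by apply/funext => i; rewrite /fcons /upd; case: unliftP => [j|] ->. Qed.

Lemma fcons_updS n a b (M : 'I_n -> pts C) i :
  fcons a (upd M i b) = upd (fcons a M) (fintype.lift ord0 i) b.
Proof.
apply/funext => j; rewrite /fcons /upd; case: unliftP => [l ->|->].
  by rewrite (inj_eq lift_inj).
by rewrite (negbTE (neq_lift _ _)).
Qed.

(* C^n is irreducible. *)
Lemma sep_irr n (Z Y : ('I_n -> pts C) -> Prop) : sepclosed Z -> sepclosed Y ->
  (forall M, Z M \/ Y M) -> (forall M, Z M) \/ (forall M, Y M).
Proof.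
elim: n Z Y => [|n IH] Z Y cZ cY ZY.
  have [x _] := (gvirr C).1; have E (M : 'I_0 -> pts C) : M = fun _ => x by apply/funext => -[].
  by case: (ZY (fun _ => x)) => h; [left|right] => M; rewrite (E M).
pose T X (M : 'I_n -> pts C) := forall a, X (fcons a M).
have cT X : sepclosed X -> sepclosed (T X).
  move=> cX M i; apply: (gclosed_setI (S := gv C) (Z := fun a => [set b | X (fcons a (upd M i b))]%classic)) => a.
  have -> : [set b | X (fcons a (upd M i b))]%classic = [set b | X (upd (fcons a M) (fintype.lift ord0 i) b)]%classic.
    by apply/funext => b /=; rewrite fcons_updS.
  exact: cX.
have key M : T Z M \/ T Y M.
  have [x _] := (gvirr C).1.
  have cl X : sepclosed X -> gclosed (S := gv C) [set a | X (fcons a M)]%classic.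
    move=> cX; have -> : [set a | X (fcons a M)]%classic = [set a | X (upd (fcons x M) ord0 a)]%classic.
      by apply/funext => b /=; rewrite (fcons_upd0 b x).
    exact: cX.
  by apply: (gclosed_irr (gvirr C) (cl Z cZ) (cl Y cY)) => a; apply: ZY.
have [h|h] := IH (T Z) (T Y) (cT Z cZ) (cT Y cY) key; [left|right] => M;
  by rewrite -(fcons_eta M); apply: h.
Qed.

Lemma sep_irr_fin n (I : finType) (Z : I -> ('I_n -> pts C) -> Prop) :
  (forall i, sepclosed (Z i)) -> (forall M, exists i, Z i M) -> exists i, forall M, Z i M.
Proof.
move=> cZ cov.
have cU (s : seq I) : sepclosed (fun M => exists2 i, i \in s & Z i M).
  elim: s => [|i s IH]; first by move=> M l a _; apply: near_T => b /= [].
  move=> M l.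
  have -> : [set a | exists2 j, j \in i :: s & Z j (upd M l a)]%classic =
      [set a | Z i (upd M l a) \/ exists2 j, j \in s & Z j (upd M l a)]%classic.
    apply/funext => a; apply/propext; split=> [[j]|[h|[j js h]]].
    - by rewrite inE => /orP[/eqP->|js] h; [left|right; exists j].
    - by exists i; rewrite ?mem_head.
    - by exists j; rewrite // inE js orbT.
  exact: (gclosedU (S := gv C) (cZ i M l) (IH M l)).
have : forall M, exists2 i, i \in enum I & Z i M.
  by move=> M; have [i h] := cov M; exists i; rewrite ?mem_enum.
elim: (enum I) => [|i s IH] h.
  by have [x _] := (gvirr C).1; have [] := h (fun _ => x).
have [|H|//] := sep_irr (cZ i) (cU s); last by exists i.
move=> M; have [j] := h M; rewrite inE => /orP[/eqP->|js] hj; [by left|by right; exists j].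
Qed.

End SeparatelyClosed.

Lemma sum_two (V : zmodType) n s (F : 'I_n.+1 -> V) k l : n = s.+1 -> k != l ->
  exists R : 'I_s -> 'I_n.+1, \sum_i F i = F k + F l + \sum_j F (R j).
Proof.
move=> E; subst n; case: (unliftP k l) => [l' ->|->]; last by rewrite eqxx.
exists (fun j => fintype.lift k (fintype.lift l' j)).
by rewrite (bigD1_ord k)//= (bigD1_ord l')//= addrA.
Qed.

(** * Generic translates of the curve meet theta transversally *)

Section GoodPoints.
Variables (K : fieldType) (Kb : closedFieldType) (iota : {rmorphism K -> Kb}).
Variables (C : variety iota) (C_curve : smooth_curve C).
Variables (J : abvar iota) (cl : cdiv C -> pts J) (J_jac : is_jacobian cl) (P0 : pts C).
Local Notation aj := (abel_jacobi cl P0).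
Local Notation Theta := (theta cl P0).
Local Notation Wset := (Wset cl P0).
Variables (T : divisor J) (TZ : is_divisor_of_set T Theta).
Variables (r : nat) (kr : krull_dim J r.+1).
Hypothesis char0 : forall m, m.+1%:R != 0 :> Kb.
Let cT : gclosed (S := gv J) Theta := theta_closed J_jac (P0 := P0).
Local Notation tangency := (tangency cl P0 T).
Local Notation ajsum M := (\sum_i aj (M i)).

(** Here [r + 1] is the dimension of [J], and [y] is a sum of [r + 1] points of [C] two of which
    coincide. For [r = 0] there is no such sum, whence the form [r = s.+1]. *)
Definition repeated y := exists s a, r = s.+1 /\ Wset s (y - aj a - aj a).

Definition bad y := (forall a, Theta (y - aj a)) \/ (exists a, tangency y a) \/ repeated y.

Lemma WT x : Theta x <-> Wset r x. Proof. exact: theta_Wset. Qed.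

Lemma repeated_closed : gclosed (S := gv J) repeated.
Proof.
case Er : r => [|s].
  by move=> y _; apply: near_T => z [s [a []]]; rewrite Er.
have rg : greg (S := gprod (gv J) (gv C)) (T := gv J) (fun u => u.1 - aj u.2 - aj u.2).
  apply: gregB (subaj_greg J_jac P0) _.
  exact: greg_comp (@greg_snd _ (gv J) (gv C)) (aj_greg J_jac P0).
have H := proj_closed (Y := gv J) (greg_closed rg (Wset_closed J_jac (P0 := P0) (r := s))).
have -> // : repeated = [set y | exists a, Wset s (y - aj a - aj a)]%classic.
apply/funext => y; apply/propext; split=> [[s' [a [E h]]]|[a h]]; last by exists s, a.
by exists a; move: E; rewrite Er => -[->].
Qed.

Lemma bad_closed : gclosed (S := gv J) bad.
Proof.
apply: (gclosedU (S := gv J)) (gclosedU (S := gv J) _ repeated_closed).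
  apply: (gclosed_setI (S := gv J) (Z := fun a => [set y | Theta (y - aj a)]%classic)) => a.
  exact: (greg_closed (greg_addr (- aj a)) cT).
exact: (proj_closed (Y := gv J) (tangency_closed C_curve J_jac TZ cT)).
Qed.

Lemma ajsum_upd n (M : 'I_n -> pts C) i a :
  ajsum (upd M i a) = aj a + \sum_(j | j != i) aj (M j).
Proof.
rewrite (bigD1 i)//= /upd eqxx; congr (_ + _); apply: eq_bigr => j ji.
by rewrite (negbTE ji).
Qed.

Lemma ajsum_greg n (M : 'I_n -> pts C) i :
  greg (S := gv C) (T := gv J) (fun a => ajsum (upd M i a)).
Proof.
rewrite (_ : (fun _ => _) = fun a => aj a + \sum_(j | j != i) aj (M j)).
  exact: (gregD (aj_greg J_jac P0) (@greg_const _ (gv C) (gv J) _)).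
by apply/funext => a; rewrite ajsum_upd.
Qed.

Lemma meets y : exists a, Theta (y - aj a).
Proof.
by have /WsetS[a h] := Wset_full J_jac P0 kr y; exists a; apply/WT.
Qed.

Lemma pencil_mem (M : 'I_r.+1 -> pts C) a : ~ (forall b, Theta (ajsum M - aj b)) ->
  Theta (ajsum M - aj a) -> exists k, a = M k.
Proof.
move=> nB /WT h; apply: contrapT => nk; apply: nB => b; apply/WT.
by apply: (pencil C_curve J_jac h) => k; apply/eqP => E; apply: nk; exists k.
Qed.

(** If every [y] were bad, the tuples [M] of [r + 1] points with sum [y] would be covered by
    finitely many closed conditions: [y - C] lies in Theta, or is tangent to it at some [M k], or
    two of the points coincide. By irreducibility one of them would always hold; [theta_proper],
    [transversal_ex] and the infinity of [C] exclude each. *)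
Lemma good_ex : exists y, ~ bad y.
Proof.
apply: contrapT => /forallNP all_bad.
have {}all_bad y : bad y by apply: contrapT; apply: all_bad.
pose Z (i : option ('I_r.+1 + 'I_r.+1 * 'I_r.+1)) (M : 'I_r.+1 -> pts C) :=
  match i with
  | None => forall a, Theta (ajsum M - aj a)
  | Some (inl k) => tangency (ajsum M) (M k)
  | Some (inr kl) => kl.1 != kl.2 /\ M kl.1 = M kl.2
  end.
have cZ i : sepclosed (Z i).
  move=> M j; case: i => [[k|[k l]]|] /=.
  - have rg : greg (S := gv C) (T := gprod (gv J) (gv C)) (fun a => (ajsum (upd M j a), upd M j a k)).
      apply: greg_pair (ajsum_greg M j) _; rewrite /upd.
      by case: eqP => _; [exact: greg_id|exact: (@greg_const _ (gv C) (gv C))].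
    exact: (greg_closed rg (tangency_closed C_curve J_jac TZ cT)).
  - rewrite /upd; have [|kl] := eqVneq k l.
      by move=> _ a _; apply: near_T => b [].
    case: eqP => [kj|_]; case: eqP => [lj|_].
    + by rewrite kj lj eqxx in kl.
    + move=> a na; have h : a <> M l by move=> E; apply: na.
      by apply: near_imp (gclosed_pt h) _ => b nb [_ E].
    + move=> a na; have h : a <> M k by move=> E; apply: na.
      by apply: near_imp (gclosed_pt h) _ => b nb [_ E]; apply: nb.
    + move=> a na; apply: near_T => b; exact: na.
  apply: (gclosed_setI (S := gv C) (Z := fun a => [set b | Theta (ajsum (upd M j b) - aj a)]%classic)) => a.
  apply: (greg_closed (S := gv C) (T := gv J) _ cT).
  exact: (gregB (ajsum_greg M j) (@greg_const _ (gv C) (gv J) (aj a))).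
have cov M : exists i, Z i M.
  have [h|nB] := pselect (forall a, Theta (ajsum M - aj a)); first by exists None.
  have [//|[[a Da]|[s [a [rs Wa]]]]] := all_bad (ajsum M).
    have [k ak] := pencil_mem nB (tangency_theta J_jac TZ cT Da).
    by exists (Some (inl k)); rewrite /= -ak.
  have [R RE] := Wa.
  have [inj|ninj] := pselect (injective M); last first.
    have [k [l [kl E]]] : exists k l, k != l /\ M k = M l.
      apply: contrapT => h; apply: ninj => k l E; apply/eqP; apply/negP => /negP kl.
      by apply: h; exists k, l.
    by exists (Some (inr (k, l))).
  (* [M'] lists the decomposition with [a] repeated, read through [nth] to avoid a cast between
     [s.+1] and [r]. By [pencil_mem] every point of [M] occurs in it, so [M] takes at most [r]
     values on [r + 1] indices. *)
  exfalso; pose M' : 'I_r.+1 -> pts C := fcons a (fun i => nth a (codom (fcons a R)) i).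
  have ME : ajsum M' = ajsum M.
    rewrite -[RHS](subrK (aj a)) -[X in X + _](subrK (aj a)) RE.
    have E (i : 'I_s.+1) : nth a (codom (fcons a R)) i = fcons a R i.
      by rewrite codomE (nth_map i) ?size_enum_ord// nth_ord_enum.
    rewrite big_ord_recl {1}/M' /fcons unlift_none addrC; congr (_ + _).
    transitivity (\sum_(i < r) aj (nth a (codom (fcons a R)) i)).
      by apply: eq_bigr => i _; rewrite /M' /fcons liftK.
    rewrite rs; under eq_bigr do rewrite E.
    rewrite big_ord_recl addrC /fcons unlift_none; congr (_ + _).
    by apply: eq_bigr => i _; rewrite liftK.
  have nB' : ~ forall b, Theta (ajsum M' - aj b) by rewrite ME.
  have sub : {subset codom M <= a :: codom R}.
    move=> x /codomP[k ->]; have : Theta (ajsum M' - aj (M k)).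
      rewrite ME; apply/WT; exists (fun i => M (fintype.lift k i)).
      by rewrite (bigD1_ord k)//= addrAC subrr add0r.
    move/(pencil_mem nB') => [l ->]; rewrite /M' /fcons; case: unliftP => [i _|_]; last exact: mem_head.
    have si : (val i < size (codom (fcons a R)))%N by rewrite size_codom card_ord -rs ltn_ord.
    have /codomP[p ->] := mem_nth a si; rewrite /fcons.
    by case: unliftP => [q _|_]; rewrite inE ?eqxx// codom_f orbT.
  have := uniq_leq_size (_ : uniq (codom M)) sub.
  rewrite /= !size_codom !card_ord -rs ltnn => h.
  by have := h; rewrite /codom /image_mem map_inj_uniq// enum_uniq => /(_ isT).
have [i Zi] := sep_irr_fin cZ cov; case: i Zi => [[k|[k l]]|] /= Zi.
- have [y [a [Th nD]]] := transversal_ex C_curve J_jac TZ cT char0 meets.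
  apply: nD; have /WT[R RE] := Th.
  pose M i := if unlift k i is Some j then R j else a.
  have <- : ajsum M = y.
    rewrite (bigD1_ord k)//= /M unlift_none; under eq_bigr do rewrite liftK.
    by rewrite -RE addrC subrK.
  by have := Zi M; rewrite {2}/M unlift_none.
- have [x _] := (gvirr C).1; have [x' xx'] := curve_infinite C_curve [:: x].
  have [kl _] := Zi (fun _ => x); have [_] := Zi (fun i => if i == k then x else x').
  rewrite eqxx eq_sym (negbTE kl) => E.
  by rewrite -E mem_head in xx'.
have [z nz] := theta_proper TZ cT.
have [M ME] := Wset_full J_jac P0 kr (z + aj P0).
by apply: nz; have := Zi M P0; rewrite -ME addrK.
Qed.

(** [N] is the sum of the points of a decomposition of [y]: they are distinct since [y] is not
    [repeated], and by [pencil_mem] they are all the points where [y - C] meets Theta. *)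
Lemma good_div y : ~ bad y -> exists N : cdiv C,
  [/\ deg N = r.+1%:Z, cl (N - << P0 >> *+ r.+1) = y &
   forall a, (Theta (y - aj a) /\ coeff a N = 1) \/ (~ Theta (y - aj a) /\ coeff a N = 0)].
Proof.
move=> /not_orP[nB /not_orP[nD nR]]; have [M ME] := Wset_full J_jac P0 kr y.
exists (\sum_i << M i >>); split; first exact: deg_sum_pts.
  by rewrite ME -(proj2 (aj_sum J_jac P0 M)).
have inj : injective M.
  move=> k l E; apply: contrapT => /eqP kl; apply: nR.
  have r0 : (0 < r)%N.
    rewrite lt0n; apply: contra kl => /eqP r0; apply/eqP/val_inj => /=.
    by have := ltn_ord k; have := ltn_ord l; lia.
  have [R RE] := sum_two (fun i => aj (M i)) (esym (prednK r0)) kl.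
  exists r.-1, (M k); rewrite prednK//; split=> //; exists (fun j => M (R j)).
  by apply/eqP; rewrite ME RE -E !subr_eq addrC addrA.
move=> a; rewrite coeff_sum_pts; case: (pselect (Theta (y - aj a))) => h; [left|right]; split=> //.
  rewrite ME in h nB; have [k ->] := pencil_mem nB h.
  rewrite (bigD1 k)//= eqxx big1 => [|i ik]; first by [].
  by rewrite (inj_eq inj) (negbTE ik).
rewrite big1// => i _; case: eqP => // E; case: h; apply/WT.
exists (fun j => M (fintype.lift i j)).
by rewrite ME (bigD1_ord i)//= E addrAC subrr add0r.
Qed.

Lemma good_ord y N a F G : ~ bad y ->
  (Theta (y - aj a) /\ coeff a N = 1) \/ (~ Theta (y - aj a) /\ coeff a N = 0) ->
  theta_eqn T (y - aj a) F G -> ord_at (fun Q => F (y - aj Q) / G (y - aj Q)) a (coeff a N).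
Proof.
move=> /not_orP[nB /not_orP[nD nR]] h L; have [d [fF fG Gx _]] := L.
have hv := restr_value (sub_greg J_jac P0 y) fF fG Gx.
have FT := theta_eqn_zero TZ cT L.
case: h => -[Th ->].
  apply: (simple_zero C_curve); first by move: hv; rewrite (proj2 FT Th) mul0r.
  by move=> D; apply: nD; exists a, F, G.
apply/(ord_unit C_curve); eexists; last exact: hv.
by rewrite mulf_neq0 ?invr_neq0//; apply/eqP => F0; apply/Th/FT.
Qed.

End GoodPoints.

(** * Autoduality *)

Section Pullback.
Variables (K : fieldType) (Kb : closedFieldType) (iota : {rmorphism K -> Kb}).

Lemma has_value_comp (X Y : variety iota) (u : pts X -> pts Y) f x v :
  greg (S := gv X) (T := gv Y) u -> (forall y, exists z, u z = y) ->
  has_value f (u x) v -> has_value (fun z => f (u z)) x v.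
Proof.
move=> ru su /has_valueP[a [b [[d [fa fb E]] bx ->]]].
apply: has_value_gen (restr_value ru fa fb bx) _.
by apply: gen_imp (greg_gen (gvirr Y) ru su E) _ => z [_ ->].
Qed.

Lemma unit_comp (X Y : variety iota) (u : pts X -> pts Y) f x :
  greg (S := gv X) (T := gv Y) u -> (forall y, exists z, u z = y) ->
  unit_at f (u x) -> unit_at (fun z => f (u z)) x.
Proof. by move=> ru su [v v0 h]; exists v => //; apply: has_value_comp. Qed.

Lemma nz_comp (X Y : variety iota) (u : pts X -> pts Y) f :
  greg (S := gv X) (T := gv Y) u -> (forall y, exists z, u z = y) ->
  nzrational f -> nzrational (fun z => f (u z)).
Proof.
move=> ru su nf; have /nzP[a [b [q [y ay]]]] := nf; have [d [fa fb E]] := q.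
have [y' by'] := quo_nz q.
have [x0 [bx ax]] := gen_ex (gen_and (gvirr X) (greg_gen (gvirr Y) ru su (gen_form (S := gv Y) fb by')) (greg_gen (gvirr Y) ru su (gen_form (S := gv Y) fa ay))).
have hv := restr_value ru fa fb bx.
have ux : unit_at (fun z => a (u z) / b (u z)) x0.
  by eexists; last exact: hv; rewrite mulf_neq0 ?invr_neq0.
apply: nz_gen_eq (unit_nz ux) _.
by apply: gen_imp (greg_gen (gvirr Y) ru su E) _ => z [_ ->].
Qed.

Variables (C : variety iota) (C_curve : smooth_curve C) (J : abvar iota).
Let irrC := gvirr C.
Let irrJ := gvirr J.

(* The restriction of the Cartier divisor E along u, when u(C) is not inside
   its support, is N. *)
Definition pulldiv (E : divisor J) (u : pts C -> pts J) (N : cdiv C) :=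
  forall a, exists n A B, [/\ vform n A, vform n B,
    unit_at (fun z => E (u a) z / (A z / B z)) (u a) &
    ord_at (fun Q => A (u Q) / B (u Q)) a (coeff a N)].

(** Rational functions matter only generically on [J], so restricting one to a curve must go through
    a fraction whose denominator does not vanish along the curve. *)
Definition is_restriction (u : pts C -> pts J) h h' := exists n H1 H2,
  [/\ vform n H1, vform n H2, quo h H1 H2 &
      gen (S := gv C) (fun Q => H2 (u Q) != 0 /\ h' Q = H1 (u Q) / H2 (u Q))].

Variables (u : pts C -> pts J) (ru : greg (S := gv C) (T := gv J) u).

Lemma ord_gen_nz f a m : ord_at f a m -> gen (S := gv C) (fun Q => f Q != 0).
Proof. by move=> o; apply: nz_gen (ord_nz C_curve o). Qed.

Lemma frac_nz (F : fieldType) (a b : F) : a / b != 0 -> a != 0 /\ b != 0.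
Proof. by rewrite mulf_eq0 invr_eq0 negb_or => /andP. Qed.

Lemma restr_value_eq h h' a v : is_restriction u h h' -> has_value h (u a) v -> has_value h' a v.
Proof.
move=> [n [H1 [H2 [f1 f2 q E]]]] /has_valueP[b [b' [q' b'x ->]]].
have R := quo_uniq q q'; have [d [fb fb' _]] := q'.
apply: has_value_gen (restr_value ru fb fb' b'x) _.
have [c [i [c0 hc]]] := ru a d.
have n' := greg_near ru (near_form (S := gv J) fb' b'x).
apply: gen_imp (gen_and irrC (near_gen n') E) _ => Q [b'0 [H20 ->]].
by apply/eqP; rewrite eqr_div// -R mulrC.
Qed.

Lemma pulldiv_unit E N a : pulldiv E u N -> unit_at (E (u a)) (u a) -> coeff a N = 0.
Proof.
move=> pE uE; have [n [A [B [fA fB uAB o]]]] := pE a.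
have : unit_at (fun z => A z / B z) (u a).
  have uu := unitD uE uAB; have nz := nz_gen (unit_nz uu).
  apply: unit_gen uu _; apply: gen_imp nz _ => z.
  by move=> /frac_nz[E0 /frac_nz[_ AB0]]; rewrite invf_div mulrCA divff// mulr1.
move=> /unitP[b [b' [q bx b'x]]].
have [d [fb fb' _]] := q; have nzo := ord_gen_nz o.
have qAB : exists z, B z != 0.
  by have [Q /frac_nz[_ h]] := gen_ex nzo; exists (u Q).
have R := quo_uniq (quo_form fA fB qAB) q.
apply: (ord_uniq C_curve o); apply/(ord_unit C_curve).
have hv := restr_value ru fb fb' b'x.
apply: (unit_gen (f := fun Q => b (u Q) / b' (u Q))).
  by eexists; last exact: hv; rewrite mulf_neq0 ?invr_neq0.
have n' := greg_near ru (near_form (S := gv J) fb' b'x).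
apply: gen_imp (gen_and irrC (near_gen n') nzo) _ => Q [b'0 /frac_nz[_ B0]].
by apply/eqP; rewrite eqr_div// R mulrC.
Qed.

(** Near [u a], [h] is the [q]-th power of the local equation [A / B] times a unit. The fraction
    that defines [h'] is found at one point and compared with the others by cross-multiplication. *)
Lemma restriction_ex E N h q : pulldiv E u N -> is_div_of h (fun x z => E x z ^+ q) ->
  exists h', is_restriction u h h' /\ is_cdiv_of h' (N *+ q).
Proof.
move=> pE [nh hE].
have loc a : exists n A B k b b', [/\ vform n A, vform n B, vform k b, vform k b' &
   [/\ b (u a) != 0, b' (u a) != 0, quo h (fun z => A z ^+ q * b z) (fun z => B z ^+ q * b' z)
   & ord_at (fun Q => A (u Q) / B (u Q)) a (coeff a N)]].
  have [n [A [B [fA fB uAB o]]]] := pE a; have nzo := ord_gen_nz o.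
  have [Q /frac_nz[A0 B0]] := gen_ex nzo.
  have u1 := unitM (hE (u a)) (unitX q uAB).
  have gA := gen_form (S := gv J) fA A0; have gB := gen_form (S := gv J) fB B0.
  have u2 : unit_at (fun z => h z / (A z / B z) ^+ q) (u a).
    have nE := nz_gen (unit_nz uAB).
    apply: unit_gen u1 _; apply: gen_imp (gen_and irrJ nE (gen_and irrJ gA gB)) _.
    move=> z [/frac_nz[E0 _] _]; rewrite expr_div_n mulrA divfK//.
    exact: expf_neq0.
  have /unitP[b [b' [qb bx b'x]]] := u2; have [k [fb fb' Eb]] := qb.
  exists n, A, B, k, b, b'; split=> //; split=> //; exists (n *+ q + k)%R; split.
  - exact: vformM (formX (S := gv J) q fA) fb.
  - exact: vformM (formX (S := gv J) q fB) fb'.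
  apply: gen_imp (gen_and irrJ Eb (gen_and irrJ gA gB)) _ => z [[b'z Ez] [Az Bz]].
  split; first by rewrite mulf_neq0 ?expf_neq0.
  have Aq := expf_neq0 q Az; have Bq := expf_neq0 q Bz; move: Ez; rewrite expr_div_n.
  have -> : A z ^+ q * b z / (B z ^+ q * b' z) = b z / b' z * (A z ^+ q / B z ^+ q).
    by rewrite [RHS]mulrC mulf_div.
  by move=> <-; rewrite divfK// mulf_neq0 ?invr_neq0.
have [a0 _] := irrC.1; have [n [A [B [k [b [b' [fA fB fb fb' [bx b'x q0 o]]]]]]]] := loc a0.
pose H1 z := A z ^+ q * b z; pose H2 z := B z ^+ q * b' z.
have nzo := ord_gen_nz o.
have nb := greg_near ru (near_and (near_form (S := gv J) fb bx) (near_form (S := gv J) fb' b'x)).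
have g12 : gen (S := gv C) (fun Q => H1 (u Q) != 0 /\ H2 (u Q) != 0).
  apply: gen_imp (gen_and irrC nzo (near_gen nb)) _ => Q [/frac_nz[A0 B0] [b0 b'0]].
  by rewrite !mulf_neq0 ?expf_neq0.
exists (fun Q => H1 (u Q) / H2 (u Q)); split.
  have [m [f1 f2 _]] := q0; exists m, H1, H2; split=> //.
  by apply: gen_imp g12 _ => Q [].
have o' a : ord_at (fun Q => H1 (u Q) / H2 (u Q)) a (coeff a (N *+ q)).
  have [n1 [A1 [B1 [k1 [b1 [b1' [fA1 fB1 fb1 fb1' [b1x b1'x q1 o1]]]]]]]] := loc a.
  have R := quo_uniq q0 q1; have nzo1 := ord_gen_nz o1.
  have hv' := restr_value ru fb1 fb1' b1'x.
  have ub : unit_at (fun Q => b1 (u Q) / b1' (u Q)) a.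
    by eexists; last exact: hv'; rewrite mulf_neq0 ?invr_neq0.
  have := ordM C_curve (ordX C_curve q o1) (proj2 (ord_unit C_curve _ _) ub).
  rewrite addr0 coeffMn => o2; apply: ord_gen o2 _.
  have nb1 := greg_near ru (near_form (S := gv J) fb1' b1'x).
  apply: gen_imp (gen_and irrC (gen_and irrC g12 nzo1) (near_gen nb1)) _.
  move=> Q [[[_ H20] /frac_nz[_ B0]] b1'0]; rewrite expr_div_n mulf_div.
  apply/eqP; rewrite eqr_div//; last by rewrite mulf_neq0 ?expf_neq0.
  by rewrite [H1 _ * _]R mulrC.
split; first by have := ord_nz C_curve (o' a0).
by move=> a; apply/(has_ordP C_curve).
Qed.

End Pullback.

(** * The class of x restricted to the curve is x *)

Section Autoduality.
Variables (K : fieldType) (Kb : closedFieldType) (iota : {rmorphism K -> Kb}).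
Variables (C : variety iota) (C_curve : smooth_curve C).
Variables (J : abvar iota) (cl : cdiv C -> pts J) (J_jac : is_jacobian cl).
Hypothesis char0 : forall m, m.+1%:R != 0 :> Kb.
Let irrC := gvirr C.
Let irrJ := gvirr J.

Definition tdiv (T : divisor J) x : divisor J := div_sub (translate x T) T.

Lemma translate_surj (x y : pts J) : exists z, z + x = y.
Proof. by exists (y - x); rewrite subrK. Qed.

Section Base.
Variables (P0 : pts C) (T : divisor J) (TZ : is_divisor_of_set T (theta cl P0)).
Local Notation aj := (abel_jacobi cl P0).
Local Notation Theta := (theta cl P0).
Let cT : gclosed (S := gv J) Theta := theta_closed J_jac (P0 := P0).

Lemma unit_off z : ~ Theta z -> unit_at (T z) z.
Proof.
move=> nz; have [F [G [L _ FT _]]] := theta_eqn_ex TZ cT z; have [d [fF fG Gx ux]] := L.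
have Fz : F z != 0 by apply/eqP => /FT.
have uFG : unit_at (fun w => F w / G w) z.
  apply/unitP; exists F, G; split=> //; exact: (quo_form fF fG (ex_intro _ z Gx)).
apply: unit_gen (unitM ux uFG) _; apply: gen_imp (nz_gen (unit_nz uFG)) _ => w w0.
by rewrite divfK.
Qed.

Lemma tdiv_unit x z : ~ Theta z -> ~ Theta (z + x) -> unit_at (tdiv T x z) z.
Proof.
move=> n1 n2; apply: unitD (unit_off n1).
exact: (unit_comp (greg_addr x) (translate_surj x) (unit_off n2)).
Qed.

Lemma tdiv_pull r (kr : krull_dim J r.+1) x y N N' : ~ bad cl P0 T r y -> ~ bad cl P0 T r (y + x) ->
  (forall a, (Theta (y - aj a) /\ coeff a N = 1) \/ (~ Theta (y - aj a) /\ coeff a N = 0)) ->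
  (forall a, (Theta (y + x - aj a) /\ coeff a N' = 1) \/ (~ Theta (y + x - aj a) /\ coeff a N' = 0)) ->
  pulldiv (tdiv T x) (fun Q => y - aj Q) (N' - N).
Proof.
move=> g g' hN hN' a; set u := fun Q => y - aj Q.
have [F [G [L _ _ [d [fF fG _ _]]]]] := theta_eqn_ex TZ cT (y - aj a).
have [F' [G' [L' _ _ [d' [fF' fG' _ _]]]]] := theta_eqn_ex TZ cT (y + x - aj a).
have uax : u a + x = y + x - aj a by rewrite /u addrAC.
have [c [j [c0 hc]]] := greg_addr x (u a) d'.
pose A z := c z * F' (z + x) * G z; pose B z := c z * G' (z + x) * F z.
have o1 := good_ord C_curve J_jac TZ g (hN a) L; have o2 := good_ord C_curve J_jac TZ g' (hN' a) L'.
have ru := sub_greg J_jac P0 y.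
have [_ [_ _ G'x uL']] := L'; have [_ [_ _ Gx uL]] := L.
have gcG : near (S := gv J) (u a) (fun z => c z != 0 /\ G' (z + x) != 0).
  have h : c (u a) * G' (u a + x) != 0 by rewrite mulf_neq0// uax.
  by apply: near_imp (near_form (S := gv J) (hc _ fG') h) _ => z; rewrite mulf_eq0 negb_or => /andP.
exists (j + d)%R, A, B; split.
- exact: vformM (hc _ fF') fG.
- exact: vformM (hc _ fG') fF.
- have u1 : unit_at (fun z => T (u a + x) (z + x) / (F' (z + x) / G' (z + x))) (u a).
    by apply: (unit_comp (f := fun z => T (u a + x) z / (F' z / G' z)) (greg_addr x) (translate_surj x)); rewrite uax.
  apply: unit_gen (unitD u1 uL) _.
  have [_ [_ _ _ _]] := L'; have gL := theta_eqn_gen TZ L.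
  have gL' := greg_gen irrJ (greg_addr x) (translate_surj x) (theta_eqn_gen TZ L').
  apply: gen_imp (gen_and irrJ gL (gen_and irrJ gL' (near_gen gcG))) _.
  move=> z [[Fz Gz Tz] [[F'z G'z T'z] [cz _]]].
  rewrite /tdiv /div_sub /translate /pullback /A /B /= -/(u a) uax.
  by field; rewrite Fz Gz Tz F'z G'z cz.
have nn := greg_near ru gcG; rewrite coeffB; apply: ord_gen (ordD C_curve o2 o1) _.
apply: gen_imp (gen_and irrC (near_gen nn) (ord_gen_nz C_curve o1)) _ => Q [[cQ G'Q] /frac_nz[FQ GQ]].
rewrite /A /B; have -> : y + x - aj Q = y - aj Q + x by rewrite addrAC.
by field; rewrite FQ GQ cQ G'Q.
Qed.

End Base.

(** What a choice of [y] provides: [u] stands for [y - C], [N] for its intersection with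
    [tdiv T (cl D)], [w] for the equivalence of [N] with [D]; the points of [s] are sent off the
    support. Only the differences of [u] are prescribed, which also covers the case where [J] is a
    point. *)
Definition datum (D : cdiv C) (s : seq (pts C)) P0 (T : divisor J) u N w := 
  [/\ is_divisor_of_set T (theta cl P0), greg (S := gv C) (T := gv J) u,
      forall a b, u a - u b = cl (<< b >> - << a >>),
      pulldiv (tdiv T (cl D)) u N &
      is_cdiv_of w (N - D) /\ forall a, a \in s -> unit_at (tdiv T (cl D) (u a)) (u a)].

(** With [x = cl D], a generic [y] makes both [y] and [y + x] good and keeps [s] off Theta and its
    translate. The divisors cut by Theta on [y + x - C] and [y - C] have classes [y + x] and [y], so
    their difference has the class of [D]. *)
Lemma datum_ex P0 T D s : is_divisor_of_set T (theta cl P0) -> deg D = 0 ->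
  (exists r, krull_dim J r.+1) \/ (forall x y : pts J, x = y) ->
  exists u N w, datum D s P0 T u N w.
Proof.
move=> TZ D0; have cT := theta_closed J_jac (P0 := P0); case=> [[r kr]|triv]; last first.
  have nT z : ~ theta cl P0 z.
    by have [z' nz] := theta_proper TZ cT; rewrite (triv z z').
  have uE a : unit_at (tdiv T (cl D) a) a by apply: (tdiv_unit TZ).
  have [w wD] : exists w, is_cdiv_of w (0 - D).
    apply/(cl_principal J_jac); first by rewrite sub0r degN D0 oppr0.
    exact: triv.
  exists (fun _ => 0), 0, w; split=> // [|a].
    exact: (@greg_const _ (gv C) (gv J)).
  exists 0%N, (fun _ => 1), (fun _ => 1); split; [exact: vform1|exact: vform1| |].
    by apply: unit_gen (uE 0) _; apply: gen_true => z; rewrite !divr1.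
  apply: (ord_gen (f := fun _ => 1)).
    by rewrite coeff0; apply/(ord_unit C_curve)/unit_const/oner_neq0.
  by apply: gen_true => z; rewrite divr1.
set x := cl D; pose aj := abel_jacobi cl P0; have bc := bad_closed C_curve J_jac (P0 := P0) TZ (r := r).
have [y0 g0] := good_ex C_curve J_jac TZ kr char0.
have G1 := near_gen (bc _ g0).
have G2 : gen (S := gv J) (fun y => ~ bad cl P0 T r (y + x)).
  exists (y0 - x); apply: (greg_near (S := gv J) (T := gv J) (P := fun y => ~ bad cl P0 T r y) (greg_addr x)); rewrite subrK; exact: bc.
have [z0 nz0] := theta_proper TZ cT.
have off c : gen (S := gv J) (fun y => ~ theta cl P0 (y + c)).
  exists (z0 - c); apply: (greg_near (S := gv J) (T := gv J) (P := fun y => ~ theta cl P0 y) (greg_addr c)); rewrite subrK; exact: cT.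
have G3 := gen_all (S := gv J) irrJ (r := s) (P := fun a y => ~ theta cl P0 (y - aj a)) (fun a _ => off (- aj a)).
have G4 := gen_all (S := gv J) irrJ (r := s) (P := fun a y => ~ theta cl P0 (y + (x - aj a))) (fun a _ => off (x - aj a)).
have [y [[g g'] [h3 h4]]] := gen_ex (gen_and irrJ (gen_and irrJ G1 G2) (gen_and irrJ G3 G4)).
have [N [dN clN hN]] := good_div C_curve J_jac kr g.
have [N' [dN' clN' hN']] := good_div C_curve J_jac kr g'.
have d0 M : deg M = r.+1%:Z -> deg (M - << P0 >> *+ r.+1) = 0.
  by move=> dM; rewrite degB dM degMn degU natz subrr.
have clNN : cl (N' - N) = x.
  have -> : N' - N = (N' - << P0 >> *+ r.+1) - (N - << P0 >> *+ r.+1).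
    by rewrite opprB addrA subrK.
  by rewrite (clB J_jac) ?d0// clN clN' addrAC subrr add0r.
have dNN : deg (N' - N) = 0 by rewrite degB dN dN' subrr.
have [w wD] : exists w, is_cdiv_of w (N' - N - D).
  apply/(cl_principal J_jac); first by rewrite degB dNN D0 subrr.
  by rewrite (clB J_jac)// clNN subrr.
exists (fun Q => y - aj Q), (N' - N), w; split=> //.
- exact: (sub_greg J_jac).
- by move=> a b; rewrite (aj_diff J_jac P0) opprB addrC addrA subrK.
- exact: (tdiv_pull TZ kr g g' hN hN').
split=> // a /[dup] /h3 n3 /h4 n4; apply: (tdiv_unit TZ) => //.
by move: n4; rewrite addrA addrAC.
Qed.

End Autoduality.

(** * The Weil pairing *)

Section Divisors.
Variables (K : fieldType) (Kb : closedFieldType) (iota : {rmorphism K -> Kb}).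

Section OneVariety.
Variable X : variety iota.
Let irr := gvirr X.
Implicit Types (D E : divisor X).

Lemma cartier_nz D x : cartier D -> gen (S := gv X) (fun z => D x z != 0).
Proof. by move=> cD; have [nD _] := cD x; apply: nz_gen. Qed.

Lemma cartier_sub D E : cartier D -> cartier E -> cartier (div_sub D E).
Proof.
move=> cD cE x; have [nD /nearP uD] := cD x; have [nE /nearP uE] := cE x.
split; first exact: nz_div.
apply/nearP; apply: near_imp (near_and uD uE) _ => y [u1 u2].
apply: unit_gen (unitD u1 u2) _.
apply: gen_imp (gen_and irr (gen_and irr (nz_gen nD) (nz_gen nE)) (cartier_nz y cE)) _.
by move=> z [[D0 E0] E'0]; rewrite /div_sub; field; rewrite D0 E0 E'0.
Qed.

Lemma lin_refl D : cartier D -> lin_equiv D D.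
Proof.
move=> cD; exists (fun _ => 1); split; first exact/nz_const/oner_neq0.
move=> x; apply: unit_gen (unit_const x (oner_neq0 Kb)) _.
by apply: gen_imp (cartier_nz x cD) _ => z D0; rewrite /div_sub !divff// oner_neq0.
Qed.

Lemma lin_common D D1 D2 : cartier D -> cartier D1 -> cartier D2 ->
  lin_equiv D1 D -> lin_equiv D2 D -> lin_equiv D1 D2.
Proof.
move=> cD c1 c2 [f1 [n1 u1]] [f2 [n2 u2]]; exists (fun z => f1 z / f2 z).
split; first exact: nz_div.
move=> x; apply: unit_gen (unitD (u1 x) (u2 x)) _.
apply: gen_imp (gen_and irr (gen_and irr (cartier_nz x cD) (cartier_nz x c1))
  (gen_and irr (cartier_nz x c2) (nz_gen n2))) _ => z [[D0 D10] [D20 f20]].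
by rewrite /div_sub; field; rewrite D0 D10 D20 f20.
Qed.

Lemma div_const f g D : cartier D -> is_div_of f D -> is_div_of g D ->
  exists2 c, c != 0 & gen (S := gv X) (fun z => f z = c * g z).
Proof.
move=> cD [nf uf] [ng ug]; have [|c c0 E] := @unit_everywhere_const _ _ _ X (fun z => f z / g z).
  move=> x; apply: unit_gen (unitD (uf x) (ug x)) _.
  apply: gen_imp (gen_and irr (cartier_nz x cD) (nz_gen ng)) _ => z [D0 g0].
  by field; rewrite D0 g0.
by exists c => //; apply: gen_imp (gen_and irr E (nz_gen ng)) _ => z [<- g0]; rewrite divfK.
Qed.

End OneVariety.

Section Map.
Variables (X Y : variety iota) (u : pts X -> pts Y).
Hypotheses (ru : greg (S := gv X) (T := gv Y) u) (su : forall y, exists x, u x = y).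

Lemma cartier_pullback D : cartier D -> cartier (pullback u D).
Proof.
move=> cD x; have [nD /nearP uD] := cD (u x); split; first exact: (nz_comp ru su nD).
apply/nearP; apply: near_imp (greg_near ru uD) _ => y uy.
exact: (unit_comp (f := fun z => D (u y) z / D (u x) z) ru su uy).
Qed.

Lemma div_pull f D : is_div_of f D -> is_div_of (fun z => f (u z)) (pullback u D).
Proof.
move=> [nf uf]; split; first exact: nz_comp.
by move=> x; apply: (unit_comp (f := fun z => f z / D (u x) z) ru su (uf (u x))).
Qed.

End Map.
End Divisors.

Section Weil.
Variables (K : fieldType) (Kb : closedFieldType) (iota : {rmorphism K -> Kb}).
Variables (A J : abvar iota) (phi : pts A -> pts J) (phi_isog : isogeny phi).
Let irrA := gvirr A.
Local Notation gen := (@gen Kb (gv A)).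

Lemma phi_greg : greg (S := gv A) (T := gv J) phi.
Proof. by have [h _ _ _] := phi_isog; apply: morphism_greg. Qed.

Lemma phiD x y : phi (x + y) = phi x + phi y. Proof. by have [_ h _ _] := phi_isog. Qed.

Lemma phi_surj y : exists x, phi x = y. Proof. by have [_ _ h _] := phi_isog. Qed.

Lemma phi0 : phi 0 = 0.
Proof. by apply: (addrI (phi 0)); rewrite -phiD !addr0. Qed.

Lemma phiN x : phi (- x) = - phi x.
Proof. by apply: (addrI (phi x)); rewrite -phiD !subrr phi0. Qed.

Lemma phiB x y : phi (x - y) = phi x - phi y. Proof. by rewrite phiD phiN. Qed.

Lemma phiMz x (m : int) : phi (x *~ m) = phi x *~ m.
Proof.
have phiMn y k : phi (y *+ k) = phi y *+ k.
  by elim: k => [|k IH]; rewrite ?mulr0n ?phi0// !mulrS phiD IH.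
by case: m => m; rewrite -?pmulrn ?phiMn// !NegzE !mulrNz phiN -!pmulrn phiMn.
Qed.

Lemma phi_sum (I : Type) (s : seq I) (F : I -> pts A) :
  phi (\sum_(i <- s) F i) = \sum_(i <- s) phi (F i).
Proof. by elim: s => [|i s IH]; rewrite ?big_nil ?phi0// !big_cons phiD IH. Qed.

Lemma gen_translate (P : pts A -> Prop) k : gen P -> gen (fun z => P (z + k)).
Proof.
by apply: (greg_gen (gvirr A) (greg_addr k)) => y; exists (y - k); rewrite subrK.
Qed.

Definition one_class (c : set (divisor J)) :=
  (forall D, c D -> cartier D) /\ forall D D', c D -> c D' -> lin_equiv D D'.

Variables (c : set (divisor J)) (c1 : one_class c).

Lemma weil_pre D g k : c D -> is_div_of g (pullback phi D) -> phi k = 0 ->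
  exists2 e, e != 0 & gen (fun x => g x = e * g (x + k)).
Proof.
move=> cD [ng ug] k0; have nk := gen_translate k (nz_gen ng).
have [|e e0 E] := @unit_everywhere_const _ _ _ A (fun z => g z / g (z + k)).
  move=> x; have u2 : unit_at (fun z => g (z + k) / pullback phi D (x + k) (z + k)) x.
    apply: (unit_comp (f := fun z => g z / pullback phi D (x + k) z) (greg_addr k) _ (ug (x + k))).
    by move=> y; exists (y - k); rewrite subrK.
  apply: unit_gen (unitD (ug x) u2) _.
  have cP := cartier_pullback phi_greg phi_surj (c1.1 _ cD).
  apply: gen_imp (gen_and irrA (cartier_nz x cP) (gen_and irrA nk (nz_gen ng))) _ => z [D0 [g0 _]].
  rewrite /pullback !phiD k0 !addr0 in D0 *.
  by field; rewrite D0 g0.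
exists e => //; apply: gen_imp (gen_and irrA E nk) _ => z [<- g0]; by rewrite divfK.
Qed.

(** The pairing is computed from some pair [D'], [g']. As [D'] and [D] differ by the divisor of some
    [h], [g'] is a constant times [h o phi] times [g]; since [h o phi] is invariant under
    translation by [k], [g] and [g'] have the same multiplier. *)
Lemma weilP D g k : c D -> is_div_of g (pullback phi D) -> phi k = 0 ->
  weil_pairing phi k c != 0 /\ gen (fun x => g x = weil_pairing phi k c * g (x + k)).
Proof.
move=> cD gD k0; have [e0 e0n E0] := weil_pre cD gD k0.
have [D' [g' [cD' gD' /genP E']]] : [set e | exists D g, [/\ c D, is_div_of g (pullback phi D)
    & generically (fun x : pts A => g x = e * g (x + k))]]%classic (weil_pairing phi k c).
  by apply: (@xgetPex _ 1); exists e0, D, g; split=> //; apply/genP.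
set e := weil_pairing phi k c in E' *.
have [h [nh uh]] := c1.2 _ _ cD' cD.
have [ng ug] := gD; have [ng' ug'] := gD'.
have hphi := div_pull phi_greg phi_surj (conj nh uh); have [nhp uhp] := hphi.
have cP := cartier_pullback phi_greg phi_surj (c1.1 _ cD).
have cP' := cartier_pullback phi_greg phi_surj (c1.1 _ cD').
have dg : is_div_of (fun z => h (phi z) * g z) (pullback phi D').
  split; first exact: nzM.
  move=> x; apply: unit_gen (unitM (uhp x) (ug x)) _.
  apply: gen_imp (gen_and irrA (cartier_nz x cP) (cartier_nz x cP')) _ => z.
  by rewrite /pullback /div_sub => -[D0 D'0]; field; rewrite D0 D'0.
have [c' c'0 Eg] := div_const cP' gD' dg.
have nk := gen_translate k (nz_gen ng).
have E : gen (fun x => g x = e * g (x + k)).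
  apply: gen_imp (gen_and irrA (gen_and irrA Eg (gen_translate k Eg)) (gen_and irrA E' (nz_gen nhp))) _.
  move=> z [[-> ->]] []; rewrite phiD k0 addr0 => H h0.
  apply: (mulfI h0); apply: (mulfI c'0); rewrite H; ring.
split=> //; apply/eqP => ez; have [z [Ez gz]] := gen_ex (gen_and irrA E (nz_gen ng)).
by rewrite Ez ez mul0r eqxx in gz.
Qed.

Variables (D0 : divisor J) (g0 : pts A -> Kb) (cD0 : c D0) (gD0 : is_div_of g0 (pullback phi D0)).
Local Notation e k := (weil_pairing phi k c).

Lemma weil_neq0 k : phi k = 0 -> e k != 0. Proof. by case/(weilP cD0 gD0). Qed.

Lemma weil_uniq k a : phi k = 0 -> gen (fun x => g0 x = a * g0 (x + k)) -> e k = a.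
Proof.
move=> k0 E; have [_ E'] := weilP cD0 gD0 k0; have [ng _] := gD0.
have [z [[-> E1] gz]] := gen_ex (gen_and irrA (gen_and irrA E' E) (gen_translate k (nz_gen ng))).
exact: (mulIf gz).
Qed.

Lemma weilD k l : phi k = 0 -> phi l = 0 -> e (k + l) = e k * e l.
Proof.
move=> k0 l0; apply: weil_uniq; first by rewrite phiD k0 l0 addr0.
have [_ E1] := weilP cD0 gD0 k0; have [_ E2] := weilP cD0 gD0 l0.
apply: gen_imp (gen_and irrA E1 (gen_translate k E2)) _ => z [-> ->].
by rewrite mulrA addrA.
Qed.

Lemma weil0 : e 0 = 1.
Proof.
apply: weil_uniq; first exact: phi0.
by have [x _] := irrA.1; exists x; apply: near_T => z; rewrite addr0 mul1r.
Qed.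

Lemma weilN k : phi k = 0 -> e (- k) = (e k)^-1.
Proof.
move=> k0; apply: (mulIf (weil_neq0 k0)); rewrite mulVf ?weil_neq0//.
by rewrite -weilD ?phiN ?k0 ?oppr0// addNr weil0.
Qed.

Lemma weilMz k (m : int) : phi k = 0 -> e (k *~ m) = e k ^ m.
Proof.
move=> k0; have H l : e (k *+ l) = e k ^+ l.
  elim: l => [|l IH]; first by rewrite mulr0n weil0.
  by rewrite mulrS weilD ?IH ?exprS// (pmulrn k l) phiMz k0 mul0rz.
case: m => m; first by rewrite -pmulrn H.
rewrite NegzE mulrNz -pmulrn weilN ?H//.
by rewrite (pmulrn k) phiMz k0 mul0rz.
Qed.

Lemma weil_sum (I : Type) (s : seq I) (k : I -> pts A) : (forall i, phi (k i) = 0) ->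
  e (\sum_(i <- s) k i) = \prod_(i <- s) e (k i).
Proof.
move=> k0; elim: s => [|i s IH]; first by rewrite !big_nil weil0.
rewrite !big_cons weilD ?IH// phi_sum big1// => j _; exact: k0.
Qed.

End Weil.

(** * Divisors in the polarization class *)

Section PolarizationClass.
Variables (K : fieldType) (Kb : closedFieldType) (iota : {rmorphism K -> Kb}).
Variables (C : variety iota) (J : abvar iota) (cl : cdiv C -> pts J).
Variables (A : abvar iota) (phi : pts A -> pts J) (phi_isog : isogeny phi).
Variables (x : pts J) (dk : dual_ker phi (polarization cl x)).

Lemma pol_one_class : one_class (polarization cl x).
Proof.
have [[D0 [cD0 _ ->]] _] := dk; split=> [D []//|D D' [c1 l1] [c2 l2]].
exact: lin_common cD0 c1 c2 l1 l2.
Qed.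

Lemma pol_translate a D D' : polarization cl x D -> polarization cl x D' -> lin_equiv (translate a D) D'.
Proof.
have [[D0 [cD0 tD0 ->]] _] := dk => -[c1 [f f1]] [c2 l2].
have ra : greg (S := gv J) (T := gv J) (fun z => z + a) := greg_addr a.
have cta E : cartier E -> cartier (translate a E) by exact: (cartier_pullback ra (translate_surj a)).
apply: (lin_common (D := D0)) => //; first exact: cta.
have [h [nh uh]] := tD0 a; have [nf uf] := div_pull ra (translate_surj a) f1.
exists (fun z => f (z + a) * h z); split; first exact: nzM.
move=> z; apply: unit_gen (unitM (uf z) (uh z)) _; have irr := gvirr J.
apply: gen_imp (gen_and irr (cartier_nz z (cta _ cD0)) (gen_and irr (cartier_nz z cD0) (cartier_nz z (cta _ c1)))) _.
move=> y; rewrite /translate /pullback /div_sub => -[d1 [d2 d3]].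
by field; rewrite d1 d2 d3.
Qed.

Lemma pol_tdiv P0 T : is_divisor_of_set T (theta cl P0) -> polarization cl x (tdiv T x).
Proof.
move=> TZ; exists P0, T; split=> //; have [cT _] := TZ.
have c1 : cartier (tdiv T x).
  exact: (cartier_sub (cartier_pullback (greg_addr x) (translate_surj x) cT) cT).
by split=> //; apply: lin_refl.
Qed.

Lemma pol_ex : exists P0 T, is_divisor_of_set T (theta cl P0).
Proof.
have [[D0 [cD0 _ E]] _] := dk; have : polarization cl x D0 by rewrite E; split=> //; apply: lin_refl.
by move=> [P0 [T [h _]]]; exists P0, T.
Qed.

Lemma pol_pull D : polarization cl x D -> exists g, is_div_of g (pullback phi D).
Proof.
move=> pD; have [_ E] := dk; have cD := pol_one_class.1 _ pD.
have cP := cartier_pullback (phi_greg phi_isog) (phi_surj phi_isog) cD.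
have : dual_isogeny phi (polarization cl x) (pullback phi D).
  by exists D => //; split=> //; apply: lin_refl.
rewrite E => -[_ [g [ng ug]]]; exists g; split=> // y.
by apply: unit_gen (ug y) _; exists y; apply: near_T => z; rewrite /div_sub /div0 divr1.
Qed.

End PolarizationClass.

(** * Roots of f(E) *)

Section PulldivOperations.
Variables (K : fieldType) (Kb : closedFieldType) (iota : {rmorphism K -> Kb}).
Variables (C : variety iota) (C_curve : smooth_curve C) (J : abvar iota).
Variables (u : pts C -> pts J) (ru : greg (S := gv C) (T := gv J) u).
Let irrC := gvirr C.
Let irrJ := gvirr J.

Lemma pulldiv_translate (E : divisor J) N t : pulldiv E (fun a => u a + t) N -> pulldiv (translate t E) u N.
Proof.
move=> pE a; have [n [A [B [fA fB uAB o]]]] := pE a.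
have [c [i [c0 hc]]] := greg_addr t (u a) n.
have [G fG G0] := vform_nv (X := J) n (u a + t).
exists i, (fun z => c z * A (z + t)), (fun z => c z * B (z + t)); split; [exact: hc|exact: hc| |].
  apply: unit_gen (unit_comp (greg_addr t) (translate_surj t) uAB) _.
  have h : c (u a) * G (u a + t) != 0 by rewrite mulf_neq0.
  apply: gen_imp (gen_form (S := gv J) (hc _ fG) h) _ => z; rewrite mulf_eq0 negb_or => /andP[cz _].
  by rewrite -mulf_div divff// mul1r.
apply: ord_gen o _; have h : c (u a) * G (u a + t) != 0 by rewrite mulf_neq0.
apply: gen_imp (near_gen (greg_near ru (near_form (S := gv J) (hc _ fG) h))) _ => Q.
by rewrite mulf_eq0 negb_or => /andP[cz _]; rewrite -mulf_div divff// mul1r.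
Qed.

Lemma pulldiv_sub (E E' : divisor J) N N' : pulldiv E u N -> pulldiv E' u N' ->
  pulldiv (div_sub E E') u (N - N').
Proof.
move=> pE pE' a; have [n [A [B [fA fB uAB o]]]] := pE a.
have [n' [A' [B' [fA' fB' uAB' o']]]] := pE' a.
exists (n + n')%R, (fun z => A z * B' z), (fun z => B z * A' z); split.
- exact: vformM fA fB'.
- exact: vformM fB fA'.
- apply: unit_gen (unitD uAB uAB') _.
  apply: gen_imp (gen_and irrJ (nz_gen (unit_nz uAB)) (nz_gen (unit_nz uAB'))) _ => z.
  move=> [/frac_nz[E0 /frac_nz[A0 B0]] /frac_nz[E'0 /frac_nz[A'0 B'0]]].
  by rewrite /div_sub; field; rewrite ?A0 ?B0 ?E'0 ?A'0 ?B'0.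
rewrite coeffB; apply: ord_gen (ordD C_curve o o') _.
apply: gen_imp (gen_and irrC (ord_gen_nz C_curve o) (ord_gen_nz C_curve o')) _ => Q [/frac_nz[A0 B0] /frac_nz[A'0 B'0]].
by field; rewrite ?A0 ?B0 ?A'0 ?B'0.
Qed.

End PulldivOperations.

Section RValue.
Variables (K : fieldType) (Kb : closedFieldType) (iota : {rmorphism K -> Kb}).
Variables (C : variety iota) (C_curve : smooth_curve C).
Variables (J : abvar iota) (cl : cdiv C -> pts J) (J_jac : is_jacobian cl).
Variables (A : abvar iota) (phi : pts A -> pts J) (phi_isog : isogeny phi).
Variables (Ev : cdiv C) (Ev0 : deg Ev = 0).
Let irrC := gvirr C.
Let irrJ := gvirr J.
Let irrA := gvirr A.
Let rph := phi_greg phi_isog.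
Let sph := phi_surj phi_isog.

Definition descent_prod (g : pts A -> Kb) (w : pts C -> Kb) (X : pts C -> pts A) :=
  \prod_(a <- dom Ev) (value g (X a) / value w a) ^ coeff a Ev.

Definition descent_pt (X : pts C -> pts A) := \sum_(a <- dom Ev) X a *~ coeff a Ev.

(** [rho] is the number r_i of the overview. It is a relation, not a function of a chosen datum, so
    that conjugation by Galois can be applied to a whole datum before uniqueness is invoked. *)
Definition descent_root D P rho := exists P0 T u N w g X, [/\ datum cl D (dom Ev) P0 T u N w,
  is_div_of g (pullback phi (tdiv T (cl D))), forall a, phi (X a) = u a &
  rho = descent_prod g w X * weil_pairing phi (descent_pt X + P) (polarization cl (cl D))].

Lemma deg_dom : \sum_(a <- dom Ev) coeff a Ev = 0.
Proof.
rewrite -[RHS]Ev0 -[Ev in RHS]freeg_sumE raddf_sum /=.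
by apply: eq_bigr => p _; rewrite degU.
Qed.

(** Degree 0 makes evaluation insensitive to constant factors; this absorbs the undetermined
    constants in the comparisons below. *)
Lemma prod_scale c (F G : pts C -> Kb) : c != 0 ->
  (forall a, a \in dom Ev -> F a = c * G a) ->
  \prod_(a <- dom Ev) F a ^ coeff a Ev = \prod_(a <- dom Ev) G a ^ coeff a Ev.
Proof.
move=> c0 FG; have c1 : \prod_(a <- dom Ev) c ^ coeff a Ev = 1.
  rewrite -[RHS](expr0z c) -[in RHS]deg_dom.
  by elim: (dom Ev) => [|a s IH]; rewrite ?big_nil ?expr0z// !big_cons expfzDr// IH.
rewrite -[RHS]mul1r -[X in X * _]c1.
rewrite -big_split /= big_seq [RHS]big_seq; apply: eq_bigr => a aE.
by rewrite FG// expfzMl.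
Qed.

Section OneClass.
Variables (D : cdiv C) (D0 : deg D = 0) (dk : dual_ker phi (polarization cl (cl D))).
Hypothesis disj : forall a, a \in dom Ev -> a \notin dom D.
Local Notation pol := (polarization cl (cl D)).
Local Notation e k := (weil_pairing phi k pol).

Section OneDatum.
Variables (P0 : pts C) (T : divisor J) (u : pts C -> pts J) (N : cdiv C) (w : pts C -> Kb).
Variables (dat : datum cl D (dom Ev) P0 T u N w).
Variables (g : pts A -> Kb) (gD : is_div_of g (pullback phi (tdiv T (cl D)))).
Let pT : pol (tdiv T (cl D)).
Proof. by have [TZ _ _ _ _] := dat; apply: pol_tdiv TZ. Qed.
Let c1 := pol_one_class dk.

Lemma sum_u : \sum_(a <- dom Ev) u a *~ coeff a Ev = - cl Ev.
Proof.
have [b _] := irrC.1; have [_ _ uB _ _] := dat.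
have ua a : u a = u b - abel_jacobi cl b a.
  by rewrite -[u a](subrK (u b)) uB addrC /abel_jacobi -(clN J_jac) ?deg_diff// opprB.
under eq_bigr do rewrite ua mulrzBl; rewrite sumrB (cl_aj J_jac b Ev0).
suff -> : \sum_(a <- dom Ev) u b *~ coeff a Ev = 0 by rewrite sub0r.
by rewrite -mulrz_sumr deg_dom.
Qed.

Section OneLift.
Variables (X : pts C -> pts A) (XE : forall a, phi (X a) = u a).

Lemma phi_descent_pt : phi (descent_pt X) = - cl Ev.
Proof.
rewrite (phi_sum phi_isog) -sum_u; apply: eq_bigr => a _.
by rewrite (phiMz phi_isog) XE.
Qed.

Lemma ker_descent_pt P : phi P = cl Ev -> phi (descent_pt X + P) = 0.
Proof. by move=> PE; rewrite (phiD phi_isog) phi_descent_pt PE addNr. Qed.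

Lemma datum_units a : a \in dom Ev -> unit_at w a /\ unit_at g (X a).
Proof.
move=> aE; have [_ ru _ pN [[nw wD] uE]] := dat; split.
  apply/(ord_unit C_curve); have /(has_ordP C_curve) := wD a.
  rewrite coeffB (pulldiv_unit C_curve ru pN (uE _ aE)) coeff_outdom ?subr0//.
  exact: disj.
have [ng ug] := gD; have uE' : unit_at (fun z => tdiv T (cl D) (phi (X a)) (phi z)) (X a).
  by apply: (unit_comp (f := tdiv T (cl D) (phi (X a))) rph sph); rewrite XE; apply: uE.
apply: unit_gen (unitM (ug (X a)) uE') _; apply: gen_imp (nz_gen (unit_nz uE')) _ => z.
by rewrite /pullback => z0; rewrite divfK.
Qed.

End OneLift.

(** Moving [X a] by a kernel element [k a] divides the value of [g] by [e (k a)] and moves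
    [descent_pt] by multiples of the [k a]; additivity of the pairing makes both changes cancel. *)
Lemma lift_indep X X' P : (forall a, phi (X a) = u a) -> (forall a, phi (X' a) = u a) -> phi P = cl Ev ->
  descent_prod g w X * e (descent_pt X + P) = descent_prod g w X' * e (descent_pt X' + P).
Proof.
move=> XE XE' PE; pose k a := X' a - X a.
have k0 a : phi (k a) = 0 by rewrite (phiB phi_isog) XE XE' subrr.
have kz0 a : phi (k a *~ coeff a Ev) = 0 by rewrite (phiMz phi_isog) k0 mul0rz.
have SX : descent_pt X' = descent_pt X + \sum_(a <- dom Ev) k a *~ coeff a Ev.
  by rewrite /descent_pt -big_split /=; apply: eq_bigr => a _; rewrite -mulrzDl addrC subrK.
have vE a : a \in dom Ev -> value g (X a) = e (k a) * value g (X' a).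
  move=> aE; have [_ ug'] := datum_units XE' aE; have [_ hv] := unit_value ug'.
  apply: valueE; have [_ E] := weilP phi_isog c1 pT gD (k0 a).
  have Xk : X a + k a = X' a by rewrite addrC subrK.
  have h := has_value_comp (f := g) (x := X a) (v := value g (X' a)) (greg_addr (k a)) _ _.
  have {}h : has_value (fun z => g (z + k a)) (X a) (value g (X' a)).
    by apply: h => [y|]; [exists (y - k a); rewrite subrK|rewrite Xk].
  by apply: has_value_gen (has_valueM (has_value_const (e (k a)) (X a)) h) _; apply: gen_imp E _.
have -> : descent_prod g w X = \prod_(a <- dom Ev) e (k a) ^ coeff a Ev * descent_prod g w X'.
  rewrite /descent_prod -big_split /= big_seq [RHS]big_seq; apply: eq_bigr => a aE.
  by rewrite vE// -expfzMl mulrA.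
have -> : \prod_(a <- dom Ev) e (k a) ^ coeff a Ev = e (\sum_(a <- dom Ev) k a *~ coeff a Ev).
  rewrite (weil_sum phi_isog c1 pT gD _ kz0); apply: eq_bigr => a _.
  by rewrite (weilMz phi_isog c1 pT gD).
set k1 := \sum_(a <- dom Ev) k a *~ coeff a Ev in SX *.
have k10 : phi k1 = 0 by rewrite (phi_sum phi_isog) big1// => a _; exact: kz0.
have -> : descent_pt X' + P = (descent_pt X + P) + k1 by rewrite SX addrAC.
rewrite (weilD phi_isog c1 pT gD (ker_descent_pt XE PE) k10).
by move: (e k1) (e (descent_pt X + P)) => a b; ring.
Qed.

(* q (t_x^* T - T) is principal, by telescoping the translates of t_x^* T - T
   by the multiples of x. *)
Lemma multiple_principal q : cl D *+ q = 0 ->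
  exists h, is_div_of h (fun x z => tdiv T (cl D) x z ^+ q).
Proof.
move=> x0; set x := cl D in x0 *; have [cT _] : is_divisor_of_set T (theta cl P0) by have [] := dat.
have cE := c1.1 _ pT.
have tr a : exists h, is_div_of h (div_sub (translate a (tdiv T x)) (tdiv T x)) := pol_translate dk a pT pT.
have H m : exists h, nzrational h /\ forall z, unit_at (fun y =>
    h y * tdiv T x z y ^+ m / (translate (x *+ m) T z y / T z y)) z.
  elim: m => [|m [h [nh uh]]].
    exists (fun _ => 1); split=> [|z]; first exact/nz_const/oner_neq0.
    apply: unit_gen (unit_const z (oner_neq0 Kb)) _.
    apply: gen_imp (cartier_nz z cT) _ => y T0.
    by rewrite expr0 mulr0n /translate /pullback !addr0 divff// mulr1 divr1.
  have [k [nk uk]] := tr (x *+ m); exists (fun y => h y * k y); split; first exact: nzM.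
  move=> z; apply: unit_gen (unitM (uh z) (uk z)) _.
  have n1 := cartier_nz z (cartier_pullback (greg_addr (x *+ m)) (translate_surj (x *+ m)) cT).
  have n2 := cartier_nz z (cartier_pullback (greg_addr (x *+ m.+1)) (translate_surj (x *+ m.+1)) cT).
  apply: gen_imp (gen_and irrJ (gen_and irrJ n1 n2) (gen_and irrJ (cartier_nz z cT) (cartier_nz z cE))) _.
  move=> y [[]]; rewrite /div_sub /translate /pullback => a1 a2 [a3 a4].
  have -> : tdiv T x (z + x *+ m) (y + x *+ m) = T (z + x *+ m.+1) (y + x *+ m.+1) / T (z + x *+ m) (y + x *+ m).
    by rewrite /tdiv /div_sub /translate /pullback mulrSr !addrA.
  by rewrite exprS; move: (tdiv T x z y) a4 => E E0; field; rewrite ?a1 ?a2 ?a3 ?E0.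
have [h [nh uh]] := H q; exists (fun y => (h y)^-1); split; first exact: nzV.
move=> z; apply: unit_gen (unitV (uh z)) _.
apply: gen_imp (gen_and irrJ (cartier_nz z cT) (nz_gen nh)) _ => y [T0 h0].
by rewrite x0 /translate /pullback !addr0 divff// divr1 invfM.
Qed.

(** Let [h] have divisor [q] times [tdiv T (cl D)]. On [A], [h o phi] is [g ^+ q] up to a constant;
    on [C], the restriction of [h] is [w ^+ q * f] up to a constant. Comparing at [X a] over [u a],
    [(g / w) ^+ q] is a constant times [f]. *)
Lemma descent_prod_exp q f X : is_cdiv_of f (D *+ q) -> (forall a, phi (X a) = u a) ->
  descent_prod g w X ^+ q = eval_cdiv f Ev.
Proof.
move=> fD XE; have [TZ ru uB pN [wD uE]] := dat.
have x0 : cl D *+ q = 0.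
  rewrite -(clMn J_jac)//; apply/(cl_principal J_jac); first by rewrite degMn D0 mul0rn.
  by exists f.
have [h hD] := multiple_principal x0; have [nh uh] := hD.
have [h' [rh h'D]] := restriction_ex C_curve ru pN hD.
have wf : is_cdiv_of (fun z => w z ^+ q * f z) (N *+ q).
  have o a : ord_at (fun z => w z ^+ q * f z) a (coeff a (N *+ q)).
    have /(has_ordP C_curve) o1 := wD.2 a; have /(has_ordP C_curve) o2 := fD.2 a.
    have := ordM C_curve (ordX C_curve q o1) o2.
    by rewrite -coeffMn -coeffD -mulrnDl subrK.
  have [b _] := irrC.1; split; first exact: (ord_nz C_curve (o b)).
  by move=> a; apply/(has_ordP C_curve).
have [c c0 E1] := cdiv_const C_curve h'D wf.
have [ng ug] := gD; have [_ uhp] := div_pull rph sph hD.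
have [|c2 c20 E2] := @unit_everywhere_const _ _ _ A (fun z => h (phi z) / g z ^+ q).
  move=> x; apply: unit_gen (unitD (uhp x) (unitX q (ug x))) _.
  have cE := cartier_pullback rph sph (c1.1 _ pT).
  apply: gen_imp (gen_and irrA (cartier_nz x cE) (nz_gen ng)) _ => z [e0 g0].
  by rewrite expr_div_n; have := expf_neq0 q e0; have := expf_neq0 q g0; rewrite /pullback => g' e'; field; rewrite ?g' ?e'.
have val a : a \in dom Ev -> (value g (X a) / value w a) ^+ q = (c / c2) * value f a.
  move=> aE; have [uw ugX] := datum_units XE aE.
  have [w0 hw] := unit_value uw; have [g0 hg] := unit_value ugX.
  have [f0 hf] : value f a != 0 /\ has_value f a (value f a).
    apply: unit_value; apply/(ord_unit C_curve); have /(has_ordP C_curve) := fD.2 a.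
    by rewrite coeffMn coeff_outdom ?mul0rn//; apply: disj.
  have uhu : unit_at h (u a).
    have uEq := unitX q (uE a aE); apply: unit_gen (unitM (uh (u a)) uEq) _.
    by apply: gen_imp (nz_gen (unit_nz uEq)) _ => z z0; rewrite divfK.
  have [v0 hv] := unit_value uhu; set v := value h (u a) in v0 hv.
  have h1 := restr_value_eq ru rh hv.
  have h2 : has_value (fun z => h (phi z)) (X a) v.
    by apply: (has_value_comp rph sph); rewrite XE.
  have h3 := has_valueM (has_value_const c a) (has_valueM (has_valueX q hw) hf).
  have v1 := has_value_uniq h1 (has_value_gen h3 (gen_imp E1 (fun z E => esym E))).
  have h4 := has_valueM (has_value_const c2 (X a)) (has_valueX q hg).
  have v2 : v = c2 * value g (X a) ^+ q.
    apply: (has_value_uniq h2); apply: has_value_gen h4 _.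
    apply: gen_imp (gen_and irrA E2 (nz_gen ng)) _ => z [<- gz].
    by rewrite divfK// expf_neq0.
  rewrite expr_div_n; have := expf_neq0 q w0; move: v1; rewrite v2.
  move: (value g _ ^+ q) (value w _ ^+ q) => gq wq E wq0.
  have -> : gq = c * (wq * value f a) / c2 by rewrite -E mulrC mulKf.
  by field; rewrite ?c20 ?wq0.
rewrite /descent_prod /eval_cdiv -(prod_scale (c := c / c2) (F := fun a => (value g (X a) / value w a) ^+ q) _ val).
  by rewrite -prodrXl; apply: eq_bigr => a _; exact: (exprzAC _ _ q%:Z).
by rewrite mulf_neq0 ?invr_neq0.
Qed.

End OneDatum.

(** The two maps differ by a translation [t = phi sg]. Shifting the lifts by [sg] leaves
    [descent_pt] unchanged as [Ev] has degree 0. A function [k] on [J] relates the first divisor to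
    the translate of the second; it changes [g] by [k o phi] and [w] by its restriction along [u],
    which agree at corresponding points. *)
Lemma datum_indep P0 T u N w g X P0' T' u' N' w' g' X' P :
  datum cl D (dom Ev) P0 T u N w -> datum cl D (dom Ev) P0' T' u' N' w' ->
  is_div_of g (pullback phi (tdiv T (cl D))) -> is_div_of g' (pullback phi (tdiv T' (cl D))) ->
  (forall a, phi (X a) = u a) -> (forall a, phi (X' a) = u' a) -> phi P = cl Ev ->
  descent_prod g w X * e (descent_pt X + P) = descent_prod g' w' X' * e (descent_pt X' + P).
Proof.
move=> dat dat' gD gD' XE XE' PE.
have [TZ ru uB pN [wD uE]] := dat; have [TZ' ru' uB' pN' [wD' uE']] := dat'.
have [b _] := irrC.1; pose t := u' b - u b; have [sg sgE] := sph t.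
have ut a : u' a = u a + t.
  rewrite -[LHS](subrK (u' b)) (_ : u' a - u' b = u a - u b); last by rewrite uB uB'.
  by rewrite /t -addrA [- u b + _]addrC.
pose X2 a := X a + sg; have X2E a : phi (X2 a) = u' a by rewrite (phiD phi_isog) XE sgE ut.
rewrite (lift_indep dat' gD' XE' X2E PE).
have -> : descent_pt X2 = descent_pt X.
  rewrite /descent_pt /X2; under eq_bigr do rewrite mulrzDl.
  by rewrite big_split /= -mulrz_sumr deg_dom mulr0z addr0.
congr (_ * _); set x := cl D in gD gD' TZ TZ' pN pN' uE uE' *.
pose E2 := translate t (tdiv T' x).
have pE := pol_tdiv (cl D) TZ; have pE' := pol_tdiv (cl D) TZ'.
have cE := (pol_one_class dk).1 _ pE; have cE' := (pol_one_class dk).1 _ pE'.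
have cE2 : cartier E2 := cartier_pullback (greg_addr t) (translate_surj t) cE'.
have [k kD] := pol_translate dk t pE' pE; have [nk uk] := kD.
have sgs y : exists z : pts A, z + sg = y by exists (y - sg); rewrite subrK.
have g2D : is_div_of (fun z => g' (z + sg)) (pullback phi E2).
  have := div_pull (greg_addr sg) sgs gD'; congr is_div_of.
  by apply/funext => y; apply/funext => z; rewrite /E2 /translate /pullback !(phiD phi_isog) sgE.
have g3D : is_div_of (fun z => g z * k (phi z)) (pullback phi E2).
  have [nkp ukp] := div_pull rph sph kD; have [ng ug] := gD.
  split; first exact: nzM.
  move=> z; apply: unit_gen (unitM (ug z) (ukp z)) _.
  have n1 := cartier_nz z (cartier_pullback rph sph cE); have n2 := cartier_nz z (cartier_pullback rph sph cE2).
  apply: gen_imp (gen_and irrA n1 n2) _ => y; rewrite /pullback /div_sub -/E2 => -[a1 a2].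
  by field; rewrite ?a1 ?a2.
have [c c0 Eg] := div_const (cartier_pullback rph sph cE2) g2D g3D.
have pE2 : pulldiv E2 u N'.
  apply: (pulldiv_translate ru); rewrite (_ : (fun a => _) = u') //.
  by apply/funext => a; rewrite ut.
have kD1 : is_div_of k (fun y z => div_sub E2 (tdiv T x) y z ^+ 1) by [].
have [k' [rk k'D]] := restriction_ex C_curve ru (pulldiv_sub C_curve pE2 pN) kD1.
have wk : is_cdiv_of (fun z => w z * k' z) (N' - D).
  have o a : ord_at (fun z => w z * k' z) a (coeff a (N' - D)).
    have /(has_ordP C_curve) o1 := wD.2 a; have /(has_ordP C_curve) o2 := k'D.2 a.
    have := ordM C_curve o1 o2; rewrite mulr1n -coeffD.
    by rewrite (_ : N - D + (N' - N) = N' - D)// addrC addrA subrK.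
  split; first exact: (ord_nz C_curve (o b)).
  by move=> a; apply/(has_ordP C_curve).
have [c' c'0 Ew] := cdiv_const C_curve wD' wk.
symmetry; apply: (prod_scale (c := c / c')); first by rewrite mulf_neq0 ?invr_neq0.
move=> a aE; have [uw ugX] := datum_units dat gD XE aE.
have [w0 hw] := unit_value uw; have [g0 hg] := unit_value ugX.
have uku : unit_at k (u a).
  have u1 : unit_at (E2 (u a)) (u a).
    apply: (unit_comp (f := tdiv T' x (u a + t)) (greg_addr t) (translate_surj t)).
    by rewrite -ut; apply: uE'.
  have u3 := unitD u1 (uE a aE); apply: unit_gen (unitM (uk (u a)) u3) _.
  by apply: gen_imp (nz_gen (unit_nz u3)) _ => z z0; rewrite divfK.
have [v0 hv] := unit_value uku; set v := value k (u a) in v0 hv.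
have hk' := restr_value_eq ru rk hv.
have hkp : has_value (fun z => k (phi z)) (X a) v.
  by apply: (has_value_comp rph sph); rewrite XE.
have -> : value w' a = c' * (value w a * v).
  apply: valueE; apply: has_value_gen (has_valueM (has_value_const c' a) (has_valueM hw hk')) _.
  by apply: gen_imp Ew _ => z.
have -> : value g' (X2 a) = c * (value g (X a) * v).
  have [_ ug2] := datum_units dat' gD' X2E aE; have [_ hg2] := unit_value ug2.
  have h2 : has_value (fun z => g' (z + sg)) (X a) (value g' (X2 a)).
    exact: (has_value_comp (f := g') (greg_addr sg) sgs).
  apply: (has_value_uniq h2).
  apply: has_value_gen (has_valueM (has_value_const c (X a)) (has_valueM hg hkp)) _.
  by apply: gen_imp Eg _ => z.
by field; rewrite ?c'0 ?w0 ?v0.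
Qed.

Lemma descent_root_uniq P rho rho' : phi P = cl Ev -> descent_root D P rho -> descent_root D P rho' -> rho = rho'.
Proof.
move=> PE [P0 [T [u [N [w [g [X [dat gD XE ->]]]]]]]] [P0' [T' [u' [N' [w' [g' [X' [dat' gD' XE' ->]]]]]]]].
exact: (datum_indep dat dat' gD gD' XE XE' PE).
Qed.

Lemma descent_root_shift P k rho : phi P = cl Ev -> phi k = 0 -> descent_root D P rho -> descent_root D (P + k) (rho * e k).
Proof.
move=> PE k0 [P0 [T [u [N [w [g [X [dat gD XE ->]]]]]]]].
exists P0, T, u, N, w, g, X; split=> //.
have [TZ _ _ _ _] := dat.
rewrite addrA (weilD phi_isog (pol_one_class dk) (pol_tdiv (cl D) TZ) gD _ k0) ?mulrA//.
exact: (ker_descent_pt dat XE).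
Qed.

(** The pairing factor is a [q]-th root of unity because [q] kills the kernel. *)
Lemma descent_root_exp q f P rho : (forall k, phi k = 0 -> k *+ q = 0) -> is_cdiv_of f (D *+ q) ->
  phi P = cl Ev -> descent_root D P rho -> rho ^+ q = eval_cdiv f Ev.
Proof.
move=> kq fD PE [P0 [T [u [N [w [g [X [dat gD XE ->]]]]]]]].
have [TZ _ _ _ _] := dat; rewrite exprMn (descent_prod_exp dat gD fD XE).
have k0 := ker_descent_pt dat XE PE.
have W := weilMz phi_isog (pol_one_class dk) (pol_tdiv (cl D) TZ) gD (q%:Z) k0.
by rewrite -[X in _ * X]W -pmulrn kq// (weil0 phi_isog (pol_one_class dk) (pol_tdiv (cl D) TZ) gD) mulr1.
Qed.

Lemma descent_root_ex P : (forall m, m.+1%:R != 0 :> Kb) ->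
  (exists r, krull_dim J r.+1) \/ (forall x y : pts J, x = y) -> exists rho, descent_root D P rho.
Proof.
move=> char0 dimJ; have [P0 [T TZ]] := pol_ex dk.
have [u [N [w dat]]] := datum_ex C_curve J_jac char0 (dom Ev) TZ D0 dimJ.
have [g gD] := pol_pull phi_isog dk (pol_tdiv (cl D) TZ).
have [X XE] := choice (fun a => sph (u a)).
by exists (descent_prod g w X * e (descent_pt X + P)), P0, T, u, N, w, g, X.
Qed.

End OneClass.
End RValue.

(** * Galois conjugation *)

Section Galois.
Variables (K : fieldType) (Kb : closedFieldType) (iota : {rmorphism K -> Kb}).
Local Notation absgal := (absgal iota).

Lemma gal_inv_ex (s : absgal) : exists t : absgal, (forall x, s (t x) = x) /\ forall x, t (s x) = x.
Proof.
have [g sK gK] := gal_bij s.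
pose gA := GRing.isZmodMorphism.Build _ _ g (can2_zmod_morphism sK gK).
pose gM := GRing.isMonoidMorphism.Build _ _ g (can2_monoid_morphism sK gK).
pose gR : {rmorphism Kb -> Kb} := HB.pack g gA gM.
have gb : bijective gR by exists s.
have gf x : gR (iota x) = iota x by apply: (can_inj sK); rewrite gK gal_fix.
by exists (AbsGal gb gf).
Qed.

Lemma gal_pev (s : absgal) n (F : {mpoly Kb[n]}) v :
  s (pev F v) = pev (map_mpoly s F) (map_mx s v).
Proof.
rewrite /pev /map_mpoly /mmap mevalE !rmorph_sum /=; apply: eq_bigr => m _.
rewrite rmorphM mevalM mevalC; congr (_ * _).
rewrite rmorph_prod /= /mmap1 rmorph_prod /=; apply: eq_bigr => i _.
by rewrite !rmorphXn /= mevalXU mxE.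
Qed.

(** The local polynomials have coefficients in [K], so applying [s] makes the coordinates of the two
    points proportional, and normalization makes them equal. *)
Lemma regular_map_gal (s : absgal) (T : Type) N (X : variety iota) (v : T -> 'rV[Kb]_N) (u : T -> pts X) (sT : T -> T) :
  (forall x, v (sT x) = map_mx s (v x)) ->
  regular_map (baseK iota) v (fun x => coords (u x)) -> forall x, u (sT x) = gal_pt s (u x).
Proof.
move=> vs ru x; have [d [F [hF [j Fj] hc]]] := ru x.
have FK i : map_mpoly s (F i) = F i.
  apply/mpolyP => m; rewrite mcoeff_map_mpoly; have [y _ <-] := (hF i).2 m; exact: gal_fix.
have [c cE] := hc x; have [c' c'E] := hc (sT x).
have sF i : pev (F i) (v (sT x)) = s (pev (F i) (v x)) by rewrite gal_pev FK vs.
have c'0 : c' != 0.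
  apply: contraNneq Fj => c'0; move: (sF j); rewrite c'E c'0 mul0r => /esym/eqP.
  by rewrite fmorph_eq0.
apply: (coords_prop (c := s c / c')); apply/rowP => i; rewrite !mxE /=.
apply: (mulfI c'0); rewrite -c'E sF cE rmorphM.
by rewrite mulrA; congr (_ * _); rewrite mulrC divfK.
Qed.

Lemma morphism_gal (s : absgal) (X Y : variety iota) (u : pts X -> pts Y) x :
  Defs.morphism u -> u (gal_pt s x) = gal_pt s (u x).
Proof. by move=> mu; apply: (regular_map_gal (v := fun x => coords x) (sT := @gal_pt _ _ _ s X)). Qed.

Lemma morphism2_gal (s : absgal) (X Y Z : variety iota) (u : pts X -> pts Y -> pts Z) x y :
  morphism2 u -> u (gal_pt s x) (gal_pt s y) = gal_pt s (u x y).
Proof.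
move=> mu; apply: (regular_map_gal (v := @segre _ _ _ X Y) (u := fun w => u w.1 w.2)
  (sT := fun w => (gal_pt s w.1, gal_pt s w.2)) _ mu (x, y)) => w.
by rewrite /segre /= map_mxvec map_mxM map_trmx.
Qed.

Lemma galD (s : absgal) (A : abvar iota) (x y : pts A) : gal_pt s (x + y) = gal_pt s x + gal_pt s y.
Proof. exact/esym/(morphism2_gal s x y (@av_add_morph _ _ _ A)). Qed.

Lemma gal0 (s : absgal) (A : abvar iota) : gal_pt s (0 : pts A) = 0.
Proof. by apply: (addrI (gal_pt s (0 : pts A))); rewrite -galD !addr0. Qed.

Lemma galN (s : absgal) (A : abvar iota) (x : pts A) : gal_pt s (- x) = - gal_pt s x.
Proof. by apply: (addrI (gal_pt s x)); rewrite -galD !subrr gal0. Qed.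

Lemma galB (s : absgal) (A : abvar iota) (x y : pts A) : gal_pt s (x - y) = gal_pt s x - gal_pt s y.
Proof. by rewrite galD galN. Qed.

Lemma galMz (s : absgal) (A : abvar iota) (x : pts A) (m : int) : gal_pt s (x *~ m) = gal_pt s x *~ m.
Proof.
have H (y : pts A) k : gal_pt s (y *+ k) = gal_pt s y *+ k.
  by elim: k => [|k IH]; rewrite ?mulr0n ?gal0// !mulrS galD IH.
by case: m => m; rewrite -?pmulrn ?H// !NegzE !mulrNz galN -!pmulrn H.
Qed.

Lemma gal_sum (s : absgal) (A : abvar iota) (I : Type) (r : seq I) (F : I -> pts A) :
  gal_pt s (\sum_(i <- r) F i) = \sum_(i <- r) gal_pt s (F i).
Proof. by elim: r => [|i r IH]; rewrite ?big_nil ?gal0// !big_cons galD IH. Qed.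

Section Conjugation.
Variables (s t : absgal) (sK : forall x, s (t x) = x) (tK : forall x, t (s x) = x).

Lemma gal_ptK (X : variety iota) (x : pts X) : gal_pt s (gal_pt t x) = x.
Proof. by apply/coords_inj/rowP => i; rewrite !mxE sK. Qed.

Lemma gal_ptK' (X : variety iota) (x : pts X) : gal_pt t (gal_pt s x) = x.
Proof. by apply/coords_inj/rowP => i; rewrite !mxE tK. Qed.

(** With [t] the inverse of [s], conjugating the argument as well turns a form into the form with
    conjugate coefficients. *)
Definition gconj (X : variety iota) (f : pts X -> Kb) : pts X -> Kb := fun x => s (f (gal_pt t x)).
Definition gdconj (X : variety iota) (D : divisor X) : divisor X := fun x => gconj (D (gal_pt t x)).

Section OneVariety.
Variable X : variety iota.
Implicit Types (f g a b : pts X -> Kb) (x : pts X).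

Lemma vform_conj d a : vform d a -> vform d (gconj a).
Proof.
move=> [F hF E]; exists (map_mpoly s F); first exact: map_mpoly_homog.
move=> x; rewrite /gconj E gal_pev; congr pev; apply/rowP => i; by rewrite !mxE sK.
Qed.

Lemma conj_neq0 a x : a x != 0 -> gconj a (gal_pt s x) != 0.
Proof. by rewrite /gconj gal_ptK' fmorph_eq0. Qed.

Lemma near_conj x P : near (S := gv X) x P -> near (S := gv X) (gal_pt s x) (fun y => P (gal_pt t y)).
Proof.
move=> [d [a [fa ax H]]]; exists d, (gconj a); split; [exact: vform_conj|exact: conj_neq0|].
by move=> y; rewrite /gconj fmorph_eq0 => /H.
Qed.

Lemma gen_conj P : gen (S := gv X) P -> gen (S := gv X) (fun y => P (gal_pt t y)).
Proof. by move=> [x /near_conj]; exists (gal_pt s x). Qed.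

Lemma quo_conj f a b : quo f a b -> quo (gconj f) (gconj a) (gconj b).
Proof.
move=> [d [fa fb E]]; exists d; split; [exact: vform_conj|exact: vform_conj|].
by apply: gen_imp (gen_conj E) _ => y [b0 fE]; rewrite /gconj fmorph_eq0 fE fmorph_div.
Qed.

Lemma has_value_conj f x v : has_value f x v -> has_value (gconj f) (gal_pt s x) (s v).
Proof.
move=> /has_valueP[a [b [q bx ->]]]; apply/has_valueP; exists (gconj a), (gconj b).
by split; [exact: quo_conj|exact: conj_neq0|rewrite /gconj gal_ptK' fmorph_div].
Qed.

Lemma unit_conj f x : unit_at f x -> unit_at (gconj f) (gal_pt s x).
Proof. by move=> [v v0 h]; exists (s v); [rewrite fmorph_eq0|apply: has_value_conj]. Qed.

Lemma regular_conj f x : regular_at f x -> regular_at (gconj f) (gal_pt s x).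
Proof. by move=> [v h]; exists (s v); apply: has_value_conj. Qed.

Lemma nz_conj f : nzrational f -> nzrational (gconj f).
Proof.
move=> /nzP[a [b [q [x ax]]]]; apply/nzP; exists (gconj a), (gconj b); split; first exact: quo_conj.
by exists (gal_pt s x); apply: conj_neq0.
Qed.

Lemma rat_conj f : rational_over setT f -> rational_over setT (gconj f).
Proof. by move=> /quoT[a [b q]]; apply/quoT; exists (gconj a), (gconj b); apply: quo_conj. Qed.

Lemma conj_div f g : gconj (fun z => f z / g z) = fun z => gconj f z / gconj g z.
Proof. by apply/funext => z; rewrite /gconj fmorph_div. Qed.

Lemma is_div_conj f D : is_div_of f D -> is_div_of (gconj f) (gdconj D).
Proof.
move=> [nf uf]; split=> [|x]; first exact: nz_conj.
by have := unit_conj (uf (gal_pt t x)); rewrite conj_div gal_ptK.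
Qed.

Lemma cartier_conj (D : divisor X) : cartier D -> cartier (gdconj D).
Proof.
move=> cD x; have [nD /nearP uD] := cD (gal_pt t x); split; first exact: nz_conj.
apply/nearP; rewrite -{1}[x]gal_ptK; apply: near_imp (near_conj uD) _ => y.
by move/unit_conj; rewrite gal_ptK conj_div.
Qed.

End OneVariety.

Lemma greg_conj (X Y : variety iota) (u : pts X -> pts Y) : 
  (forall d a, vform d a -> vform d (fun x : pts Y => t (a (gal_pt s x)))) ->
  greg (S := gv X) (T := gv Y) u ->
  greg (S := gv X) (T := gv Y) (fun x => gal_pt s (u (gal_pt t x))).
Proof.
move=> ft ru x j; have [c [i [c0 hc]]] := ru (gal_pt t x) j.
exists (gconj c), i; split; first by rewrite /gconj fmorph_eq0.
move=> a fa; apply: form_ext (vform_conj (hc _ (ft _ _ fa))) _ => y.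
by rewrite /gconj rmorphM sK.
Qed.

End Conjugation.

Section Transport.
Variables (s t : absgal) (sK : forall x, s (t x) = x) (tK : forall x, t (s x) = x).
Local Notation conj := (gconj s t).
Local Notation dconj := (gdconj s t).

Lemma conjK (X : variety iota) (f : pts X -> Kb) : conj (gconj t s f) = f.
Proof. by apply/funext => x; rewrite /gconj sK (gal_ptK sK). Qed.

Lemma divisor_of_set_conj (X : variety iota) (D : divisor X) (Z : set (pts X)) : is_divisor_of_set D Z ->
  is_divisor_of_set (dconj D) [set x | Z (gal_pt t x)]%classic.
Proof.
move=> [cD H]; split; first exact: cartier_conj.
move=> y h rh; have rh' := rat_conj tK sK rh; have [h1 h2] := H (gal_pt t y) _ rh'.
split=> [[rg nv]|rg].
  have [|v hv] := h1.
    split; first exact: (regular_conj tK sK).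
    apply/nearP; move/nearP: nv => nv; apply: near_imp (near_conj tK sK nv) _ => z + Zz.
    rewrite /= (gal_ptK' tK) => /(_ Zz) /(has_value_conj tK sK).
    by rewrite (gal_ptK' tK) rmorph0.
  have := has_value_conj sK tK hv; rewrite gal_ptK// => hv'; exists (s v).
  by move: hv'; rewrite conj_div conjK.
have rg' : regular_at (fun z => gconj t s h z / D (gal_pt t y) z) (gal_pt t y).
  have := regular_conj tK sK rg; rewrite conj_div.
  by rewrite (_ : gconj t s (dconj D y) = D (gal_pt t y)) //; apply/funext => z; rewrite /gconj tK (gal_ptK' tK).
have [rh1 nv] := h2 rg'; split.
  by have := regular_conj sK tK rh1; rewrite gal_ptK// conjK.
apply/nearP; move/nearP: nv => nv; have nv' := near_conj sK tK nv; rewrite gal_ptK// in nv'.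
apply: near_imp nv' _ => z H' Zz; have := has_value_conj sK tK (H' Zz).
by rewrite gal_ptK// conjK rmorph0.
Qed.

Variables (C : variety iota) (C_curve : smooth_curve C).

Lemma coeff_gal z (D : cdiv C) : coeff z (gal_cdiv s D) = coeff (gal_pt t z) D.
Proof.
rewrite /gal_cdiv -[D in RHS]freeg_sumE !raddf_sum /=; apply: eq_bigr => x _.
rewrite !coeffU; congr (_ * _%:R); congr nat_of_bool; apply/eqP/eqP => [<-|->].
  by rewrite (gal_ptK' tK).
by rewrite (gal_ptK sK).
Qed.

Lemma ord_conj (f : pts C -> Kb) a m : ord_at f a m -> ord_at (conj f) (gal_pt s a) m.
Proof.
move=> o; have [v v0 hv] := o; apply/(has_ordP C_curve).
have [nt t0 tdiv] := unifP C_curve a.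
exists (conj (unif a)).
  split; first exact: nz_conj.
    by rewrite -(rmorph0 s); apply: has_value_conj.
  move=> h h0; have h0' := has_value_conj tK sK h0; rewrite rmorph0 (gal_ptK' tK) in h0'.
  by have := regular_conj sK tK (tdiv _ h0'); rewrite conj_div conjK.
have := unit_conj sK tK o; rewrite conj_div; congr unit_at; apply/funext => z.
by rewrite /gconj fmorphXz.
Qed.

Lemma is_cdiv_conj (f : pts C -> Kb) D : is_cdiv_of f D -> is_cdiv_of (conj f) (gal_cdiv s D).
Proof.
move=> [nf of']; split=> [|x]; first exact: nz_conj.
apply/(has_ordP C_curve); rewrite -{1}[x](gal_ptK sK) coeff_gal.
by apply: ord_conj; apply/(has_ordP C_curve).
Qed.

Variables (J : abvar iota) (cl : cdiv C -> pts J) (J_jac : is_jacobian cl).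

Lemma cl_gal D : deg D = 0 -> cl (gal_cdiv s D) = gal_pt s (cl D).
Proof. by have [_ _ _ H _] := J_jac; apply: H. Qed.

Lemma gal_diff (a b : pts C) : gal_cdiv s (<< a >> - << b >>) = << gal_pt s a >> - << gal_pt s b >>.
Proof.
have E (c z : pts C) : (c == gal_pt t z) = (gal_pt s c == z).
  by apply/eqP/eqP => [->|<-]; rewrite ?(gal_ptK sK) ?(gal_ptK' tK).
by apply/eqP/freeg_eqP => z; rewrite coeff_gal !coeffB !coeffU !E.
Qed.

Lemma theta_gal P0 x : theta cl P0 x -> theta cl (gal_pt s P0) (gal_pt s x).
Proof.
move=> [r [P [kr ->]]]; exists r, (fun i => gal_pt s (P i)); split=> //.
rewrite gal_sum; apply: eq_bigr => i _.
by rewrite -cl_gal ?deg_diff// gal_diff.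
Qed.

End Transport.

(** * Conjugates of descent data *)

Section DatumConj.
Variables (s t : absgal) (sK : forall x, s (t x) = x) (tK : forall x, t (s x) = x).
Local Notation conj := (gconj s t).
Local Notation dconj := (gdconj s t).
Variables (C : variety iota) (C_curve : smooth_curve C).
Variables (J : abvar iota) (cl : cdiv C -> pts J) (J_jac : is_jacobian cl).

Lemma theta_conj P0 : [set x | theta cl P0 (gal_pt t x)]%classic = theta cl (gal_pt s P0).
Proof.
apply/seteqP; split=> x /= h.
  by rewrite -[x](gal_ptK sK); apply: (theta_gal sK tK J_jac).
by have := theta_gal tK sK J_jac h; rewrite (gal_ptK' tK).
Qed.

Lemma tdiv_conj (T : divisor J) x : dconj (tdiv T x) = tdiv (dconj T) (gal_pt s x).
Proof.
apply/funext => y; apply/funext => z.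
rewrite /tdiv /div_sub /translate /pullback /gdconj /gconj fmorph_div.
by rewrite !galD (gal_ptK' tK).
Qed.

Lemma pulldiv_conj (E : divisor J) (u : pts C -> pts J) N : pulldiv E u N ->
  pulldiv (dconj E) (fun a => gal_pt s (u (gal_pt t a))) (gal_cdiv s N).
Proof.
move=> pE a; have [n [A [B [fA fB uAB o]]]] := pE (gal_pt t a).
exists n, (conj A), (conj B); split; [exact: vform_conj|exact: vform_conj| |].
  have := unit_conj sK tK uAB; rewrite !conj_div /gdconj.
  by rewrite (gal_ptK' tK).
rewrite (coeff_gal sK tK); have := ord_conj sK tK C_curve o; rewrite gal_ptK// conj_div.
congr ord_at; apply/funext => z; rewrite /gconj.
by rewrite !(gal_ptK' tK).
Qed.

Lemma datum_conj D r P0 T u N w : deg D = 0 -> (forall a, a \in r -> gal_pt t a \in r) ->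
  datum cl D r P0 T u N w -> datum cl (gal_cdiv s D) r (gal_pt s P0) (dconj T)
    (fun a => gal_pt s (u (gal_pt t a))) (gal_cdiv s N) (conj w).
Proof.
move=> D0 rt [TZ ru uB pN [wD uE]]; split.
- by rewrite -theta_conj; apply: divisor_of_set_conj.
- by apply: greg_conj => // d a; apply: (vform_conj tK).
- by move=> a b; rewrite -galB uB -(cl_gal s J_jac) ?deg_diff// (gal_diff sK tK) !gal_ptK.
- by rewrite (cl_gal s J_jac)// -tdiv_conj; apply: pulldiv_conj.
split.
  have -> : gal_cdiv s N - gal_cdiv s D = gal_cdiv s (N - D).
    by apply/eqP/freeg_eqP => z; rewrite coeffB !(coeff_gal sK tK) coeffB.
  exact: is_cdiv_conj.
move=> a /rt ar; have := unit_conj sK tK (uE _ ar); rewrite (cl_gal s J_jac)// -tdiv_conj.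
by rewrite /gdconj (gal_ptK' tK).
Qed.

Variables (A : abvar iota) (phi : pts A -> pts J) (phi_isog : isogeny phi).
Variables (Ev : cdiv C) (Ev0 : deg Ev = 0) (Evr : rational_cdiv Ev).

Lemma phi_gal (r : absgal) x : phi (gal_pt r x) = gal_pt r (phi x).
Proof. by have [m _ _ _] := phi_isog; apply: morphism_gal. Qed.

Lemma coeff_rat (r : absgal) a : coeff (gal_pt r a) Ev = coeff a Ev.
Proof.
have [r' [rK r'K]] := gal_inv_ex r.
by rewrite -{1}(Evr r) (coeff_gal rK r'K) (gal_ptK' r'K).
Qed.

Lemma dom_rat (r : absgal) a : a \in dom Ev -> gal_pt r a \in dom Ev.
Proof. by rewrite !mem_dom coeff_rat. Qed.

Lemma big_rat (R : Type) (idx : R) (op : Monoid.com_law idx) (F : pts C -> R) :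
  \big[op/idx]_(a <- dom Ev) F a = \big[op/idx]_(a <- dom Ev) F (gal_pt s a).
Proof.
rewrite -[RHS](big_map (@gal_pt _ _ _ s C) xpredT F); apply: perm_big.
have inj : injective (@gal_pt _ _ _ s C) := can_inj (gal_ptK' tK (X := C)).
apply: uniq_perm; [exact: uniq_dom|by rewrite map_inj_uniq//; apply: uniq_dom|].
move=> a; apply/idP/mapP => [aE|[b bE ->]]; last exact: dom_rat.
by exists (gal_pt t a); [apply: dom_rat|rewrite (gal_ptK sK)].
Qed.

(** Every ingredient of a root for [D] conjugates to one for [gal_cdiv s D]; as [Ev] is rational,
    products and sums over its support can be reindexed by [s]. *)
Lemma descent_root_gal D P rho : deg D = 0 -> dual_ker phi (polarization cl (cl D)) ->
  dual_ker phi (polarization cl (cl (gal_cdiv s D))) ->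
  (forall a, a \in dom Ev -> a \notin dom D) -> phi P = cl Ev ->
  descent_root cl phi Ev D P rho -> descent_root cl phi Ev (gal_cdiv s D) (gal_pt s P) (s rho).
Proof.
move=> D0 dk dk' disj PE [P0 [T [u [N [w [g [X [dat gD XE ->]]]]]]]].
have dat' := datum_conj D0 (fun a => @dom_rat t a) dat.
have gD' : is_div_of (conj g) (pullback phi (tdiv (dconj T) (cl (gal_cdiv s D)))).
  have := is_div_conj sK tK gD; congr is_div_of.
  rewrite (cl_gal s J_jac)// -tdiv_conj; apply/funext => y; apply/funext => z.
  by rewrite /pullback /gdconj /gconj !phi_gal.
exists (gal_pt s P0), (dconj T), (fun a => gal_pt s (u (gal_pt t a))), (gal_cdiv s N), (conj w), (conj g),
  (fun a => gal_pt s (X (gal_pt t a))); split=> //.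
  by move=> a; rewrite phi_gal XE.
rewrite rmorphM; congr (_ * _).
  rewrite /descent_prod [RHS]big_rat rmorph_prod big_seq [RHS]big_seq; apply: eq_bigr => a aE.
  rewrite coeff_rat fmorphXz fmorph_div (gal_ptK' tK); congr ((_ / _) ^ _).
    have [_ ug] := datum_units C_curve phi_isog disj dat gD XE aE; have [_ hg] := unit_value ug.
    by apply/esym/valueE; apply: (has_value_conj sK tK).
  have [uw _] := datum_units C_curve phi_isog disj dat gD XE aE; have [_ hw] := unit_value uw.
  by apply/esym/valueE; apply: (has_value_conj sK tK).
have -> : descent_pt Ev (fun a => gal_pt s (X (gal_pt t a))) = gal_pt s (descent_pt Ev X).
  rewrite /descent_pt [LHS]big_rat gal_sum; apply: eq_bigr => a _.
  by rewrite coeff_rat galMz (gal_ptK' tK).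
have k0 := ker_descent_pt J_jac phi_isog Ev0 dat XE PE.
rewrite -galD; set k := descent_pt Ev X + P in k0 *.
have [TZ _ _ _ _] := dat; have [TZ' _ _ _ _] := dat'.
have [_ E] := weilP phi_isog (pol_one_class dk) (pol_tdiv (cl D) TZ) gD k0.
apply/esym; apply: (weil_uniq phi_isog (pol_one_class dk') (pol_tdiv _ TZ') gD').
  by rewrite phi_gal k0 gal0.
apply: gen_imp (gen_conj sK tK E) _ => z gz.
by rewrite /gconj gz rmorphM galD (gal_ptK' tK).
Qed.

End DatumConj.
End Galois.

(** * Moving rational divisors *)

Section Moving.
Variables (K : fieldType) (Kb : closedFieldType) (iota : {rmorphism K -> Kb}).
Hypothesis char0 : forall m, m.+1%:R != 0 :> Kb.
Local Notation absgal := (absgal iota).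

Lemma natr_char0_inj (m n : nat) : m%:R = n%:R :> Kb -> m = n.
Proof.
wlog mn : m n / (m <= n)%N => [H E|E].
  by case: (leqP m n) => [/H/(_ E)|/ltnW/H/(_ (esym E))/esym].
have : (n - m)%:R = 0 :> Kb by rewrite natrB// E subrr.
case E' : (n - m)%N => [|k]; first by lia.
by move/eqP; rewrite (negbTE (char0 k)).
Qed.

(** Powers of an integer are Galois-fixed coefficients. In characteristic 0 infinitely many integers
    are available, while each condition excludes only the roots of a nonzero polynomial. *)
Lemma avoid_nat t (I : eqType) (s : seq I) (ev : I -> 'I_t -> Kb) :
  (forall x, x \in s -> exists j, ev x j != 0) ->
  exists N : nat, forall x, x \in s -> \sum_(j < t) N%:R ^+ j * ev x j != 0.
Proof.
move=> nz; pose p x : {poly Kb} := \sum_(j < t) ev x j *: 'X^j.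
have p0 x : x \in s -> p x != 0.
  move=> /nz[j ej]; apply: contraNneq ej => p0; apply/eqP.
  have := congr1 (fun q : {poly Kb} => q`_j) p0; rewrite coef0 coef_sum (bigD1 j)//= coefZ coefXn eqxx mulr1.
  rewrite big1 ?addr0// => i ij; rewrite coefZ coefXn.
  by rewrite (_ : (j == i :> nat) = false) ?mulr0//; apply/negbTE; rewrite eq_sym.
pose q := \prod_(x <- s) p x.
have q0 : q != 0 by rewrite prodf_seq_neq0; apply/allP => x /p0.
have [N qN] : exists N : nat, q.[N%:R] != 0.
  apply: contrapT => /forallNP h.
  have := max_poly_roots (rs := [seq n%:R | n <- seq.iota 0 (size q)]) q0.
  rewrite size_map size_iota ltnn => H; suff : false by []; apply: H.
    by apply/allP => c /mapP[n _ ->]; apply: contrapT => /negP; apply: h.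
  by rewrite map_inj_uniq ?iota_uniq// => m n; apply: natr_char0_inj.
exists N => x xs; apply: contraNneq qN => E.
rewrite horner_prod (big_rem x)//= mulf_eq0; apply/orP; left; apply/eqP.
rewrite -E horner_sum; apply: eq_bigr => j _; by rewrite hornerZ hornerXn mulrC.
Qed.

(* A Galois-stable subspace has the basis whose columns at some positions form
   the identity; its uniqueness makes it Galois-fixed. *)
Lemma galois_basis n (V : 'rV[Kb]_n -> Prop) : V 0 ->
  (forall c u v, V u -> V v -> V (c *: u + v)) ->
  (forall (g : absgal) v, V v -> V (map_mx g v)) ->
  exists t (B : 'M[Kb]_(t, n)), [/\ forall i, V (row i B), forall v, V v -> (v <= B)%MS
    & forall g : absgal, map_mx g B = B].
Proof.
move=> V0 VL Vg; have [t [M [VM fM hM]]] := row_select V.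
have Vsub v : (v <= M)%MS -> V v.
  move=> /submxP[D ->]; rewrite mulmx_sum_row; elim: (index_enum _) => [|i r IH].
    by rewrite big_nil.
  by rewrite big_cons; apply: VL.
have fT : row_full M^T by rewrite /row_full mxrank_tr.
pose Q : 'M[Kb]_(n, t) := (rowsub (fullrankfun fT) 1%:M)^T.
have Qg (g : absgal) : map_mx g Q = Q.
  by apply/matrixP => i j; rewrite !mxE rmorph_nat.
have uMQ : M *m Q \in unitmx.
  by rewrite -unitmx_tr trmx_mul trmxK -rowsubE fullrowsub_unit.
pose B := invmx (M *m Q) *m M.
have BQ : B *m Q = 1%:M by rewrite -mulmxA mulVmx.
have BM : (B <= M)%MS by apply: submxMl.
have MB : (M <= B)%MS by rewrite -[M in X in (X <= _)%MS](mulKVmx uMQ) submxMl.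
have VB i : V (row i B) by apply: Vsub; apply: submx_trans (row_sub i B) BM.
exists t, B; split=> // [v /hM h|g]; first exact: submx_trans h MB.
have /submxP[D E] : (map_mx g B <= B)%MS.
  by apply/row_subP => i; rewrite -map_row; apply: submx_trans MB; apply/hM/Vg.
have D1 : D = 1%:M.
  by rewrite -[D]mulmx1 -BQ mulmxA -E -{1}(Qg g) -map_mxM BQ map_mx1.
by rewrite E D1 mul1mx.
Qed.

Variables (C : variety iota) (C_curve : smooth_curve C).
Let irr := gvirr C.

Definition gfixed (a : pts C -> Kb) := forall (g : absgal) x, a (gal_pt g x) = g (a x).

Lemma conj_fixed (g t : absgal) a : (forall x, g (t x) = x) -> gfixed a -> gconj g t a = a.
Proof. by move=> gK fa; apply/funext => x; rewrite /gconj fa gK. Qed.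

Lemma fixed_linear (s : seq (pts C)) :
  exists l, [/\ vform 1 l, gfixed l & forall x, x \in s -> l x != 0].
Proof.
have [|N hN] := @avoid_nat (ncoords C) _ s (fun x j => coords x 0 j) _.
  move=> x _; have /andP[/existsP[j /andP[/eqP xj _]] _] := coordsP x.
  by exists j; rewrite xj oner_neq0.
exists (fun x => \sum_(j < ncoords C) N%:R ^+ j * coords x 0 j); split=> // [|g x].
  have [x0 _] := irr.1; apply: (form_sum (S := gv C) (index_enum _) x0) => j.
  exact: (formZ (g := gv C) _ (coords_form j)).
rewrite rmorph_sum; apply: eq_bigr => j _ /=.
by rewrite rmorphM rmorphXn /= rmorph_nat mxE.
Qed.

Section OrderForm.
Variables (s : seq (pts C)) (s_gal : forall (g : absgal) x, x \in s -> gal_pt g x \in s).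
Variables (l : pts C -> Kb) (fl : vform 1 l) (gl : gfixed l) (l0 : forall x, x \in s -> l x != 0).
Variables (m : pts C -> nat) (m_gal : forall (g : absgal) x, m (gal_pt g x) = m x).

Let flX e : vform e (fun z => l z ^+ e).
Proof. by have := formX (S := gv C) e fl; rewrite mulrn_one. Qed.

Lemma quo_linear e a x : vform e a -> x \in s -> quo (fun z => a z / l z ^+ e) a (fun z => l z ^+ e).
Proof. by move=> fa xs; apply: (quo_form fa (flX e)); exists x; rewrite expf_neq0 ?l0. Qed.

Lemma regular_linear e a x : vform e a -> x \in s -> regular_at (fun z => a z / l z ^+ e) x.
Proof.
move=> fa xs; apply/regularP; exists a, (fun z => l z ^+ e).
by split; [exact: quo_linear fa xs|rewrite expf_neq0 ?l0].
Qed.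

Lemma unit_linear e a x : vform e a -> x \in s -> a x != 0 -> unit_at (fun z => a z / l z ^+ e) x.
Proof.
move=> fa xs ax; apply/unitP; exists a, (fun z => l z ^+ e).
by split; [exact: quo_linear fa xs|done|rewrite expf_neq0 ?l0].
Qed.

Lemma gen_linear x : x \in s -> gen (S := gv C) (fun z => l z != 0).
Proof. by move=> xs; apply: gen_form fl (l0 xs). Qed.

Definition order_geq e (a : pts C -> Kb) x := regular_at (fun z => a z / l z ^+ e / unif x z ^+ m x) x.

Lemma away x (r : seq (pts C)) : x \in s -> {subset r <= s} -> x \notin r ->
  exists e Q, [/\ vform e Q, Q x != 0 & forall y, y \in r -> order_geq e Q y].
Proof.
move=> xs; elim: r => [|y r IH] sub xr.
  by exists 0%N, (fun _ => 1); split; [exact: vform1|exact: oner_neq0|].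
move: xr; rewrite inE negb_or => /andP[xy xr].
have [|e [Q [fQ Qx oQ]]] := IH _ xr; first by move=> z zr; apply: sub; rewrite inE zr orbT.
have [S fS [Sy Sx]] := separate (X := C) (x := y) (y := x) ltac:(by rewrite eq_sym).
have fSm : vform (m y) (fun z => S z ^+ m y).
  by have := formX (S := gv C) (m y) fS; rewrite mulrn_one.
exists (e + m y)%N, (fun z => Q z * S z ^+ m y); split.
- exact: vformM fQ fSm.
- by rewrite mulf_neq0 ?expf_neq0.
have ys : y \in s by apply: sub; exact: mem_head.
have regS w : w \in s -> regular_at (fun z => S z ^+ m y / l z ^+ m y) w by exact: regular_linear fSm.
move=> w; rewrite inE; have [-> _|wy /= wr] := eqVneq w y; last first.
  have ws : w \in s by apply: sub; rewrite inE wr orbT.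
  apply: regular_gen (regularM (oQ w wr) (regS w ws)) _.
  apply: gen_true => z; rewrite exprD invfM; ring.
have S1 : regular_at (fun z => (S z / l z ^+ 1 / unif y z) ^+ m y) y.
  apply: regularX; apply: (unif_div C_curve); apply/has_valueP; exists S, (fun z => l z ^+ 1).
  by split; [exact: quo_linear fS ys|rewrite expf_neq0 ?l0|rewrite Sy mul0r].
apply: regular_gen (regularM (regular_linear fQ ys) S1) _.
apply: gen_true => z; rewrite expr1 !expr_div_n exprD invfM; ring.
Qed.

Lemma exact_form x : x \in s -> exists e Q, [/\ vform e Q, forall y, y \in s -> order_geq e Q y
  & ord_at (fun z => Q z / l z ^+ e) x (m x)].
Proof.
move=> xs; pose r := [seq y <- s | y != x].
have [||e [Q [fQ Qx oQ]]] := @away x r xs.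
- by move=> y; rewrite mem_filter => /andP[].
- by rewrite mem_filter eqxx.
have /regularP[a [b [q bx]]] := unif_regular C_curve x; have [d [fa fb E]] := q.
have oa : ord_at (fun z => a z / l z ^+ d) x 1.
  have ub := unit_linear fb xs bx.
  have := ordM C_curve (ord_unif C_curve x) (proj2 (ord_unit C_curve _ _) ub); rewrite addr0.
  move=> o; apply: ord_gen o _; apply: gen_imp (gen_and irr E (gen_linear xs)) _ => z [[bz ->] lz].
  by have := expf_neq0 d lz; move: (l z ^+ d) => L L0; field; rewrite bz L0.
have fam : vform (d * m x)%N (fun z => a z ^+ m x).
  by have := formX (S := gv C) (m x) fa; rewrite -mulr_natr natn.
exists (e + d * m x)%N, (fun z => Q z * a z ^+ m x); split; first exact: vformM fQ fam.
  have Eq z : Q z * a z ^+ m x / l z ^+ (e + d * m x) = Q z / l z ^+ e * (a z / l z ^+ d) ^+ m x.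
    by rewrite expr_div_n exprD -exprM invfM; ring.
  move=> y ys; have [->|yx] := eqVneq y x.
    have /(ord_ge0_regular C_curve (m := 0)) ru : ord_at (fun z => a z / l z ^+ d / unif x z) x 0.
      by have := ordD C_curve oa (ord_unif C_curve x).
    apply: regular_gen (regularM (regular_linear fQ xs) (regularX (m x) ru)) _.
    by apply: gen_true => z; rewrite Eq [X in _ * X]expr_div_n mulrA.
  have yr : y \in r by rewrite mem_filter yx.
  apply: regular_gen (regularM (oQ y yr) (regularX (m x) (regular_linear fa ys))) _.
  by apply: gen_true => z; rewrite Eq; ring.
have uQ := unit_linear fQ xs Qx.
have := ordM C_curve (proj2 (ord_unit C_curve _ _) uQ) (ordX C_curve (m x) oa).
rewrite add0r natz => o; apply: ord_gen o _; apply: gen_true => z.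
by rewrite expr_div_n exprD -exprM invfM; ring.
Qed.

(** The forms of degree [e] with order at least [m] on [s] make a Galois-stable space, which has a
    Galois-fixed basis. By [exact_form], at each [x] some basis element attains the order [m x]; a
    combination with integer coefficients attains it at all points at once. *)
Lemma order_form : exists e a, [/\ vform e a, gfixed a &
  forall x, x \in s -> ord_at (fun z => a z / l z ^+ e) x (m x)].
Proof.
have ex x : exists e, exists Q, x \in s -> [/\ vform e Q, forall y, y \in s -> order_geq e Q y
  & ord_at (fun z => Q z / l z ^+ e) x (m x)].
  have [xs|xs] := boolP (x \in s); last by exists 0%N, (fun _ => 0).
  by have [e [Q h]] := exact_form xs; exists e, Q.
have [ee eP] := choice ex; have [QQ QP] := choice eP.
pose e := \sum_(x <- s) ee x.
have lee x : x \in s -> (ee x <= e)%N.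
  by move=> xs; rewrite /e (big_rem x)//= leq_addr.
have [n [mu [/all_and2[fmu gmu] span]]] := form_basis C e.
pose pf (c : 'rV[Kb]_n) z := \sum_i c 0 i * mu i z.
have fpf c : vform e (pf c).
  have [x0 _] := irr.1; apply: (form_sum (S := gv C) (index_enum _) x0) => i.
  exact: (formZ (g := gv C) _ (fmu i)).
pose q c x z := pf c z / l z ^+ e / unif x z ^+ m x.
pose V c := forall x, x \in s -> order_geq e (pf c) x.
have qL a u v x z : q (a *: u + v) x z = a * q u x z + q v x z.
  rewrite /q; have -> : pf (a *: u + v) z = a * pf u z + pf v z.
    by rewrite /pf mulr_sumr -big_split; apply: eq_bigr => i _; rewrite !mxE mulrDl mulrA.
  by rewrite !mulrDl !mulrA.
have V0 : V 0.
  move=> x xs; exists 0; apply: has_value_gen (has_value_const 0 x) _.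
  apply: gen_true => z; rewrite /pf big1 ?mul0r// => i _; by rewrite mxE mul0r.
have VL a u v : V u -> V v -> V (a *: u + v).
  move=> Vu Vv x xs; have [cu hu] := regularZ a (Vu x xs); have [cv hv] := Vv x xs.
  exists (cu + cv); apply: has_value_gen (has_valueD hu hv) _.
  by apply: gen_true => z; have := qL a u v x z; rewrite /q => ->.
have Vg (g : absgal) c : V c -> V (map_mx g c).
  move=> Vc x xs; have [t [gK tK]] := gal_inv_ex g.
  have := regular_conj gK tK (Vc _ (s_gal t xs)); rewrite (gal_ptK gK) => rg.
  have ou := ord_conj gK tK C_curve (ord_unif C_curve (gal_pt t x)); rewrite (gal_ptK gK) in ou.
  have ux : unit_at (fun z => gconj g t (unif (gal_pt t x)) z / unif x z) x.
    by apply/(ord_unit C_curve); have := ordD C_curve ou (ord_unif C_curve x); rewrite subrr.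
  apply: regular_gen (regularM rg (unit_regular (unitX (m x) ux))) _.
  apply: gen_imp (nz_gen (unit_nz ux)) _ => z /frac_nz[u0 u0'].
  have -> : pf (map_mx g c) z = g (pf c (gal_pt t z)).
    rewrite rmorph_sum; apply: eq_bigr => i _ /=.
    by rewrite rmorphM !mxE gmu gK.
  move: u0; rewrite /gconj !fmorph_div !rmorphXn /= gl gK m_gal => u0.
  have := expf_neq0 (m x) u0; have := expf_neq0 (m x) u0'; rewrite expr_div_n.
  by move: (_ ^+ m x) (_ ^+ m x) (l z ^+ e)^-1 => a b L b0 a0; field; rewrite a0 b0.
have [t [B [VB hB gB]]] := galois_basis V0 VL Vg.
have [ev evP] : exists ev, forall x j, x \in s -> has_value (q (row j B) x) x (ev x j).
  have h x : exists v : 'I_t -> Kb, forall j, x \in s -> has_value (q (row j B) x) x (v j).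
    have [xs|xs] := boolP (x \in s); last by exists (fun _ => 0).
    by have [v hv] := choice (fun j => VB j x xs); exists v => j _; exact: hv.
  by have [ev hev] := choice h; exists ev => x j; exact: hev.
have comb (d : 'I_t -> Kb) x : x \in s -> has_value (q (\sum_j d j *: row j B) x) x (\sum_j d j * ev x j).
  move=> xs; have h := has_value_sum (index_enum 'I_t) (fun j => has_valueM (has_value_const (d j) x) (evP x j xs)).
  apply: has_value_gen h _; apply: gen_true => z.
  elim: (index_enum _) => [|j r IH].
    by rewrite !big_nil /q /pf big1 ?mul0r// => i _; rewrite mxE mul0r.
  by rewrite !big_cons qL IH.
have nz x : x \in s -> exists j, ev x j != 0.
  move=> xs; have [fQ oQ ordQ] := QP x xs.
  have fQ' : vform e (fun z => QQ x z * l z ^+ (e - ee x)).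
    by have := vformM fQ (flX (e - ee x)); rewrite /GRing.add /= subnKC// lee.
  have [c cE] := span _ fQ'; pose cv : 'rV[Kb]_n := \row_i c i.
  have pfE z : pf cv z = QQ x z * l z ^+ (e - ee x).
    by rewrite cE; apply: eq_bigr => i _; rewrite mxE.
  have same y : y \in s -> gen (S := gv C) (fun z => QQ x z / l z ^+ ee x = pf cv z / l z ^+ e).
    move=> ys; apply: gen_imp (gen_linear ys) _ => z lz; rewrite pfE.
    have -> : l z ^+ e = l z ^+ ee x * l z ^+ (e - ee x) by rewrite -exprD subnKC// lee.
    have := expf_neq0 (ee x) lz; have := expf_neq0 (e - ee x) lz.
    by move: (l z ^+ ee x) (l z ^+ (e - ee x)) => a b b0 a0; field; rewrite a0 b0.
  have Vc : V cv.
    by move=> y ys; apply: regular_gen (oQ y ys) _; apply: gen_imp (same y ys) _ => z ->.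
  have /submxP[D DE] := hB _ Vc; rewrite mulmx_sum_row in DE.
  have h := comb (fun j => D 0 j) x xs; rewrite -DE in h.
  have [v v0 hv] := ordQ.
  have hv' : has_value (q cv x) x v.
    by apply: has_value_gen hv _; apply: gen_imp (same x xs) _ => z ->.
  apply: contrapT => /forallNP all0; case/negP: v0; rewrite (has_value_uniq hv' h); apply/eqP.
  by rewrite big1// => j _; have /negP/negPn/eqP -> := all0 j; rewrite mulr0.
have [N hN] := avoid_nat nz.
pose c := \sum_(j < t) N%:R ^+ j *: row j B.
exists e, (pf c); split=> // [g x|x xs].
  rewrite rmorph_sum; apply: eq_bigr => i _ /=; rewrite rmorphM gmu; congr (_ * _).
  rewrite /c !summxE rmorph_sum; apply: eq_bigr => j _ /=.
  rewrite !mxE rmorphM rmorphXn /= rmorph_nat; congr (_ * _).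
  by have /matrixP/(_ j i) := gB g; rewrite mxE => ->.
exists (\sum_(j < t) N%:R ^+ j * ev x j); first exact: hN.
exact: comb.
Qed.

End OrderForm.

(** The quotient of two Galois-fixed forms, with the orders on [s] of the negative and of the
    positive part of [E], cancels [E] there; being Galois-fixed, it has a rational divisor. *)
Lemma moving (E : cdiv C) (s : seq (pts C)) : rational_cdiv E ->
  (forall (g : absgal) x, x \in s -> gal_pt g x \in s) ->
  exists V : cdiv C, [/\ rational_cdiv V, exists h, is_cdiv_of h V
    & forall x, x \in s -> coeff x (E + V) = 0].
Proof.
move=> Er s_gal; case: s s_gal => [|x0 s'] s_gal.
  exists 0; split=> // [g|].
    by apply/eqP/freeg_eqP => z; have [t [gK tK]] := gal_inv_ex g; rewrite (coeff_gal gK tK) !coeff0.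
  exists (fun _ => 1); split; first exact/nz_const/oner_neq0.
  by move=> x; apply/(has_ordP C_curve); rewrite coeff0; apply/(ord_unit C_curve)/unit_const/oner_neq0.
set s := x0 :: s' in s_gal *.
have [l [fl gl l0]] := fixed_linear s.
pose m1 x := if coeff x E is Negz n then n.+1 else 0%N.
pose m2 x := if coeff x E is Posz n then n else 0%N.
have g1 (g : absgal) x : m1 (gal_pt g x) = m1 x by rewrite /m1 (coeff_rat Er).
have g2 (g : absgal) x : m2 (gal_pt g x) = m2 x by rewrite /m2 (coeff_rat Er).
have [e1 [a [fa ga oa]]] := order_form s_gal fl gl l0 g1.
have [e2 [b [fb gb ob]]] := order_form s_gal fl gl l0 g2.
pose h z := (a z / l z ^+ e1) / (b z / l z ^+ e2).
have oh x : x \in s -> ord_at h x (- coeff x E).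
  move=> xs; have := ordD C_curve (oa x xs) (ob x xs).
  by rewrite /m1 /m2; case: (coeff x E) => n; rewrite ?sub0r ?subr0// NegzE opprK.
have nh : nzrational h := ord_nz C_curve (oh x0 (mem_head _ _)).
have [V VP] := cdiv_ex C_curve nh.
exists V; split; last first.
- move=> x xs; rewrite coeffD; have /(has_ordP C_curve) o := VP.2 x.
  by rewrite (ord_uniq C_curve o (oh x xs)) subrr.
- by exists h.
move=> g; have [t [gK tK]] := gal_inv_ex g.
have hf : gfixed h by move=> g' x; rewrite /h !fmorph_div !rmorphXn /= ga gb gl.
have := is_cdiv_conj gK tK C_curve VP; rewrite (conj_fixed gK hf) => -[_ o'].
apply/eqP/freeg_eqP => x; have /(has_ordP C_curve) o1 := o' x; have /(has_ordP C_curve) o2 := VP.2 x.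
exact: (ord_uniq C_curve o1 o2).
Qed.

End Moving.

(** * Descent *)

Section Dimension.
Variables (K : fieldType) (Kb : closedFieldType) (iota : {rmorphism K -> Kb}).
Variables (C : variety iota) (J : abvar iota) (cl : cdiv C -> pts J) (J_jac : is_jacobian cl).
Variables (A : abvar iota) (phi : pts A -> pts J) (phi_isog : isogeny phi).
Let irrJ := gvirr J.

Lemma cartier0 (X : variety iota) : cartier (@div0 _ _ _ X).
Proof.
move=> x; split; first exact/nz_const/oner_neq0.
by apply/nearP/near_T => y; apply: unit_gen (unit_const y (oner_neq0 Kb)) _; exists y; apply: near_T => z; rewrite divr1.
Qed.

(** A divisor of the empty set has units as local equations, so every class in the image of the
    polarization is that of the zero divisor. *)
Lemma polarization_empty (x : pts J) : (forall P0 z, ~ theta cl P0 z) ->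
  polarization cl x = pic_class (@div0 _ _ _ J).
Proof.
move=> noth; have c0 := @cartier0 J; apply/seteqP; split=> E.
  move=> [P0 [T [TZ [cE lE]]]]; split=> //; have [cT _] := TZ.
  have c1 : cartier (tdiv T x).
    exact: (cartier_sub (cartier_pullback (greg_addr x) (translate_surj x) cT) cT).
  have l1 : lin_equiv (@div0 _ _ _ J) (tdiv T x).
    exists (fun _ => 1); split=> [|z]; first exact/nz_const/oner_neq0.
    apply: unit_gen (tdiv_unit J_jac TZ (x := x) (z := z) (noth P0 z) (noth P0 _)) _.
    by exists z; apply: near_T => y; rewrite /div_sub /div0 !div1r invrK.
  exact: lin_common c1 cE c0 lE l1.
move=> [cE lE]; have [[P0 _] _] := gvirr C; exists P0, (@div0 _ _ _ J); split.
  split=> // y h rh; split=> [[rg _]|rg].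
    have [v hv] := rg; exists v; apply: has_value_gen hv _.
    by exists y; apply: near_T => z; rewrite /div0 divr1.
  split; last by apply/nearP/near_T => z /noth.
  have [v hv] := rg; exists v; apply: has_value_gen hv _.
  by exists y; apply: near_T => z; rewrite /div0 divr1.
split=> //; have -> : div_sub (translate x (@div0 _ _ _ J)) (@div0 _ _ _ J) = @div0 _ _ _ J.
  by apply/funext => y; apply/funext => z; rewrite /div_sub /translate /pullback /div0 divr1.
exact: lE.
Qed.

Lemma dual_ker0 : dual_ker phi (pic_class (@div0 _ _ _ J)).
Proof.
have c0 := @cartier0 J; split.
  by exists (@div0 _ _ _ J); split=> // a; apply: lin_refl.
apply/seteqP; split=> E.
  move=> [D [cD [f fD]] [cE lE]]; split=> //.
  have ra := phi_greg phi_isog; have su := phi_surj phi_isog.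
  apply: (lin_common (cartier_pullback ra su cD) cE (@cartier0 A) lE).
  have [nf uf] := div_pull ra su fD; exists (fun z => (f (phi z))^-1); split; first exact: nzV.
  move=> z; apply: unit_gen (unitV (uf z)) _; exists z; apply: near_T => y.
  by rewrite /pullback /div_sub /div0 divr1 invf_div div1r invrK mulrC.
by move=> [cE lE]; exists (@div0 _ _ _ J) => //; split=> //; apply: lin_refl.
Qed.

(* When J has no Krull dimension of the form r + 1, the theta divisor is empty,
   so every point lies in Psi and J is finite, hence a point. *)
Lemma dimension_or_trivial n q (D : 'I_n -> cdiv C) : (0 < q)%N ->
  (forall i, deg (D i) = 0) -> (forall i, cl (D i) *+ q = 0) ->
  (forall x : pts J, in_Psi phi cl x <->
       exists m : 'I_n -> int, x = \sum_(i < n) cl (D i) *~ m i) ->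
  (exists r, krull_dim J r.+1) \/ (forall x y : pts J, x = y).
Proof.
move=> q0 D0 tor span; have [|nr] := pselect (exists r, krull_dim J r.+1); [by left|right].
have noth P0 z : ~ theta cl P0 z by move=> [r [P [kr _]]]; apply: nr; exists r.
pose pt (k : {ffun 'I_n -> 'I_q}) := \sum_(i < n) cl (D i) *+ k i.
have fin x : exists k, x = pt k.
  have /span[m ->] : in_Psi phi cl x by rewrite /in_Psi (polarization_empty x noth); apply: dual_ker0.
  have h i : exists k : 'I_q, cl (D i) *~ m i = cl (D i) *+ k.
    have mi : (0 <= (m i %% q%:Z)%Z) by apply: modz_ge0; lia.
    have [k kE] := int_nonneg mi.
    have kq : (k < q)%N by have := ltz_pmod (m i) (_ : 0 < q%:Z); rewrite kE; lia.
    exists (Ordinal kq); rewrite {1}(divz_eq (m i) q%:Z) mulrzDr mulrC mulrzA -pmulrn tor mul0rz add0r.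
    by rewrite kE -pmulrn.
  have [k kE] := choice h; exists [ffun i => k i].
  by apply: eq_bigr => i _; rewrite kE ffunE.
(* [J] is a finite union of points; irreducibility, used for tuples of length 1, leaves only one. *)
have [||k hk] := @sep_irr_fin _ _ _ J 1%N _ (fun k M => M ord0 = pt k).
- move=> k M i; rewrite ord1.
  have -> : [set a | upd M ord0 a ord0 = pt k]%classic = [set pt k]%classic.
    by apply/funext => a; rewrite /upd eqxx.
  exact: gclosed_pt.
- by move=> M; apply: fin.
by move=> x y; rewrite (hk (fun _ => x)) (hk (fun _ => y)).
Qed.

End Dimension.

(** * Cocycles and the Kummer isomorphism *)

Section Descent.
Variables (K : fieldType) (Kb : closedFieldType) (iota : {rmorphism K -> Kb}).
Hypothesis char0 : forall m, m.+1%:R != 0 :> Kb.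
Variables (C : variety iota) (C_curve : smooth_curve C).
Variables (J : abvar iota) (cl : cdiv C -> pts J) (J_jac : is_jacobian cl).
Variables (A : abvar iota) (phi : pts A -> pts J) (phi_isog : isogeny phi).
Variables (n q : nat) (q0 : (0 < q)%N) (kerq : forall k, phi k = 0 -> k *+ q = 0).
Variables (D : 'I_n -> cdiv C) (D_deg : forall i, deg (D i) = 0).
Variables (D_gal : forall (s : absgal iota) i, exists j, gal_cdiv s (D i) = D j).
Variables (D_ker : forall i, dual_ker phi (polarization cl (cl (D i)))).
Variables (dimJ : (exists r, krull_dim J r.+1) \/ (forall x y : pts J, x = y)).
Variables (f : 'I_n -> pts C -> Kb) (f_div : forall i, is_cdiv_of (f i) (D i *+ q)).
Local Notation absgal := (absgal iota).
Local Notation map_w := (map_w D phi cl).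
Local Notation actL := (actL D).
Local Notation mu_class := (mu_class q D).
Implicit Types (s : absgal) (a b r : algL' Kb n) (E : cdiv C).

Lemma perm_invP s i : gal_cdiv s (D (Defs.perm_inv D s i)) = D i.
Proof.
rewrite /Defs.perm_inv; case: pickP => [j /eqP//|nj] /=.
have [t [sK tK]] := gal_inv_ex s; have [j jE] := D_gal t i.
have /negP := negbT (nj j); case; rewrite -jE; apply/eqP/eqP/freeg_eqP => z.
by rewrite (coeff_gal sK tK) (coeff_gal tK sK) (gal_ptK sK).
Qed.

Lemma actLM s a b : actL s (mulL a b) = mulL (actL s a) (actL s b).
Proof. by apply/ffunP => i; rewrite !ffunE rmorphM. Qed.

Lemma weil_gal s i k : phi k = 0 ->
  weil_pairing phi (gal_pt s k) (polarization cl (cl (D i))) =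
  s (weil_pairing phi k (polarization cl (cl (D (Defs.perm_inv D s i))))).
Proof.
move=> k0; have [t [sK tK]] := gal_inv_ex s; set j := Defs.perm_inv D s i.
have Di : gal_cdiv s (D j) = D i by exact: perm_invP.
have [P0 [T TZ]] := pol_ex (D_ker j).
have [g gD] := pol_pull phi_isog (D_ker j) (pol_tdiv (cl (D j)) TZ).
have TZ' : is_divisor_of_set (gdconj s t T) (theta cl (gal_pt s P0)).
  by rewrite -(theta_conj sK tK J_jac); apply: divisor_of_set_conj.
have gD' : is_div_of (gconj s t g) (pullback phi (tdiv (gdconj s t T) (cl (D i)))).
  have := is_div_conj sK tK gD; congr is_div_of.
  rewrite -Di (cl_gal s J_jac)// -(tdiv_conj tK); apply/funext => y; apply/funext => z.
  by rewrite /pullback /gdconj /gconj !(phi_gal phi_isog).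
have [_ E] := weilP phi_isog (pol_one_class (D_ker j)) (pol_tdiv _ TZ) gD k0.
apply: (weil_uniq phi_isog (pol_one_class (D_ker i)) (pol_tdiv _ TZ') gD').
  by rewrite (phi_gal phi_isog) k0 gal0.
apply: gen_imp (gen_conj sK tK E) _ => z gz.
by rewrite /gconj gz rmorphM galD (gal_ptK' tK).
Qed.

Lemma weil_data i : exists D0 g, polarization cl (cl (D i)) D0 /\ is_div_of g (pullback phi D0).
Proof.
have [P0 [T TZ]] := pol_ex (D_ker i).
have [g gD] := pol_pull phi_isog (D_ker i) (pol_tdiv (cl (D i)) TZ).
by exists (tdiv T (cl (D i))), g; split=> //; apply: pol_tdiv TZ.
Qed.

Lemma map_wD k l : phi k = 0 -> phi l = 0 -> map_w (k + l) = mulL (map_w k) (map_w l).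
Proof.
move=> k0 l0; apply/ffunP => i; rewrite !ffunE; have [D0 [g [pD gD]]] := weil_data i.
exact: (weilD phi_isog (pol_one_class (D_ker i)) pD gD k0 l0).
Qed.

Lemma map_w_gal s k : phi k = 0 -> map_w (gal_pt s k) = actL s (map_w k).
Proof. by move=> k0; apply/ffunP => i; rewrite !ffunE weil_gal. Qed.

Lemma map_w_mu k : phi k = 0 -> muL q (map_w k).
Proof.
move=> k0; apply/ffunP => i; rewrite !ffunE; have [D0 [g [pD gD]]] := weil_data i.
have c1 := pol_one_class (D_ker i).
have W := weilMz phi_isog c1 pD gD (q%:Z) k0.
by rewrite -[LHS]W -pmulrn kerq// (weil0 phi_isog c1 pD gD).
Qed.

Lemma mu_neq0 b i : muL q b -> b i != 0.
Proof.
move=> /ffunP/(_ i); rewrite !ffunE => b1; apply/eqP => b0.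
by move/eqP: b1; rewrite b0 expr0n eqn0Ngt q0 eq_sym oner_eq0.
Qed.

Lemma mu_class_eq xi eta b : muL q b -> (forall s, mulL (xi s) (actL s b) = mulL (eta s) b) ->
  mu_class xi = mu_class eta.
Proof.
move=> mb H; have b0 i := mu_neq0 i mb.
pose b' : algL' Kb n := [ffun i => (b i)^-1].
have mb' : muL q b'.
  apply/ffunP => i; have /ffunP/(_ i) := mb; rewrite !ffunE exprVn => ->; exact: invr1.
have muM c d : muL q c -> muL q d -> muL q (mulL c d).
  move=> /ffunP mc /ffunP md; apply/ffunP => i.
  by have := mc i; have := md i; rewrite !ffunE exprMn => -> ->; rewrite mulr1.
have H' s i : xi s i * s (b (Defs.perm_inv D s i)) = eta s i * b i.
  by have /ffunP/(_ i) := H s; rewrite !ffunE.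
have sb s i : s (b (Defs.perm_inv D s i)) != 0 by rewrite fmorph_eq0.
apply/seteqP; split=> z [cz [c mc Hc]]; split=> //.
  exists (mulL b' c); first exact: muM.
  move=> s; apply/ffunP => i; have /ffunP/(_ i) := Hc s; rewrite !ffunE rmorphM fmorphV => E.
  apply: (mulfI (b0 i)); apply: (mulfI (sb s i)).
  transitivity (eta s i * b i * s (c (Defs.perm_inv D s i))); first by field; rewrite ?sb ?b0.
  by rewrite -H' [_ * s (b _)]mulrC -mulrA E; field; rewrite ?sb ?b0.
exists (mulL b c); first exact: muM.
move=> s; apply/ffunP => i; have /ffunP/(_ i) := Hc s; rewrite !ffunE rmorphM => E.
by rewrite mulrA H' mulrAC E; ring.
Qed.

Lemma eval_neq0 i E : good_cdiv D E -> eval_cdiv (f i) E != 0.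
Proof.
move=> [E0 Er dis]; rewrite /eval_cdiv big_seq; elim/big_rec: _ => [|x v xE v0].
  exact: oner_neq0.
rewrite mulf_neq0// expfz_neq0//; suff /unit_value[] : unit_at (f i) x by [].
apply/(ord_unit C_curve); have /(has_ordP C_curve) := (f_div i).2 x.
by rewrite coeffMn coeff_outdom ?mul0rn//; apply: dis.
Qed.

(** The root at [i] belongs to [D i] and [P]; the [s]-conjugate of the root at [perm_inv D s i]
    belongs to [D i] and the conjugate of [P]. Uniqueness and [descent_root_shift] give their
    ratio. *)
Lemma kummer_root E P : good_cdiv D E -> phi P = cl E -> exists r,
  [/\ unitL' r, expL r q = evalF f E &
      forall s, [ffun i => actL s r i / r i] = map_w (gal_pt s P - P)].
Proof.
move=> gE PE; have [E0 Er dis] := gE.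
have dis' i x : x \in dom E -> x \notin dom (D i) by apply: dis.
have ex i := descent_root_ex C_curve J_jac phi_isog E (D_deg i) (D_ker i) P char0 dimJ.
have [r0 rP] := choice ex; pose r : algL' Kb n := [ffun i => r0 i].
have rq i : r i ^+ q = eval_cdiv (f i) E.
  by rewrite ffunE; apply: (descent_root_exp C_curve J_jac phi_isog E0 (D_deg i) (D_ker i) (@dis' i) kerq (f_div i) PE (rP i)).
have r_neq0 i : r i != 0.
  have := eval_neq0 i gE; rewrite -rq; apply: contraNneq => ->.
  by rewrite expr0n eqn0Ngt q0.
exists r; split=> //; first by apply/ffunP => i; rewrite !ffunE -rq ffunE.
move=> s; apply/ffunP => i; rewrite !ffunE; set j := Defs.perm_inv D s i.
have [t [sK tK]] := gal_inv_ex s; have Di : gal_cdiv s (D j) = D i by exact: perm_invP.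
have k0 : phi (gal_pt s P - P) = 0.
  by rewrite (phiB phi_isog) (phi_gal phi_isog) PE -(cl_gal s J_jac)// Er subrr.
have PE' : phi (gal_pt s P) = cl E.
  by have := k0; rewrite (phiB phi_isog) PE => /eqP; rewrite subr_eq0 => /eqP.
have h1 : descent_root cl phi E (D i) (gal_pt s P) (s (r0 j)).
  rewrite -Di; apply: (descent_root_gal sK tK C_curve J_jac phi_isog E0 Er (D_deg j) (D_ker j) _ (@dis' j) PE (rP j)).
  by rewrite Di.
have h2 := descent_root_shift J_jac phi_isog E0 (D_ker i) PE k0 (rP i).
rewrite addrC subrK in h2.
have -> := descent_root_uniq C_curve J_jac phi_isog E0 (D_ker i) (@dis' i) PE' h1 h2.
have := r_neq0 i; rewrite ffunE => ri; by rewrite mulrAC divff// mul1r.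
Qed.

Section OneCoset.
Variables (X : set (pts J)) (hX : is_coset phi X).
Local Notation coc P := (fun s : absgal => gal_pt s P - P).

Lemma coset_rational y : X y -> rational_pt y.
Proof.
have [x rx ->] := hX => -[a ra ->] s.
by rewrite galD rx -(phi_gal phi_isog) ra.
Qed.

Lemma coc_ker P s : X (phi P) -> phi (gal_pt s P - P) = 0.
Proof. by move=> XP; rewrite (phiB phi_isog) (phi_gal phi_isog) (coset_rational XP) subrr. Qed.

Lemma coc_continuous (P : pts A) : exists S : seq Kb, forall s t : absgal,
  (forall x, x \in S -> s x = t x) -> gal_pt s P - P = gal_pt t P - P.
Proof.
exists [seq coords P 0 i | i <- enum 'I_(ncoords A)] => s t H; congr (_ - _).
apply/coords_inj/rowP => i; rewrite !mxE; apply: H.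
by apply: map_f; rewrite mem_enum.
Qed.

Lemma coc_mul (P : pts A) s (t : absgal) : gal_pt (Defs.gal_mul s t) P - P = (gal_pt s P - P) + gal_pt s (gal_pt t P - P).
Proof.
have -> : gal_pt (Defs.gal_mul s t) P = gal_pt s (gal_pt t P).
  by apply/coords_inj/rowP => i; rewrite !mxE.
by rewrite galB [RHS]addrC addrA subrK.
Qed.

Lemma coc_cocycle P : X (phi P) -> cocycle +%R (fun s => @gal_pt _ _ _ s A) (in_ker phi) (coc P).
Proof.
move=> XP; split; first by move=> s; apply: coc_ker.
  by move=> s t; rewrite coc_mul.
exact: coc_continuous.
Qed.

Lemma map_w_cocycle P : X (phi P) -> cocycle (@mulL Kb n) actL (muL q) (map_w \o coc P).
Proof.
move=> XP; split; first by move=> s; apply/map_w_mu/coc_ker.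
  move=> s t; rewrite /= coc_mul map_wD ?map_w_gal//; try exact: coc_ker.
  by rewrite (phi_gal phi_isog) coc_ker// gal0.
have [S HS] := coc_continuous P; exists S => s t h.
by rewrite /= (HS s t h).
Qed.

(** [P - P'] is a rational point [w], which does not affect the cocycle, plus a kernel point [k],
    which changes it by a coboundary. *)
Lemma class_indep P P' : X (phi P) -> X (phi P') -> mu_class (map_w \o coc P) = mu_class (map_w \o coc P').
Proof.
move=> XP XP'; have [x rx XE] := hX.
have [a ra E] : exists2 a, rational_pt a & phi P' = x + phi a by move: XP'; rewrite XE.
have [a' ra' E'] : exists2 a, rational_pt a & phi P = x + phi a by move: XP; rewrite XE.
pose w := a' - a; pose k := (P - P') - w; have k0 : phi k = 0.
  by rewrite !(phiB phi_isog) E E' opprD addrACA subrr add0r subrr.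
apply: (@mu_class_eq _ _ (map_w (- k))).
  by apply: map_w_mu; rewrite (phiN phi_isog) k0 oppr0.
move=> s; have nk0 : phi (- k) = 0 by rewrite (phiN phi_isog) k0 oppr0.
have snk0 : phi (gal_pt s (- k)) = 0 by rewrite (phi_gal phi_isog) nk0 gal0.
rewrite /= -map_w_gal// -!map_wD ?coc_ker//; congr (map_w _).
have PE : P = P' + w + k by rewrite /k -addrA [w + _]addrC subrK addrC subrK.
have sw : gal_pt s w = w by rewrite galB ra ra'.
clearbody k; clearbody w.
rewrite {1 2}PE !galD galN sw addrAC addrK opprD addrA; congr (_ - k).
by rewrite opprD addrACA subrr addr0.
Qed.

Lemma descent_class P : X (phi P) ->
  map_w_h1 q D phi cl (coboundary phi X) = mu_class (map_w \o coc P).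
Proof.
move=> XP; apply/seteqP; split=> eta.
  move=> [xi [P' [XP' [cxi [b kb Hb]]]] eta'].
  have xiE : xi = coc (P' + b).
    apply/funext => s; apply: (addIr b); rewrite -Hb galD opprD [_ + (- P' - b)]addrA subrK.
    by rewrite addrAC.
  have XPb : X (phi (P' + b)) by rewrite (phiD phi_isog) kb addr0.
  by move: eta'; rewrite xiE (class_indep XPb XP).
move=> eta'; exists (coc P) => //; exists P; split=> //; split; first exact: coc_cocycle.
by exists 0; [exact: (phi0 phi_isog)|move=> s; rewrite gal0].
Qed.

(** Equality of the maps and well-definedness of [F] come from one circle of inclusions: values of
    [F] lie in the Kummer image, which lies in a single class modulo [q]-th powers, namely that of
    [evalF f E], and this class consists of values of [F]. *)
Lemma coset_main E : good_cdiv D E -> X (cl E) ->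
  mapF q D cl f X = kummer q D (map_w_h1 q D phi cl (coboundary phi X)) /\
  exists2 a, unitL D a & mapF q D cl f X = qclass q D a.
Proof.
move=> gE XE; set c := map_w_h1 _ _ _ _ _.
have root E' : good_cdiv D E' -> X (cl E') -> exists r, [/\ unitL' r, expL r q = evalF f E',
    c = mu_class (fun s => [ffun i => actL s r i / r i]),
    unitL D (evalF f E') & c (fun s => [ffun i => actL s r i / r i])].
  move=> gE' XE'; have [P PE] := phi_surj phi_isog (cl E').
  have XP : X (phi P) by rewrite PE.
  have [r [ur rq rc]] := kummer_root gE' PE; exists r.
  have rcE : (fun s : absgal => [ffun i => actL s r i / r i]) = map_w \o coc P.
    by apply/funext => s; rewrite rc.
  have cE : c = mu_class (map_w \o coc P) := descent_class XP.
  split=> //; first by rewrite rcE.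
    split; first by move=> i; rewrite ffunE; apply: eval_neq0.
    move=> s; rewrite -rq; apply/ffunP => i; rewrite !ffunE rmorphXn.
    have /ffunP/(_ i) := rc s; rewrite !ffunE => rci.
    have -> : s (r (Defs.perm_inv D s i)) = map_w (gal_pt s P - P) i * r i.
      by rewrite [map_w _ i]ffunE -rci divfK//; apply: ur.
    have mq : map_w (gal_pt s P - P) i ^+ q = 1.
      by have /ffunP/(_ i) := map_w_mu (coc_ker s XP); rewrite ffunE [RHS]ffunE.
    by rewrite exprMn mq mul1r.
  rewrite rcE cE; split; first exact: map_w_cocycle.
  exists (map_w 0); first by apply: map_w_mu; exact: (phi0 phi_isog).
  by move=> s; rewrite -map_w_gal ?gal0//; exact: (phi0 phi_isog).
have sub1 : (mapF q D cl f X `<=` kummer q D c)%classic.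
  move=> l [E' [gE' XE' [b [ub bg] ->]]]; have [r [ur rq cE [ua ag] _]] := root E' gE' XE'.
  have lE : mulL (evalF f E') (expL b q) = expL (mulL r b) q.
    by rewrite -rq; apply/ffunP => i; rewrite !ffunE exprMn.
  split.
    split; first by move=> i; rewrite !ffunE mulf_neq0 ?expf_neq0//; have := ua i; rewrite ?ffunE.
    move=> s; rewrite actLM ag; congr mulL; apply/ffunP => i; rewrite !ffunE rmorphXn.
    by have /ffunP/(_ i) := bg s; rewrite !ffunE => ->.
  exists (mulL r b); split=> //; first by move=> i; rewrite ffunE mulf_neq0.
  rewrite cE; congr (mu_class _); apply/funext => s; apply/ffunP => i; rewrite !ffunE rmorphM.
  have /ffunP/(_ i) := bg s; rewrite ffunE => ->; have := ub i => bi; have := ur i => ri.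
  by rewrite -mulf_div divff// mulr1.
have [r [ur rq cE uE cr]] := root E gE XE.
(* The cocycles of [r] and [r'] are cohomologous through some [b] in mu_q, so [r' * b / r] is
   Galois-fixed; its [q]-th power is the ratio of [l] to [evalF f E]. *)
have sub2 : (kummer q D c `<=` qclass q D (evalF f E))%classic.
  move=> l [ul [r' [ur' r'q c']]]; move: cr; rewrite c' => -[_ [b mb Hb]].
  have b0 i := mu_neq0 i mb.
  pose e0 : algL' Kb n := [ffun i => r' i * b i / r i].
  exists e0; last first.
    apply/ffunP => i; rewrite !ffunE -r'q ffunE.
    have /ffunP/(_ i) := mb; rewrite !ffunE => bq; have /ffunP/(_ i) := rq; rewrite !ffunE => <-.
    by rewrite expr_div_n exprMn bq mulr1 mulrC divfK// expf_neq0//; apply: ur.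
  split; first by move=> i; rewrite ffunE; exact: mulf_neq0 (mulf_neq0 (ur' i) (b0 i)) (invr_neq0 (ur i)).
  move=> s; apply/ffunP => i; have /ffunP/(_ i) := Hb s; rewrite !ffunE fmorph_div rmorphM.
  have := ur i; have := ur' i; have := b0 i; have := ur (Defs.perm_inv D s i).
  rewrite -(fmorph_eq0 s); move: (s (r _)) (s (r' _)) (s (b _)) => x y z x0 bi ri' ri h.
  have -> : y * z / x = (y / r' i * z) * (r' i / x) by field; rewrite ?x0 ?ri'.
  by rewrite h; field; rewrite ?x0 ?ri ?ri'.
have sub3 : (qclass q D (evalF f E) `<=` mapF q D cl f X)%classic by move=> l ql; exists E.
split.
  by apply/seteqP; split=> // l /sub2/sub3.
exists (evalF f E) => //; apply/seteqP; split=> // l /sub1/sub2//.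
Qed.

End OneCoset.
End Descent.

Theorem theorem2p3
    (* the number field K, and an algebraic closure Kb of K *)
    (K : fieldExtType rat) (Kb : closedFieldType) (iota : {rmorphism K -> Kb})
    (Kb_alg : forall x : Kb, algebraicOver iota x)
    (* the curve C and its Jacobian J *)
    (C : variety iota) (C_curve : smooth_curve C)
    (J : abvar iota) (cl : cdiv C -> pts J) (J_jac : is_jacobian cl)
    (* the isogeny phi, whose kernel has exponent q = p ^ l *)
    (A : abvar iota) (phi : pts A -> pts J) (phi_isog : isogeny phi)
    (p l q : nat) (p_prime : prime p) (q_def : q = (p ^ l)%N)
    (q_exp : ker_exponent phi q)
    (* Assumption I *)
    (assumptionI : forall x : pts J, rational_pt x ->
       exists (E : cdiv C) (a : pts A),
         [/\ deg E = 0, rational_cdiv E, rational_pt a & cl E = x + phi a])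
    (* a Galois-invariant set of divisors of degree 0 spanning Psi *)
    (n : nat) (D : 'I_n -> cdiv C) (D_inj : injective D)
    (D_deg : forall i, deg (D i) = 0)
    (D_gal : forall (s : absgal iota) i, exists j, gal_cdiv s (D i) = D j)
    (D_span : forall x : pts J, in_Psi phi cl x <->
       exists m : 'I_n -> int, x = \sum_(i < n) cl (D i) *~ m i)
    (* the functions f_i *)
    (f : 'I_n -> pts C -> Kb)
    (f_field : forall i, rational_over (field_of_cdiv (D i)) (f i))
    (f_div : forall i, is_cdiv_of (f i) (D i *+ q)) :
  forall X : set (pts J), is_coset phi X ->
    mapF q D cl f X = kummer q D (map_w_h1 q D phi cl (coboundary phi X)) /\
    exists2 a, unitL D a & mapF q D cl f X = qclass q D a.
Proof.
have char0 m : m.+1%:R != 0 :> Kb.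
  rewrite -(rmorph_nat iota) fmorph_eq0 -(rmorph_nat (in_alg K)) fmorph_eq0.
  by rewrite pnatr_eq0.
have q0 : (0 < q)%N by rewrite q_def expn_gt0 prime_gt0.
have kerq k : phi k = 0 -> k *+ q = 0.
  by move=> k0; have /(_ k k0) := proj2 (q_exp q) (dvdnn q).
have tor i : cl (D i) *+ q = 0.
  rewrite -(clMn J_jac)//; apply/(cl_principal J_jac); first by rewrite degMn D_deg mul0rn.
  by exists (f i).
have D_ker i : dual_ker phi (polarization cl (cl (D i))).
  apply/D_span; exists (fun j => (j == i)%:R); rewrite (bigD1 i)//= eqxx mulr1z.
  by rewrite big1 ?addr0// => j ji; rewrite (negbTE ji) mulr0z.
have dimJ := dimension_or_trivial J_jac phi_isog q0 D_deg tor D_span.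
move=> X hX; have [x rx XE] := hX; have [E0 [a [dE0 rE0 ra E0x]]] := assumptionI x rx.
(* The representative from Assumption I may meet the supports of the [D i]. Their union is
   Galois-stable, so [moving] applies, and adding a principal divisor keeps the class. *)
pose s := flatten [seq dom (D i) | i <- enum 'I_n].
have sP y : reflect (exists i, y \in dom (D i)) (y \in s).
  apply: (iffP flatten_mapP) => [[i _ yi]|[i yi]]; first by exists i.
  by exists i; rewrite ?mem_enum.
have s_gal (g : absgal iota) y : y \in s -> gal_pt g y \in s.
  move=> /sP[i yi]; apply/sP; have [j jE] := D_gal g i; exists j.
  have [t [gK tK]] := gal_inv_ex g.
  by rewrite -jE mem_dom (coeff_gal gK tK) (gal_ptK' tK) -mem_dom.
have [V [rV [h hV] V0]] := moving char0 C_curve rE0 s_gal.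
have dV := deg_principal C_curve hV.
have clV : cl V = 0 by apply/(cl_principal J_jac) => //; exists h.
have gE : good_cdiv D (E0 + V).
  split; first by rewrite degD dE0 dV.
    move=> g; have [t [gK tK]] := gal_inv_ex g; apply/eqP/freeg_eqP => z.
    by rewrite -[in RHS](rE0 g) -[in RHS](rV g) coeffD !(coeff_gal gK tK) coeffD.
  move=> i y yE; apply/negP => yi; have /V0 y0 : y \in s by apply/sP; exists i.
  by move: yE; rewrite mem_dom y0 eqxx.
have XcE : X (cl (E0 + V)).
  by rewrite (clD J_jac)// clV addr0 E0x XE; exists a.
exact: (coset_main char0 C_curve J_jac phi_isog q0 kerq D_deg D_gal D_ker dimJ f_div hX gE XcE).
Qed.
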